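(* Let $M\ge 2$, let $\Omega_1,\dots,\Omega_M\subset\mathbb{R}^2$ be discs with pairwise disjoint closures, $\Omega_p$ having center $O_p$ and radius $a_p>0$, and let $k>0$ be such that $k^2$ is not a Dirichlet eigenvalue of $-\Delta$ in any $\Omega_p$. Let the incident field be either a plane wave or a point source located at a point $x_0$ exterior to all closed discs. Write $d_{pq}=|O_p-O_q|$, $d_{px_0}=|O_p-x_0|$ and $\mathbb{N}_M=\{1,\dots,M\}$. Let $\mathcal{E}(N)=\|\Phi-\tilde\Phi(N)\|_{-1/2}$ be the approximation error of the multipole expansion method with truncation number $N$ (defined in the context). Then, as $N\to\infty$, $\mathcal{E}(N)\lesssim\gamma_1(N)$, where $$\gamma_1(N):=\begin{cases}\displaystyle \max\Big\{\max_{p\in\mathbb{N}_M}\Big(\frac{a_p}{d_{px_0}}\Big)^N,\ \max_{\substack{p,q\in\mathbb{N}_M\\ q\ne p}}\Big(\frac{a_p}{d_{pq}-a_q}\Big)^N\Big\}, & \text{for a point source},\\[2ex] \displaystyle \max_{\substack{p,q\in\mathbb{N}_M\\ q\neq p}}\Big(\frac{a_p}{d_{pq}-a_q}\Big)^N, & \text{for a plane wave}.\end{cases}$$ That is, there is a sub-exponentially increasing function $s$ with $\mathcal{E}(N)\le s(N)\,\gamma_1(N)$ for all sufficiently large $N$.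
   Context: Notation $\lesssim$: a positive function $s$ of an integer variable $t$ is sub-exponentially increasing if for every $C>0$ it grows slower than $e^{Ct}$ as $t\to\infty$, i.e. $s(t)=o(e^{Ct})$. $A(N)\lesssim B(N)$ as $N\to\infty$ means $A(N)\le s(N)B(N)$ for all large $N$, for some sub-exponentially increasing $s$ (independent of $N$; it may depend on all fixed data: $k$, the discs, the incident field). $J_m$ is the Bessel function and $H_m$ the Hankel function of the first kind, of order $m$. $\Gamma_p=\partial\Omega_p$, $\Gamma=\bigcup_p\Gamma_p$; $(r_p(x),\theta_p(x))$ are polar coordinates of $x$ centered at $O_p$. $\mathbb{Z}_N=\{n\in\mathbb{Z}:|n|\le N\}$, $\mathbb{Z}_N^c=\mathbb{Z}\setminus\mathbb{Z}_N$. Sequence spaces: for $s\in\mathbb{R}$, $l_s$ is the space of sequences $\alpha=(\alpha_m^p)_{m\in\mathbb{Z}}^{p\in\mathbb{N}_M}$ with $\|\alpha\|_s^2:=\sum_{p}\sum_{m}(1+|m|^2)^s|\alpha_m^p|^2<\infty$; $\|\cdot\|_{s,t}$ is the operator norm $l_s\to l_t$. Incident field: $u^{\rm inc}(x)=e^{ik\beta\cdot x}$ with $\beta=(\cos\hat\beta,\sin\hat\beta)$, $\hat\beta\in[0,2\pi]$ (plane wave), or $u^{\rm inc}(x)=\frac i4H_0(k|x-x_0|)$ (point source). Let $f=-u^{\rm inc}$. Basis functions: $b_m^p(x)=e^{im\theta_p(x)}/\sqrt{2\pi a_p}$ for $x\in\Gamma_p$ and $b_m^p=0$ on $\Gamma\setminus\Gamma_p$.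 Let $f_m^p=\int_\Gamma f\,\overline{b_m^p}\,d\sigma$ and $V^{pq}_{mn}=\int_\Gamma\int_\Gamma\frac i4H_0(k|x-y|)b_n^q(y)\overline{b_m^p(x)}\,d\sigma(y)\,d\sigma(x)$ (the matrix of the single layer boundary operator). The underlying problem is the boundary integral equation $V\phi=f$ for the exterior Dirichlet Helmholtz scattering problem. Each $V^{pp}$ is diagonal with $V^{pp}_{mm}=\frac{i\pi a_p}{2}J_m(ka_p)H_m(ka_p)$, nonzero by the assumption on $k$. Put $A^{pp}=0$, $A^{pq}=(V^{pp})^{-1}V^{pq}$ for $p\ne q$, and $g^p=(V^{pp})^{-1}f^p$. Explicitly, for $p\neq q$, $$A^{pq}_{mn}=\sqrt{\tfrac{a_q}{a_p}}\,\frac{H_{n-m}(kd_{pq})\,e^{i(n-m)\alpha_{pq}}J_n(ka_q)}{H_m(ka_p)},\quad \alpha_{pq}\text{ the polar angle of }O_p-O_q,$$ and $g_m^p=-\frac{2\sqrt2}{i\sqrt{\pi a_p}}e^{ik\beta\cdot O_p}e^{im(\pi/2-\hat\beta)}/H_m(ka_p)$ (plane wave), $g_m^p=-\frac{H_m(kd_{px_0})}{H_m(ka_p)}\frac{e^{-im\theta_p(x_0)}}{\sqrt{2\pi a_p}}$ (point source). Let $\mathbb{A}=(A^{pq})_{p,q}$, $G=(g^p)_p$, $\mathbb{I}$ the identity. $\Phi\in l_{-1/2}$ is the solution of $(\mathbb{I}+\mathbb{A})\Phi=G$; under the assumption on $k$ it exists and is unique and $\mathbb{I}+\mathbb{A}$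 is boundedly invertible on $l_{-1/2}$. Truncation: $\tilde A^{pq}_{mn}=A^{pq}_{mn}$ if $m,n\in\mathbb{Z}_N$ and $0$ otherwise; $\tilde g_m^p=g_m^p$ if $m\in\mathbb{Z}_N$ and $0$ otherwise; $\tilde{\mathbb{I}}$ is the identity truncated in the same way. $\tilde\Phi(N)$ is the sequence with $\tilde\Phi_m^p=0$ for $m\in\mathbb{Z}_N^c$ solving $(\tilde{\mathbb{I}}+\tilde{\mathbb{A}}(N))\tilde\Phi=\tilde G(N)$ (uniquely solvable for all sufficiently large $N$). *)

(* Defs.v *)
(* Points of the plane R^2 are elements of Coquelicot's C = R * R, and |x - y| is [Cmod (x - y)].  The index
   set {1, ..., M} is rendered as {p : nat | p < M}; values at indices p >= M are
   irrelevant. *)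
From Stdlib Require Import Reals ZArith List Arith.
From Coquelicot Require Import Coquelicot.

Open Scope R_scope.

(** * Finite sums, finite maxima, two-sided series *)

Definition rsum (n : nat) (f : nat -> R) : R :=
  fold_right Rplus 0 (map f (seq 0 n)).

Definition csum (n : nat) (f : nat -> C) : C :=
  fold_right Cplus (RtoC 0) (map f (seq 0 n)).

(* Maximum of a list of nonnegative reals (0 for the empty list). *)
Definition rmax (l : list R) : R := fold_right Rmax 0 l.

(* The sum over Z is split at 0; only absolutely convergent families occur. *)
Definition is_seriesZ (f : Z -> C) (l : C) : Prop :=
  exists l1 l2 : C,
    is_series (fun n : nat => f (Z.of_nat n)) l1 /\
    is_series (fun n : nat => f (- Z.of_nat (S n))%Z) l2 /\
    l = (l1 + l2)%C.

Definition ex_seriesZ (f : Z -> R) : Prop :=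
  ex_series (fun n : nat => f (Z.of_nat n)) /\
  ex_series (fun n : nat => f (- Z.of_nat (S n))%Z).

Definition SeriesZ (f : Z -> R) : R :=
  Series (fun n : nat => f (Z.of_nat n)) +
  Series (fun n : nat => f (- Z.of_nat (S n))%Z).

(** * Sub-exponential comparison *)

Definition subexponential (s : nat -> R) : Prop :=
  (forall t : nat, 0 < s t) /\
  (forall c : R, 0 < c -> is_lim_seq (fun t => s t / exp (c * INR t)) 0).

Definition lesssim (A B : nat -> R) : Prop :=
  exists s : nat -> R, subexponential s /\
    exists N0 : nat, forall N : nat, (N0 <= N)%nat -> A N <= s N * B N.

(** * Bessel and Hankel functions of integer order and positive argument *)

Definition besselJ_nat (n : nat) (x : R) : R :=
  Series (fun j : nat =>
    (-1) ^ j / (INR (fact j) * INR (fact (j + n))) * (x / 2) ^ (2 * j + n)).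

Definition harmonic (n : nat) : R := rsum n (fun i => / INR (S i)).

Definition euler_gamma : R :=
  real (Lim_seq (fun n : nat => harmonic n - ln (INR n))).

(* The digamma function at n + 1. *)
Definition digammaS (n : nat) : R := harmonic n - euler_gamma.

(* The standard series of Y_n (Abramowitz-Stegun 9.1.11). *)
Definition besselY_nat (n : nat) (x : R) : R :=
  2 / PI * ln (x / 2) * besselJ_nat n x
  - / PI * rsum n (fun j =>
      INR (fact (n - j - 1)) / INR (fact j) * (x / 2) ^ (2 * j) / (x / 2) ^ n)
  - / PI * Series (fun j : nat =>
      (digammaS j + digammaS (j + n)) * (-1) ^ j
      / (INR (fact j) * INR (fact (j + n))) * (x / 2) ^ (2 * j + n)).

(* J_{-n} = (-1)^n J_n and Y_{-n} = (-1)^n Y_n. *)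
Definition extend_order (F : nat -> R -> R) (m : Z) (x : R) : R :=
  if (0 <=? m)%Z then F (Z.abs_nat m) x
  else (-1) ^ Z.abs_nat m * F (Z.abs_nat m) x.

Definition besselJ : Z -> R -> R := extend_order besselJ_nat.
Definition besselY : Z -> R -> R := extend_order besselY_nat.

Definition hankel1 (m : Z) (x : R) : C := (besselJ m x, besselY m x).

(** * Discs and Dirichlet eigenvalues *)

Definition open_disc (c : C) (r : R) (x : C) : Prop := Cmod (x - c) < r.
Definition closed_disc (c : C) (r : R) (x : C) : Prop := Cmod (x - c) <= r.
Definition circle (c : C) (r : R) (x : C) : Prop := Cmod (x - c) = r.

(* There is a nonzero classical eigenfunction u, of class C^2 in the open disc
   and continuous up to the boundary. *)
Definition dirichlet_eigenvalue (c : C) (r lambda : R) : Prop :=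
  exists u : R -> R -> R,
    (forall x y, open_disc c r (x, y) -> ex_diff_n u 2 x y) /\
    continuous_on (T := C_UniformSpace) (U := R_UniformSpace)
      (closed_disc c r) (fun z => u (fst z) (snd z)) /\
    (exists x y, open_disc c r (x, y) /\ u x y <> 0) /\
    (forall x y, circle c r (x, y) -> u x y = 0) /\
    (forall x y, open_disc c r (x, y) ->
       - (partial_derive 2 0 u x y + partial_derive 0 2 u x y)
       = lambda * u x y).

Definition disjoint_closed_discs (M : nat) (O : nat -> C) (a : nat -> R) : Prop :=
  forall p q : nat, (p < M)%nat -> (q < M)%nat -> p <> q ->
    forall x : C, ~ (closed_disc (O p) (a p) x /\ closed_disc (O q) (a q) x).

(** * Incident fields *)

Inductive incident_field : Type :=
  | PlaneWave (beta_hat : R)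
  | PointSource (x0 : C).

Definition admissible_field (M : nat) (O : nat -> C) (a : nat -> R)
    (inc : incident_field) : Prop :=
  match inc with
  | PlaneWave b => 0 <= b <= 2 * PI
  | PointSource x0 => forall p : nat, (p < M)%nat -> ~ closed_disc (O p) (a p) x0
  end.

(* exp (i t) *)
Definition cis (t : R) : C := (cos t, sin t).

(* The fundamental solution of the Helmholtz equation. *)
Definition helmholtz_G (k : R) (x y : C) : C :=
  (Ci / 4 * hankel1 0 (k * Cmod (x - y)))%C.

Definition u_inc (k : R) (inc : incident_field) (x : C) : C :=
  match inc with
  | PlaneWave b => cis (k * (cos b * fst x + sin b * snd x))
  | PointSource x0 => helmholtz_G k x x0
  end.

(** * Sequence spaces *)

Definition sequence := nat -> Z -> C.
Definition imatrix := nat -> nat -> Z -> Z -> C.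

Definition l_term (s : R) (alpha : sequence) (p : nat) (m : Z) : R :=
  Rpower (1 + IZR m ^ 2) s * Cmod (alpha p m) ^ 2.

Definition in_l (M : nat) (s : R) (alpha : sequence) : Prop :=
  forall p : nat, (p < M)%nat -> ex_seriesZ (l_term s alpha p).

Definition l_norm (M : nat) (s : R) (alpha : sequence) : R :=
  sqrt (rsum M (fun p => SeriesZ (l_term s alpha p))).

Definition seq_minus (alpha gamma : sequence) : sequence :=
  fun p m => (alpha p m - gamma p m)%C.

(* B alpha = gamma, all the series involved being convergent. *)
Definition acts_to (M : nat) (B : imatrix) (alpha gamma : sequence) : Prop :=
  forall (p : nat) (m : Z), (p < M)%nat ->
    exists S : nat -> C,
      (forall q : nat, (q < M)%nat ->
         is_seriesZ (fun n => (B p q m n * alpha q n)%C) (S q)) /\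
      csum M S = gamma p m.

Definition imat_plus (A B : imatrix) : imatrix :=
  fun p q m n => (A p q m n + B p q m n)%C.

Definition imat_id : imatrix :=
  fun p q m n => if ((p =? q)%nat && (m =? n)%Z)%bool then RtoC 1 else RtoC 0.

Definition inZN (N : nat) (m : Z) : bool := (Z.abs m <=? Z.of_nat N)%Z.

Definition trunc_mat (N : nat) (B : imatrix) : imatrix :=
  fun p q m n => if (inZN N m && inZN N n)%bool then B p q m n else RtoC 0.

Definition trunc_seq (N : nat) (alpha : sequence) : sequence :=
  fun p m => if inZN N m then alpha p m else RtoC 0.

(** * Boundary integrals over the circles *)

(* Gamma_p is parametrized by t |-> O_p + a_p exp (i t), with dsigma = a_p dt. *)
Definition circle_pt (c : C) (r t : R) : C := (c + r * cis t)%C.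

(* b_m^p at the point of Gamma_p with polar angle t. *)
Definition basis (r : R) (m : Z) (t : R) : C :=
  (cis (IZR m * t) / sqrt (2 * PI * r))%C.

(* f_m^p with f = - u_inc *)
Definition rhs_coef (k : R) (O : nat -> C) (a : nat -> R) (inc : incident_field)
    (p : nat) (m : Z) : C :=
  RInt (V := C_R_CompleteNormedModule)
    (fun s => (- u_inc k inc (circle_pt (O p) (a p) s)
               * Cconj (basis (a p) m s) * a p)%C)
    0 (2 * PI).

(* V^{pq}_{mn}.  The inner integral runs over one period starting at the outer
   angle s, as an improper integral: for p = q this puts the logarithmic
   singularity of the kernel at the end points t = s and t = s + 2 pi. *)
Definition single_layer (k : R) (O : nat -> C) (a : nat -> R) : imatrix :=
  fun p q m n =>
  RInt (V := C_R_CompleteNormedModule)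
    (fun s =>
       RInt_gen (V := C_R_CompleteNormedModule)
         (fun t =>
            (helmholtz_G k (circle_pt (O p) (a p) s) (circle_pt (O q) (a q) t)
             * basis (a q) n t * Cconj (basis (a p) m s) * a q * a p)%C)
         (at_right s) (at_left (s + 2 * PI)))
    0 (2 * PI).

(* V^{pp} is diagonal, hence (V^{pp})^{-1} divides the m-th row by V^{pp}_{mm}. *)
Definition mpe_A (k : R) (O : nat -> C) (a : nat -> R) : imatrix :=
  fun p q m n =>
    if (p =? q)%nat then RtoC 0
    else (single_layer k O a p q m n / single_layer k O a p p m m)%C.

Definition mpe_G (k : R) (O : nat -> C) (a : nat -> R) (inc : incident_field)
    : sequence :=
  fun p m => (rhs_coef k O a inc p m / single_layer k O a p p m m)%C.

(** * Exact and truncated solutions, error, convergence rate *)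

Definition exact_solution (M : nat) (k : R) (O : nat -> C) (a : nat -> R)
    (inc : incident_field) (Phi : sequence) : Prop :=
  in_l M (- / 2) Phi /\
  acts_to M (imat_plus imat_id (mpe_A k O a)) Phi (mpe_G k O a inc).

Definition truncated_solution (M : nat) (k : R) (O : nat -> C) (a : nat -> R)
    (inc : incident_field) (N : nat) (Phit : sequence) : Prop :=
  (forall (p : nat) (m : Z), (p < M)%nat -> inZN N m = false ->
     Phit p m = RtoC 0) /\
  acts_to M (imat_plus (trunc_mat N imat_id) (trunc_mat N (mpe_A k O a))) Phit
    (trunc_seq N (mpe_G k O a inc)).

Definition mpe_error (M : nat) (Phi : sequence) (Phit : nat -> sequence)
    (N : nat) : R :=
  l_norm M (- / 2) (seq_minus Phi (Phit N)).

Definition offdiag_pairs (M : nat) : list (nat * nat) :=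
  filter (fun pq => negb (fst pq =? snd pq)%nat)
    (list_prod (seq 0 M) (seq 0 M)).

(* max over p <> q of (a_p / (d_pq - a_q))^N *)
Definition gamma_discs (M : nat) (O : nat -> C) (a : nat -> R) (N : nat) : R :=
  rmax (map (fun pq : nat * nat =>
               let (p, q) := pq in (a p / (Cmod (O p - O q) - a q)) ^ N)
          (offdiag_pairs M)).

Definition gamma1 (M : nat) (O : nat -> C) (a : nat -> R)
    (inc : incident_field) (N : nat) : R :=
  match inc with
  | PointSource x0 =>
      Rmax (rmax (map (fun p => (a p / Cmod (O p - x0)) ^ N) (seq 0 M)))
        (gamma_discs M O a N)
  | PlaneWave _ => gamma_discs M O a N
  end.

(* Main.v *)
(* The entries of A satisfy, up to polynomial factors,
     |A^{pq}_{mn}| <= C binom(|m|+|n|, |n|) (a_p/d_pq)^|m| (a_q/d_pq)^|n|,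
   since H_m(r) has size |m|! (2/r)^|m| and J_n(r) has size (r/2)^|n| / |n|!.  By the negative
   binomial series the weighted m-th row sum is then at most C (1+|m|)^2 (a_p/(d_pq-a_q))^|m|.
   Hence Phi = G - A Phi decays like (1+|m|)^2 sigma^|m|, where sigma is the largest of the
   ratios defining gamma_1; so the residual of Phi in the truncated system, and the discarded
   tail of Phi, are both O((1+N)^3 sigma^N).

   What remains is the stability of the truncated systems, uniformly in N.  The decay of the rows
   makes A compact, so a sequence of violations would converge to a bounded solution x of
   (I + A) x = 0.  With c_n = J_n(k a_q) x_n this says that the field radiated by the multipoles
   c_n H_n(k |y-O_q|) e^{i n theta_q(y)} is orthogonal to c on every circle.  Pairing with c and
   taking the part that is even under conjugation replaces H by J, and the pairing becomes the
   sum of the squared moduli of the far field coefficients, which therefore vanish.  By Graf's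
   addition theorem the field is zero far away, and by re-expansion along paths everywhere
   outside the discs, together with the fields obtained from it by shifting all orders by m.
   The Fourier coefficients of these on a circle of radius r around O_q are
   c_n H_l(k r) + d_n J_l(k r) with n = m + l, d_n not depending on l; as H_l is unbounded in l
   and J_l bounded, c_n = 0, and x = 0 because no J_n(k a_q) vanishes. *)

Require Import Defs.
From Stdlib Require Import Reals ZArith List Arith Lia Lra Psatz Permutation Cantor.
From Stdlib Require Import FunctionalExtensionality ClassicalEpsilon.
From Coquelicot Require Import Coquelicot.

(** * Unordered sums *)

(** The matrix and the data are given as boundary integrals, so they must be evaluated before
    anything can be estimated. The addition theorem does this, and it serves again, in place of
    Green's formula and Rellich's lemma, in the uniqueness argument. It is therefore proved once for
    all families with the ladder relations, from Taylor's formula on a segment, under two growth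
    conditions: boundedness, for J and plane waves, and factorial growth, for H. Double and triple
    sums are rearranged throughout; sums are thus taken as limits over finite sets, and series split
    at 0 appear only where the given definitions are met. Stability is measured in a sup norm with
    weight [1 + |m|]: membership in the space of exponent -1/2 implies at most this growth,
    compactness becomes a diagonal argument over the entries, and the return to the given norm costs
    only powers of N, which a sub-exponential factor absorbs. The Dirichlet condition is used
    through one fact, that no J_m(k a_p) vanishes; besides its role in uniqueness it keeps the
    denominators H_m(k a_p) and the diagonal of V away from zero. *)

Definition lsum {T : Type} (f : T -> C) (L : list T) : C :=
  fold_right Cplus (RtoC 0) (map f L).

Definition lsumR {T : Type} (f : T -> R) (L : list T) : R :=
  fold_right Rplus 0 (map f L).

(** Bounding all finite partial sums expresses absolute summability together with a numerical bound,
    without naming the sum; nearly all estimates below are carried in this form. *)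
Definition bsum {T : Type} (f : T -> R) (B : R) : Prop :=
  forall L : list T, NoDup L -> lsumR f L <= B.

Definition summable {T : Type} (f : T -> C) : Prop :=
  exists B : R, bsum (fun x => Cmod (f x)) B.

(** Convergence along finite sets directed by inclusion, a finite set being a list without
    duplicates. No enumeration of the index type enters, so rearrangement and change of index are
    immediate. *)
Definition has_sum {T : Type} (f : T -> C) (l : C) : Prop :=
  forall eps : R, 0 < eps -> exists L0 : list T, NoDup L0 /\
    forall L : list T, NoDup L -> incl L0 L -> Cmod (lsum f L - l) <= eps.

(** A total function by choice; it carries information only where [has_sum] holds for some value,
    which [has_sum_unique] then pins down. *)
Definition tsum {T : Type} (f : T -> C) : C :=
  epsilon (inhabits (RtoC 0)) (has_sum f).

Lemma lsum_app {T} (f : T -> C) L1 L2 :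
  lsum f (L1 ++ L2) = (lsum f L1 + lsum f L2)%C.
Proof.
  induction L1 as [|a L1 IH]; unfold lsum in *; simpl; [ring|rewrite IH; ring].
Qed.

Lemma lsumR_app {T} (f : T -> R) L1 L2 :
  lsumR f (L1 ++ L2) = lsumR f L1 + lsumR f L2.
Proof.
  induction L1 as [|a L1 IH]; unfold lsumR in *; simpl; [ring|rewrite IH; ring].
Qed.

Lemma lsum_perm {T} (f : T -> C) L1 L2 : Permutation L1 L2 -> lsum f L1 = lsum f L2.
Proof. intros H; induction H; unfold lsum in *; simpl; try congruence; ring. Qed.

Lemma lsumR_perm {T} (f : T -> R) L1 L2 : Permutation L1 L2 -> lsumR f L1 = lsumR f L2.
Proof. intros H; induction H; unfold lsumR in *; simpl; try congruence; ring. Qed.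

Lemma lsum_map {T U} (f : T -> C) (h : U -> T) L :
  lsum f (map h L) = lsum (fun x => f (h x)) L.
Proof. unfold lsum; now rewrite map_map. Qed.

Lemma lsumR_map {T U} (f : T -> R) (h : U -> T) L :
  lsumR f (map h L) = lsumR (fun x => f (h x)) L.
Proof. unfold lsumR; now rewrite map_map. Qed.

Lemma lsum_ext {T} (f g : T -> C) L :
  (forall x, In x L -> f x = g x) -> lsum f L = lsum g L.
Proof.
  intros H; induction L as [|a L IH]; unfold lsum in *; simpl; auto.
  rewrite H by now left. rewrite IH; auto. intros; apply H; now right.
Qed.

Lemma lsumR_le {T} (f g : T -> R) L :
  (forall x, In x L -> f x <= g x) -> lsumR f L <= lsumR g L.
Proof.
  intros H; induction L as [|a L IH]; unfold lsumR in *; simpl; [lra|].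
  apply Rplus_le_compat; [apply H; now left|apply IH; intros; apply H; now right].
Qed.

Lemma lsumR_ge_0 {T} (f : T -> R) L : (forall x, 0 <= f x) -> 0 <= lsumR f L.
Proof.
  intros H; induction L as [|a L IH]; unfold lsumR in *; simpl; [lra|].
  specialize (H a); lra.
Qed.

Lemma lsumR_scal {T} (f : T -> R) c L : lsumR (fun x => c * f x) L = c * lsumR f L.
Proof. induction L as [|a L IH]; unfold lsumR in *; simpl; [ring|rewrite IH; ring]. Qed.

Lemma lsumR_plus {T} (f g : T -> R) L :
  lsumR (fun x => f x + g x) L = lsumR f L + lsumR g L.
Proof. induction L as [|a L IH]; unfold lsumR in *; simpl; [ring|rewrite IH; ring]. Qed.

Lemma lsumR_const {T} c (L : list T) : lsumR (fun _ => c) L = INR (length L) * c.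
Proof.
  induction L as [|a L IH]; unfold lsumR in *; cbn [map fold_right length]; [simpl; ring|].
  rewrite IH, S_INR; ring.
Qed.

Lemma lsum_scal {T} (f : T -> C) c L : lsum (fun x => c * f x)%C L = (c * lsum f L)%C.
Proof. induction L as [|a L IH]; unfold lsum in *; simpl; [ring|rewrite IH; ring]. Qed.

Lemma lsum_plus {T} (f g : T -> C) L :
  lsum (fun x => f x + g x)%C L = (lsum f L + lsum g L)%C.
Proof. induction L as [|a L IH]; unfold lsum in *; simpl; [ring|rewrite IH; ring]. Qed.

Lemma lsum_minus {T} (f g : T -> C) L :
  lsum (fun x => f x - g x)%C L = (lsum f L - lsum g L)%C.
Proof. induction L as [|a L IH]; unfold lsum in *; simpl; [ring|rewrite IH; ring]. Qed.

Lemma Cmod_lsum {T} (f : T -> C) L : Cmod (lsum f L) <= lsumR (fun x => Cmod (f x)) L.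
Proof.
  induction L as [|a L IH]; unfold lsum, lsumR in *; simpl; [rewrite Cmod_0; lra|].
  eapply Rle_trans; [apply Cmod_triangle|]; lra.
Qed.

Lemma lsum_RtoC {T} (f : T -> R) L : lsum (fun x => RtoC (f x)) L = RtoC (lsumR f L).
Proof.
  induction L as [|a L IH]; unfold lsum, lsumR in *; simpl; auto.
  now rewrite IH, RtoC_plus.
Qed.

Lemma Cconj_lsum {T} (f : T -> C) L : Cconj (lsum f L) = lsum (fun x => Cconj (f x)) L.
Proof.
  induction L as [|a L IH]; unfold lsum in *; simpl.
  - unfold Cconj, RtoC; simpl; f_equal; ring.
  - rewrite <- IH. unfold Cconj, Cplus; simpl; f_equal; ring.
Qed.

Lemma lsum_prod {A B} (F : A * B -> C) K L :
  lsum F (list_prod K L) = lsum (fun a => lsum (fun b => F (a, b)) L) K.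
Proof.
  induction K as [|a K IH]; [reflexivity|].
  simpl. rewrite lsum_app, IH, lsum_map. reflexivity.
Qed.

Lemma lsumR_prod {A B} (F : A * B -> R) K L :
  lsumR F (list_prod K L) = lsumR (fun a => lsumR (fun b => F (a, b)) L) K.
Proof.
  induction K as [|a K IH]; [reflexivity|].
  simpl. rewrite lsumR_app, IH, lsumR_map. reflexivity.
Qed.

Lemma incl_NoDup_split {T} (U L : list T) :
  NoDup U -> incl U L -> exists V, Permutation L (U ++ V).
Proof.
  revert L; induction U as [|a U IH]; intros L HU HI.
  - exists L; reflexivity.
  - inversion HU; subst.
    destruct (in_split a L) as [l1 [l2 ->]]; [apply HI; now left|].
    destruct (IH (l1 ++ l2)) as [V HV]; auto.
    + intros x Hx. assert (Hx' : In x (l1 ++ a :: l2)) by (apply HI; now right).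
      apply in_app_or in Hx'; apply in_or_app; destruct Hx' as [|[E|]]; auto.
      subst; contradiction.
    + exists V. simpl. rewrite <- HV. symmetry; apply Permutation_middle.
Qed.

Lemma lsumR_incl {T} (f : T -> R) U L :
  (forall x, 0 <= f x) -> NoDup U -> incl U L -> lsumR f U <= lsumR f L.
Proof.
  intros Hf HU HI; destruct (incl_NoDup_split U L HU HI) as [V HV].
  rewrite (lsumR_perm f _ _ HV), lsumR_app.
  pose proof (lsumR_ge_0 f V Hf); lra.
Qed.

Definition clfilter {T} (P : T -> Prop) : list T -> list T :=
  filter (fun x => if excluded_middle_informative (P x) then true else false).

Lemma In_clfilter {T} (P : T -> Prop) L x : In x (clfilter P L) <-> In x L /\ P x.
Proof.
  unfold clfilter; rewrite filter_In.
  destruct (excluded_middle_informative (P x)); intuition congruence.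
Qed.

Definition clnodup {T} : list T -> list T :=
  nodup (fun x y : T => excluded_middle_informative (x = y)).

Lemma NoDup_clnodup {T} (L : list T) : NoDup (clnodup L).
Proof. apply NoDup_nodup. Qed.

Lemma In_clnodup {T} (L : list T) x : In x (clnodup L) <-> In x L.
Proof. apply nodup_In. Qed.

Lemma NoDup_map_inj {T U} (h : U -> T) L :
  (forall x y, h x = h y -> x = y) -> NoDup L -> NoDup (map h L).
Proof. intros; now apply FinFun.Injective_map_NoDup. Qed.

Lemma NoDup_prod {A B} (K : list A) (L : list B) :
  NoDup K -> NoDup L -> NoDup (list_prod K L).
Proof.
  intros HK HL; induction HK as [|a K Ha HK IH]; simpl; [constructor|].
  apply NoDup_app; auto.
  - apply NoDup_map_inj; auto. now intros x y [= ->].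
  - intros [a' b] H1 H2. apply in_map_iff in H1 as [b' [[= <- <-] _]].
    apply in_prod_iff in H2 as [? _]; contradiction.
Qed.

Lemma bsum_nonneg {T} (f : T -> R) B : bsum f B -> 0 <= B.
Proof. intros H; apply (H nil); constructor. Qed.

Lemma bsum_le {T} (f g : T -> R) B : (forall x, f x <= g x) -> bsum g B -> bsum f B.
Proof.
  intros H Hg L HL; eapply Rle_trans; [apply lsumR_le; intros; apply H|auto].
Qed.

Lemma bsum_weaken {T} (f : T -> R) B B' : bsum f B -> B <= B' -> bsum f B'.
Proof. intros H Hb L HL; specialize (H L HL); lra. Qed.

Lemma bsum_scal {T} (f : T -> R) c B :
  0 <= c -> bsum f B -> bsum (fun x => c * f x) (c * B).
Proof. intros Hc H L HL; rewrite lsumR_scal; apply Rmult_le_compat_l; auto. Qed.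

Lemma bsum_plus {T} (f g : T -> R) B B' :
  bsum f B -> bsum g B' -> bsum (fun x => f x + g x) (B + B').
Proof. intros H H' L HL; rewrite lsumR_plus; apply Rplus_le_compat; auto. Qed.

Lemma bsum_point {T} (f : T -> R) B x : bsum f B -> f x <= B.
Proof.
  intros H; specialize (H (x :: nil)); unfold lsumR in H; simpl in H.
  rewrite Rplus_0_r in H; apply H; constructor; [easy|constructor].
Qed.

Lemma bsum_inj {T U} (f : T -> R) (h : U -> T) B :
  (forall x y, h x = h y -> x = y) -> bsum f B -> bsum (fun x => f (h x)) B.
Proof. intros Hh H L HL; rewrite <- lsumR_map; apply H; now apply NoDup_map_inj. Qed.

(** A finite set of pairs lies in the product of its two projections, where the sum can be taken row
    by row. This is Tonelli's theorem at the level of bounds. *)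
Lemma bsum_prod {A B} (F : A * B -> R) (g : A -> R) Bd :
  (forall x, 0 <= F x) ->
  (forall a, bsum (fun b => F (a, b)) (g a)) -> bsum g Bd -> bsum F Bd.
Proof.
  intros HF Hr Hg L HL.
  apply Rle_trans with
    (lsumR F (list_prod (clnodup (map fst L)) (clnodup (map snd L)))).
  - apply lsumR_incl; auto. intros [a b] H.
    apply in_prod_iff; rewrite !In_clnodup; split;
    [apply (in_map fst _ _ H)|apply (in_map snd _ _ H)].
  - rewrite lsumR_prod. eapply Rle_trans; [apply lsumR_le|apply Hg, NoDup_clnodup].
    intros a _; apply Hr, NoDup_clnodup.
Qed.

(** A finite set whose sum comes within [eps] of the supremum of all partial sums leaves room for at
    most [eps] on any disjoint set. *)
Lemma bsum_tail {T} (g : T -> R) B : (forall x, 0 <= g x) -> bsum g B ->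
  forall eps, 0 < eps -> exists L0, NoDup L0 /\
    forall L, NoDup L -> (forall x, In x L -> ~ In x L0) -> lsumR g L <= eps.
Proof.
  intros Hg HB eps He.
  destruct (completeness (fun r => exists L, NoDup L /\ r = lsumR g L)) as [S [HS1 HS2]].
  - exists B; intros r [L [HL ->]]; auto.
  - exists 0, nil; split; [constructor|reflexivity].
  - destruct (excluded_middle_informative (exists L0, NoDup L0 /\ S - eps < lsumR g L0))
      as [[L0 [HL0 H0]]|Hn].
    + exists L0; split; auto. intros L HL Hd.
      assert (H : lsumR g (L0 ++ L) <= S).
      { apply HS1; exists (L0 ++ L); split; auto. apply NoDup_app; auto.
        intros x H1 H2; now apply (Hd x). }
      rewrite lsumR_app in H; lra.
    + exfalso. assert (S <= S - eps); [|lra]. apply HS2.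
      intros r [L [HL ->]]. destruct (Rle_dec (lsumR g L) (S - eps)); auto.
      exfalso; apply Hn; exists L; split; auto; lra.
Qed.

Lemma has_sum_unique {T} (f : T -> C) l1 l2 : has_sum f l1 -> has_sum f l2 -> l1 = l2.
Proof.
  intros H1 H2. destruct (Ceq_dec l1 l2) as [|Hn]; auto. exfalso.
  assert (Hd : 0 < Cmod (l1 - l2)) by (apply Cmod_gt_0; now apply Cminus_eq_contra).
  destruct (H1 (Cmod (l1 - l2) / 4)) as [A [HA H1']]; [lra|].
  destruct (H2 (Cmod (l1 - l2) / 4)) as [B [HB H2']]; [lra|].
  pose (L := clnodup (A ++ B)).
  assert (E1 := H1' L (NoDup_clnodup _)). assert (E2 := H2' L (NoDup_clnodup _)).
  unfold L in E1, E2.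
  assert (I1 : incl A (clnodup (A ++ B))) by (intros x Hx; apply In_clnodup, in_or_app; auto).
  assert (I2 : incl B (clnodup (A ++ B))) by (intros x Hx; apply In_clnodup, in_or_app; auto).
  specialize (E1 I1); specialize (E2 I2). fold L in E1, E2.
  assert (E : (l1 - l2 = (lsum f L - l2) + - (lsum f L - l1))%C) by ring.
  pose proof (Cmod_triangle (lsum f L - l2) (- (lsum f L - l1))) as E3.
  rewrite <- E, Cmod_opp in E3. lra.
Qed.

Lemma has_sum_scal {T} (f : T -> C) c l :
  has_sum f l -> has_sum (fun x => c * f x)%C (c * l)%C.
Proof.
  intros H eps He. pose proof (Cmod_ge_0 c) as Hc.
  destruct (H (eps / (Cmod c + 1))) as [L0 [HL0 H0]].
  { apply Rdiv_lt_0_compat; lra. }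
  exists L0; split; auto. intros L HL HI. rewrite lsum_scal.
  replace (c * lsum f L - c * l)%C with (c * (lsum f L - l))%C by ring.
  rewrite Cmod_mult. specialize (H0 L HL HI).
  apply Rle_trans with ((Cmod c + 1) * (eps / (Cmod c + 1))).
  - apply Rmult_le_compat; try lra. apply Cmod_ge_0.
  - right; field; lra.
Qed.

Lemma has_sum_plus {T} (f g : T -> C) l l' :
  has_sum f l -> has_sum g l' -> has_sum (fun x => f x + g x)%C (l + l')%C.
Proof.
  intros H1 H2 eps He.
  destruct (H1 (eps / 2)) as [A [HA H1']]; [lra|].
  destruct (H2 (eps / 2)) as [B [HB H2']]; [lra|].
  exists (clnodup (A ++ B)); split; [apply NoDup_clnodup|]. intros L HL HI.
  rewrite lsum_plus.
  replace (lsum f L + lsum g L - (l + l'))%C with ((lsum f L - l) + (lsum g L - l'))%C by ring.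
  eapply Rle_trans; [apply Cmod_triangle|].
  assert (incl A L) by (intros x Hx; apply HI, In_clnodup, in_or_app; auto).
  assert (incl B L) by (intros x Hx; apply HI, In_clnodup, in_or_app; auto).
  specialize (H1' L HL H); specialize (H2' L HL H0). lra.
Qed.

Lemma has_sum_ext {T} (f g : T -> C) l :
  (forall x, f x = g x) -> has_sum f l -> has_sum g l.
Proof. intros E H. replace g with f; auto. now apply functional_extensionality. Qed.

Lemma has_sum_nonneg {T} (g : T -> R) B : (forall x, 0 <= g x) -> bsum g B ->
  exists S : R, has_sum (fun x => RtoC (g x)) (RtoC S).
Proof.
  intros Hg HB.
  destruct (completeness (fun r => exists L, NoDup L /\ r = lsumR g L)) as [S [HS1 HS2]].
  - exists B; intros r [L [HL ->]]; auto.
  - exists 0, nil; split; [constructor|reflexivity].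
  - exists S; intros eps He.
    destruct (excluded_middle_informative (exists L0, NoDup L0 /\ S - eps < lsumR g L0))
      as [[L0 [HL0 H0]]|Hn].
    + exists L0; split; auto. intros L HL HI.
      rewrite lsum_RtoC, <- RtoC_minus, Cmod_R.
      assert (lsumR g L <= S) by (apply HS1; eauto).
      pose proof (lsumR_incl g L0 L Hg HL0 HI).
      rewrite Rabs_left1; lra.
    + exfalso. assert (S <= S - eps); [|lra]. apply HS2.
      intros r [L [HL ->]]. destruct (Rle_dec (lsumR g L) (S - eps)); auto.
      exfalso; apply Hn; exists L; split; auto; lra.
Qed.

(** Write g as (|g| + g) - |g|: both parts are nonnegative, so their sums are suprema. *)
Lemma has_sum_real {T} (g : T -> R) B : bsum (fun x => Rabs (g x)) B ->
  exists S : C, has_sum (fun x => RtoC (g x)) S.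
Proof.
  intros HB.
  destruct (has_sum_nonneg (fun x => Rabs (g x) + g x) (2 * B)) as [S1 H1].
  { intros x; pose proof (Rle_abs (- g x)) as H; rewrite Rabs_Ropp in H; lra. }
  { apply bsum_le with (fun x => 2 * Rabs (g x)); [|apply bsum_scal; auto; lra].
    intros x; pose proof (Rle_abs (g x)); lra. }
  destruct (has_sum_nonneg (fun x => Rabs (g x)) B) as [S2 H2]; auto using Rabs_pos.
  exists (S1 + RtoC (-1) * S2)%C.
  apply has_sum_ext with (fun x => RtoC (Rabs (g x) + g x) + RtoC (-1) * RtoC (Rabs (g x)))%C.
  - intros x. rewrite <- RtoC_mult, <- RtoC_plus. f_equal; ring.
  - apply has_sum_plus; auto. now apply has_sum_scal.
Qed.

Lemma Rabs_fst_Cmod (z : C) : Rabs (fst z) <= Cmod z.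
Proof. eapply Rle_trans; [|apply Rmax_Cmod]; apply Rmax_l. Qed.

Lemma Rabs_snd_Cmod (z : C) : Rabs (snd z) <= Cmod z.
Proof. eapply Rle_trans; [|apply Rmax_Cmod]; apply Rmax_r. Qed.

Lemma summable_has_sum {T} (f : T -> C) : summable f -> has_sum f (tsum f).
Proof.
  intros [B HB]. unfold tsum. apply epsilon_spec.
  destruct (has_sum_real (fun x => fst (f x)) B) as [S1 H1].
  { eapply bsum_le; [|exact HB]; intros; apply Rabs_fst_Cmod. }
  destruct (has_sum_real (fun x => snd (f x)) B) as [S2 H2].
  { eapply bsum_le; [|exact HB]; intros; apply Rabs_snd_Cmod. }
  exists (S1 + Ci * S2)%C.
  apply has_sum_ext with (fun x => RtoC (fst (f x)) + Ci * RtoC (snd (f x)))%C.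
  - intros x. destruct (f x) as [u v]. unfold RtoC, Ci, Cplus, Cmult; simpl; f_equal; ring.
  - apply has_sum_plus; auto. now apply has_sum_scal.
Qed.

Lemma has_sum_tsum {T} (f : T -> C) l : has_sum f l -> tsum f = l.
Proof.
  intros H. apply has_sum_unique with f; auto. unfold tsum. apply epsilon_spec; eauto.
Qed.

Lemma tsum_ext {T} (f g : T -> C) : (forall x, f x = g x) -> tsum f = tsum g.
Proof. intros E. replace g with f; auto. now apply functional_extensionality. Qed.

Lemma summable_le {T} (f : T -> C) (g : T -> R) B :
  (forall x, Cmod (f x) <= g x) -> bsum g B -> summable f.
Proof. intros H Hg; exists B; eapply bsum_le; eauto. Qed.

Lemma summable_ext {T} (f g : T -> C) : (forall x, f x = g x) -> summable f -> summable g.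
Proof. intros E H. replace g with f; auto. now apply functional_extensionality. Qed.

Lemma summable_scal {T} (f : T -> C) c : summable f -> summable (fun x => c * f x)%C.
Proof.
  intros [B HB]. exists (Cmod c * B).
  apply bsum_le with (fun x => Cmod c * Cmod (f x)).
  - intros; rewrite Cmod_mult; lra.
  - apply bsum_scal; auto. apply Cmod_ge_0.
Qed.

Lemma summable_plus {T} (f g : T -> C) :
  summable f -> summable g -> summable (fun x => f x + g x)%C.
Proof.
  intros [B HB] [B' HB']. exists (B + B').
  apply bsum_le with (fun x => Cmod (f x) + Cmod (g x)).
  - intros; apply Cmod_triangle.
  - now apply bsum_plus.
Qed.

Lemma tsum_scal {T} (f : T -> C) c :
  summable f -> tsum (fun x => c * f x)%C = (c * tsum f)%C.
Proof. intros H. apply has_sum_tsum, has_sum_scal, summable_has_sum, H. Qed.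

Lemma tsum_plus {T} (f g : T -> C) : summable f -> summable g ->
  tsum (fun x => f x + g x)%C = (tsum f + tsum g)%C.
Proof.
  intros H H'. apply has_sum_tsum, has_sum_plus; now apply summable_has_sum.
Qed.

Lemma tsum_0 {T} : tsum (fun _ : T => RtoC 0) = RtoC 0.
Proof.
  apply has_sum_tsum. intros eps He. exists nil; split; [constructor|].
  intros L _ _. rewrite lsum_RtoC, lsumR_const.
  rewrite Rmult_0_r. replace (0 - 0)%C with (RtoC 0) by ring. rewrite Cmod_0; lra.
Qed.

Lemma Cmod_le_eps (z : C) r : (forall eps, 0 < eps -> Cmod z <= r + eps) -> Cmod z <= r.
Proof. intros H. apply le_epsilon; auto. Qed.

Lemma Cmod_tsum_le {T} (f : T -> C) (g : T -> R) B :
  (forall x, Cmod (f x) <= g x) -> bsum g B -> Cmod (tsum f) <= B.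
Proof.
  intros H Hg. assert (Hs := summable_has_sum f (summable_le f g B H Hg)).
  apply Cmod_le_eps. intros eps He.
  destruct (Hs eps He) as [L [HL Hs']]. specialize (Hs' L HL (incl_refl _)).
  replace (tsum f) with (lsum f L + - (lsum f L - tsum f))%C by ring.
  eapply Rle_trans; [apply Cmod_triangle|]. rewrite Cmod_opp.
  pose proof (Cmod_lsum f L).
  assert (lsumR (fun x => Cmod (f x)) L <= B); [|lra].
  eapply Rle_trans; [apply lsumR_le; intros; apply H|auto].
Qed.

Lemma Cconj_RtoC r : Cconj (RtoC r) = RtoC r.
Proof. unfold Cconj, RtoC; simpl; f_equal; ring. Qed.

Lemma tsum_conj {T} (f : T -> C) :
  summable f -> tsum (fun x => Cconj (f x)) = Cconj (tsum f).
Proof.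
  intros H. apply has_sum_tsum. intros eps He.
  destruct (summable_has_sum f H eps He) as [L0 [HL0 H0]].
  exists L0; split; auto. intros L HL HI.
  rewrite <- Cconj_lsum, <- Cminus_conj, Cmod_conj. auto.
Qed.

Lemma has_sum_bij {T U} (f : T -> C) (h : U -> T) (g : T -> U) l :
  (forall x, h (g x) = x) -> (forall y, g (h y) = y) ->
  has_sum f l -> has_sum (fun y => f (h y)) l.
Proof.
  intros E1 E2 H eps He. destruct (H eps He) as [L0 [HL0 H0]].
  assert (Hh : forall x y, h x = h y -> x = y) by (intros x y Hxy; rewrite <- (E2 x), Hxy; auto).
  assert (Hg : forall x y, g x = g y -> x = y) by (intros x y Hxy; rewrite <- (E1 x), Hxy; auto).
  exists (map g L0); split; [now apply NoDup_map_inj|].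
  intros L HL HI. rewrite <- lsum_map. apply H0; [now apply NoDup_map_inj|].
  intros x Hx. rewrite <- (E1 x). apply in_map, HI, in_map, Hx.
Qed.

Lemma tsum_bij {T U} (f : T -> C) (h : U -> T) (g : T -> U) :
  (forall x, h (g x) = x) -> (forall y, g (h y) = y) ->
  summable f -> tsum (fun y => f (h y)) = tsum f.
Proof.
  intros E1 E2 H. apply has_sum_tsum, (has_sum_bij _ h g); auto. now apply summable_has_sum.
Qed.

Lemma summable_inj {T U} (f : T -> C) (h : U -> T) :
  (forall x y, h x = h y -> x = y) -> summable f -> summable (fun x => f (h x)).
Proof.
  intros Hh [B HB]; exists B. now apply (bsum_inj (fun x => Cmod (f x))).
Qed.

Lemma summable_row {A B} (F : A * B -> C) a : summable F -> summable (fun b => F (a, b)).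
Proof. intros H. apply (summable_inj F (fun b => (a, b))); auto. now intros x y [= ->]. Qed.

(** Compare with the sum over a rectangle [K] times [B1]: for [B1] large it is close to the total
    sum and, simultaneously, to the sum of the finitely many row sums over [K]. *)
Lemma has_sum_fubini {A B} (F : A * B -> C) : summable F ->
  has_sum (fun a => tsum (fun b => F (a, b))) (tsum F).
Proof.
  intros HF eps He.
  destruct (summable_has_sum F HF (eps / 2)) as [L0 [HL0 H0]]; [lra|].
  exists (clnodup (map fst L0)); split; [apply NoDup_clnodup|].
  intros K HK HI. set (g := fun a => tsum (fun b => F (a, b))).
  (* Error allowed per row, so that all rows of [K] together cost at most [eps / 2]; the added 1
     covers an empty [K]. *)
  set (e := eps / 2 / (INR (length K) + 1)).
  pose proof (pos_INR (length K)) as HlK.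
  assert (Hepos : 0 < e) by (unfold e; apply Rdiv_lt_0_compat; lra).
  assert (Hcommon : forall K' : list A, exists B0 : list B, forall B1, NoDup B1 -> incl B0 B1 ->
    forall a, In a K' -> Cmod (lsum (fun b => F (a, b)) B1 - g a) <= e).
  { induction K' as [|a K' [B0 IH]].
    - exists nil; intros ? ? ? ? [].
    - destruct (summable_has_sum _ (summable_row F a HF) e Hepos) as [Ba [_ Ha]].
      exists (Ba ++ B0). intros B1 HB1 HI1 a' [<-|Ha'].
      + apply Ha; auto. intros x Hx; apply HI1, in_or_app; auto.
      + apply IH; auto. intros x Hx; apply HI1, in_or_app; auto. }
  destruct (Hcommon K) as [B0 HB0].
  set (B1 := clnodup (B0 ++ map snd L0)).
  assert (HB1 : NoDup B1) by apply NoDup_clnodup.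
  specialize (HB0 B1 HB1). specialize (H0 (list_prod K B1) (NoDup_prod K B1 HK HB1)).
  assert (HI1 : incl L0 (list_prod K B1)).
  { intros [a b] Hab. apply in_prod_iff; split.
    - apply HI, In_clnodup, (in_map fst _ _ Hab).
    - apply In_clnodup, in_or_app; right; apply (in_map snd _ _ Hab). }
  specialize (H0 HI1). rewrite lsum_prod in H0.
  assert (HI2 : incl B0 B1) by (intros x Hx; apply In_clnodup, in_or_app; auto).
  specialize (HB0 HI2).
  set (S := lsum (fun a => lsum (fun b => F (a, b)) B1) K) in *.
  replace (lsum g K - tsum F)%C with (- (S - lsum g K) + (S - tsum F))%C by ring.
  eapply Rle_trans; [apply Cmod_triangle|]. rewrite Cmod_opp.
  assert (Cmod (S - lsum g K) <= INR (length K) * e).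
  { unfold S. rewrite <- lsum_minus. eapply Rle_trans; [apply Cmod_lsum|].
    rewrite <- lsumR_const. apply lsumR_le. auto. }
  assert (INR (length K) * e <= eps / 2); [|lra].
  apply Rle_trans with ((INR (length K) + 1) * e); [nra|].
  right; unfold e; field; lra.
Qed.

Lemma tsum_fubini {A B} (F : A * B -> C) : summable F ->
  tsum F = tsum (fun a => tsum (fun b => F (a, b))).
Proof. intros H. symmetry. now apply has_sum_tsum, has_sum_fubini. Qed.

Lemma summable_swap {A B} (F : A * B -> C) :
  summable F -> summable (fun x : B * A => F (snd x, fst x)).
Proof.
  intros H. apply (summable_inj F (fun x : B * A => (snd x, fst x))); auto.
  intros [] [] [=]; subst; auto.
Qed.

Lemma tsum_fubini_swap {A B} (F : A -> B -> C) : summable (fun x => F (fst x) (snd x)) ->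
  tsum (fun a => tsum (fun b => F a b)) = tsum (fun b => tsum (fun a => F a b)).
Proof.
  intros H.
  transitivity (tsum (fun x => F (fst x) (snd x))).
  - symmetry. apply (tsum_fubini (fun x => F (fst x) (snd x)) H).
  - transitivity (tsum (fun x : B * A => F (snd x) (fst x))).
    + symmetry. apply (tsum_bij (fun x => F (fst x) (snd x))
        (fun x : B * A => (snd x, fst x)) (fun x : A * B => (snd x, fst x))); auto;
      intros []; auto.
    + apply (tsum_fubini (fun x : B * A => F (snd x) (fst x))).
      apply (summable_swap (fun x => F (fst x) (snd x))); auto.
Qed.

Lemma summable_prod {A B} (F : A * B -> C) (G : A * B -> R) (g : A -> R) Bd :
  (forall x, Cmod (F x) <= G x) -> (forall a, bsum (fun b => G (a, b)) (g a)) ->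
  bsum g Bd -> summable F.
Proof.
  intros H1 H2 H3; apply summable_le with G Bd; auto.
  apply bsum_prod with g; auto.
  intros x; eapply Rle_trans; [apply Cmod_ge_0|apply H1].
Qed.

(** Dominated convergence: outside a finite set the dominating sum is small, and on that set
    convergence is termwise. *)
Lemma bsum_lim {T} (g : T -> R) B (f : nat -> T -> C) (f0 : T -> C) :
  (forall x, 0 <= g x) -> bsum g B ->
  (forall j x, Cmod (f j x) <= g x) ->
  (forall x, is_lim_seq (fun j => Cmod (f j x - f0 x)) 0) ->
  is_lim_seq (fun j => Cmod (tsum (f j) - tsum f0)) 0.
Proof.
  intros Hg HB Hf Hl.
  assert (Hf0 : forall x, Cmod (f0 x) <= g x).
  { intros x. apply Cmod_le_eps. intros eps He.
    destruct (proj2 (is_lim_seq_spec _ _) (Hl x) (mkposreal eps He)) as [N HN].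
    specialize (HN N (le_n _)). simpl in HN. rewrite Rminus_0_r, Rabs_pos_eq in HN by apply Cmod_ge_0.
    replace (f0 x) with (f N x + - (f N x - f0 x))%C by ring.
    eapply Rle_trans; [apply Cmod_triangle|]. rewrite Cmod_opp. specialize (Hf N x). lra. }
  apply is_lim_seq_spec. intros [eps He]. simpl.
  destruct (bsum_tail g B Hg HB (eps / 8)) as [L0 [HL0 H0]]; [lra|].
  assert (Hfin : is_lim_seq (fun j => lsumR (fun x => Cmod (f j x - f0 x)) L0) 0).
  { clear - Hl. induction L0 as [|a L IH]; unfold lsumR; simpl; [apply is_lim_seq_const|].
    replace (Finite 0) with (Finite (0 + 0)) by (f_equal; ring).
    apply is_lim_seq_plus'; auto. }
  destruct (proj2 (is_lim_seq_spec _ _) Hfin (mkposreal (eps / 4) ltac:(lra))) as [N HN].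
  exists N. intros n Hn. specialize (HN n Hn). simpl in HN.
  rewrite Rminus_0_r in *. rewrite Rabs_pos_eq in * by (try apply Cmod_ge_0; apply lsumR_ge_0; intros; apply Cmod_ge_0).
  assert (E : (tsum (f n) - tsum f0 = tsum (fun x => f n x - f0 x))%C).
  { unfold Cminus. replace (- tsum f0)%C with (RtoC (-1) * tsum f0)%C by ring.
    rewrite <- tsum_scal by now apply summable_le with g B.
    rewrite <- tsum_plus; try apply summable_scal; try (apply summable_le with g B; auto).
    apply tsum_ext; intros; ring. }
  rewrite E. apply Rle_lt_trans with (eps / 4 + eps / 4); [|lra].
  apply Cmod_tsum_le with (fun x => Cmod (f n x - f0 x)); [intros; lra|].
  intros L HL.
  set (P := fun x => In x L0).
  assert (Hp : Permutation L (clfilter P L ++ clfilter (fun x => ~ P x) L)).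
  { clear - L. induction L as [|a L IH]; simpl; auto.
    destruct (excluded_middle_informative (P a)), (excluded_middle_informative (~ P a)); try tauto; simpl.
    - now constructor.
    - rewrite <- Permutation_middle. now constructor. }
  rewrite (lsumR_perm _ _ _ Hp), lsumR_app.
  apply Rplus_le_compat.
  - eapply Rle_trans; [|left; exact HN]. apply lsumR_incl.
    + intros; apply Cmod_ge_0.
    + now apply NoDup_filter.
    + intros x Hx; now apply In_clfilter in Hx.
  - apply Rle_trans with (lsumR (fun x => 2 * g x) (clfilter (fun x => ~ P x) L)).
    + apply lsumR_le. intros x _. unfold Cminus. eapply Rle_trans; [apply Cmod_triangle|].
      rewrite Cmod_opp. specialize (Hf n x); specialize (Hf0 x). lra.
    + rewrite lsumR_scal. enough (lsumR g (clfilter (fun x => ~ P x) L) <= eps / 8) by lra.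
      apply H0; [now apply NoDup_filter|]. intros x Hx; now apply In_clfilter in Hx.
Qed.

(** * Unordered sums compared with series over the naturals and the integers *)

Lemma lsumR_seq_sum_n (f : nat -> R) n : lsumR f (seq 0 (S n)) = sum_n f n.
Proof.
  induction n as [|n IH].
  - rewrite sum_O. unfold lsumR; simpl; ring.
  - rewrite seq_S, lsumR_app, IH, sum_Sn. unfold lsumR, plus; simpl; ring.
Qed.

Lemma lsum_seq_sum_n (f : nat -> C) n :
  lsum f (seq 0 (S n)) = @sum_n C_AbelianMonoid f n.
Proof.
  induction n as [|n IH].
  - rewrite sum_O. unfold lsum; simpl; ring.
  - rewrite seq_S, lsum_app, IH, sum_Sn. unfold lsum, plus; simpl; ring.
Qed.

Lemma bsum_nat (f : nat -> R) B : (forall n, 0 <= f n) ->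
  (forall n, sum_n f n <= B) -> bsum f B.
Proof.
  intros Hf H L HL.
  assert (exists n, forall x, In x L -> (x <= n)%nat) as [n Hn].
  { exists (list_max L). intros x Hx. pose proof (proj1 (list_max_le L _) (le_n _)) as F.
    rewrite Forall_forall in F; auto. }
  apply Rle_trans with (lsumR f (seq 0 (S n))).
  - apply lsumR_incl; auto. intros x Hx; apply in_seq; specialize (Hn x Hx); lia.
  - rewrite lsumR_seq_sum_n; auto.
Qed.

Lemma sum_n_le_Series (f : nat -> R) n :
  (forall n, 0 <= f n) -> ex_series f -> sum_n f n <= Series f.
Proof.
  intros Hf [l Hl]. rewrite (is_series_unique _ _ Hl).
  apply (is_lim_seq_incr_compare (sum_n f)); [exact Hl|].
  intros m. rewrite sum_Sn. unfold plus; simpl. specialize (Hf (S m)); lra.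
Qed.

Lemma bsum_Series (f : nat -> R) : (forall n, 0 <= f n) -> ex_series f -> bsum f (Series f).
Proof. intros Hf Hs; apply bsum_nat; auto. intros; now apply sum_n_le_Series. Qed.

Lemma bsum_ex_series (f : nat -> R) B : (forall n, 0 <= f n) -> bsum f B -> ex_series f.
Proof.
  intros Hf HB. assert (Hi : forall n, sum_n f n <= sum_n f (S n)).
  { intros m. rewrite sum_Sn. unfold plus; simpl. specialize (Hf (S m)); lra. }
  destruct (ex_finite_lim_seq_incr (sum_n f) B Hi) as [l Hl].
  - intros n. rewrite <- lsumR_seq_sum_n. apply HB, seq_NoDup.
  - now exists l.
Qed.

Lemma bsum_Series_le (f : nat -> R) B : (forall n, 0 <= f n) -> bsum f B -> Series f <= B.
Proof.
  intros Hf HB. destruct (bsum_ex_series f B Hf HB) as [l Hl].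
  rewrite (is_series_unique _ _ Hl).
  apply (is_lim_seq_le (sum_n f) (fun _ => B) l B); [|exact Hl|apply is_lim_seq_const].
  intros n. rewrite <- lsumR_seq_sum_n. apply HB, seq_NoDup.
Qed.

Lemma has_sum_is_series (f : nat -> C) l : has_sum f l -> is_series (V := C_NormedModule) f l.
Proof.
  intros H. apply filterlim_locally_ball_norm. intros [eps He].
  destruct (H (eps / 2)) as [L0 [HL0 H0]]; [lra|].
  exists (list_max L0). intros n Hn. unfold ball_norm.
  change (Cmod (sum_n f n - l) < eps).
  change (sum_n f n) with (@sum_n C_AbelianMonoid f n).
  rewrite <- lsum_seq_sum_n. change (pos (mkposreal eps He)) with eps.
  apply Rle_lt_trans with (eps / 2); [|lra].
  apply H0; [apply seq_NoDup|]. intros x Hx. apply in_seq.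
  pose proof (proj1 (list_max_le L0 _) (le_n _)) as F. rewrite Forall_forall in F.
  specialize (F x Hx). lia.
Qed.

Lemma is_series_C_unique (f : nat -> C) l l' :
  is_series (V := C_NormedModule) f l -> is_series (V := C_NormedModule) f l' -> l = l'.
Proof.
  intros H H'.
  exact (filterlim_locally_unique (K := C_AbsRing) (V := C_NormedModule) (F := eventually)
    (@sum_n C_AbelianMonoid f) l l' H H').
Qed.

Lemma has_sum_series_R (f : nat -> R) l : is_series f l -> bsum (fun n => Rabs (f n)) (Series (fun n => Rabs (f n))) ->
  tsum (fun n => RtoC (f n)) = RtoC l.
Proof.
  intros Hl HB.
  assert (Hs : summable (fun n => RtoC (f n))).
  { eexists. eapply bsum_le; [|exact HB]. intros; rewrite Cmod_R; lra. }
  assert (H := has_sum_is_series _ _ (summable_has_sum _ Hs)).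
  assert (H' : is_series (V := C_NormedModule) (fun n => RtoC (f n)) (RtoC l)).
  { apply filterlim_locally_ball_norm. intros eps.
    destruct (proj1 (filterlim_locally_ball_norm _ _) Hl eps) as [N HN].
    exists N. intros n Hn. specialize (HN n Hn). unfold ball_norm in *.
    change (Rabs (sum_n f n - l) < eps) in HN.
    change (Cmod (@sum_n C_AbelianMonoid (fun n => RtoC (f n)) n - RtoC l) < eps).
    rewrite <- lsum_seq_sum_n, lsum_RtoC, lsumR_seq_sum_n, <- RtoC_minus, Cmod_R; auto. }
  now apply is_series_C_unique with (fun n => RtoC (f n)).
Qed.

(** Enumerates the negative half exactly as [is_seriesZ] does; starting at -1 keeps 0 from being
    counted twice. *)
Definition negS (n : nat) : Z := (- Z.of_nat (S n))%Z.

Lemma list_Z_split (L : list Z) : NoDup L -> exists L1 L2 : list nat,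
  Permutation L (map Z.of_nat L1 ++ map negS L2) /\ NoDup L1 /\ NoDup L2.
Proof.
  induction 1 as [|a L Ha HL (L1 & L2 & HP & H1 & H2)].
  - exists nil, nil; repeat split; constructor.
  - destruct (Z_le_dec 0 a) as [Hp|Hn].
    + exists (Z.to_nat a :: L1), L2. repeat split; auto.
      * simpl. rewrite Z2Nat.id by lia. now constructor.
      * constructor; auto. intros Hi; apply Ha.
        rewrite HP. apply in_or_app; left. rewrite <- (Z2Nat.id a) by lia. now apply in_map.
    + exists L1, (Z.to_nat (- a - 1) :: L2).
      assert (E : negS (Z.to_nat (- a - 1)) = a) by (unfold negS; lia).
      repeat split; auto.
      * simpl map. rewrite E, <- Permutation_middle. now constructor.
      * constructor; auto. intros Hi; apply Ha.
        rewrite HP. apply in_or_app; right. rewrite <- E. now apply in_map.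
Qed.

Lemma bsum_Z_split (f : Z -> R) B1 B2 :
  bsum (fun n => f (Z.of_nat n)) B1 -> bsum (fun n => f (negS n)) B2 -> bsum f (B1 + B2).
Proof.
  intros H1 H2 L HL. destruct (list_Z_split L HL) as (L1 & L2 & HP & N1 & N2).
  rewrite (lsumR_perm _ _ _ HP), lsumR_app, !lsumR_map.
  apply Rplus_le_compat; auto.
Qed.

(** At most two integers share an absolute value, whence the factor 2. *)
Lemma bsum_Z_abs (f : Z -> R) (g : nat -> R) B :
  (forall n, 0 <= f n) -> (forall n, f n <= g (Z.abs_nat n)) -> bsum g B -> bsum f (2 * B).
Proof.
  intros H0 H HB. replace (2 * B) with (B + B) by ring. apply bsum_Z_split.
  - eapply bsum_le; [|exact HB]. intros n. eapply Rle_trans; [apply H|].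
    rewrite Zabs2Nat.id; lra.
  - apply bsum_le with (fun n => g (S n)); [|apply (bsum_inj g S); auto].
    intros n. eapply Rle_trans; [apply H|]. replace (Z.abs_nat (negS n)) with (S n); [lra|].
    unfold negS; lia.
Qed.

Lemma negS_inj x y : negS x = negS y -> x = y.
Proof. unfold negS; lia. Qed.

Lemma has_sum_Z (f : Z -> C) : summable f -> is_seriesZ f (tsum f).
Proof.
  intros Hf.
  assert (Hs1 := summable_inj f Z.of_nat Nat2Z.inj Hf).
  assert (Hs2 := summable_inj f negS negS_inj Hf).
  exists (tsum (fun n => f (Z.of_nat n))), (tsum (fun n => f (negS n))).
  split; [now apply has_sum_is_series, summable_has_sum|].
  split; [now apply (has_sum_is_series (fun n => f (negS n))), summable_has_sum|].
  apply has_sum_tsum. intros eps He.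
  destruct (summable_has_sum _ Hs1 (eps / 2)) as [A [HA H1]]; [lra|].
  destruct (summable_has_sum _ Hs2 (eps / 2)) as [B [HB H2]]; [lra|].
  exists (clnodup (map Z.of_nat A ++ map negS B)); split; [apply NoDup_clnodup|].
  intros L HL HI.
  destruct (list_Z_split L HL) as (L1 & L2 & HP & N1 & N2).
  rewrite (lsum_perm _ _ _ HP), lsum_app, !lsum_map.
  match goal with |- Cmod (?a + ?b - (?c + ?d)) <= _ =>
    replace (a + b - (c + d))%C with ((a - c) + (b - d))%C by ring end.
  eapply Rle_trans; [apply Cmod_triangle|].
  replace eps with (eps / 2 + eps / 2) by lra.
  apply Rplus_le_compat; [apply H1|apply H2]; auto.
  - intros x Hx. assert (Hin : In (Z.of_nat x) L).
    { apply HI, In_clnodup, in_or_app; left. now apply in_map. }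
    rewrite HP in Hin. apply in_app_or in Hin as [Hin|Hin];
    apply in_map_iff in Hin as [y [E Hy]].
    + apply Nat2Z.inj in E; now subst.
    + unfold negS in E; lia.
  - intros x Hx. assert (Hin : In (negS x) L).
    { apply HI, In_clnodup, in_or_app; right. now apply in_map. }
    rewrite HP in Hin. apply in_app_or in Hin as [Hin|Hin];
    apply in_map_iff in Hin as [y [E Hy]].
    + unfold negS in E; lia.
    + apply negS_inj in E; now subst.
Qed.

Lemma is_seriesZ_tsum (f : Z -> C) l : summable f -> is_seriesZ f l -> tsum f = l.
Proof.
  intros Hf (l1 & l2 & H1 & H2 & ->).
  destruct (has_sum_Z f Hf) as (l1' & l2' & H1' & H2' & ->).
  now rewrite (is_series_C_unique _ _ _ H1 H1'), (is_series_C_unique _ _ _ H2 H2').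
Qed.

(** * Bessel functions *)

(** Domination by the coefficients of [D * exp] gives an infinite radius of convergence and the
    bound [D * exp (Rabs x)] at once, with explicit dependence on the order through [D]. *)
Definition exp_coef (a : nat -> R) (D : R) : Prop :=
  forall j : nat, Rabs (a j) <= D * / INR (fact j).

Lemma fact_S_R n : INR (fact (S n)) = (INR n + 1) * INR (fact n).
Proof. rewrite fact_simpl, mult_INR, S_INR; ring. Qed.

Lemma fact_add_ge j n : INR (fact j) * INR (fact n) <= INR (fact (j + n)).
Proof.
  induction j as [|j IH].
  - simpl fact; simpl INR. rewrite Rmult_1_l. apply Rle_refl.
  - replace (S j + n)%nat with (S (j + n)) by lia. rewrite !fact_S_R.
    pose proof (INR_fact_lt_0 j); pose proof (INR_fact_lt_0 n); pose proof (INR_fact_lt_0 (j + n)).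
    rewrite plus_INR. pose proof (pos_INR j); pose proof (pos_INR n). nra.
Qed.

Lemma fact_ge_1 n : 1 <= INR (fact n).
Proof. apply (le_INR 1), lt_O_fact. Qed.

Lemma exp_series x : is_series (fun n => / INR (fact n) * x ^ n) (exp x).
Proof. apply is_pseries_R, is_exp_Reals. Qed.

Lemma exp_coef_CV a D : exp_coef a D -> CV_radius a = p_infty.
Proof.
  intros H. assert (Hr : forall r : R, Rbar_le r (CV_radius a)).
  { intros r. unfold CV_radius, Lub.Lub_Rbar. destruct Lub.ex_lub_Rbar as [l Hl]. simpl.
    apply (proj1 Hl r). apply (ex_series_le (V := R_CompleteNormedModule) _
      (fun n => D * (/ INR (fact n) * Rabs r ^ n))).
    - intros n. unfold norm; simpl. unfold abs; simpl.
      rewrite Rabs_Rabsolu, Rabs_mult, RPow_abs.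
      rewrite <- Rmult_assoc. apply Rmult_le_compat_r; [apply Rabs_pos|apply H].
    - apply (ex_series_scal_l D (fun n => / INR (fact n) * Rabs r ^ n)).
      eexists; apply exp_series. }
  destruct (CV_radius a) as [r| |]; auto.
  - specialize (Hr (r + 1)); simpl in Hr; lra.
  - specialize (Hr 0); simpl in Hr; contradiction.
Qed.

Lemma exp_coef_ex a D x : exp_coef a D -> ex_pseries a x.
Proof. intros H; apply CV_radius_inside. now rewrite (exp_coef_CV a D H). Qed.

Lemma exp_coef_derive a D x :
  exp_coef a D -> is_derive (PSeries a) x (PSeries (PS_derive a) x).
Proof. intros H; apply is_derive_PSeries. now rewrite (exp_coef_CV a D H). Qed.

Lemma exp_coef_bsum a D x : exp_coef a D ->
  bsum (fun j => Rabs (a j * x ^ j)) (D * exp (Rabs x)).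
Proof.
  intros H. apply bsum_le with (fun n => D * (/ INR (fact n) * Rabs x ^ n)).
  - intros n. rewrite Rabs_mult, RPow_abs, <- Rmult_assoc.
    apply Rmult_le_compat_r; [apply Rabs_pos|apply H].
  - assert (0 <= D).
    { specialize (H 0%nat). simpl in H. pose proof (Rabs_pos (a 0%nat)). lra. }
    apply bsum_scal; auto.
    rewrite <- (is_series_unique _ _ (exp_series (Rabs x))).
    apply bsum_Series; [|eexists; apply exp_series].
    intros n. apply Rmult_le_pos; [left; apply Rinv_0_lt_compat, INR_fact_lt_0|].
    apply pow_le, Rabs_pos.
Qed.

Lemma exp_coef_tsum a D x : exp_coef a D ->
  tsum (fun j => RtoC (a j * x ^ j)) = RtoC (PSeries a x).
Proof.
  intros H. pose proof (exp_coef_bsum a D x H) as HB. apply has_sum_series_R.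
  - apply is_pseries_R, PSeries_correct. now apply exp_coef_ex with D.
  - apply bsum_Series; [intros; apply Rabs_pos|].
    eapply bsum_ex_series; [intros; apply Rabs_pos|exact HB].
Qed.

Lemma exp_coef_PSeries a D x : exp_coef a D -> Rabs (PSeries a x) <= D * exp (Rabs x).
Proof.
  intros H. rewrite <- Cmod_R, <- (exp_coef_tsum a D x H).
  eapply Cmod_tsum_le; [|apply exp_coef_bsum, H].
  intros j; simpl. rewrite Cmod_R; lra.
Qed.

Definition jc (n j : nat) : R := (-1) ^ j / (INR (fact j) * INR (fact (j + n))).

Definition pc (n j : nat) : R :=
  (digammaS j + digammaS (j + n)) * (-1) ^ j / (INR (fact j) * INR (fact (j + n))).

Definition jK (n : nat) (s : R) : R := PSeries (jc n) s.

Definition sK (n : nat) (s : R) : R :=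
  rsum n (fun j => INR (fact (n - j - 1)) / INR (fact j) * s ^ j / s ^ n).

(* With [s = (x/2)^2], [jK n s] and [yK n s] are [J_n(x)] and [Y_n(x)] divided by [(x/2)^n]. *)
Definition yK (n : nat) (s : R) : R :=
  / PI * (ln s * jK n s - sK n s - PSeries (pc n) s).

Lemma Rabs_pow_m1 j : Rabs ((-1) ^ j) = 1.
Proof. apply pow_1_abs. Qed.

Lemma jc_exp_coef n : exp_coef (jc n) (/ INR (fact n)).
Proof.
  intros j. unfold jc, Rdiv. rewrite Rabs_mult, Rabs_pow_m1, Rmult_1_l.
  pose proof (INR_fact_lt_0 j); pose proof (INR_fact_lt_0 (j + n)); pose proof (INR_fact_lt_0 n).
  rewrite Rabs_pos_eq by (left; apply Rinv_0_lt_compat; nra).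
  rewrite <- Rinv_mult. apply Rinv_le_contravar; [nra|].
  pose proof (fact_add_ge j n); pose proof (fact_ge_1 j). nra.
Qed.

Lemma rsum_S n f : rsum (S n) f = rsum n f + f n.
Proof. unfold rsum. fold (lsumR f (seq 0 (S n))) (lsumR f (seq 0 n)).
  rewrite seq_S, lsumR_app. unfold lsumR at 2; simpl. ring. Qed.

Lemma rsum_ext n f g : (forall j, (j < n)%nat -> f j = g j) -> rsum n f = rsum n g.
Proof.
  induction n as [|n IH]; intros H; [reflexivity|]. rewrite !rsum_S.
  rewrite IH, H; auto.
Qed.

Lemma rsum_Sl n f : rsum (S n) f = f 0%nat + rsum n (fun j => f (S j)).
Proof. induction n as [|n IH]; [unfold rsum; simpl; ring|]. rewrite rsum_S, IH, rsum_S; ring. Qed.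

Lemma rsum_plus n f g : rsum n (fun j => f j + g j) = rsum n f + rsum n g.
Proof. induction n as [|n IH]; [unfold rsum; simpl; ring|]. rewrite !rsum_S, IH; ring. Qed.

Lemma rsum_scal n c f : rsum n (fun j => c * f j) = c * rsum n f.
Proof. induction n as [|n IH]; [unfold rsum; simpl; ring|]. rewrite !rsum_S, IH; ring. Qed.

Lemma rsum_le n f g : (forall j, (j < n)%nat -> f j <= g j) -> rsum n f <= rsum n g.
Proof.
  induction n as [|n IH]; intros H; [apply Rle_refl|]. rewrite !rsum_S.
  apply Rplus_le_compat; auto.
Qed.

Lemma rsum_nonneg n f : (forall j, (j < n)%nat -> 0 <= f j) -> 0 <= rsum n f.
Proof.
  induction n as [|n IH]; intros H; [apply Rle_refl|]. rewrite !rsum_S.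
  apply Rplus_le_le_0_compat; auto.
Qed.

Lemma rsum_lsumR n f : rsum n f = lsumR f (seq 0 n).
Proof. reflexivity. Qed.

Lemma is_derive_rsum n (f g : nat -> R -> R) x :
  (forall j, (j < n)%nat -> is_derive (f j) x (g j x)) ->
  is_derive (fun y => rsum n (fun j => f j y)) x (rsum n (fun j => g j x)).
Proof.
  induction n as [|n IH]; intros H.
  - unfold rsum; simpl. apply (is_derive_const (K := R_AbsRing) (V := R_NormedModule)).
  - rewrite rsum_S. apply is_derive_ext with (fun y => rsum n (fun j => f j y) + f n y).
    { intros t; now rewrite rsum_S. }
    apply (is_derive_plus (K := R_AbsRing) (V := R_NormedModule)); auto.
Qed.

Lemma harmonic_S n : harmonic (S n) = harmonic n + / (INR n + 1).
Proof. unfold harmonic. now rewrite rsum_S, S_INR. Qed.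

Lemma digammaS_S n : digammaS (S n) = digammaS n + / (INR n + 1).
Proof. unfold digammaS. rewrite harmonic_S. ring. Qed.

Lemma harmonic_bound n : 0 <= harmonic n <= INR n.
Proof.
  induction n as [|n IH]; [unfold harmonic, rsum; simpl; lra|].
  rewrite harmonic_S, S_INR. pose proof (pos_INR n).
  assert (0 < / (INR n + 1)) by (apply Rinv_0_lt_compat; lra).
  assert (/ (INR n + 1) <= / 1) by (apply Rinv_le_contravar; lra). lra.
Qed.

(** The two digamma values at j and j + n add up to at most 2 (1 + |gamma|) (j + n + 1), and j + n +
    1 is at most 2 (j + n)!. The factorial of j + n in the denominator is thus spent, leaving a
    constant independent of n. *)
Definition pcD : R := 4 * (1 + Rabs euler_gamma).

Lemma pc_exp_coef n : exp_coef (pc n) pcD.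
Proof.
  intros j. unfold pc, Rdiv. rewrite !Rabs_mult, Rabs_pow_m1, Rmult_1_r.
  pose proof (INR_fact_lt_0 j); pose proof (INR_fact_lt_0 (j + n)).
  rewrite (Rabs_pos_eq (/ _)) by (left; apply Rinv_0_lt_compat; nra).
  rewrite Rinv_mult.
  assert (Hd : Rabs (digammaS j + digammaS (j + n)) <= 2 * (1 + Rabs euler_gamma) * (INR (j + n) + 1)).
  { unfold digammaS. pose proof (harmonic_bound j); pose proof (harmonic_bound (j + n)).
    rewrite plus_INR in *. pose proof (pos_INR j); pose proof (pos_INR n).
    pose proof (Rle_abs euler_gamma); pose proof (Rle_abs (- euler_gamma)) as H7; rewrite Rabs_Ropp in H7.
    apply Rabs_le; split; nra. }
  assert (Hf : INR (j + n) + 1 <= 2 * INR (fact (j + n))).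
  { generalize (j + n)%nat; clear; intros m; induction m as [|m IH]; [simpl; lra|].
    rewrite fact_S_R, S_INR. pose proof (fact_ge_1 m). pose proof (pos_INR m).
    destruct m as [|m]; [simpl; lra|]. rewrite S_INR in *. pose proof (pos_INR m). nra. }
  rewrite Rmult_comm, Rmult_assoc, Rmult_comm, (Rmult_comm _ (Rabs _)).
  apply Rmult_le_compat_r; [left; now apply Rinv_0_lt_compat|].
  apply Rmult_le_reg_r with (INR (fact (j + n))); auto. rewrite Rmult_assoc, Rinv_l, Rmult_1_r by lra.
  unfold pcD. pose proof (Rabs_pos euler_gamma). nra.
Qed.

(** In the variable s = (x/2)^2 the classical formula for the derivative of x^(-n) J_n becomes a
    pure shift of the index. This is the reason for splitting off the power (x/2)^n. *)
Lemma jK_derive n s : is_derive (jK n) s (- jK (S n) s).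
Proof.
  unfold jK at 2. rewrite <- PSeries_opp.
  rewrite (PSeries_ext _ (PS_derive (jc n))).
  - apply exp_coef_derive with (/ INR (fact n)), jc_exp_coef.
  - intros j. unfold PS_opp, PS_derive, jc, opp; cbn -[INR fact pow].
    replace (j + S n)%nat with (S (j + n)) by lia. rewrite S_INR, (fact_S_R j).
    pose proof (INR_fact_lt_0 j); pose proof (INR_fact_lt_0 (S (j + n))); pose proof (pos_INR j).
    simpl pow. field. lra.
Qed.

Lemma jK_rec n s : jK n s + s * jK (S (S n)) s = (INR n + 1) * jK (S n) s.
Proof.
  unfold jK. rewrite <- PSeries_incr_1, <- PSeries_scal, <- PSeries_plus.
  - apply PSeries_ext. intros j. unfold PS_plus, PS_incr_1, PS_scal, plus, scal; cbn -[jc].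
    unfold mult; cbn -[jc]. unfold jc. destruct j as [|j].
    + unfold zero. change (0 + S n)%nat with (S n). change (0 + n)%nat with n. rewrite fact_S_R. simpl fact; simpl pow; simpl INR.
      unfold zero; simpl. pose proof (INR_fact_lt_0 n); pose proof (pos_INR n). field; lra.
    + replace (S j + n)%nat with (S (j + n)) by lia.
      replace (S j + S n)%nat with (S (S (j + n))) by lia.
      replace (j + S (S n))%nat with (S (S (j + n))) by lia.
      rewrite (fact_S_R (S (j + n))), !fact_S_R, !S_INR, plus_INR.
      pose proof (INR_fact_lt_0 j); pose proof (INR_fact_lt_0 (j + n)); pose proof (pos_INR j); pose proof (pos_INR n).
      simpl pow. field. repeat split; nra.
  - apply exp_coef_ex with (/ INR (fact n)), jc_exp_coef.
  - eapply CV_radius_inside. rewrite CV_radius_incr_1.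
    now rewrite (exp_coef_CV _ _ (jc_exp_coef _)).
Qed.

(** The increments 1/(j+1) of the digamma function produce the quotient by s. In [yK_derive] it
    cancels against the derivative of [ln s] and the boundary term of [sK_derive], so Y obeys the
    same shift rule as J. *)
Lemma pK_derive n s : s <> 0 ->
  is_derive (PSeries (pc n)) s ((jK n s - / INR (fact n)) / s - PSeries (pc (S n)) s).
Proof.
  intros Hs.
  enough (E : PSeries (PS_derive (pc n)) s = (jK n s - / INR (fact n)) / s - PSeries (pc (S n)) s).
  { rewrite <- E. apply exp_coef_derive with pcD, pc_exp_coef. }
  unfold jK. rewrite (PSeries_decr_1 (jc n)) by (apply exp_coef_ex with (/ INR (fact n)), jc_exp_coef).
  replace (jc n 0) with (/ INR (fact n)).
  2:{ unfold jc. simpl. field. pose proof (INR_fact_lt_0 n); lra. }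
  replace ((/ INR (fact n) + s * PSeries (PS_decr_1 (jc n)) s - / INR (fact n)) / s)
    with (PSeries (PS_decr_1 (jc n)) s) by (field; auto using INR_fact_neq_0).
  rewrite (PSeries_ext (PS_decr_1 (jc n)) (PS_plus (PS_derive (pc n)) (pc (S n)))).
  - rewrite PSeries_plus; [ring| |apply exp_coef_ex with pcD, pc_exp_coef].
    apply CV_radius_inside. rewrite CV_radius_derive. now rewrite (exp_coef_CV _ _ (pc_exp_coef n)).
  - intros j. unfold PS_decr_1, PS_plus, PS_derive, plus, jc, pc; cbn -[INR fact pow].
    replace (S j + n)%nat with (S (j + n)) by lia. replace (j + S n)%nat with (S (j + n)) by lia.
    rewrite !digammaS_S, !fact_S_R, !S_INR, plus_INR. simpl pow.
    pose proof (INR_fact_lt_0 j); pose proof (INR_fact_lt_0 (j + n)); pose proof (pos_INR j); pose proof (pos_INR n).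
    field. repeat split; nra.
Qed.

(** The defect [/ INR (fact (S n))] is the one of [sK_rec] with opposite sign; in [yK_rec] the two
    cancel and the recurrence of [jK] is recovered. *)
Lemma pK_rec n s : PSeries (pc n) s + s * PSeries (pc (S (S n))) s
  = (INR n + 1) * PSeries (pc (S n)) s - / INR (fact (S n)).
Proof.
  (* The constant defect is written as a power series with a single coefficient, so that the
     identity can be compared coefficient by coefficient. *)
  assert (E : forall a : R, ex_pseries (fun j => match j with O => a | _ => 0 end) s /\
     PSeries (fun j => match j with O => a | _ => 0 end) s = a).
  { intros a. assert (H : is_pseries (fun j => match j with O => a | _ => 0 end) s a).
    { apply is_pseries_R. apply is_series_decr_1.
      match goal with |- is_series _ ?l => replace l with 0 by (unfold plus, opp; simpl; ring) end.
      apply filterlim_ext with (fun _ => 0); [|apply filterlim_const].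
      intros m. induction m as [|m IH]; [rewrite sum_O; simpl; ring|].
      rewrite sum_Sn, <- IH. unfold plus; simpl; ring. }
    split; [now exists a|now apply is_pseries_unique]. }
  destruct (E (- / INR (fact (S n)))) as [E1 E2].
  unfold Rminus. rewrite <- E2 at 1.
  rewrite <- PSeries_incr_1, <- PSeries_scal, <- !PSeries_plus; auto.
  - apply PSeries_ext. intros j. unfold PS_plus, PS_incr_1, PS_scal, plus, scal; cbn -[INR fact pow].
    unfold mult; cbn -[INR fact pow]. unfold pc. destruct j as [|j].
    + unfold zero; cbn -[INR fact pow]. rewrite !digammaS_S, !fact_S_R. simpl pow; simpl (fact 0); simpl (INR 1).
      pose proof (INR_fact_lt_0 n); pose proof (pos_INR n). field; lra.
    + replace (S j + n)%nat with (S (j + n)) by lia.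
      replace (S j + S n)%nat with (S (S (j + n))) by lia.
      replace (j + S (S n))%nat with (S (S (j + n))) by lia.
      rewrite !digammaS_S, (fact_S_R (S (j + n))), !fact_S_R, !S_INR, plus_INR.
      pose proof (INR_fact_lt_0 j); pose proof (INR_fact_lt_0 (j + n)); pose proof (pos_INR j); pose proof (pos_INR n).
      simpl pow. field. repeat split; nra.
  - apply (ex_pseries_scal (K := R_AbsRing) (V := R_NormedModule)); [apply Rmult_comm|].
    apply exp_coef_ex with pcD, pc_exp_coef.
  - apply exp_coef_ex with pcD, pc_exp_coef.
  - eapply CV_radius_inside. rewrite CV_radius_incr_1.
    now rewrite (exp_coef_CV _ _ (pc_exp_coef _)).
Qed.

Lemma sK_rec n s : s <> 0 ->
  sK n s + s * sK (S (S n)) s = (INR n + 1) * sK (S n) s + / INR (fact (S n)).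
Proof.
  intros Hs. unfold sK.
  rewrite (rsum_S (S n)), !rsum_Sl, Rmult_plus_distr_l.
  replace (S (S n) - S n - 1)%nat with 0%nat by lia.
  replace (S (S n) - 0 - 1)%nat with (S n) by lia.
  replace (S n - 0 - 1)%nat with n by lia.
  rewrite !Rmult_plus_distr_l, <- !rsum_scal.
  match goal with |- rsum n ?a + (?b + rsum n ?c + ?d) = ?e + rsum n ?f + ?g =>
    assert (E : rsum n a + rsum n c = rsum n f) end.
  { rewrite <- rsum_plus. apply rsum_ext. intros j Hj.
    replace (S (S n) - S j - 1)%nat with (S (n - S j)) by lia.
    replace (S n - S j - 1)%nat with (n - S j)%nat by lia.
    replace (n - j - 1)%nat with (n - S j)%nat by lia.
    rewrite !fact_S_R. replace (INR n) with (INR (n - S j) + INR j + 1).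
    2:{ rewrite <- plus_INR. rewrite <- S_INR. f_equal. lia. }
    pose proof (INR_fact_lt_0 j); pose proof (pos_INR j). simpl pow. field.
    repeat split; try lra. now apply pow_nonzero. }
  rewrite <- E, !fact_S_R. simpl pow. simpl (fact 0). simpl (INR 1).
  pose proof (INR_fact_lt_0 n); pose proof (pos_INR n). field.
  repeat split; try lra. now apply pow_nonzero.
Qed.

Lemma sK_derive n s : s <> 0 ->
  is_derive (sK n) s (- sK (S n) s + / INR (fact n) / s).
Proof.
  intros Hs.
  replace (- sK (S n) s + / INR (fact n) / s)
    with (rsum n (fun j => (fun y => - (INR (fact (n - j)) / INR (fact j) * y ^ j / y ^ S n)) s)).
  - unfold sK. apply is_derive_rsum with
      (f := fun j y => INR (fact (n - j - 1)) / INR (fact j) * y ^ j / y ^ n)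
      (g := fun j y => - (INR (fact (n - j)) / INR (fact j) * y ^ j / y ^ S n)).
    intros j Hj. assert (s ^ n <> 0) by now apply pow_nonzero.
    assert (E : INR (fact (n - j)) = (INR n - INR j) * INR (fact (n - j - 1))).
    { replace (n - j)%nat with (S (n - j - 1)) at 1 by lia. rewrite fact_S_R.
      rewrite !minus_INR by lia. simpl (INR 1). ring. }
    rewrite E. clear E. generalize (INR (fact (n - j - 1))) as F. intros F.
    auto_derive; auto.
    pose proof (INR_fact_lt_0 j).
    destruct n as [|n]; [lia|]. simpl pred. rewrite S_INR.
    assert (s ^ n <> 0) by now apply pow_nonzero.
    destruct j as [|j]; simpl pred.
    + simpl. field. repeat split; auto.
    + rewrite S_INR. simpl pow. field. repeat split; auto; lra.
  - unfold sK. rewrite rsum_S.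
    replace (S n - n - 1)%nat with 0%nat by lia. simpl (INR (fact 0)).
    assert (s ^ n <> 0) by now apply pow_nonzero.
    rewrite (rsum_ext n (fun j => INR (fact (S n - j - 1)) / INR (fact j) * s ^ j / s ^ S n)
      (fun j => (-1) * - (INR (fact (n - j)) / INR (fact j) * s ^ j / s ^ S n))).
    + rewrite rsum_scal. pose proof (INR_fact_lt_0 n). simpl pow. field. repeat split; auto; lra.
    + intros j Hj. replace (S n - j - 1)%nat with (n - j)%nat by lia. ring.
Qed.

Lemma yK_derive n s : 0 < s -> is_derive (yK n) s (- yK (S n) s).
Proof.
  intros Hs. assert (Hs' : s <> 0) by lra. unfold yK.
  replace (- (/ PI * (ln s * jK (S n) s - sK (S n) s - PSeries (pc (S n)) s)))
    with (/ PI * ((/ s * jK n s + ln s * - jK (S n) s)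
       - (- sK (S n) s + / INR (fact n) / s)
       - ((jK n s - / INR (fact n)) / s - PSeries (pc (S n)) s))).
  2:{ field. pose proof PI_RGT_0. pose proof (INR_fact_lt_0 n). repeat split; auto; lra. }
  apply is_derive_scal.
  apply (is_derive_minus (K := R_AbsRing) (V := R_NormedModule)); [|now apply pK_derive].
  apply (is_derive_minus (K := R_AbsRing) (V := R_NormedModule)); [|now apply sK_derive].
  apply (is_derive_mult (K := R_AbsRing)); [|apply jK_derive|intros; apply Rmult_comm].
  now apply is_derive_ln.
Qed.

Lemma yK_rec n s : 0 < s -> yK n s + s * yK (S (S n)) s = (INR n + 1) * yK (S n) s.
Proof.
  intros Hs. unfold yK.
  pose proof (jK_rec n s) as H1. pose proof (sK_rec n s ltac:(lra)) as H2.
  pose proof (pK_rec n s) as H3.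
  replace (jK n s) with ((INR n + 1) * jK (S n) s - s * jK (S (S n)) s) by lra.
  replace (sK n s) with ((INR n + 1) * sK (S n) s + / INR (fact (S n)) - s * sK (S (S n)) s) by lra.
  replace (PSeries (pc n) s) with ((INR n + 1) * PSeries (pc (S n)) s - / INR (fact (S n)) - s * PSeries (pc (S (S n))) s) by lra.
  ring.
Qed.

Lemma besselJ_nat_0 x : besselJ_nat 0 x = jK 0 (x ^ 2 / 4).
Proof.
  unfold besselJ_nat, jK, PSeries. apply Series_ext. intros j. unfold jc.
  replace (2 * j + 0)%nat with (2 * j)%nat by lia. rewrite pow_mult.
  replace ((x / 2) ^ 2) with (x ^ 2 / 4) by field. reflexivity.
Qed.

Lemma besselY_nat_0 x : 0 < x -> besselY_nat 0 x = yK 0 (x ^ 2 / 4).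
Proof.
  intros Hx. unfold besselY_nat, yK. rewrite besselJ_nat_0.
  unfold sK. change (rsum 0 _) with 0 at 1. change (rsum 0 _) with 0.
  replace (ln (x ^ 2 / 4)) with (2 * ln (x / 2)).
  2:{ replace (x ^ 2 / 4) with ((x / 2) * (x / 2)) by field. rewrite ln_mult; lra. }
  replace (Series _) with (PSeries (pc 0) (x ^ 2 / 4)).
  - field. pose proof PI_RGT_0; lra.
  - apply Series_ext. intros j. unfold pc.
    replace (2 * j + 0)%nat with (2 * j)%nat by lia. rewrite pow_mult.
    replace ((x / 2) ^ 2) with (x ^ 2 / 4) by field. reflexivity.
Qed.

(** * Upper and lower bounds for the Bessel kernels *)

Ltac pos_tac :=
  match goal with
  | H : ?P |- ?P => exact H
  | |- 0 < ?a * ?b => apply Rmult_lt_0_compat; pos_tac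
  | |- 0 < ?a + ?b => apply Rplus_lt_0_compat; pos_tac
  | |- 0 < ?a / ?b => apply Rdiv_lt_0_compat; pos_tac
  | |- 0 < / ?a => apply Rinv_0_lt_compat; pos_tac
  | |- 0 < ?a ^ ?b => apply pow_lt; pos_tac
  | |- 0 < exp _ => apply exp_pos
  | |- 0 < INR (fact _) => apply INR_fact_lt_0
  | |- 0 <= ?a * ?b => apply Rmult_le_pos; pos_tac
  | |- 0 <= ?a + ?b => apply Rplus_le_le_0_compat; pos_tac
  | |- 0 <= ?a / ?b => apply Rdiv_le_0_compat; pos_tac
  | |- 0 <= ?a ^ ?b => apply pow_le; pos_tac
  | |- 0 <= INR _ => apply pos_INR
  | |- 0 <= Cmod _ => apply Cmod_ge_0
  | |- 0 <= Rabs _ => apply Rabs_pos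
  | |- 0 <= / _ => left; pos_tac
  | |- 0 <= exp _ => left; pos_tac
  | |- _ => lra
  end.

Lemma pow_le_1 x j : 0 <= x <= 1 -> x ^ j <= 1.
Proof. intros H. rewrite <- (pow1 j). now apply pow_incr. Qed.

Lemma pow_fact_le_exp s n : 0 <= s -> s ^ n <= INR (fact n) * exp s.
Proof.
  intros Hs.
  assert (HB : bsum (fun n => / INR (fact n) * s ^ n) (exp s)).
  { rewrite <- (is_series_unique _ _ (exp_series s)).
    apply bsum_Series; [|eexists; apply exp_series].
    intros m. apply Rmult_le_pos; [left; apply Rinv_0_lt_compat, INR_fact_lt_0|now apply pow_le]. }
  pose proof (bsum_point _ _ n HB) as H. simpl in H.
  apply Rmult_le_compat_l with (r := INR (fact n)) in H; [|left; apply INR_fact_lt_0].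
  rewrite <- Rmult_assoc, Rinv_r, Rmult_1_l in H; auto. apply INR_fact_neq_0.
Qed.

Lemma exp_bsum s : 0 <= s -> bsum (fun n => / INR (fact n) * s ^ n) (exp s).
Proof.
  intros Hs. rewrite <- (is_series_unique _ _ (exp_series s)).
  apply bsum_Series; [|eexists; apply exp_series].
  intros m. apply Rmult_le_pos; [left; apply Rinv_0_lt_compat, INR_fact_lt_0|now apply pow_le].
Qed.

Lemma jK_bound n s : Rabs (jK n s) <= exp (Rabs s) / INR (fact n).
Proof.
  unfold Rdiv. rewrite Rmult_comm. apply exp_coef_PSeries, jc_exp_coef.
Qed.

Lemma sK_upper n s : 0 < s -> 0 <= sK n s <= INR (fact n) * exp s / s ^ n.
Proof.
  intros Hs. pose proof (pow_lt s n Hs) as Hp. split.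
  - apply rsum_nonneg. intros j Hj. pose proof (INR_fact_lt_0 j); pose proof (INR_fact_lt_0 (n - j - 1)).
    pose proof (pow_lt s j Hs). unfold Rdiv.
    pos_tac.
  - apply Rle_trans with (INR (fact n) / s ^ n * rsum n (fun j => / INR (fact j) * s ^ j)).
    + rewrite <- rsum_scal. apply rsum_le. intros j Hj.
      assert (INR (fact (n - j - 1)) <= INR (fact n)) by (apply le_INR, fact_le; lia).
      pose proof (INR_fact_lt_0 j). pose proof (pow_lt s j Hs).
      replace (INR (fact (n - j - 1)) / INR (fact j) * s ^ j / s ^ n)
        with (INR (fact (n - j - 1)) * (/ s ^ n * (/ INR (fact j) * s ^ j))) by (field; lra).
      replace (INR (fact n) / s ^ n * (/ INR (fact j) * s ^ j))
        with (INR (fact n) * (/ s ^ n * (/ INR (fact j) * s ^ j))) by (field; lra).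
      apply Rmult_le_compat_r; auto.
      pos_tac.
    + replace (INR (fact n) * exp s / s ^ n) with (INR (fact n) / s ^ n * exp s) by (field; lra).
      apply Rmult_le_compat_l.
      * apply Rmult_le_pos; [left; apply INR_fact_lt_0|left; now apply Rinv_0_lt_compat].
      * rewrite rsum_lsumR. apply exp_bsum; [lra|apply seq_NoDup].
Qed.

Lemma Rabs_ln_bound u : 0 < u -> Rabs (ln u) <= u + / u.
Proof.
  intros Hu. pose proof (Rinv_0_lt_compat u Hu).
  assert (Hl : forall v, 0 < v -> ln v <= v).
  { intros v Hv. rewrite <- (ln_exp v) at 2. left. apply ln_increasing; auto.
    pose proof (exp_ineq1 v ltac:(lra)); lra. }
  pose proof (Hl u Hu). pose proof (Hl (/ u) H) as H2. rewrite ln_Rinv in H2 by auto.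
  apply Rabs_le; lra.
Qed.

Lemma sqrt4_pow4 s : 0 <= s -> s = sqrt (sqrt s) ^ 4.
Proof.
  intros Hs. replace (sqrt (sqrt s) ^ 4) with ((sqrt (sqrt s) * sqrt (sqrt s)) * (sqrt (sqrt s) * sqrt (sqrt s))) by ring.
  rewrite !sqrt_sqrt; auto. apply sqrt_pos.
Qed.

(** The logarithm is traded for s^(-1/4). With s = r^2/4 this is a multiple of r^(-1/2), an
    integrable singularity whose primitive is elementary. *)
Lemma Rabs_ln_sqrt4 s S : 0 < s <= S ->
  Rabs (ln s) <= 4 * (sqrt (sqrt S) ^ 2 + 1) / sqrt (sqrt s).
Proof.
  intros Hs. assert (Hu : 0 < sqrt (sqrt s)) by (apply sqrt_lt_R0, sqrt_lt_R0; lra).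
  assert (HU : sqrt (sqrt s) <= sqrt (sqrt S)) by (apply sqrt_le_1_alt, sqrt_le_1_alt; lra).
  rewrite (sqrt4_pow4 s) at 1 by lra. rewrite ln_pow by auto.
  rewrite Rabs_mult, (Rabs_pos_eq (INR 4)) by apply pos_INR.
  replace (INR 4) with 4 by (simpl; ring).
  pose proof (Rabs_ln_bound _ Hu) as H. set (u := sqrt (sqrt s)) in *. set (U := sqrt (sqrt S)) in *.
  apply Rmult_le_reg_r with u; auto.
  replace (4 * (U ^ 2 + 1) / u * u) with (4 * (U ^ 2 + 1)) by (field; lra).
  assert (Rabs (ln u) * u <= (u + / u) * u) by (apply Rmult_le_compat_r; lra).
  replace ((u + / u) * u) with (u ^ 2 + 1) in H0 by (field; lra).
  assert (u ^ 2 <= U ^ 2) by (apply pow_incr; lra). lra.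
Qed.

Lemma yK_upper S : 0 < S -> exists D, 0 < D /\ forall n s, 0 < s <= S ->
  Rabs (yK n s) <= D * (INR (fact n) / s ^ n) / sqrt (sqrt s).
Proof.
  intros HS. set (U := sqrt (sqrt S)).
  assert (HU0 : 0 < U) by (apply sqrt_lt_R0, sqrt_lt_R0; lra).
  pose proof (exp_pos S) as HE. set (E := exp S) in *.
  assert (HpD : 0 < pcD) by (unfold pcD; pose proof (Rabs_pos euler_gamma); lra).
  exists (4 * (U ^ 2 + 1) * E * E + E * U + pcD * E * E * U). split.
  { pos_tac. }
  intros n s Hs.
  assert (Hu : 0 < sqrt (sqrt s)) by (apply sqrt_lt_R0, sqrt_lt_R0; lra).
  assert (HuU : sqrt (sqrt s) <= U) by (apply sqrt_le_1_alt, sqrt_le_1_alt; lra).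
  pose proof (Rabs_ln_sqrt4 s S Hs) as Hln. fold U in Hln.
  set (u := sqrt (sqrt s)) in *.
  assert (HEs : exp s <= E) by (destruct (Req_dec s S); [subst; unfold E; lra|left; apply exp_increasing; lra]).
  set (q := INR (fact n) / s ^ n).
  pose proof (pow_lt s n ltac:(lra)) as Hp. pose proof (INR_fact_lt_0 n) as Hf.
  assert (Hq : 0 < q) by (apply Rdiv_lt_0_compat; auto).
  (* Together with [H1u], this lets the terms that are bounded in n be absorbed into the leading
     size [q / u]. *)
  assert (H1q : 1 <= E * q).
  { pose proof (pow_fact_le_exp s n ltac:(lra)). unfold q.
    apply Rmult_le_reg_r with (s ^ n); auto. rewrite Rmult_1_l.
    replace (E * (INR (fact n) / s ^ n) * s ^ n) with (INR (fact n) * E) by (field; lra).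
    eapply Rle_trans; [exact H|]. apply Rmult_le_compat_l; lra. }
  assert (H1u : 1 <= U / u).
  { apply Rmult_le_reg_r with u; auto. replace (U / u * u) with U by (field; lra). lra. }
  assert (Hj : Rabs (jK n s) <= E).
  { eapply Rle_trans; [apply jK_bound|]. rewrite Rabs_pos_eq by lra.
    apply Rle_trans with (exp s / 1); [|lra]. apply Rmult_le_compat_l; [left; apply exp_pos|].
    apply Rinv_le_contravar; [lra|apply fact_ge_1]. }
  assert (Hsk : Rabs (sK n s) <= E * q).
  { destruct (sK_upper n s ltac:(lra)). rewrite Rabs_pos_eq by lra. unfold q.
    replace (E * (INR (fact n) / s ^ n)) with (INR (fact n) * E / s ^ n) by (field; lra).
    eapply Rle_trans; [eassumption|]. apply Rmult_le_compat_r; [left; now apply Rinv_0_lt_compat|].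
    apply Rmult_le_compat_l; lra. }
  assert (Hpk : Rabs (PSeries (pc n) s) <= pcD * E).
  { eapply Rle_trans; [apply exp_coef_PSeries, pc_exp_coef|]. rewrite (Rabs_pos_eq s) by lra.
    apply Rmult_le_compat_l; lra. }
  unfold yK. rewrite Rabs_mult.
  assert (HPI : 0 < / PI <= 1).
  { pose proof PI2_1. split; [apply Rinv_0_lt_compat; lra|]. rewrite <- Rinv_1. apply Rinv_le_contravar; lra. }
  rewrite (Rabs_pos_eq (/ PI)) by lra.
  apply Rle_trans with (1 * Rabs (ln s * jK n s - sK n s - PSeries (pc n) s)).
  { apply Rmult_le_compat_r; [apply Rabs_pos|lra]. }
  rewrite Rmult_1_l.
  assert (HA : Rabs (ln s * jK n s) <= 4 * (U ^ 2 + 1) / u * E).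
  { rewrite Rabs_mult. apply Rmult_le_compat; auto using Rabs_pos. }
  apply Rle_trans with (Rabs (ln s * jK n s) + Rabs (sK n s) + Rabs (PSeries (pc n) s)).
  { unfold Rminus. eapply Rle_trans; [apply Rabs_triang|]. rewrite Rabs_Ropp.
    apply Rplus_le_compat_r. eapply Rle_trans; [apply Rabs_triang|]. rewrite Rabs_Ropp. lra. }
  replace ((4 * (U ^ 2 + 1) * E * E + E * U + pcD * E * E * U) * q / u)
    with (4 * (U ^ 2 + 1) / u * E * (E * q) + E * q * (U / u) + pcD * E * (E * q) * (U / u)) by (field; lra).
  assert (0 <= 4 * (U ^ 2 + 1) / u * E).
  { pose proof (pow2_ge_0 U). apply Rmult_le_pos; [apply Rdiv_le_0_compat; lra|lra]. }
  assert (0 <= pcD * E) by (apply Rmult_le_pos; lra).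
  assert (A1 : Rabs (ln s * jK n s) <= 4 * (U ^ 2 + 1) / u * E * (E * q)).
  { eapply Rle_trans; [exact HA|]. rewrite <- (Rmult_1_r (_ * E)) at 1. now apply Rmult_le_compat_l. }
  assert (A2 : Rabs (sK n s) <= E * q * (U / u)).
  { eapply Rle_trans; [exact Hsk|]. rewrite <- (Rmult_1_r (E * q)) at 1. apply Rmult_le_compat_l; lra. }
  assert (A3 : Rabs (PSeries (pc n) s) <= pcD * E * (E * q) * (U / u)).
  { eapply Rle_trans; [exact Hpk|].
    apply Rle_trans with (pcD * E * (E * q)); [rewrite <- (Rmult_1_r (pcD * E)) at 1; now apply Rmult_le_compat_l|].
    rewrite <- (Rmult_1_r (pcD * E * (E * q))) at 1. apply Rmult_le_compat_l; auto. apply Rmult_le_pos; lra. }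
  lra.
Qed.

(** A deliberately wasteful bound, of the same shape as [yK_upper], so that both components of the
    Hankel function are estimated by one expression in [chi_upper]. *)
Lemma jK_upper S : 0 < S -> exists D, 0 < D /\ forall n s, 0 < s <= S ->
  Rabs (jK n s) <= D * (INR (fact n) / s ^ n) / sqrt (sqrt s).
Proof.
  intros HS. set (U := sqrt (sqrt S)).
  assert (HU0 : 0 < U) by (apply sqrt_lt_R0, sqrt_lt_R0; lra).
  pose proof (exp_pos S) as HE. set (E := exp S) in *.
  exists (E * E * U). split; [pos_tac|]. intros n s Hs.
  assert (Hu : 0 < sqrt (sqrt s)) by (apply sqrt_lt_R0, sqrt_lt_R0; lra).
  assert (HuU : sqrt (sqrt s) <= U) by (apply sqrt_le_1_alt, sqrt_le_1_alt; lra).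
  set (u := sqrt (sqrt s)) in *.
  assert (HEs : exp s <= E) by (destruct (Req_dec s S); [subst; unfold E; lra|left; apply exp_increasing; lra]).
  pose proof (pow_lt s n ltac:(lra)) as Hp. pose proof (INR_fact_lt_0 n) as Hf.
  pose proof (pow_fact_le_exp s n ltac:(lra)) as Hpf.
  eapply Rle_trans; [apply jK_bound|]. rewrite Rabs_pos_eq by lra.
  apply Rmult_le_reg_r with (INR (fact n) * s ^ n * u); [pos_tac|].
  replace (exp s / INR (fact n) * (INR (fact n) * s ^ n * u)) with (exp s * s ^ n * u) by (field; lra).
  replace (E * E * U * (INR (fact n) / s ^ n) / u * (INR (fact n) * s ^ n * u))
    with (E * (INR (fact n) * E) * U * INR (fact n)) by (field; lra).
  assert (H1 : s ^ n <= INR (fact n) * E).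
  { eapply Rle_trans; [exact Hpf|]. apply Rmult_le_compat_l; lra. }
  assert (exp s * s ^ n <= E * (INR (fact n) * E)).
  { apply Rmult_le_compat; try lra. left; apply exp_pos. }
  assert (exp s * s ^ n * u <= E * (INR (fact n) * E) * U).
  { apply Rmult_le_compat; try lra. pos_tac. }
  rewrite <- (Rmult_1_r (exp s * s ^ n * u)). apply Rmult_le_compat; try lra; try pos_tac.
  apply fact_ge_1.
Qed.

Lemma pow2_ge_S n : INR n + 1 <= 2 ^ n.
Proof.
  induction n as [|n IH]; [simpl; lra|]. rewrite S_INR. simpl pow. pose proof (pos_INR n). lra.
Qed.

(** All terms of [sK] are nonnegative and the one with j = 0 is (n-1)!/s^n, while the logarithmic
    term and the power series stay bounded in n. The factor 8 is 2 for absorbing the bounded terms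
    and 4 for bounding pi. *)
Lemma yK_lower s : 0 < s -> exists n0, forall n, (n0 <= n)%nat ->
  INR (fact n) / s ^ n / (8 * (INR n + 1)) <= Rabs (yK n s).
Proof.
  intros Hs. set (B := (Rabs (ln s) + pcD) * exp s).
  assert (HpD : 0 < pcD) by (unfold pcD; pose proof (Rabs_pos euler_gamma); lra).
  pose proof (Rabs_pos (ln s)). pose proof (exp_pos s). pose proof (exp_pos (4 * s)).
  assert (HB : 0 < B) by (apply Rmult_lt_0_compat; lra).
  destruct (INR_unbounded (2 * B * exp (4 * s))) as [n0 Hn0].
  exists (S n0). intros n Hn.
  set (q := INR (fact n) / s ^ n).
  pose proof (pow_lt s n Hs) as Hp. pose proof (INR_fact_lt_0 n) as Hf. pose proof (pos_INR n).
  assert (Hq : 0 < q) by (apply Rdiv_lt_0_compat; auto).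
  (* In (4 s)^n <= n! exp(4 s), the factor 4^n is split into two powers of 2: one beats n + 1, the
     other beats the constant that determined [n0]. *)
  assert (Hbig : 2 * B <= q / (INR n + 1)).
  { pose proof (pow_fact_le_exp (4 * s) n ltac:(lra)) as H4. rewrite Rpow_mult_distr in H4.
    replace (4 ^ n) with (2 ^ n * 2 ^ n) in H4 by (rewrite <- Rpow_mult_distr; f_equal; ring).
    pose proof (pow2_ge_S n). assert (INR n0 <= INR n) by (apply le_INR; lia).
    assert (H5' : 2 * B * exp (4 * s) <= 2 ^ n) by lra.
    apply Rmult_le_reg_r with ((INR n + 1) * s ^ n * exp (4 * s)).
    { pos_tac. }
    unfold q. replace (INR (fact n) / s ^ n / (INR n + 1) * ((INR n + 1) * s ^ n * exp (4 * s)))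
      with (INR (fact n) * exp (4 * s)) by (field; lra).
    eapply Rle_trans; [|exact H4].
    replace (2 * B * ((INR n + 1) * s ^ n * exp (4 * s))) with ((2 * B * exp (4 * s)) * (INR n + 1) * s ^ n) by ring.
    apply Rmult_le_compat_r; [lra|].
    apply Rmult_le_compat; try lra. pos_tac. }
  assert (HsK : q / (INR n + 1) <= sK n s).
  { destruct n as [|n]; [lia|]. unfold sK. rewrite rsum_Sl.
    replace (S n - 0 - 1)%nat with n by lia.
    assert (0 <= rsum n (fun j => INR (fact (S n - S j - 1)) / INR (fact (S j)) * s ^ S j / s ^ S n)).
    { apply rsum_nonneg. intros j Hj.
      pose proof (INR_fact_lt_0 (S j)); pose proof (INR_fact_lt_0 (S n - S j - 1)).
      pose proof (pow_lt s (S j) Hs). unfold Rdiv.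
      pos_tac. }
    enough (q / (INR (S n) + 1) <= INR (fact n) / INR (fact 0) * s ^ 0 / s ^ S n) by lra.
    unfold q. rewrite fact_S_R, S_INR. simpl (fact 0). simpl (s ^ 0). simpl (INR 1).
    pose proof (pos_INR n). pose proof (INR_fact_lt_0 n).
    replace ((INR n + 1) * INR (fact n) / s ^ S n / (INR n + 1 + 1))
      with (INR (fact n) / s ^ S n * ((INR n + 1) / (INR n + 1 + 1))) by (field; lra).
    replace (INR (fact n) / 1 * 1 / s ^ S n) with (INR (fact n) / s ^ S n * 1) by (field; lra).
    apply Rmult_le_compat_l; [left; apply Rdiv_lt_0_compat; lra|].
    apply Rmult_le_reg_r with (INR n + 1 + 1); [lra|]. field_simplify; lra. }
  assert (Hj : Rabs (jK n s) <= exp s).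
  { eapply Rle_trans; [apply jK_bound|]. rewrite Rabs_pos_eq by lra.
    apply Rle_trans with (exp s / 1); [|lra]. apply Rmult_le_compat_l; [left; apply exp_pos|].
    apply Rinv_le_contravar; [lra|apply fact_ge_1]. }
  assert (Hpk : Rabs (PSeries (pc n) s) <= pcD * exp s).
  { eapply Rle_trans; [apply exp_coef_PSeries, pc_exp_coef|]. rewrite (Rabs_pos_eq s) by lra. lra. }
  unfold yK. rewrite Rabs_mult.
  assert (HPI : / 4 <= / PI) by (pose proof PI_4; pose proof PI_RGT_0; apply Rinv_le_contravar; lra).
  rewrite (Rabs_pos_eq (/ PI)) by lra.
  assert (HA : Rabs (ln s * jK n s) <= Rabs (ln s) * exp s).
  { rewrite Rabs_mult. apply Rmult_le_compat; auto using Rabs_pos. lra. }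
  assert (HT : q / (INR n + 1) / 2 <= Rabs (ln s * jK n s - sK n s - PSeries (pc n) s)).
  { pose proof (Rle_abs (- (ln s * jK n s - sK n s - PSeries (pc n) s))) as H6. rewrite Rabs_Ropp in H6.
    pose proof (Rle_abs (ln s * jK n s)). pose proof (Rle_abs (- PSeries (pc n) s)) as H7. rewrite Rabs_Ropp in H7.
    assert (Rabs (ln s) * exp s + pcD * exp s = B) by (unfold B; ring).
    pose proof (Rle_abs (PSeries (pc n) s)). pose proof (Rle_abs (- (ln s * jK n s))) as H8; rewrite Rabs_Ropp in H8. lra. }
  apply Rle_trans with (/ 4 * (q / (INR n + 1) / 2)); [right; field; lra|].
  apply Rmult_le_compat; try lra.
Qed.

(** * Cylindrical waves *)

Definition Cder (f : R -> C) (t : R) (l : C) : Prop :=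
  is_derive (fun u => fst (f u)) t (fst l) /\ is_derive (fun u => snd (f u)) t (snd l).

Lemma Cder_ext f g t l : (forall u, f u = g u) -> Cder f t l -> Cder g t l.
Proof.
  intros H [H1 H2]; split.
  - apply is_derive_ext with (fun u => fst (f u)); auto. intros; now rewrite H.
  - apply is_derive_ext with (fun u => snd (f u)); auto. intros; now rewrite H.
Qed.

Lemma Cder_eq f t l l' : l = l' -> Cder f t l -> Cder f t l'.
Proof. now intros ->. Qed.

Lemma Cder_const c t : Cder (fun _ => c) t (RtoC 0).
Proof. split; simpl; apply (is_derive_const (K := R_AbsRing) (V := R_NormedModule)). Qed.

Lemma Cder_plus f g t l m : Cder f t l -> Cder g t m ->
  Cder (fun u => f u + g u)%C t (l + m)%C.
Proof.
  intros [H1 H2] [H3 H4]; split; simpl;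
  apply (is_derive_plus (K := R_AbsRing) (V := R_NormedModule)); auto.
Qed.

Lemma Cder_mult f g t l m : Cder f t l -> Cder g t m ->
  Cder (fun u => f u * g u)%C t (l * g t + f t * m)%C.
Proof.
  intros [H1 H2] [H3 H4]; split; simpl.
  - apply is_derive_ext with (fun u => fst (f u) * fst (g u) - snd (f u) * snd (g u)); [easy|].
    replace (fst l * fst (g t) - snd l * snd (g t) + (fst (f t) * fst m - snd (f t) * snd m))
      with ((fst l * fst (g t) + fst (f t) * fst m) - (snd l * snd (g t) + snd (f t) * snd m)) by ring.
    apply (is_derive_minus (K := R_AbsRing) (V := R_NormedModule));
    apply (is_derive_mult (K := R_AbsRing)); auto; intros; apply Rmult_comm.
  - apply is_derive_ext with (fun u => fst (f u) * snd (g u) + snd (f u) * fst (g u)); [easy|].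
    replace (fst l * snd (g t) + snd l * fst (g t) + (fst (f t) * snd m + snd (f t) * fst m))
      with ((fst l * snd (g t) + fst (f t) * snd m) + (snd l * fst (g t) + snd (f t) * fst m)) by ring.
    apply (is_derive_plus (K := R_AbsRing) (V := R_NormedModule));
    apply (is_derive_mult (K := R_AbsRing)); auto; intros; apply Rmult_comm.
Qed.

Lemma Cder_scal c f t l : Cder f t l -> Cder (fun u => c * f u)%C t (c * l)%C.
Proof.
  intros H. eapply Cder_eq; [|apply Cder_mult; [apply Cder_const|exact H]]. cbv beta. ring.
Qed.

Lemma Cder_pow f t l n : Cder f t l ->
  Cder (fun u => f u ^ n)%C t (INR n * f t ^ (n - 1) * l)%C.
Proof.
  intros H. induction n as [|n IH].
  - simpl. eapply Cder_eq; [|apply Cder_const]. ring.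
  - eapply Cder_eq; [|apply (Cder_mult f (fun u => f u ^ n)%C t _ _ H IH)].
    rewrite S_INR, RtoC_plus. destruct n as [|n]; [simpl; ring|].
    replace (S (S n) - 1)%nat with (S n) by lia. replace (S n - 1)%nat with n by lia.
    rewrite !Cpow_S. ring.
Qed.

Lemma Cder_comp (f : R -> C) (s : R -> R) t l ds :
  Cder f (s t) l -> is_derive s t ds -> Cder (fun u => f (s u)) t (ds * l)%C.
Proof.
  intros [H1 H2] Hs. split.
  - replace (fst (ds * l)%C) with (scal ds (fst l)) by (unfold scal; simpl; unfold mult; simpl; ring).
    apply (is_derive_comp (K := R_AbsRing) (V := R_NormedModule) (fun u => fst (f u)) s); auto.
  - replace (snd (ds * l)%C) with (scal ds (snd l)) by (unfold scal; simpl; unfold mult; simpl; ring).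
    apply (is_derive_comp (K := R_AbsRing) (V := R_NormedModule) (fun u => snd (f u)) s); auto.
Qed.

Lemma Cder_line x v t : Cder (fun u => x + u * v)%C t v.
Proof.
  split; simpl; auto_derive; auto; ring.
Qed.

Lemma Cder_conj f t l : Cder f t l -> Cder (fun u => Cconj (f u)) t (Cconj l).
Proof.
  intros [H1 H2]; split; simpl; auto.
  apply (is_derive_opp (K := R_AbsRing) (V := R_NormedModule)); auto.
Qed.

(** For w = r e^(i theta), [zalpha w] is (r/2) e^(i theta) and [zbeta w] is -(r/2) e^(-i theta).
    Powers of the first carry the waves of positive order and powers of the second those of negative
    order, the sign encoding J_(-n) = (-1)^n J_n, and no polar angle has to be chosen. The same two
    quantities of a direction v are the coefficients of the derivative along v. *)
Definition zalpha (w : C) : C := (/ 2 * w)%C.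

Definition zbeta (w : C) : C := (- (/ 2) * Cconj w)%C.

Definition zp (n : Z) (w : C) : C :=
  (zalpha w ^ Z.to_nat n * zbeta w ^ Z.to_nat (- n))%C.

Definition cyl (K : nat -> R -> C) (n : Z) (w : C) : C :=
  (zp n w * K (Z.abs_nat n) (Cmod w ^ 2 / 4)%R)%C.

Definition Kj (n : nat) (s : R) : C := RtoC (jK n s).

Definition Kh (n : nat) (s : R) : C := (jK n s, yK n s).

(* In polar coordinates [psi n] and [chi n] are J_n(r) e^(i n theta) and H_n(r) e^(i n theta).
   The functions of both families satisfy the same ladder relations between consecutive n. *)
Definition psi : Z -> C -> C := cyl Kj.

Definition chi : Z -> C -> C := cyl Kh.

(** The differentiation rule handles the radial factor; the recurrence is what absorbs the
    derivative of the angular power. For H both hold only at s > 0. *)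
Definition ladder_kernel (K : nat -> R -> C) (s : R) : Prop :=
  forall n : nat, Cder (K n) s (- K (S n) s)%C /\
    (K n s + s * K (S (S n)) s = (INR n + 1) * K (S n) s)%C.

Lemma Kj_ladder s : ladder_kernel Kj s.
Proof.
  intros n; split.
  - split; simpl.
    + apply jK_derive.
    + rewrite Ropp_0. apply (is_derive_const (K := R_AbsRing) (V := R_NormedModule)).
  - unfold Kj. pose proof (jK_rec n s) as H.
    rewrite <- RtoC_mult, <- !RtoC_plus, <- RtoC_mult. now f_equal.
Qed.

Lemma Kh_ladder s : 0 < s -> ladder_kernel Kh s.
Proof.
  intros Hs n; split.
  - split; simpl; [apply jK_derive|now apply yK_derive].
  - unfold Kh. pose proof (jK_rec n s) as H. pose proof (yK_rec n s Hs) as H'.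
    unfold RtoC, Cplus, Cmult; simpl. f_equal; lra.
Qed.

Lemma RtoC_half : RtoC (/ 2) = (/ 2)%C.
Proof. now rewrite RtoC_inv by lra. Qed.

Lemma Cmod2_zab w : RtoC (Cmod w ^ 2 / 4) = (- (zalpha w * zbeta w))%C.
Proof.
  unfold Cmod. rewrite pow2_sqrt by nra. unfold zalpha, zbeta. rewrite <- RtoC_half.
  destruct w as [a b]. unfold RtoC, Copp, Cconj, Cmult; simpl. f_equal; field.
Qed.

Lemma cyl_pos K p w :
  cyl K (Z.of_nat p) w = (zalpha w ^ p * K p (Cmod w ^ 2 / 4)%R)%C.
Proof.
  unfold cyl, zp. rewrite Nat2Z.id, Zabs2Nat.id.
  replace (Z.to_nat (- Z.of_nat p)) with 0%nat by lia. simpl. ring.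
Qed.

Lemma cyl_neg K p w :
  cyl K (- Z.of_nat p) w = (zbeta w ^ p * K p (Cmod w ^ 2 / 4)%R)%C.
Proof.
  unfold cyl, zp. rewrite Z.opp_involutive, Nat2Z.id.
  replace (Z.abs_nat (- Z.of_nat p)) with p by lia.
  replace (Z.to_nat (- Z.of_nat p)) with 0%nat by lia. simpl. ring.
Qed.

Lemma Z_cases n : n = 0%Z \/ (exists p, n = Z.of_nat (S p)) \/ (exists p, n = (- Z.of_nat (S p))%Z).
Proof.
  destruct (Z.lt_trichotomy n 0) as [H|[H|H]]; auto; right; [right|left].
  - exists (Z.to_nat (- n - 1)). lia.
  - exists (Z.to_nat (n - 1)). lia.
Qed.

Lemma is_derive_Cmod2 x v (t : R) :
  is_derive (fun u : R => Cmod (x + u * v) ^ 2 / 4) t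
    ((fst (x + t * v)%C * fst v + snd (x + t * v)%C * snd v) / 2).
Proof.
  apply is_derive_ext with
    (fun u : R => (fst (x + u * v)%C ^ 2 + snd (x + u * v)%C ^ 2) / 4).
  { intros u. unfold Cmod. rewrite pow2_sqrt; [reflexivity|nra]. }
  simpl. auto_derive; auto. field.
Qed.

(** The two Wirtinger derivatives of a cylindrical wave lower and raise its order; here they are
    contracted with the direction v. For n = 0 the radial rule suffices, otherwise the recurrence
    rewrites [K p] so that the terms with a lowered power combine. *)
Lemma cyl_ladder K n x v (t : R) : ladder_kernel K (Cmod (x + t * v) ^ 2 / 4) ->
  Cder (fun u : R => cyl K n (x + u * v)%C) t
    (zalpha v * cyl K (n - 1) (x + t * v) + zbeta v * cyl K (n + 1) (x + t * v))%C.
Proof.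
  intros HK. set (w := (x + t * v)%C) in *. set (s := Cmod w ^ 2 / 4) in *.
  set (ds := (fst w * fst v + snd w * snd v) / 2).
  assert (Es : RtoC s = (- (zalpha w * zbeta w))%C) by apply Cmod2_zab.
  assert (Eds : RtoC ds = (- (zalpha v * zbeta w + zalpha w * zbeta v))%C).
  { unfold ds, zalpha, zbeta. rewrite <- RtoC_half. destruct w as [a b], v as [c d].
    unfold RtoC, Copp, Cconj, Cmult, Cplus; simpl. f_equal; field. }
  assert (HKd : forall p, Cder (fun u : R => K p (Cmod (x + u * v) ^ 2 / 4)) t (ds * - K (S p) s)%C).
  { intros p. apply (Cder_comp (K p) (fun u : R => Cmod (x + u * v) ^ 2 / 4)); [apply HK|apply is_derive_Cmod2]. }
  assert (Ha : Cder (fun u : R => zalpha (x + u * v)) t (zalpha v)) by apply Cder_scal, Cder_line.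
  assert (Hb : Cder (fun u : R => zbeta (x + u * v)) t (zbeta v)) by apply Cder_scal, Cder_conj, Cder_line.
  destruct (Z_cases n) as [->|[[p ->]|[p ->]]].
  - apply Cder_ext with (fun u : R => K 0%nat (Cmod (x + u * v) ^ 2 / 4)).
    { intros u. change 0%Z with (Z.of_nat 0). rewrite cyl_pos. simpl. ring. }
    eapply Cder_eq; [|apply HKd].
    change (0 - 1)%Z with (- Z.of_nat 1)%Z. change (0 + 1)%Z with (Z.of_nat 1).
    rewrite cyl_pos, cyl_neg, !Cpow_1_r, Eds. fold s. ring.
  - apply Cder_ext with (fun u : R => zalpha (x + u * v) ^ S p * K (S p) (Cmod (x + u * v) ^ 2 / 4)%R)%C.
    { intros u. now rewrite cyl_pos. }
    eapply Cder_eq; [|apply Cder_mult; [apply Cder_pow; exact Ha|apply HKd]].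
    replace (Z.of_nat (S p) - 1)%Z with (Z.of_nat p) by lia.
    replace (Z.of_nat (S p) + 1)%Z with (Z.of_nat (S (S p))) by lia.
    rewrite !cyl_pos. fold w s. replace (S p - 1)%nat with p by lia. rewrite Eds, S_INR, RtoC_plus.
    destruct (HK p) as [_ Hr]. fold s in Hr. rewrite Es in Hr.
    replace (K p s) with ((INR p + 1) * K (S p) s + (zalpha w * zbeta w) * K (S (S p)) s)%C
      by (rewrite <- Hr; ring).
    rewrite !Cpow_S. ring.
  - apply Cder_ext with (fun u : R => zbeta (x + u * v) ^ S p * K (S p) (Cmod (x + u * v) ^ 2 / 4)%R)%C.
    { intros u. now rewrite cyl_neg. }
    eapply Cder_eq; [|apply Cder_mult; [apply Cder_pow; exact Hb|apply HKd]].
    replace (- Z.of_nat (S p) + 1)%Z with (- Z.of_nat p)%Z by lia.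
    replace (- Z.of_nat (S p) - 1)%Z with (- Z.of_nat (S (S p)))%Z by lia.
    rewrite !cyl_neg. fold w s. replace (S p - 1)%nat with p by lia. rewrite Eds, S_INR, RtoC_plus.
    destruct (HK p) as [_ Hr]. fold s in Hr. rewrite Es in Hr.
    replace (K p s) with ((INR p + 1) * K (S p) s + (zalpha w * zbeta w) * K (S (S p)) s)%C
      by (rewrite <- Hr; ring).
    rewrite !Cpow_S. ring.
Qed.

Lemma cis_plus a b : cis (a + b) = (cis a * cis b)%C.
Proof. unfold cis, Cmult; simpl. rewrite cos_plus, sin_plus. f_equal; ring. Qed.

Lemma cis_0 : cis 0 = RtoC 1.
Proof. unfold cis. now rewrite cos_0, sin_0. Qed.

Lemma Cconj_cis t : Cconj (cis t) = cis (- t).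
Proof. unfold cis, Cconj; simpl. now rewrite cos_neg, sin_neg. Qed.

Lemma Cmod_cis t : Cmod (cis t) = 1.
Proof.
  unfold Cmod, cis; simpl. replace (_ + _) with 1; [apply sqrt_1|].
  pose proof (sin2_cos2 t) as H. unfold Rsqr in H. lra.
Qed.

Lemma cis_pow t n : (cis t ^ n)%C = cis (INR n * t).
Proof.
  induction n as [|n IH]; [simpl; now rewrite Rmult_0_l, cis_0|].
  rewrite Cpow_S, IH, S_INR, <- cis_plus. f_equal; ring.
Qed.

Lemma zp_rot n w t : zp n (w * cis t) = (zp n w * cis (IZR n * t))%C.
Proof.
  unfold zp. replace (zalpha (w * cis t)) with (zalpha w * cis t)%C by (unfold zalpha; ring).
  replace (zbeta (w * cis t)) with (zbeta w * cis (- t))%C.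
  2:{ unfold zbeta. rewrite Cmult_conj, Cconj_cis. ring. }
  rewrite !Cpow_mult_l, !cis_pow.
  replace (cis (IZR n * t)) with (cis (INR (Z.to_nat n) * t) * cis (INR (Z.to_nat (- n)) * - t))%C.
  - ring.
  - rewrite <- cis_plus. f_equal. rewrite !INR_IZR_INZ.
    replace (IZR n) with (IZR (Z.of_nat (Z.to_nat n)) - IZR (Z.of_nat (Z.to_nat (- n)))).
    + ring.
    + rewrite <- minus_IZR. f_equal. lia.
Qed.

Lemma cyl_rot K n w t : cyl K n (w * cis t) = (cyl K n w * cis (IZR n * t))%C.
Proof.
  unfold cyl. rewrite zp_rot, Cmod_mult, Cmod_cis, Rmult_1_r. ring.
Qed.

Lemma Cmod_half w : Cmod (zalpha w) = Cmod w / 2.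
Proof.
  unfold zalpha. rewrite <- RtoC_half, Cmod_mult, Cmod_R, Rabs_pos_eq by lra. field.
Qed.

Lemma Cmod_zbeta w : Cmod (zbeta w) = Cmod w / 2.
Proof.
  unfold zbeta. rewrite <- RtoC_half, Cmod_mult, Cmod_opp, Cmod_R, Cmod_conj, Rabs_pos_eq by lra. field.
Qed.

Lemma Cmod_zp n w : Cmod (zp n w) = (Cmod w / 2) ^ Z.abs_nat n.
Proof.
  unfold zp. rewrite Cmod_mult, !Cmod_pow, Cmod_half, Cmod_zbeta, <- pow_add.
  f_equal. lia.
Qed.

Lemma zp_conj n w : Cconj (zp n w) = zp (- n) (- w).
Proof.
  unfold zp. rewrite Cmult_conj, !Cpow_conj, Z.opp_involutive.
  replace (Cconj (zalpha w)) with (zbeta (- w)).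
  2:{ unfold zalpha, zbeta. rewrite <- RtoC_half, Cmult_conj, Copp_conj, Cconj_RtoC. ring. }
  replace (Cconj (zbeta w)) with (zalpha (- w)).
  2:{ unfold zalpha, zbeta. rewrite <- RtoC_half, Cmult_conj, Copp_conj, Cconj_RtoC, Cconj_conj. ring. }
  ring.
Qed.

Lemma Zabs_nat_opp n : Z.abs_nat (- n) = Z.abs_nat n.
Proof. lia. Qed.

Lemma psi_conj n w : Cconj (psi n w) = psi (- n) (- w).
Proof.
  unfold psi, cyl. rewrite Cmult_conj, zp_conj, Cmod_opp, (Zabs_nat_opp n).
  unfold Kj. now rewrite Cconj_RtoC.
Qed.

(** Conjugation combined with reversal of order and argument keeps the J part and changes the sign
    of the Y part. Thus J is the Hermitian part of the interaction kernel, which later makes the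
    energy form computable. *)
Lemma chi_herm n w : (chi n w + Cconj (chi (- n) (- w)) = 2 * psi n w)%C.
Proof.
  unfold psi, chi, cyl. rewrite Cmult_conj, zp_conj, Z.opp_involutive, Cmod_opp, (Zabs_nat_opp n).
  replace (- - w)%C with w by ring. unfold Kj, Kh.
  set (j := jK _ _). set (y := yK _ _).
  transitivity (zp n w * ((j, y) + Cconj (j, y)))%C; [ring|].
  transitivity (zp n w * (2 * RtoC j))%C; [f_equal|ring].
  unfold RtoC, Cconj, Cplus, Cmult; simpl; f_equal; ring.
Qed.

Lemma psi_0_0 : psi 0 0 = RtoC 1.
Proof.
  replace (psi 0 0) with (psi (Z.of_nat 0) 0) by reflexivity. unfold psi. rewrite cyl_pos. simpl Cpow. rewrite Cmod_0.
  replace (0 ^ 2 / 4) with 0 by (simpl; field). unfold Kj, jK. rewrite PSeries_0.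
  unfold jc. simpl. rewrite <- RtoC_mult. f_equal. field.
Qed.

Lemma psi_n_0 n : n <> 0%Z -> psi n 0 = RtoC 0.
Proof.
  intros Hn. apply Cmod_eq_0. unfold psi, cyl. rewrite Cmod_mult, Cmod_zp, Cmod_0.
  replace (0 / 2) with 0 by field. rewrite (pow_i (Z.abs_nat n)) by lia. ring.
Qed.

Lemma psi_bound n w :
  Cmod (psi n w) <= exp (Cmod w ^ 2 / 4) * ((Cmod w / 2) ^ Z.abs_nat n / INR (fact (Z.abs_nat n))).
Proof.
  unfold psi, cyl. rewrite Cmod_mult, Cmod_zp. unfold Kj. rewrite Cmod_R.
  pose proof (Cmod_ge_0 w).
  pose proof (jK_bound (Z.abs_nat n) (Cmod w ^ 2 / 4)) as HJ.
  rewrite (Rabs_pos_eq (Cmod w ^ 2 / 4)) in HJ by pos_tac.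
  pose proof (INR_fact_lt_0 (Z.abs_nat n)).
  replace (exp (Cmod w ^ 2 / 4) * ((Cmod w / 2) ^ Z.abs_nat n / INR (fact (Z.abs_nat n))))
    with ((Cmod w / 2) ^ Z.abs_nat n * (exp (Cmod w ^ 2 / 4) / INR (fact (Z.abs_nat n)))) by (field; lra).
  apply Rmult_le_compat_l; auto. pos_tac.
Qed.

Lemma Cmod_le_Rabs (a b : R) : Cmod (a, b) <= Rabs a + Rabs b.
Proof.
  replace (a, b) with (RtoC a + Ci * RtoC b)%C by (unfold RtoC, Ci, Cmult, Cplus; simpl; f_equal; ring).
  eapply Rle_trans; [apply Cmod_triangle|]. rewrite Cmod_mult, Cmod_Ci, !Cmod_R; lra.
Qed.

(* (n-1)! (2/r)^n / pi is the leading term of |Y_n(r)|: up to factors polynomial in n,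
   [hbound] is the size of [chi n] at radius r. *)
Definition hbound (n : nat) (r : R) : R := INR (fact n) * (2 / r) ^ n.

Lemma chi_upper R0 : 0 < R0 -> exists D, 0 < D /\ forall n w, 0 < Cmod w <= R0 ->
  Cmod (chi n w) <= D * hbound (Z.abs_nat n) (Cmod w) / sqrt (Cmod w).
Proof.
  intros HR.
  destruct (yK_upper (R0 ^ 2 / 4)) as [D1 [HD1 H1]]; [pos_tac|].
  destruct (jK_upper (R0 ^ 2 / 4)) as [D2 [HD2 H2]]; [pos_tac|].
  exists ((D1 + D2) * sqrt 2). split.
  { apply Rmult_lt_0_compat; [lra|]. apply sqrt_lt_R0; lra. }
  intros n w Hw. unfold chi, cyl. rewrite Cmod_mult, Cmod_zp. unfold Kh.
  set (p := Z.abs_nat n). set (r := Cmod w) in *.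
  assert (Hs : 0 < r ^ 2 / 4 <= R0 ^ 2 / 4).
  { split; [pos_tac|]. apply Rmult_le_compat_r; [lra|]. apply pow_incr; lra. }
  specialize (H1 p _ Hs). specialize (H2 p _ Hs).
  assert (E1 : sqrt (r ^ 2 / 4) = r / 2).
  { replace (r ^ 2 / 4) with ((r / 2) ^ 2) by field. apply sqrt_pow2; lra. }
  rewrite E1 in H1, H2.
  assert (E2 : sqrt (r / 2) = sqrt r / sqrt 2) by (apply sqrt_div; lra).
  rewrite E2 in H1, H2.
  assert (0 < sqrt r) by (apply sqrt_lt_R0; lra). assert (0 < sqrt 2) by (apply sqrt_lt_R0; lra).
  apply Rle_trans with ((r / 2) ^ p * ((D1 + D2) * (INR (fact p) / (r ^ 2 / 4) ^ p) / (sqrt r / sqrt 2))).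
  - apply Rmult_le_compat_l; [pos_tac|]. eapply Rle_trans; [apply Cmod_le_Rabs|].
    replace ((D1 + D2) * (INR (fact p) / (r ^ 2 / 4) ^ p) / (sqrt r / sqrt 2)) with
      (D1 * (INR (fact p) / (r ^ 2 / 4) ^ p) / (sqrt r / sqrt 2) + D2 * (INR (fact p) / (r ^ 2 / 4) ^ p) / (sqrt r / sqrt 2)); [lra|].
    field. repeat split; try lra. apply pow_nonzero. lra.
  - right. unfold hbound.
    replace ((2 / r) ^ p) with ((r / 2) ^ p / (r ^ 2 / 4) ^ p).
    + field. repeat split; try lra. apply pow_nonzero. lra.
    + unfold Rdiv at 1. rewrite <- pow_inv, <- Rpow_mult_distr. f_equal. field. lra.
Qed.

Lemma chi_lower r : 0 < r -> exists n0, forall n, (n0 <= Z.abs_nat n)%nat -> forall w, Cmod w = r ->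
  hbound (Z.abs_nat n) r / (8 * (INR (Z.abs_nat n) + 1)) <= Cmod (chi n w).
Proof.
  intros Hr. destruct (yK_lower (r ^ 2 / 4)) as [n0 H]; [pos_tac|].
  exists n0. intros n Hn w Hw. unfold chi, cyl. rewrite Cmod_mult, Cmod_zp, Hw. unfold Kh.
  set (p := Z.abs_nat n) in *. specialize (H p Hn). pose proof (pos_INR p). pose proof (pow_lt r 2 Hr).
  pose proof (Rabs_snd_Cmod (jK p (r ^ 2 / 4), yK p (r ^ 2 / 4))) as H2. simpl snd in H2.
  apply Rle_trans with ((r / 2) ^ p * (INR (fact p) / (r ^ 2 / 4) ^ p / (8 * (INR p + 1)))).
  - right. unfold hbound.
    replace ((2 / r) ^ p) with ((r / 2) ^ p / (r ^ 2 / 4) ^ p).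
    + field. repeat split; try lra. apply pow_nonzero. lra.
    + unfold Rdiv at 1. rewrite <- pow_inv, <- Rpow_mult_distr. f_equal. field. lra.
  - apply Rmult_le_compat_l; [pos_tac|]. eapply Rle_trans; [exact H|exact H2].
Qed.

Lemma chi_0_hankel w : 0 < Cmod w -> chi 0 w = hankel1 0 (Cmod w).
Proof.
  intros Hw. change 0%Z with (Z.of_nat 0). unfold chi. rewrite cyl_pos.
  unfold hankel1, besselJ, besselY, extend_order, Kh. simpl.
  change (Z.abs_nat 0) with 0%nat. rewrite Cmult_1_l.
  rewrite besselJ_nat_0, besselY_nat_0; auto.
Qed.

(** * Graf's addition theorem *)

(** Required along one segment only: the waves [chi] are singular at 0, which the segment has to
    avoid. *)
Definition ladder_family (F : Z -> C -> C) (x v : C) : Prop :=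
  forall (n : Z) (t : R), 0 <= t <= 1 ->
    Cder (fun u : R => F n (x + u * v)%C) t
      (zalpha v * F (n - 1)%Z (x + t * v) + zbeta v * F (n + 1)%Z (x + t * v))%C.

Fixpoint line_derivative (F : Z -> C -> C) (x v : C) (j : nat) (n : Z) (t : R) : C :=
  match j with
  | O => F n (x + t * v)%C
  | S i => (zalpha v * line_derivative F x v i (n - 1) t
            + zbeta v * line_derivative F x v i (n + 1) t)%C
  end.

Lemma line_derivative_Cder F x v j n t : ladder_family F x v -> 0 <= t <= 1 ->
  Cder (line_derivative F x v j n) t (line_derivative F x v (S j) n t).
Proof.
  intros HF Ht. revert n; induction j as [|j IH]; intros n.
  - simpl. now apply HF.
  - apply (Cder_plus (fun u => zalpha v * line_derivative F x v j (n - 1) u)%C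
      (fun u => zbeta v * line_derivative F x v j (n + 1) u)%C); apply Cder_scal; apply IH.
Qed.

Definition taylor_term (F : Z -> C -> C) (x v : C) (n : Z) (t : R) (ab : nat * nat) : C :=
  ((/ INR (fact (fst ab)))%R * zalpha v ^ fst ab * ((/ INR (fact (snd ab)))%R * zbeta v ^ snd ab)
   * F (n - Z.of_nat (fst ab) + Z.of_nat (snd ab))%Z (x + t * v))%C.

Definition diag (i : nat) : list (nat * nat) := map (fun a => (a, (i - a)%nat)) (seq 0 (S i)).

Fixpoint triangle (j : nat) : list (nat * nat) :=
  match j with O => diag 0 | S i => triangle i ++ diag (S i) end.

Lemma In_diag i a b : In (a, b) (diag i) <-> (a + b = i)%nat.
Proof.
  unfold diag. rewrite in_map_iff. split.
  - intros (a' & [= <- <-] & H). apply in_seq in H. lia.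
  - intros H. exists a. split; [f_equal; lia|]. apply in_seq; lia.
Qed.

Lemma In_triangle j a b : In (a, b) (triangle j) <-> (a + b <= j)%nat.
Proof.
  induction j as [|j IH]; simpl triangle.
  - rewrite In_diag. lia.
  - rewrite in_app_iff, IH, In_diag. lia.
Qed.

Lemma NoDup_triangle j : NoDup (triangle j).
Proof.
  assert (Hd : forall i, NoDup (diag i)).
  { intros i. unfold diag. apply NoDup_map_inj; [now intros x y [= ->]|apply seq_NoDup]. }
  induction j as [|j IH]; simpl triangle; auto.
  apply NoDup_app; auto. intros [a b] H1 H2.
  apply In_triangle in H1. apply In_diag in H2. lia.
Qed.

Lemma Cpow_pred_fact (z : C) a :
  (RtoC (INR (S a)) * ((/ INR (fact (S a)))%R * z ^ S a) = z * ((/ INR (fact a))%R * z ^ a))%C.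
Proof.
  rewrite fact_S_R, Rinv_mult, RtoC_mult, Cpow_S, S_INR.
  pose proof (pos_INR a).
  transitivity ((RtoC (INR a + 1) * RtoC (/ (INR a + 1))) * (z * ((/ INR (fact a))%R * z ^ a)))%C; [ring|].
  rewrite <- RtoC_mult, Rinv_r by lra. ring.
Qed.

(** The two order shifts commute, so their j-th iterate expands by the binomial theorem. The
    inductive step splits j + 1 as a + (j + 1 - a), each part cancelling one factor of a
    factorial. *)
Lemma line_derivative_diag F x v j n t :
  line_derivative F x v j n t = (INR (fact j) * lsum (taylor_term F x v n t) (diag j))%C.
Proof.
  revert n; induction j as [|j IH]; intros n.
  - unfold diag, lsum, taylor_term; simpl.
    replace (n - 0 + 0)%Z with n by lia. rewrite Rinv_1. ring.
  - cbn [line_derivative]. rewrite !IH, fact_S_R, <- S_INR, RtoC_mult.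
    transitivity (INR (fact j) * (zalpha v * lsum (taylor_term F x v (n - 1) t) (diag j)
      + zbeta v * lsum (taylor_term F x v (n + 1) t) (diag j)))%C; [ring|].
    transitivity (INR (fact j) * (INR (S j) * lsum (taylor_term F x v n t) (diag (S j))))%C; [|ring].
    f_equal. rewrite <- !lsum_scal. unfold diag. rewrite !lsum_map.
    transitivity (lsum (fun a => RtoC (INR a) * taylor_term F x v n t (a, S j - a)%nat
      + RtoC (INR (S j - a)) * taylor_term F x v n t (a, S j - a)%nat) (seq 0 (S (S j))))%C.
    + rewrite lsum_plus. f_equal.
      * change (seq 0 (S (S j))) with (0%nat :: seq 1 (S j)). rewrite <- (seq_shift (S j) 0).
        unfold lsum at 2. cbn [map fold_right].
        fold (lsum (fun a => RtoC (INR a) * taylor_term F x v n t (a, S j - a)%nat) (map S (seq 0 (S j))))%C.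
        rewrite lsum_map. simpl (INR 0). rewrite Cmult_0_l, Cplus_0_l.
        apply lsum_ext. intros a Ha. unfold taylor_term. cbn [fst snd].
        replace (S j - S a)%nat with (j - a)%nat by lia.
        replace (n - Z.of_nat (S a))%Z with (n - 1 - Z.of_nat a)%Z by lia.
        rewrite !Cmult_assoc, <- (Cmult_assoc (RtoC (INR (S a)))), Cpow_pred_fact. ring.
      * rewrite (seq_S (S j)), lsum_app. unfold lsum at 3. cbn [map fold_right].
        replace (S j - (0 + S j))%nat with 0%nat by lia. simpl (INR 0).
        rewrite Cmult_0_l, !Cplus_0_r.
        apply lsum_ext. intros a Ha. apply in_seq in Ha. unfold taylor_term. cbn [fst snd].
        replace (S j - a)%nat with (S (j - a)) by lia.
        replace (n - Z.of_nat a + Z.of_nat (S (j - a)))%Z with (n + 1 - Z.of_nat a + Z.of_nat (j - a))%Z by lia.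
        transitivity ((/ INR (fact a))%R * zalpha v ^ a * (RtoC (INR (S (j - a))) * ((/ INR (fact (S (j - a))))%R * zbeta v ^ S (j - a))) * F (n + 1 - Z.of_nat a + Z.of_nat (j - a))%Z (x + t * v))%C; [|ring].
        rewrite Cpow_pred_fact. ring.
    + apply lsum_ext. intros a Ha. apply in_seq in Ha.
      replace (INR (S j)) with (INR a + INR (S j - a)) by (rewrite <- plus_INR; f_equal; lia).
      rewrite RtoC_plus. ring.
Qed.

(** The mean value theorem is applied to the real and imaginary parts separately, which costs the
    factor 2. *)
Lemma Cmod_Cder_bound (f df : R -> C) B :
  (forall t, 0 <= t <= 1 -> Cder f t (df t)) -> (forall t, 0 <= t <= 1 -> Cmod (df t) <= B) ->
  Cmod (f 1 - f 0) <= 2 * B.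
Proof.
  intros Hd HB.
  assert (Hm : forall (g dg : R -> R), (forall t, 0 <= t <= 1 -> is_derive g t (dg t)) ->
    (forall t, 0 <= t <= 1 -> Rabs (dg t) <= B) -> Rabs (g 1 - g 0) <= B).
  { intros g dg H1 H2. destruct (MVT_gen g 0 1 dg) as [c [Hc E]].
    - intros t Ht. rewrite Rmin_left, Rmax_right in Ht by lra. apply H1; lra.
    - intros t Ht. rewrite Rmin_left, Rmax_right in Ht by lra.
      apply continuity_pt_filterlim. apply (ex_derive_continuous (K := R_AbsRing) (V := R_NormedModule)).
      eexists; now apply H1.
    - rewrite E. rewrite Rmin_left, Rmax_right in Hc by lra.
      replace (dg c * (1 - 0)) with (dg c) by ring. now apply H2. }
  replace (f 1 - f 0)%C with ((fst (f 1) - fst (f 0), snd (f 1) - snd (f 0))) by reflexivity.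
  eapply Rle_trans; [apply Cmod_le_Rabs|].
  replace (2 * B) with (B + B) by ring. apply Rplus_le_compat.
  - apply (Hm (fun t => fst (f t)) (fun t => fst (df t))); [intros; now apply Hd|].
    intros; eapply Rle_trans; [apply Rabs_fst_Cmod|auto].
  - apply (Hm (fun t => snd (f t)) (fun t => snd (df t))); [intros; now apply Hd|].
    intros; eapply Rle_trans; [apply Rabs_snd_Cmod|auto].
Qed.

(** Taylor polynomial with moving base point t, evaluated at the end point 1 of the segment. Its
    derivative in t telescopes to a single term, so a bound on that term controls the remainder. *)
Fixpoint taylor_sum (F : Z -> C -> C) (x v : C) (j : nat) (n : Z) (t : R) : C :=
  match j with
  | O => line_derivative F x v 0 n t
  | S i => (taylor_sum F x v i n t
      + RtoC ((1 - t) ^ S i / INR (fact (S i))) * line_derivative F x v (S i) n t)%C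
  end.

Lemma is_derive_pow_compl j (c t : R) : 0 < c ->
  is_derive (fun u : R => (1 - u) ^ S j / c) t (- (INR j + 1) * (1 - t) ^ j / c).
Proof.
  intros Hc. auto_derive; auto. rewrite <- S_INR. change (pred (S j)) with j.
  change (1 + - t) with (1 - t).
  destruct j as [|j]; [simpl; field; lra|field; lra].
Qed.

Lemma taylor_sum_Cder F x v j n t : ladder_family F x v -> 0 <= t <= 1 ->
  Cder (taylor_sum F x v j n) t
    (RtoC ((1 - t) ^ j / INR (fact j)) * line_derivative F x v (S j) n t)%C.
Proof.
  intros HF Ht. induction j as [|j IH].
  - eapply Cder_eq; [|apply (line_derivative_Cder F x v 0 n t); auto].
    simpl fact. simpl pow. simpl INR. replace (1 / 1) with 1 by field. ring.
  - assert (Hp : Cder (fun u => RtoC ((1 - u) ^ S j / INR (fact (S j)))) t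
      (RtoC (- ((1 - t) ^ j / INR (fact j))))).
    { split; cbn [fst snd RtoC].
      - pose proof (INR_fact_lt_0 j). pose proof (pos_INR j).
        apply is_derive_ext with (fun u => (1 - u) ^ S j / ((INR j + 1) * INR (fact j))).
        { intros u. now rewrite fact_S_R. }
        replace (- ((1 - t) ^ j / INR (fact j)))
          with (- (INR j + 1) * (1 - t) ^ j / ((INR j + 1) * INR (fact j))) by (field; lra).
        apply is_derive_pow_compl. apply Rmult_lt_0_compat; lra.
      - apply (is_derive_const (K := R_AbsRing) (V := R_NormedModule)). }
    pose proof (Cder_plus _ _ t _ _ IH
      (Cder_mult _ _ t _ _ Hp (line_derivative_Cder F x v (S j) n t HF Ht))) as H.
    eapply Cder_eq; [|exact H]. rewrite RtoC_opp. ring.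
Qed.

Lemma taylor_sum_1 F x v j n : taylor_sum F x v j n 1 = F n (x + v)%C.
Proof.
  induction j as [|j IH]; cbn [taylor_sum].
  - simpl. f_equal. ring.
  - rewrite IH. replace (1 - 1) with 0 by ring. rewrite pow_i by lia.
    unfold Rdiv. rewrite Rmult_0_l. ring.
Qed.

Lemma taylor_sum_0 F x v j n : taylor_sum F x v j n 0 = lsum (taylor_term F x v n 0) (triangle j).
Proof.
  assert (E : forall i, (RtoC (/ INR (fact i)) * line_derivative F x v i n 0)%C
    = lsum (taylor_term F x v n 0) (diag i)).
  { intros i. rewrite line_derivative_diag, Cmult_assoc, <- RtoC_mult, Rinv_l by apply INR_fact_neq_0. ring. }
  induction j as [|j IH]; cbn [taylor_sum triangle].
  - rewrite <- E. simpl fact. simpl INR. rewrite Rinv_1. ring.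
  - rewrite lsum_app, IH, <- E. do 3 f_equal. rewrite Rminus_0_r, pow1. unfold Rdiv. ring.
Qed.

(** A bidegree (a, b) corresponds to m = a - b, the order of the Bessel function produced, and l =
    min(a, b), the index in its power series. *)
Definition split_index (ml : Z * nat) : nat * nat :=
  ((snd ml + Z.to_nat (fst ml))%nat, (snd ml + Z.to_nat (- fst ml))%nat).

Definition join_index (ab : nat * nat) : Z * nat :=
  ((Z.of_nat (fst ab) - Z.of_nat (snd ab))%Z, Nat.min (fst ab) (snd ab)).

Lemma split_join ab : split_index (join_index ab) = ab.
Proof. destruct ab as [a b]. unfold split_index, join_index; simpl. f_equal; lia. Qed.

Lemma join_split ml : join_index (split_index ml) = ml.
Proof. destruct ml as [m l]. unfold split_index, join_index; simpl. f_equal; lia. Qed.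

(** The triangles exhaust the set of bidegrees; given absolute summability, the limit of the Taylor
    polynomials must be the unordered sum. *)
Lemma tsum_triangle (f : nat * nat -> C) S (e : nat -> R) : summable f ->
  (forall j, Cmod (lsum f (triangle j) - S) <= e j) -> is_lim_seq e 0 -> tsum f = S.
Proof.
  intros Hf He Hl.
  destruct (Ceq_dec (tsum f) S) as [|Hn]; auto. exfalso.
  assert (Hd : 0 < Cmod (tsum f - S)) by (apply Cmod_gt_0; now apply Cminus_eq_contra).
  destruct (summable_has_sum f Hf (Cmod (tsum f - S) / 4)) as [A [HA H1]]; [lra|].
  destruct (proj2 (is_lim_seq_spec _ _) Hl (mkposreal (Cmod (tsum f - S) / 4) ltac:(lra))) as [N HN].
  set (j := (N + list_max (map (fun ab => fst ab + snd ab)%nat A))%nat).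
  specialize (HN j ltac:(lia)). simpl in HN. rewrite Rminus_0_r in HN.
  pose proof (Rle_abs (e j)). specialize (He j).
  assert (HI : incl A (triangle j)).
  { intros [a b] Hab. apply In_triangle.
    pose proof (proj1 (list_max_le (map (fun ab => fst ab + snd ab)%nat A) _) (le_n _)) as HF.
    rewrite Forall_forall in HF.
    specialize (HF (a + b)%nat (in_map (fun ab => fst ab + snd ab)%nat _ _ Hab)). lia. }
  specialize (H1 _ (NoDup_triangle j) HI).
  pose proof (Cmod_triangle (- (lsum f (triangle j) - tsum f)) (lsum f (triangle j) - S)) as H2.
  rewrite Cmod_opp in H2.
  replace (- (lsum f (triangle j) - tsum f) + (lsum f (triangle j) - S))%C with (tsum f - S)%C in H2 by ring.
  lra.
Qed.

(** With m fixed, a! b! equals l! (l + |m|)! and the powers combine to [zp m v] times a power of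
    [zalpha v * zbeta v], which is -|v|^2/4: exactly the Bessel series. *)
Lemma taylor_term_row F x v n m :
  tsum (fun l => taylor_term F x v n 0 (split_index (m, l))) = (F (n - m)%Z x * psi m v)%C.
Proof.
  transitivity (tsum (fun l => (F (n - m)%Z x * zp m v) * RtoC (jc (Z.abs_nat m) l * (Cmod v ^ 2 / 4) ^ l)))%C.
  - apply tsum_ext. intros l. unfold taylor_term, split_index. cbn [fst snd].
    replace (x + 0 * v)%C with x by ring.
    replace (n - Z.of_nat (l + Z.to_nat m) + Z.of_nat (l + Z.to_nat (- m)))%Z with (n - m)%Z by lia.
    rewrite RtoC_mult, RtoC_pow, Cmod2_zab, !Cpow_add_r. unfold jc, zp.
    assert (E : INR (fact (l + Z.to_nat m)) * INR (fact (l + Z.to_nat (- m)))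
      = INR (fact l) * INR (fact (l + Z.abs_nat m))).
    { destruct (Z_le_dec 0 m).
      - replace (Z.to_nat (- m)) with 0%nat by lia. replace (Z.to_nat m) with (Z.abs_nat m) by lia.
        rewrite Nat.add_0_r; ring.
      - replace (Z.to_nat m) with 0%nat by lia. replace (Z.to_nat (- m)) with (Z.abs_nat m) by lia.
        rewrite Nat.add_0_r; ring. }
    replace (- (zalpha v * zbeta v))%C with (RtoC (-1) * (zalpha v * zbeta v))%C by ring.
    rewrite !Cpow_mult_l. unfold Rdiv. rewrite RtoC_mult, <- E, Rinv_mult, RtoC_mult, RtoC_pow.
    assert (Es : (RtoC (-1) ^ l * RtoC (-1) ^ l = 1)%C).
    { rewrite <- Cpow_mult_l, <- RtoC_mult. replace (-1 * -1) with 1 by ring. apply Cpow_1_l. }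
    match goal with |- ?lhs = _ => transitivity ((RtoC (-1) ^ l * RtoC (-1) ^ l) * lhs)%C end.
    + rewrite Es; ring.
    + ring.
  - rewrite tsum_scal.
    + rewrite (exp_coef_tsum _ _ _ (jc_exp_coef _)). unfold psi, cyl, Kj, jK. ring.
    + eexists. eapply bsum_le; [|apply (exp_coef_bsum _ _ (Cmod v ^ 2 / 4) (jc_exp_coef (Z.abs_nat m)))].
      intros j. rewrite Cmod_R. apply Rle_refl.
Qed.

(* Taylor expansion of [F n] along the segment: the term of bidegree (a, b) in the two
   Wirtinger directions is a multiple of [F (n - a + b)], and collecting the terms with
   a - b = m produces the Bessel series of [psi m v]. *)
Lemma graf_abstract F x v n (e : nat -> R) : ladder_family F x v ->
  summable (fun ml => taylor_term F x v n 0 (split_index ml)) ->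
  (forall j t, 0 <= t <= 1 ->
    Cmod (RtoC ((1 - t) ^ j / INR (fact j)) * line_derivative F x v (S j) n t)%C <= e j) ->
  is_lim_seq e 0 ->
  tsum (fun m => F (n - m)%Z x * psi m v)%C = F n (x + v)%C.
Proof.
  intros HF Hs Hr He.
  assert (HsT : summable (taylor_term F x v n 0)).
  { apply summable_ext with (fun ab => taylor_term F x v n 0 (split_index (join_index ab))).
    - intros; now rewrite split_join.
    - apply (summable_inj (fun ml => taylor_term F x v n 0 (split_index ml)) join_index); auto.
      intros a b H. now rewrite <- (split_join a), H, split_join. }
  rewrite (tsum_ext _ (fun m => tsum (fun l => taylor_term F x v n 0 (split_index (m, l))))).
  2:{ intros m. now rewrite taylor_term_row. }
  rewrite <- (tsum_fubini _ Hs).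
  rewrite (tsum_bij (taylor_term F x v n 0) split_index join_index split_join join_split HsT).
  apply tsum_triangle with (fun j => 2 * e j); auto.
  - intros j. rewrite <- (taylor_sum_1 F x v j n), <- (taylor_sum_0 F x v j n).
    replace (taylor_sum F x v j n 0 - taylor_sum F x v j n 1)%C
      with (- (taylor_sum F x v j n 1 - taylor_sum F x v j n 0))%C by ring.
    rewrite Cmod_opp.
    apply (Cmod_Cder_bound (taylor_sum F x v j n) _ (e j) (fun t Ht => taylor_sum_Cder F x v j n t HF Ht)).
    intros t Ht; auto.
  - replace (Finite 0) with (Rbar_mult 2 0) by (simpl; f_equal; ring).
    now apply is_lim_seq_scal_l.
Qed.

(** * Negative binomial estimates and the addition theorem for outgoing waves *)

Definition nbc (n d : nat) : R := INR (fact (n + d)) / (INR (fact n) * INR (fact d)).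

Lemma nbc_pos n d : 0 < nbc n d.
Proof. unfold nbc. pose proof (INR_fact_lt_0 n); pose proof (INR_fact_lt_0 d); pose proof (INR_fact_lt_0 (n + d)). pos_tac. Qed.

Lemma nbc_sym n d : nbc n d = nbc d n.
Proof. unfold nbc. rewrite Nat.add_comm, Rmult_comm. reflexivity. Qed.

Lemma nbc_0_r n : nbc n 0 = 1.
Proof. unfold nbc. rewrite Nat.add_0_r. simpl. field. apply INR_fact_neq_0. Qed.

Lemma nbc_SS n d : nbc (S n) (S d) = nbc n (S d) + nbc (S n) d.
Proof.
  unfold nbc. replace (S n + S d)%nat with (S (n + S d)) by lia.
  replace (S n + d)%nat with (n + S d)%nat by lia.
  rewrite !fact_S_R, !plus_INR, !S_INR.
  pose proof (INR_fact_lt_0 n); pose proof (INR_fact_lt_0 d); pose proof (pos_INR n); pose proof (pos_INR d).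
  field. lra.
Qed.

(** Pascal's rule bounds (1 - th) times the partial sum for n + 1 by the partial sum for n, so each
    step contributes one factor 1/(1 - th). *)
Lemma nbc_rsum th n D : 0 <= th < 1 ->
  rsum D (fun d => nbc n d * th ^ d) <= / (1 - th) ^ S n.
Proof.
  intros Ht. assert (H1 : 0 < 1 - th) by lra.
  assert (Hp : forall m k, 0 <= nbc m k * th ^ k).
  { intros m k. pose proof (nbc_pos m k). apply Rmult_le_pos; [lra|apply pow_le; lra]. }
  revert D; induction n as [|n IH]; intros D.
  - assert (E : forall D, rsum D (fun d => nbc 0 d * th ^ d) = (1 - th ^ D) / (1 - th)).
    { intros D'; induction D' as [|D' IH]; [unfold rsum; simpl; field; lra|].
      rewrite rsum_S, IH, nbc_sym, nbc_0_r. simpl. field; lra. }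
    rewrite E. simpl. rewrite Rmult_1_r. unfold Rdiv. pose proof (pow_le th D (proj1 Ht)).
    rewrite <- (Rmult_1_l (/ (1 - th))) at 2. apply Rmult_le_compat_r; [|lra].
    left; now apply Rinv_0_lt_compat.
  - assert (Hrec : rsum (S D) (fun d => nbc (S n) d * th ^ d)
      = rsum (S D) (fun d => nbc n d * th ^ d) + th * rsum D (fun d => nbc (S n) d * th ^ d)).
    { rewrite !rsum_Sl, !nbc_0_r, <- rsum_scal, Rplus_assoc, <- rsum_plus. f_equal.
      apply rsum_ext. intros d _. rewrite nbc_SS. simpl. ring. }
    rewrite rsum_S in Hrec at 1.
    pose proof (IH (S D)) as H2. pose proof (Hp (S n) D).
    set (Q := rsum D (fun d => nbc (S n) d * th ^ d)) in *.
    assert ((1 - th) * Q <= / (1 - th) ^ S n) by lra.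
    change ((1 - th) ^ S (S n)) with ((1 - th) * (1 - th) ^ S n).
    rewrite Rinv_mult. apply Rmult_le_reg_l with (1 - th); auto.
    rewrite <- Rmult_assoc, Rinv_r by lra. lra.
Qed.

Lemma nbc_bsum th n : 0 <= th < 1 -> bsum (fun d => nbc n d * th ^ d) (/ (1 - th) ^ S n).
Proof.
  intros Ht. apply bsum_nat.
  - intros k. pose proof (nbc_pos n k). apply Rmult_le_pos; [lra|apply pow_le; lra].
  - intros m. rewrite <- lsumR_seq_sum_n, <- rsum_lsumR. now apply nbc_rsum.
Qed.

Lemma geom_bsum th : 0 <= th < 1 -> bsum (fun d => th ^ d) (/ (1 - th)).
Proof.
  intros Ht. pose proof (nbc_bsum th 0 Ht) as H. rewrite pow_1 in H.
  eapply bsum_le; [|exact H]. intros d. cbv beta. rewrite nbc_sym, nbc_0_r. lra.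
Qed.

Lemma nbc_le th n d : 0 < th < 1 -> nbc n d <= / (1 - th) ^ S n * (/ th) ^ d.
Proof.
  intros Ht. pose proof (bsum_point _ _ d (nbc_bsum th n ltac:(lra))) as H. simpl in H.
  pose proof (pow_lt th d (proj1 Ht)). rewrite pow_inv.
  apply Rmult_le_reg_r with (th ^ d); auto.
  rewrite Rmult_assoc, Rinv_l, Rmult_1_r by lra. exact H.
Qed.

(** The size n! (2/r)^n decreases while n is below r/2; the factor exp(r/2) pays for this, since
    (r/2)^k <= k! exp(r/2). *)
Lemma hbound_mono i N r : 0 < r -> (i <= N)%nat -> hbound i r <= exp (r / 2) * hbound N r.
Proof.
  intros Hr HiN. unfold hbound. set (k := (N - i)%nat).
  replace N with (k + i)%nat by lia.
  pose proof (fact_add_ge k i) as H1. pose proof (pow_fact_le_exp (r / 2) k ltac:(lra)) as H2.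
  assert (0 < 2 / r) by pos_tac.
  rewrite pow_add. pose proof (pow_lt (2 / r) i H). pose proof (pow_lt (2 / r) k H).
  pose proof (INR_fact_lt_0 i). pose proof (exp_pos (r / 2)).
  replace (INR (fact i) * (2 / r) ^ i) with ((INR (fact i) * 1) * (2 / r) ^ i) by ring.
  replace (exp (r / 2) * (INR (fact (k + i)) * ((2 / r) ^ k * (2 / r) ^ i)))
    with ((INR (fact (k + i)) * (exp (r / 2) * (2 / r) ^ k)) * (2 / r) ^ i) by ring.
  apply Rmult_le_compat_r; [lra|].
  apply Rle_trans with (INR (fact k) * INR (fact i) * (exp (r / 2) * (2 / r) ^ k)).
  - replace (INR (fact k) * INR (fact i) * (exp (r / 2) * (2 / r) ^ k))
      with (INR (fact i) * ((INR (fact k) * exp (r / 2)) * (2 / r) ^ k)) by ring.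
    apply Rmult_le_compat_l; [lra|].
    apply Rle_trans with ((r / 2) ^ k * (2 / r) ^ k); [|apply Rmult_le_compat_r; lra].
    rewrite <- Rpow_mult_distr. replace (r / 2 * (2 / r)) with 1 by (field; lra). rewrite pow1; lra.
  - apply Rmult_le_compat_r; [pos_tac|lra].
Qed.

Lemma Cmod_taylor_term F x v n t a b : Cmod (taylor_term F x v n t (a, b)) =
  (/ INR (fact a) * (Cmod v / 2) ^ a) * (/ INR (fact b) * (Cmod v / 2) ^ b)
  * Cmod (F (n - Z.of_nat a + Z.of_nat b)%Z (x + t * v)%C).
Proof.
  unfold taylor_term. cbn [fst snd]. rewrite !Cmod_mult, !Cmod_pow, Cmod_half, Cmod_zbeta, !Cmod_R.
  rewrite !Rabs_pos_eq; auto; left; apply Rinv_0_lt_compat, INR_fact_lt_0.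
Qed.

(** The coefficients of a line derivative sum to at most |v|^j in modulus, so a common bound on the
    family leaves a remainder of order |v|^j / j! and v may be arbitrary. *)
Lemma graf_bounded F x v n B : ladder_family F x v ->
  (forall m t, 0 <= t <= 1 -> Cmod (F m (x + t * v)%C) <= B) ->
  tsum (fun m => F (n - m)%Z x * psi m v)%C = F n (x + v)%C.
Proof.
  intros HF HB. pose proof (Cmod_ge_0 v) as Hv.
  assert (HB0 : 0 <= B).
  { eapply Rle_trans; [apply Cmod_ge_0|apply (HB 0%Z 0); lra]. }
  apply graf_abstract with (fun j => B * Cmod v * (Cmod v ^ j / INR (fact j))); auto.
  - apply (summable_inj (taylor_term F x v n 0) split_index).
    { intros a b H. now rewrite <- (join_split a), H, join_split. }
    set (E := exp (Cmod v / 2)).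
    apply summable_prod with
      (G := fun ab => (/ INR (fact (fst ab)) * (Cmod v / 2) ^ fst ab) * (/ INR (fact (snd ab)) * (Cmod v / 2) ^ snd ab) * B)
      (g := fun a => (/ INR (fact a) * (Cmod v / 2) ^ a) * (B * E)) (Bd := (B * E) * E).
    + intros [a b]. rewrite Cmod_taylor_term. cbn [fst snd].
      pose proof (INR_fact_lt_0 a); pose proof (INR_fact_lt_0 b).
      apply Rmult_le_compat_l; [pos_tac|apply HB; lra].
    + intros a. cbn [fst snd].
      apply bsum_le with (fun b => ((/ INR (fact a) * (Cmod v / 2) ^ a) * B) * (/ INR (fact b) * (Cmod v / 2) ^ b)).
      * intros b. right; ring.
      * rewrite <- Rmult_assoc. pose proof (INR_fact_lt_0 a).
        apply bsum_scal; [pos_tac|apply exp_bsum; lra].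
    + apply bsum_le with (fun a => (B * E) * (/ INR (fact a) * (Cmod v / 2) ^ a)).
      * intros a. right; ring.
      * apply bsum_scal; [unfold E; pos_tac|apply exp_bsum; lra].
  - intros j t Ht.
    assert (Hd : forall j m, Cmod (line_derivative F x v j m t) <= Cmod v ^ j * B).
    { clear j n. intros j; induction j as [|j IH]; intros m; simpl.
      - rewrite Rmult_1_l. now apply HB.
      - eapply Rle_trans; [apply Cmod_triangle|]. rewrite !Cmod_mult, Cmod_half, Cmod_zbeta.
        pose proof (IH (m - 1)%Z). pose proof (IH (m + 1)%Z).
        assert (Cmod v / 2 * Cmod (line_derivative F x v j (m - 1) t) <= Cmod v / 2 * (Cmod v ^ j * B)) by (apply Rmult_le_compat_l; lra).
        assert (Cmod v / 2 * Cmod (line_derivative F x v j (m + 1) t) <= Cmod v / 2 * (Cmod v ^ j * B)) by (apply Rmult_le_compat_l; lra).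
        lra. }
    rewrite Cmod_mult, Cmod_R. pose proof (INR_fact_lt_0 j).
    assert (0 <= (1 - t) ^ j <= 1).
    { split; [pos_tac|]. apply pow_le_1; lra. }
    assert (0 <= (1 - t) ^ j / INR (fact j)) by (apply Rdiv_le_0_compat; lra).
    rewrite Rabs_pos_eq by auto.
    apply Rle_trans with (1 / INR (fact j) * (Cmod v ^ S j * B)).
    + apply Rmult_le_compat; auto using Cmod_ge_0.
      apply Rmult_le_compat_r; [pos_tac|lra].
    + right. simpl. field. lra.
  - replace (Finite 0) with (Rbar_mult (B * Cmod v) 0) by (simpl; f_equal; ring).
    apply is_lim_seq_scal_l. apply is_lim_seq_Reals, cv_speed_pow_fact.
Qed.

Lemma diag_min a b : let d := Z.abs_nat (Z.of_nat a - Z.of_nat b) in let l := Nat.min a b in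
  (a + b = d + 2 * l)%nat /\ INR (fact l) * (INR (fact l) * INR (fact d)) <= INR (fact a) * INR (fact b).
Proof.
  intros d l. split; [lia|].
  assert (H : INR (fact l) * INR (fact d) <= INR (fact (l + d))) by apply fact_add_ge.
  pose proof (INR_fact_lt_0 l).
  destruct (le_dec a b).
  - replace a with l by lia. replace b with (l + d)%nat by lia. apply Rmult_le_compat_l; lra.
  - replace b with l by lia. replace a with (l + d)%nat by lia. rewrite (Rmult_comm (INR (fact (l + d)))).
    apply Rmult_le_compat_l; lra.
Qed.

(** Separates the fixed order n from the growing d. One term of the negative binomial series bounds
    the binomial coefficient, at the price of th^(-d); a value of th near 1 keeps the loss small. *)
Lemma hbound_shift n d th r : 0 < th < 1 -> 0 < r ->
  hbound (n + d) r <= hbound n r * / (1 - th) ^ S n * (INR (fact d) * (2 / (r * th)) ^ d).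
Proof.
  intros Ht Hr. unfold hbound. pose proof (nbc_le th n d Ht) as H. unfold nbc in H.
  pose proof (INR_fact_lt_0 n); pose proof (INR_fact_lt_0 d).
  assert (E : INR (fact (n + d)) <= (/ (1 - th) ^ S n * (/ th) ^ d) * (INR (fact n) * INR (fact d))).
  { apply Rmult_le_compat_r with (r := INR (fact n) * INR (fact d)) in H; [|pos_tac].
    replace (INR (fact (n + d)) / (INR (fact n) * INR (fact d)) * (INR (fact n) * INR (fact d)))
      with (INR (fact (n + d))) in H by (field; lra). exact H. }
  assert (0 < 2 / r) by pos_tac.
  rewrite pow_add. replace (2 / (r * th)) with (2 / r * / th) by (field; lra).
  rewrite Rpow_mult_distr.
  replace (INR (fact n) * (2 / r) ^ n * / (1 - th) ^ S n * (INR (fact d) * ((2 / r) ^ d * (/ th) ^ d)))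
    with ((/ (1 - th) ^ S n * (/ th) ^ d) * (INR (fact n) * INR (fact d)) * ((2 / r) ^ n * (2 / r) ^ d)) by ring.
  apply Rmult_le_compat_r; [pos_tac|exact E].
Qed.

(* The constant of the bound depends on [r] only through an increasing and a decreasing factor. *)
Lemma taylor_term_bound F x v n (t B th : R) a b : 0 < th < 1 -> 0 <= B -> 0 < Cmod (x + t * v) ->
  (forall m, Cmod (F m (x + t * v)%C) <= B * hbound (Z.abs_nat m) (Cmod (x + t * v))) ->
  let r := Cmod (x + t * v) in
  let d := Z.abs_nat (Z.of_nat a - Z.of_nat b) in
  let l := Nat.min a b in
  Cmod (taylor_term F x v n t (a, b)) <=
    B * (exp (r / 2) * (hbound (Z.abs_nat n) r * / (1 - th) ^ S (Z.abs_nat n)))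
      * ((Cmod v / (r * th)) ^ d * ((Cmod v / 2) ^ (2 * l) * / (INR (fact l) * INR (fact l)))).
Proof.
  intros Ht HB Hr HF r d l. rewrite Cmod_taylor_term. fold r in Hr, HF.
  destruct (diag_min a b) as [E1 E2]. fold d l in E1, E2.
  pose proof (Cmod_ge_0 v) as Hv. pose proof (INR_fact_lt_0 a); pose proof (INR_fact_lt_0 b).
  pose proof (INR_fact_lt_0 l); pose proof (INR_fact_lt_0 d).
  set (n0 := Z.abs_nat n).
  assert (Hh : Cmod (F (n - Z.of_nat a + Z.of_nat b)%Z (x + t * v)%C)
    <= B * (exp (r / 2) * (hbound n0 r * / (1 - th) ^ S n0 * (INR (fact d) * (2 / (r * th)) ^ d)))).
  { eapply Rle_trans; [apply HF|]. apply Rmult_le_compat_l; auto.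
    eapply Rle_trans; [apply (hbound_mono _ (n0 + d)); auto; lia|].
    apply Rmult_le_compat_l; [pos_tac|]. now apply hbound_shift. }
  replace (/ INR (fact a) * (Cmod v / 2) ^ a * (/ INR (fact b) * (Cmod v / 2) ^ b))
    with (/ (INR (fact a) * INR (fact b)) * ((Cmod v / 2) ^ d * (Cmod v / 2) ^ (2 * l))).
  2:{ rewrite <- pow_add, <- E1, pow_add. field. lra. }
  set (Cst := B * (exp (r / 2) * (hbound n0 r * / (1 - th) ^ S n0))).
  apply Rle_trans with (/ (INR (fact l) * (INR (fact l) * INR (fact d))) * ((Cmod v / 2) ^ d * (Cmod v / 2) ^ (2 * l))
    * (Cst * (INR (fact d) * (2 / (r * th)) ^ d))).
  - apply Rmult_le_compat; [pos_tac|pos_tac| |].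
    + apply Rmult_le_compat_r; [pos_tac|]. apply Rinv_le_contravar; [pos_tac|exact E2].
    + eapply Rle_trans; [exact Hh|]. right. unfold Cst. ring.
  - right. assert (0 < r * th) by (apply Rmult_lt_0_compat; lra).
    replace (Cmod v / (r * th)) with (Cmod v / 2 * (2 / (r * th))) by (field; lra).
    rewrite Rpow_mult_distr. field. lra.
Qed.

Lemma sq_le_of_pos l : / (INR (fact l) * INR (fact l)) <= / INR (fact l).
Proof.
  pose proof (fact_ge_1 l). apply Rinv_le_contravar; [lra|]. nra.
Qed.

Lemma is_lim_seq_poly2_geom r : 0 <= r < 1 ->
  is_lim_seq (fun j => (INR j + 1) * (INR j + 2) * r ^ j) 0.
Proof.
  intros Hr.
  assert (H : ex_series (fun j => nbc 2 j * r ^ j)).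
  { apply bsum_ex_series with (/ (1 - r) ^ 3); [|now apply nbc_bsum].
    intros k. pose proof (nbc_pos 2 k). apply Rmult_le_pos; [lra|apply pow_le; lra]. }
  apply ex_series_lim_0 in H.
  apply is_lim_seq_ext with (fun j => 2 * (nbc 2 j * r ^ j)).
  - intros j. unfold nbc. change (2 + j)%nat with (S (S j)). rewrite (fact_S_R (S j)), (fact_S_R j), S_INR.
    replace (INR (fact 2)) with 2 by (simpl; ring). pose proof (INR_fact_lt_0 j). field. lra.
  - replace (Finite 0) with (Rbar_mult 2 0) by (simpl; f_equal; ring).
    now apply is_lim_seq_scal_l.
Qed.

Lemma graf_factorial F x v n B : ladder_family F x v -> Cmod v < Cmod x -> 0 <= B ->
  (forall m t, 0 <= t <= 1 ->
     Cmod (F m (x + t * v)%C) <= B * hbound (Z.abs_nat m) (Cmod (x + t * v))) ->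
  tsum (fun m => F (n - m)%Z x * psi m v)%C = F n (x + v)%C.
Proof.
  intros HF Hxv HB0 HB. pose proof (Cmod_ge_0 v) as Hv.
  set (rx := Cmod x) in *. set (rv := Cmod v) in *.
  set (q := rv / rx). assert (Hq : 0 <= q < 1).
  { unfold q; split; [pos_tac|]. apply Rmult_lt_reg_r with rx; [lra|].
    unfold Rdiv. rewrite Rmult_assoc, Rinv_l by lra. lra. }
  (* Any value strictly between q and 1 would serve: the loss th^(-d) of [hbound_shift] then leaves
     the ratio q/th below 1. *)
  set (th := (1 + q) / 2). assert (Hth : 0 < th < 1) by (unfold th; lra).
  set (q1 := q / th). assert (Hq1 : 0 <= q1 < 1).
  { unfold q1; split; [pos_tac|]. apply Rmult_lt_reg_r with th; [lra|].
    unfold Rdiv. rewrite Rmult_assoc, Rinv_l by lra. unfold th; lra. }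
  (* A ratio at least q1, still below 1, and positive even for v = 0, so that dividing by [rho ^ 2]
     is allowed. *)
  set (rho := (1 + q1) / 2). assert (Hrho : 0 < rho < 1 /\ q1 <= rho) by (unfold rho; lra).
  assert (Hr : forall t : R, 0 <= t <= 1 -> rx - t * rv <= Cmod (x + t * v) <= rx + rv).
  { intros t Ht. split.
    - pose proof (Cmod_triangle (x + t * v) (- (t * v))) as H.
      replace (x + t * v + - (t * v))%C with x in H by ring.
      rewrite Cmod_opp, Cmod_mult, Cmod_R, Rabs_pos_eq in H by lra. fold rx rv in H. lra.
    - eapply Rle_trans; [apply Cmod_triangle|]. rewrite Cmod_mult, Cmod_R, Rabs_pos_eq by lra.
      fold rx rv. assert (t * rv <= 1 * rv) by (apply Rmult_le_compat_r; lra). lra. }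
  assert (Hmu : forall t, 0 <= t <= 1 -> rx - rv <= rx - t * rv).
  { intros t Ht. assert (t * rv <= 1 * rv) by (apply Rmult_le_compat_r; lra). lra. }
  set (n0 := Z.abs_nat n).
  set (K := B * (exp ((rx + rv) / 2) * (hbound n0 (rx - rv) * / (1 - th) ^ S n0))).
  assert (Hhb : forall r, 0 < r -> 0 <= hbound n0 r).
  { intros r Hr'. unfold hbound. pose proof (INR_fact_lt_0 n0). pos_tac. }
  assert (HK0 : 0 <= K).
  { unfold K. pose proof (Hhb (rx - rv) ltac:(lra)). pos_tac. }
  assert (HT : forall (t : R) a b, 0 <= t <= 1 -> Cmod (taylor_term F x v n t (a, b)) <=
    K * ((rv / (Cmod (x + t * v) * th)) ^ Z.abs_nat (Z.of_nat a - Z.of_nat b)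
      * ((rv / 2) ^ (2 * Nat.min a b) * / INR (fact (Nat.min a b))))).
  { intros t a b Ht. pose proof (Hr t Ht) as Hrt. pose proof (Hmu t Ht).
    eapply Rle_trans; [apply (taylor_term_bound F x v n t B th a b); auto; try lra|].
    fold rv n0. set (l := Nat.min a b). pose proof (INR_fact_lt_0 l).
    assert (0 < Cmod (x + t * v)) by lra.
    apply Rmult_le_compat.
    - pose proof (Hhb (Cmod (x + t * v)) ltac:(lra)). pos_tac.
    - pos_tac.
    - unfold K. apply Rmult_le_compat_l; auto.
      pose proof (Hhb (Cmod (x + t * v)) ltac:(lra)).
      apply Rmult_le_compat; [pos_tac|pos_tac| |].
      + destruct (Req_dec (Cmod (x + t * v) / 2) ((rx + rv) / 2)) as [->|]; [lra|].
        left; apply exp_increasing; lra.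
      + apply Rmult_le_compat_r; [pos_tac|]. unfold hbound.
        apply Rmult_le_compat_l; [left; apply INR_fact_lt_0|]. apply pow_incr.
        split; [pos_tac|]. apply Rmult_le_compat_l; [lra|]. apply Rinv_le_contravar; lra.
    - apply Rmult_le_compat_l; [pos_tac|]. apply Rmult_le_compat_l; [pos_tac|].
      apply sq_le_of_pos. }
  set (w := (rv / 2) ^ 2). assert (Hw : 0 <= w) by (unfold w; pos_tac).
  (* From w^l / l! <= rho^(2l) exp(w / rho^2): the factorially small part in l is exchanged for a
     power of rho, so that d and l contribute to one geometric rate. *)
  set (E := exp (w / rho ^ 2)).
  assert (Hrho2 : 0 < rho ^ 2) by (apply pow_lt; lra).
  (* The factor j + 1 comes from (j+1)!/j!, and j + 2 is the number of bidegrees on the diagonal j +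
     1. *)
  apply graf_abstract with (fun j => (K * E * (rv / (rx - rv) + 1) / th) * ((INR j + 1) * (INR j + 2) * rho ^ j)); auto.
  - apply summable_prod with
      (G := fun ml => K * (q1 ^ Z.abs_nat (fst ml) * (/ INR (fact (snd ml)) * w ^ snd ml)))
      (g := fun m => q1 ^ Z.abs_nat m * (K * exp w)) (Bd := 2 * (/ (1 - q1) * (K * exp w))).
    + intros [m l]. unfold split_index. cbn [fst snd].
      eapply Rle_trans; [apply HT; lra|].
      replace (Z.abs_nat (Z.of_nat (l + Z.to_nat m) - Z.of_nat (l + Z.to_nat (- m)))) with (Z.abs_nat m) by lia.
      replace (Nat.min (l + Z.to_nat m) (l + Z.to_nat (- m))) with l by lia.
      replace (x + 0 * v)%C with x by ring. fold rx.
      replace (rv / (rx * th)) with q1 by (unfold q1, q; field; lra).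
      rewrite pow_mult. fold w. right. ring.
    + intros m. cbn [fst snd].
      apply bsum_le with (fun l => (K * q1 ^ Z.abs_nat m) * (/ INR (fact l) * w ^ l)).
      * intros l. right; ring.
      * replace (q1 ^ Z.abs_nat m * (K * exp w)) with ((K * q1 ^ Z.abs_nat m) * exp w) by ring.
        apply bsum_scal; [pos_tac|now apply exp_bsum].
    + apply bsum_Z_abs with (g := fun m => q1 ^ m * (K * exp w)).
      * intros m. pos_tac.
      * intros m. apply Rle_refl.
      * rewrite (Rmult_comm (/ (1 - q1))). apply bsum_le with (fun m => (K * exp w) * q1 ^ m).
        -- intros m; right; ring.
        -- apply bsum_scal; [pos_tac|now apply geom_bsum].
  - intros j t Ht. pose proof (Hr t Ht) as Hrt. pose proof (Hmu t Ht).
    set (r := Cmod (x + t * v)) in *. assert (Hr0 : 0 < r) by lra.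
    rewrite line_derivative_diag, Cmod_mult, Cmod_mult, !Cmod_R.
    pose proof (INR_fact_lt_0 j). pose proof (INR_fact_lt_0 (S j)).
    assert (0 <= (1 - t) ^ j) by (apply pow_le; lra).
    rewrite !Rabs_pos_eq by pos_tac. rewrite fact_S_R.
    replace ((1 - t) ^ j / INR (fact j) * ((INR j + 1) * INR (fact j) * Cmod (lsum (taylor_term F x v n t) (diag (S j)))))
      with ((INR j + 1) * ((1 - t) ^ j * Cmod (lsum (taylor_term F x v n t) (diag (S j))))) by (field; lra).
    replace (K * E * (rv / (rx - rv) + 1) / th * ((INR j + 1) * (INR j + 2) * rho ^ j))
      with ((INR j + 1) * ((INR j + 2) * (K * E * (rv / (rx - rv) + 1) / th * rho ^ j))) by (unfold Rdiv; ring).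
    apply Rmult_le_compat_l; [pose proof (pos_INR j); lra|].
    apply Rle_trans with (lsumR (fun ab => (1 - t) ^ j * Cmod (taylor_term F x v n t ab)) (diag (S j))).
    { rewrite lsumR_scal. apply Rmult_le_compat_l; auto. apply Cmod_lsum. }
    replace (INR j + 2) with (INR (length (diag (S j)))).
    2:{ unfold diag. rewrite length_map, length_seq, !S_INR. ring. }
    rewrite <- lsumR_const. apply lsumR_le. intros [a b] Hab. apply In_diag in Hab.
    destruct (diag_min a b) as [Ed _]. rewrite Hab in Ed.
    set (d := Z.abs_nat (Z.of_nat a - Z.of_nat b)) in *. set (l := Nat.min a b) in *.
    assert (HT' := HT t a b Ht). fold d l r in HT'.
    pose proof (INR_fact_lt_0 l).
    apply Rle_trans with ((1 - t) ^ j * (K * ((rv / (r * th)) ^ d * ((rv / 2) ^ (2 * l) * / INR (fact l))))).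
    { now apply Rmult_le_compat_l. }
    (* The heart of the estimate: the remainder weight (1-t)^j compensates for the approach to the
       singularity, because |x + t v| >= |x| - t |v| >= (1-t) |x|. *)
    assert (H1t : (1 - t) * (rv / r) <= q).
    { unfold q. apply Rmult_le_reg_r with (r * rx); [apply Rmult_lt_0_compat; lra|].
      replace ((1 - t) * (rv / r) * (r * rx)) with (rv * ((1 - t) * rx)) by (field; lra).
      replace (rv / rx * (r * rx)) with (rv * r) by (field; lra).
      apply Rmult_le_compat_l; auto.
      assert (t * rv <= t * rx) by (apply Rmult_le_compat_l; lra). lra. }
    assert (Hrr : rv / r <= rv / (rx - rv)).
    { apply Rmult_le_compat_l; auto. apply Rinv_le_contravar; lra. }
    assert (Hrr0 : 0 <= rv / r) by pos_tac.
    (* The derivative has order j + 1 but the weight only power j, so one factor rv/r may remain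
       without a factor 1 - t. It is bounded by its value at the end point, hence the exponent d -
       1. *)
    assert (Hd : (1 - t) ^ j * (rv / (r * th)) ^ d <= (rv / (rx - rv) + 1) / th * q1 ^ (d - 1)).
    { assert (Hth1 : 1 <= / th) by (rewrite <- Rinv_1; apply Rinv_le_contravar; lra).
      assert (0 <= rv / (rx - rv)) by lra.
      destruct d as [|d].
      - simpl. assert ((1 - t) ^ j <= 1) by (apply pow_le_1; lra).
        assert (1 * 1 <= (rv / (rx - rv) + 1) * / th) by (apply Rmult_le_compat; lra).
        unfold Rdiv in *. lra.
      - replace (S d - 1)%nat with d by lia.
        replace j with (d + (j - d))%nat by lia. rewrite pow_add.
        assert (0 <= (1 - t) ^ (j - d) <= 1).
        { split; [apply pow_le; lra|]. apply pow_le_1; lra. }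
        assert (0 <= (1 - t) ^ d) by (apply pow_le; lra).
        replace (rv / (r * th)) with (rv / r * / th) by (field; lra).
        apply Rle_trans with ((1 - t) ^ d * 1 * (rv / r * / th) ^ S d).
        { apply Rmult_le_compat_r; [pos_tac|]. apply Rmult_le_compat_l; lra. }
        replace ((1 - t) ^ d * 1 * (rv / r * / th) ^ S d)
          with ((rv / r * / th) * ((1 - t) * (rv / r) * / th) ^ d).
        2:{ rewrite <- tech_pow_Rmult, !Rpow_mult_distr. ring. }
        apply Rmult_le_compat; [pos_tac|apply pow_le; pos_tac| |].
        + apply Rmult_le_compat_r; [pos_tac|]. lra.
        + apply pow_incr. split; [pos_tac|]. unfold q1, Rdiv. apply Rmult_le_compat_r; [pos_tac|]. exact H1t. }
    assert (Hl : (rv / 2) ^ (2 * l) * / INR (fact l) <= rho ^ (2 * l) * E).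
    { rewrite !pow_mult. fold w.
      pose proof (pow_fact_le_exp (w / rho ^ 2) l ltac:(pos_tac)) as Hp. fold E in Hp.
      replace (w ^ l) with ((rho ^ 2) ^ l * (w / rho ^ 2) ^ l).
      2:{ rewrite <- Rpow_mult_distr. f_equal. field. lra. }
      apply Rmult_le_reg_r with (INR (fact l)); auto.
      rewrite !Rmult_assoc, Rinv_l, Rmult_1_r by lra.
      apply Rmult_le_compat_l; [pos_tac|]. lra. }
    apply Rle_trans with (K * (((rv / (rx - rv) + 1) / th * q1 ^ (d - 1)) * (rho ^ (2 * l) * E))).
    { replace ((1 - t) ^ j * (K * ((rv / (r * th)) ^ d * ((rv / 2) ^ (2 * l) * / INR (fact l)))))
        with (K * (((1 - t) ^ j * (rv / (r * th)) ^ d) * ((rv / 2) ^ (2 * l) * / INR (fact l)))) by ring.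
      apply Rmult_le_compat_l; auto. apply Rmult_le_compat; auto; pos_tac. }
    assert (0 <= rv / (rx - rv)) by lra.
    replace (K * ((rv / (rx - rv) + 1) / th * q1 ^ (d - 1) * (rho ^ (2 * l) * E)))
      with (K * E * (rv / (rx - rv) + 1) / th * (q1 ^ (d - 1) * rho ^ (2 * l))) by (unfold Rdiv; ring).
    apply Rmult_le_compat_l; [unfold E; pos_tac|].
    apply Rle_trans with (rho ^ (d - 1) * rho ^ (2 * l)).
    { apply Rmult_le_compat_r; [pos_tac|]. apply pow_incr; lra. }
    rewrite <- pow_add.
    replace (d - 1 + 2 * l)%nat with (j + (d - 1 + 2 * l - j))%nat by lia.
    rewrite pow_add. rewrite <- (Rmult_1_r (rho ^ j)) at 2.
    apply Rmult_le_compat_l; [pos_tac|].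
    apply pow_le_1; lra.
  - match goal with |- is_lim_seq (fun j => ?c * _) _ =>
      replace (Finite 0) with (Rbar_mult c 0) by (simpl; f_equal; ring) end.
    apply is_lim_seq_scal_l, is_lim_seq_poly2_geom; lra.
Qed.

Lemma hbound_pos n r : 0 < r -> 0 < hbound n r.
Proof. intros H. unfold hbound. pose proof (INR_fact_lt_0 n). pos_tac. Qed.

Lemma chi_ladder x v : (forall t : R, 0 <= t <= 1 -> 0 < Cmod (x + t * v)) -> ladder_family chi x v.
Proof.
  intros H n t Ht. apply cyl_ladder, Kh_ladder. specialize (H t Ht). pos_tac.
Qed.

Lemma psi_ladder x v : ladder_family psi x v.
Proof. intros n t Ht. apply cyl_ladder, Kj_ladder. Qed.

Lemma Cmod_line_lower x v t : 0 <= t <= 1 -> Cmod x - Cmod v <= Cmod (x + t * v).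
Proof.
  intros Ht. pose proof (Cmod_triangle (x + t * v) (- (t * v))) as H.
  replace (x + t * v + - (t * v))%C with x in H by ring.
  rewrite Cmod_opp, Cmod_mult, Cmod_R, Rabs_pos_eq in H by lra.
  pose proof (Cmod_ge_0 v). nra.
Qed.

Lemma Cmod_line_upper x v t : 0 <= t <= 1 -> Cmod (x + t * v) <= Cmod x + Cmod v.
Proof.
  intros Ht. eapply Rle_trans; [apply Cmod_triangle|].
  rewrite Cmod_mult, Cmod_R, Rabs_pos_eq by lra.
  pose proof (Cmod_ge_0 v). nra.
Qed.

Lemma chi_annulus_bound r R0 : 0 < r -> r <= R0 -> exists D, 0 < D /\ forall n w, r <= Cmod w <= R0 ->
  Cmod (chi n w) <= D * hbound (Z.abs_nat n) (Cmod w).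
Proof.
  intros Hr HR. destruct (chi_upper R0 ltac:(lra)) as [D [HD H]].
  assert (0 < sqrt r) by (apply sqrt_lt_R0; lra).
  exists (D / sqrt r). split; [pos_tac|]. intros n w Hw.
  eapply Rle_trans; [apply H; lra|].
  replace (D / sqrt r * hbound (Z.abs_nat n) (Cmod w)) with (D * hbound (Z.abs_nat n) (Cmod w) / sqrt r) by (field; lra).
  pose proof (hbound_pos (Z.abs_nat n) (Cmod w) ltac:(lra)).
  apply Rmult_le_compat_l; [pos_tac|]. apply Rinv_le_contravar; auto.
  apply sqrt_le_1_alt; lra.
Qed.

Lemma chi_graf n x v : Cmod v < Cmod x ->
  tsum (fun m => chi (n - m) x * psi m v)%C = chi n (x + v).
Proof.
  intros H. pose proof (Cmod_ge_0 v).
  destruct (chi_annulus_bound (Cmod x - Cmod v) (Cmod x + Cmod v)) as [D [HD HB]]; try lra.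
  apply (graf_factorial chi x v n D); auto; try lra.
  - apply chi_ladder; auto. intros t Ht. pose proof (Cmod_line_lower x v t Ht). lra.
  - intros m t Ht. apply HB. split; [now apply Cmod_line_lower|now apply Cmod_line_upper].
Qed.

Lemma psi_bounded R0 : exists D, 0 < D /\ forall n w, Cmod w <= R0 -> Cmod (psi n w) <= D.
Proof.
  exists (exp (R0 ^ 2 / 4) * exp (R0 / 2)). split; [pos_tac|].
  intros n w Hw. pose proof (Cmod_ge_0 w).
  assert (He : forall a b, a <= b -> exp a <= exp b).
  { intros a b Hab. destruct (Req_dec a b) as [->|]; [lra|left; apply exp_increasing; lra]. }
  eapply Rle_trans; [apply psi_bound|]. apply Rmult_le_compat; [pos_tac| | |].
  - pose proof (INR_fact_lt_0 (Z.abs_nat n)). pos_tac.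
  - apply He. apply Rmult_le_compat_r; [lra|]. apply pow_incr; lra.
  - apply Rle_trans with (exp (Cmod w / 2)); [|apply He; lra].
    pose proof (INR_fact_lt_0 (Z.abs_nat n)).
    apply Rmult_le_reg_r with (INR (fact (Z.abs_nat n))); auto.
    unfold Rdiv at 1. rewrite Rmult_assoc, Rinv_l, Rmult_1_r by lra.
    rewrite Rmult_comm. apply pow_fact_le_exp. lra.
Qed.

Lemma psi_graf n x v : tsum (fun m => psi (n - m) x * psi m v)%C = psi n (x + v).
Proof.
  destruct (psi_bounded (Cmod x + Cmod v)) as [D [HD HB]].
  apply (graf_bounded psi x v n D); [apply psi_ladder|].
  intros m t Ht. apply HB. now apply Cmod_line_upper.
Qed.

(* e^(i Im(w e^(ig))), multiplied by the n-th power of e^(-ig) so as to form a ladder. *)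
Definition plane_wave (g : R) (n : Z) (w : C) : C :=
  cis (- IZR n * g + (fst w * sin g + snd w * cos g)).

Lemma Cder_cis (h : R -> R) t dh : is_derive h t dh ->
  Cder (fun u => cis (h u)) t (Ci * dh * cis (h t))%C.
Proof.
  intros H. split; simpl.
  - replace ((0 * dh - 1 * 0) * cos (h t) - (0 * 0 + 1 * dh) * sin (h t)) with (dh * - sin (h t)) by ring.
    apply (is_derive_comp (K := R_AbsRing) (V := R_NormedModule) cos h); auto.
    apply is_derive_cos.
  - replace ((0 * dh - 1 * 0) * sin (h t) + (0 * 0 + 1 * dh) * cos (h t)) with (dh * cos (h t)) by ring.
    apply (is_derive_comp (K := R_AbsRing) (V := R_NormedModule) sin h); auto.
    apply is_derive_sin.
Qed.

Lemma plane_wave_graf g n x v :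
  tsum (fun m => plane_wave g (n - m) x * psi m v)%C = plane_wave g n (x + v).
Proof.
  apply (graf_bounded (plane_wave g) x v n 1).
  - intros m t _.
    assert (E1 : forall w, plane_wave g (m - 1) w = (plane_wave g m w * cis g)%C).
    { intros w. unfold plane_wave. rewrite <- cis_plus, minus_IZR. f_equal; ring. }
    assert (E2 : forall w, plane_wave g (m + 1) w = (plane_wave g m w * cis (- g))%C).
    { intros w. unfold plane_wave. rewrite <- cis_plus, plus_IZR. f_equal; ring. }
    rewrite E1, E2. set (P := plane_wave g m (x + t * v)).
    apply Cder_eq with (Ci * RtoC (fst v * sin g + snd v * cos g) * P)%C.
    + transitivity ((zalpha v * cis g + zbeta v * cis (- g)) * P)%C; [f_equal|ring].
      unfold zalpha, zbeta. rewrite <- RtoC_half. unfold cis. rewrite cos_neg, sin_neg.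
      destruct v as [a b]. unfold Ci, RtoC, Cconj, Copp, Cmult, Cplus; simpl. f_equal; field.
    + apply (Cder_cis (fun u : R => - IZR m * g + (fst (x + u * v)%C * sin g + snd (x + u * v)%C * cos g)) t).
      simpl. auto_derive; auto. ring.
  - intros m t _. unfold plane_wave. rewrite Cmod_cis. lra.
Qed.

(** * Boundary integrals over circles *)

Definition CRInt (f : R -> C) (a b : R) (l : C) : Prop :=
  is_RInt (V := C_R_NormedModule) f a b l.

Lemma CRInt_pair f a b l : is_RInt (fun t => fst (f t)) a b (fst l) ->
  is_RInt (fun t => snd (f t)) a b (snd l) -> CRInt f a b l.
Proof.
  intros H1 H2. rewrite (surjective_pairing l).
  exact (is_RInt_fct_extend_pair (U := R_NormedModule) (V := R_NormedModule) f a b _ _ H1 H2).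
Qed.

Lemma CRInt_fst f a b l : CRInt f a b l -> is_RInt (fun t => fst (f t)) a b (fst l).
Proof. exact (is_RInt_fct_extend_fst (U := R_NormedModule) (V := R_NormedModule) f a b l). Qed.

Lemma CRInt_snd f a b l : CRInt f a b l -> is_RInt (fun t => snd (f t)) a b (snd l).
Proof. exact (is_RInt_fct_extend_snd (U := R_NormedModule) (V := R_NormedModule) f a b l). Qed.

Lemma CRInt_unique f a b l l' : CRInt f a b l -> CRInt f a b l' -> l = l'.
Proof.
  intros H1 H2. unfold CRInt in *.
  rewrite <- (is_RInt_unique (V := C_R_CompleteNormedModule) f a b l H1).
  exact (is_RInt_unique (V := C_R_CompleteNormedModule) f a b l' H2).
Qed.

Lemma CRInt_plus f g a b l m : CRInt f a b l -> CRInt g a b m ->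
  CRInt (fun t => f t + g t)%C a b (l + m)%C.
Proof. intros H1 H2. exact (is_RInt_plus (V := C_R_NormedModule) f g a b l m H1 H2). Qed.

Lemma CRInt_ext f g a b l : (forall t, f t = g t) -> CRInt f a b l -> CRInt g a b l.
Proof. intros E H. replace g with f; auto. now apply functional_extensionality. Qed.

Lemma CRInt_scal c f a b l : CRInt f a b l -> CRInt (fun t => c * f t)%C a b (c * l)%C.
Proof.
  intros H. pose proof (CRInt_fst _ _ _ _ H) as H1. pose proof (CRInt_snd _ _ _ _ H) as H2.
  apply CRInt_pair; simpl.
  - apply (is_RInt_minus (V := R_NormedModule)); apply (is_RInt_scal (V := R_NormedModule)); auto.
  - apply (is_RInt_plus (V := R_NormedModule)); apply (is_RInt_scal (V := R_NormedModule)); auto.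
Qed.

Lemma CRInt_Chasles f a b c l m : CRInt f a b l -> CRInt f b c m -> CRInt f a c (l + m)%C.
Proof. intros H1 H2. exact (is_RInt_Chasles (V := C_R_NormedModule) f a b c l m H1 H2). Qed.

Lemma norm_C_R (z : C) : norm (V := C_R_NormedModule) z = Cmod z.
Proof.
  unfold norm; simpl. unfold prod_norm, Cmod, norm; simpl. unfold abs; simpl. f_equal.
  rewrite !Rmult_1_r, <- !Rabs_mult, !Rabs_pos_eq; auto; nra.
Qed.

Lemma CRInt_bound f (g : R -> R) a b l lg : a <= b -> (forall t, a <= t <= b -> Cmod (f t) <= g t) ->
  CRInt f a b l -> is_RInt g a b lg -> Cmod l <= lg.
Proof.
  intros Hab H1 H2 H3. rewrite <- norm_C_R.
  apply (norm_RInt_le (V := C_R_NormedModule) f g a b l lg Hab); auto.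
  intros t Ht. rewrite norm_C_R. auto.
Qed.

Lemma CRInt_bound_const f M a b l : a <= b -> (forall t, a <= t <= b -> Cmod (f t) <= M) ->
  CRInt f a b l -> Cmod l <= (b - a) * M.
Proof.
  intros Hab H1 H2. apply (CRInt_bound f (fun _ => M) a b); auto.
  apply (is_RInt_const (V := R_NormedModule)).
Qed.

Lemma is_RInt_const_eq (v a b l : R) : l = (b - a) * v -> is_RInt (fun _ => v) a b l.
Proof. intros ->. apply (is_RInt_const (V := R_NormedModule)). Qed.

Lemma CRInt_cis j a : CRInt (fun t => cis (IZR j * t)) a (a + 2 * PI)
  (if Z.eq_dec j 0 then RtoC (2 * PI) else RtoC 0).
Proof.
  destruct (Z.eq_dec j 0) as [->|Hj].
  - apply CRInt_pair; simpl.
    + apply is_RInt_ext with (fun _ => 1).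
      { intros t _. rewrite Rmult_0_l, cos_0; auto. }
      apply is_RInt_const_eq. ring.
    + apply is_RInt_ext with (fun _ => 0).
      { intros t _. rewrite Rmult_0_l, sin_0; auto. }
      apply is_RInt_const_eq. ring.
  - assert (Hr : IZR j <> 0) by (now apply not_0_IZR).
    assert (E : forall t, cos (IZR j * (t + 2 * PI)) = cos (IZR j * t) /\ sin (IZR j * (t + 2 * PI)) = sin (IZR j * t)).
    { intros t. replace (IZR j * (t + 2 * PI)) with (IZR j * t + 2 * (IZR j * PI)) by ring.
      rewrite cos_plus, sin_plus.
      assert (sin (2 * (IZR j * PI)) = 0).
      { apply sin_eq_0_1. exists (2 * j)%Z. rewrite mult_IZR. ring. }
      assert (cos (2 * (IZR j * PI)) = 1).
      { rewrite cos_2a_sin. rewrite sin_eq_0_1 by (exists j; ring). ring. }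
      rewrite H, H0. split; ring. }
    apply CRInt_pair; simpl.
    + replace 0 with (minus (sin (IZR j * (a + 2 * PI)) / IZR j) (sin (IZR j * a) / IZR j)).
      * apply (is_RInt_derive (V := R_CompleteNormedModule) (fun t => sin (IZR j * t) / IZR j)).
        -- intros t _. auto_derive; auto. field; auto.
        -- intros t _. apply (ex_derive_continuous (K := R_AbsRing) (V := R_NormedModule)). auto_derive; auto.
      * rewrite (proj2 (E a)). unfold minus, plus, opp; simpl. ring.
    + replace 0 with (minus (- cos (IZR j * (a + 2 * PI)) / IZR j) (- cos (IZR j * a) / IZR j)).
      * apply (is_RInt_derive (V := R_CompleteNormedModule) (fun t => - cos (IZR j * t) / IZR j)).
        -- intros t _. auto_derive; auto. field; auto.
        -- intros t _. apply (ex_derive_continuous (K := R_AbsRing) (V := R_NormedModule)). auto_derive; auto.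
      * rewrite (proj1 (E a)). unfold minus, plus, opp; simpl. ring.
Qed.

Lemma tsum_minus_lsum {T} (f : T -> C) L eps : summable f -> NoDup L ->
  (forall L', NoDup L' -> (forall x, In x L' -> ~ In x L) -> lsumR (fun x => Cmod (f x)) L' <= eps) ->
  Cmod (tsum f - lsum f L) <= eps.
Proof.
  intros Hf HL Ht. apply Cmod_le_eps. intros e He.
  destruct (summable_has_sum f Hf e He) as [L1 [HL1 H1]].
  specialize (H1 (clnodup (L1 ++ L)) (NoDup_clnodup _)).
  assert (I1 : incl L1 (clnodup (L1 ++ L))) by (intros x Hx; apply In_clnodup, in_or_app; auto).
  assert (I2 : incl L (clnodup (L1 ++ L))) by (intros x Hx; apply In_clnodup, in_or_app; auto).
  specialize (H1 I1). destruct (incl_NoDup_split _ _ HL I2) as [V HV].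
  assert (HN : NoDup (L ++ V)) by (eapply Permutation_NoDup; [exact HV|apply NoDup_clnodup]).
  rewrite (lsum_perm _ _ _ HV), lsum_app in H1.
  replace (tsum f - lsum f L)%C with (- (lsum f L + lsum f V - tsum f) + lsum f V)%C by ring.
  eapply Rle_trans; [apply Cmod_triangle|]. rewrite Cmod_opp.
  pose proof (Cmod_lsum f V).
  assert (lsumR (fun x => Cmod (f x)) V <= eps); [|lra].
  apply Ht.
  - now apply NoDup_app_remove_l in HN.
  - intros x Hx HxL. revert HN Hx HxL. clear. intros HN Hx HxL.
    apply in_split in HxL as [l1 [l2 ->]]. rewrite <- app_assoc in HN. simpl in HN.
    apply NoDup_remove_2 in HN. apply HN. apply in_or_app; right. apply in_or_app; auto.
Qed.

(** The finite stage of termwise integration; [CRInt_fourier] passes from it to absolutely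
    convergent Fourier series. *)
Lemma CRInt_lsum {T} (f : T -> R -> C) (I : T -> C) L a b :
  (forall x, CRInt (f x) a b (I x)) -> CRInt (fun t => lsum (fun x => f x t) L) a b (lsum I L).
Proof.
  intros H. induction L as [|x L IH].
  - unfold lsum; simpl. apply CRInt_pair; simpl; apply is_RInt_const_eq; ring.
  - apply (CRInt_plus (f x) (fun t => lsum (fun x => f x t) L)); auto.
Qed.

(** Absolute summability makes the Fourier series converge uniformly, so it may be integrated
    termwise; orthogonality leaves one coefficient. *)
Lemma CRInt_fourier (c : Z -> C) (f : R -> C) m a : summable c ->
  (forall t, f t = tsum (fun n => c n * cis (IZR n * t))%C) ->
  CRInt (fun t => f t * cis (- IZR m * t))%C a (a + 2 * PI) (2 * PI * c m)%C.
Proof.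
  intros [B HB] Hf.
  (* One finite set serves all t because |cis| = 1; it is made to contain m, so that every partial
     sum has the same integral. *)
  assert (HL : forall k : nat, exists L : list Z, NoDup L /\ In m L /\
    forall t, Cmod (f t - lsum (fun n => c n * cis (IZR n * t))%C L) <= / (INR k + 1)).
  { intros k. pose proof (pos_INR k).
    destruct (bsum_tail _ B (fun x => Cmod_ge_0 (c x)) HB (/ (INR k + 1))) as [L0 [HL0 H0]].
    { apply Rinv_0_lt_compat; lra. }
    exists (clnodup (m :: L0)). split; [apply NoDup_clnodup|]. split; [apply In_clnodup; now left|].
    intros t. rewrite Hf. apply tsum_minus_lsum.
    - exists B. eapply bsum_le; [|exact HB]. intros n. simpl. rewrite Cmod_mult, Cmod_cis; lra.
    - apply NoDup_clnodup.
    - intros L' HL' Hd. apply Rle_trans with (lsumR (fun x => Cmod (c x)) L').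
      + apply lsumR_le. intros n _. rewrite Cmod_mult, Cmod_cis; lra.
      + apply H0; auto. intros x Hx Hx'. apply (Hd x Hx), In_clnodup. now right. }
  apply choice in HL as [L HL].
  set (g := fun (k : nat) (t : R) => (lsum (fun n => c n * cis (IZR n * t))%C (L k) * cis (- IZR m * t))%C).
  assert (Hg : forall k, CRInt (g k) a (a + 2 * PI) (2 * PI * c m)%C).
  { intros k. destruct (HL k) as [HN [Hm _]].
    apply CRInt_ext with (fun t => lsum (fun n => c n * cis (IZR (n - m) * t))%C (L k)).
    { intros t. unfold g. rewrite Cmult_comm, <- lsum_scal. apply lsum_ext. intros n _.
      replace (cis (IZR (n - m) * t)) with (cis (IZR n * t) * cis (- IZR m * t))%C; [ring|].
      rewrite <- cis_plus, minus_IZR. f_equal; ring. }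
    replace (2 * PI * c m)%C with (lsum (fun n => c n * (if Z.eq_dec (n - m) 0 then RtoC (2 * PI) else RtoC 0))%C (L k)).
    - apply CRInt_lsum. intros n. apply CRInt_scal, CRInt_cis.
    - assert (Hz : forall l, ~ In m l -> lsum (fun n => c n * (if Z.eq_dec (n - m) 0 then RtoC (2 * PI) else RtoC 0))%C l = RtoC 0).
      { induction l as [|x l IH]; intros Hl; unfold lsum in *; cbn [map fold_right]; auto.
        rewrite IH by (intros Hx; apply Hl; now right).
        destruct (Z.eq_dec (x - m) 0); [exfalso; apply Hl; left; lia|ring]. }
      apply in_split in Hm as [l1 [l2 E]]. rewrite E in *.
      apply NoDup_remove_2 in HN.
      rewrite lsum_app. change (m :: l2) with ((m :: nil) ++ l2). rewrite lsum_app, (Hz l1), (Hz l2);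
        try (intros Hx; apply HN, in_or_app; auto).
      unfold lsum; cbn [map fold_right]. match goal with |- context [Z.eq_dec ?u 0] => destruct (Z.eq_dec u 0) as [|Hne] end;
        [|exfalso; apply Hne; lia].
      rewrite RtoC_mult. ring. }
  destruct (filterlim_RInt (V := C_R_CompleteNormedModule) g a (a + 2 * PI) eventually _
    (fun t => f t * cis (- IZR m * t))%C (fun _ => (2 * PI * c m)%C) Hg) as [If [H1 H2]].
  - apply filterlim_locally. intros [eps He].
    destruct (INR_unbounded (/ eps)) as [k0 Hk0]. exists k0. intros k Hk t. simpl.
    assert (Hd : Cmod (g k t - f t * cis (- IZR m * t)) < eps).
    { unfold g. destruct (HL k) as [_ [_ H]]. specialize (H t).
      replace (lsum (fun n => c n * cis (IZR n * t)) (L k) * cis (- IZR m * t) - f t * cis (- IZR m * t))%C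
        with (- (f t - lsum (fun n => c n * cis (IZR n * t)) (L k)) * cis (- IZR m * t))%C by ring.
      rewrite Cmod_mult, Cmod_cis, Cmod_opp, Rmult_1_r.
      eapply Rle_lt_trans; [exact H|]. pose proof (Rinv_0_lt_compat _ He).
      assert (INR k0 <= INR k) by (now apply le_INR).
      rewrite <- (Rinv_inv eps). apply Rinv_lt_contravar; [apply Rmult_lt_0_compat; lra|lra]. }
    split; simpl.
    + eapply Rle_lt_trans; [|exact Hd].
      apply (Rabs_fst_Cmod (g k t - f t * cis (- IZR m * t))).
    + eapply Rle_lt_trans; [|exact Hd].
      apply (Rabs_snd_Cmod (g k t - f t * cis (- IZR m * t))).
  - replace (2 * PI * c m)%C with If; auto.
    symmetry. eapply (filterlim_locally_unique (K := R_AbsRing) (V := C_R_NormedModule) (F := eventually) (fun _ => (2 * PI * c m)%C)); [|exact H1].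
    apply filterlim_const.
Qed.

Lemma chi_fixed x : 0 < Cmod x -> exists D, 0 < D /\ forall i N, (Z.abs_nat i <= N)%nat ->
  Cmod (chi i x) <= D * hbound N (Cmod x).
Proof.
  intros Hx. destruct (chi_annulus_bound (Cmod x) (Cmod x)) as [D [HD H]]; try lra.
  exists (D * exp (Cmod x / 2)). split; [pos_tac|]. intros i N HN.
  eapply Rle_trans; [apply H; lra|]. rewrite Rmult_assoc. apply Rmult_le_compat_l; [lra|].
  now apply hbound_mono.
Qed.

Lemma hbound_term N l r rho : 0 < r ->
  hbound (N + l) r * ((rho / 2) ^ l / INR (fact l)) = hbound N r * (nbc N l * (rho / r) ^ l).
Proof.
  intros Hr. unfold hbound, nbc. rewrite pow_add.
  replace (rho / r) with (2 / r * (rho / 2)) by (field; lra). rewrite Rpow_mult_distr.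
  pose proof (INR_fact_lt_0 N); pose proof (INR_fact_lt_0 l). field. repeat split; lra.
Qed.

Lemma psi_fixed v : exists E, 0 < E /\ forall m,
  Cmod (psi m v) <= E * ((Cmod v / 2) ^ Z.abs_nat m / INR (fact (Z.abs_nat m))).
Proof.
  exists (exp (Cmod v ^ 2 / 4)). split; [apply exp_pos|]. intros m. apply psi_bound.
Qed.

Lemma summable_chi_graf n x v : Cmod v < Cmod x -> summable (fun m => chi (n - m) x * psi m v)%C.
Proof.
  intros Hv. pose proof (Cmod_ge_0 v). destruct (chi_fixed x) as [D [HD H1]]; [lra|].
  destruct (psi_fixed v) as [E [HE H2]].
  set (N := Z.abs_nat n). set (q := Cmod v / Cmod x).
  assert (Hq : 0 <= q < 1).
  { unfold q; split; [pos_tac|]. apply Rmult_lt_reg_r with (Cmod x); [lra|].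
    unfold Rdiv. rewrite Rmult_assoc, Rinv_l by lra. lra. }
  pose proof (hbound_pos N (Cmod x) ltac:(lra)).
  exists (2 * (D * E * hbound N (Cmod x) * / (1 - q) ^ S N)).
  apply bsum_Z_abs with (g := fun l => D * E * hbound N (Cmod x) * (nbc N l * q ^ l)).
  - intros; apply Cmod_ge_0.
  - intros m. rewrite Cmod_mult. set (l := Z.abs_nat m).
    apply Rle_trans with (D * hbound (N + l) (Cmod x) * (E * ((Cmod v / 2) ^ l / INR (fact l)))).
    + apply Rmult_le_compat; try apply Cmod_ge_0; [apply H1; lia|apply H2].
    + right. unfold q. rewrite !Rmult_assoc. f_equal.
      transitivity (E * (hbound (N + l) (Cmod x) * ((Cmod v / 2) ^ l / INR (fact l)))); [ring|].
      rewrite hbound_term by lra. ring.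
  - apply bsum_scal; [pos_tac|now apply nbc_bsum].
Qed.

Lemma CRInt_chi n m x v a : Cmod v < Cmod x ->
  CRInt (fun t => chi n (x + v * cis t) * cis (- IZR m * t))%C a (a + 2 * PI)
    (2 * PI * (chi (n - m) x * psi m v))%C.
Proof.
  intros H. apply CRInt_fourier with (c := fun m => (chi (n - m) x * psi m v)%C).
  - now apply summable_chi_graf.
  - intros t. rewrite <- chi_graf by (rewrite Cmod_mult, Cmod_cis; lra).
    apply tsum_ext. intros j. unfold psi. rewrite cyl_rot. ring.
Qed.

Lemma summable_plane_wave g n x v : summable (fun m => plane_wave g (n - m) x * psi m v)%C.
Proof.
  destruct (psi_fixed v) as [E [HE H2]]. pose proof (Cmod_ge_0 v).
  exists (2 * (E * exp (Cmod v / 2))).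
  apply bsum_Z_abs with (g := fun l => E * (/ INR (fact l) * (Cmod v / 2) ^ l)).
  - intros; apply Cmod_ge_0.
  - intros m. rewrite Cmod_mult. unfold plane_wave. rewrite Cmod_cis, Rmult_1_l.
    eapply Rle_trans; [apply H2|]. right. unfold Rdiv. ring.
  - apply bsum_scal; [lra|apply exp_bsum; lra].
Qed.

Lemma CRInt_plane_wave g n m x v a :
  CRInt (fun t => plane_wave g n (x + v * cis t) * cis (- IZR m * t))%C a (a + 2 * PI)
    (2 * PI * (plane_wave g (n - m) x * psi m v))%C.
Proof.
  apply CRInt_fourier with (c := fun m => (plane_wave g (n - m) x * psi m v)%C).
  - now apply summable_plane_wave.
  - intros t. rewrite <- plane_wave_graf.
    apply tsum_ext. intros j. unfold psi. rewrite cyl_rot. ring.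
Qed.

Lemma ex_CRInt f u w : u <= w -> (forall t, u <= t <= w -> exists l, Cder f t l) ->
  exists I, CRInt f u w I.
Proof.
  intros Huw H.
  assert (H1 : ex_RInt (fun t => fst (f t)) u w).
  { apply (ex_RInt_continuous (V := R_CompleteNormedModule)). intros t Ht.
    rewrite Rmin_left, Rmax_right in Ht by lra. destruct (H t Ht) as [l [Hl _]].
    apply (ex_derive_continuous (K := R_AbsRing) (V := R_NormedModule)). now exists (fst l). }
  assert (H2 : ex_RInt (fun t => snd (f t)) u w).
  { apply (ex_RInt_continuous (V := R_CompleteNormedModule)). intros t Ht.
    rewrite Rmin_left, Rmax_right in Ht by lra. destruct (H t Ht) as [l [_ Hl]].
    apply (ex_derive_continuous (K := R_AbsRing) (V := R_NormedModule)). now exists (snd l). }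
  destruct H1 as [I1 H1], H2 as [I2 H2]. exists (I1, I2). now apply CRInt_pair.
Qed.

Lemma chi_0_circle_Cder x v j t : 0 < Cmod (x + v * cis t) ->
  exists l, Cder (fun t => chi 0 (x + v * cis t) * cis (IZR j * t))%C t l.
Proof.
  intros H. eexists. apply Cder_mult.
  - apply Cder_ext with (fun t : R => Kh 0 (Cmod (x + v * cis t) ^ 2 / 4)).
    + intros u. unfold chi, cyl, zp. simpl. change (Pos.to_nat 1) with 1%nat. ring.
    + apply (Cder_comp (Kh 0) (fun t : R => Cmod (x + v * cis t) ^ 2 / 4)).
      * apply Kh_ladder. pos_tac.
      * apply is_derive_ext with (fun t => (fst (x + v * cis t)%C ^ 2 + snd (x + v * cis t)%C ^ 2) / 4).
        { intros u. unfold Cmod. rewrite pow2_sqrt; [reflexivity|nra]. }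
        apply Derive_correct. simpl. auto_derive. auto.
  - apply Cder_cis. apply Derive_correct. auto_derive. auto.
Qed.

(** Replaces the product of one-sided filters by independent cut-offs h1 and h2 at the two ends of
    the period. *)
Lemma is_CRInt_gen_intro f s L :
  (forall eps, 0 < eps -> exists eta, 0 < eta /\ forall h1 h2, 0 < h1 < eta -> 0 < h2 < eta ->
     exists I, CRInt f (s + h1) (s + 2 * PI - h2) I /\ Cmod (I - L) <= eps) ->
  RInt_gen (V := C_R_CompleteNormedModule) f (at_right s) (at_left (s + 2 * PI)) = L.
Proof.
  intros H. apply is_RInt_gen_unique.
  intros P [[eps He] HP]. destruct (H (eps / 2)) as [eta [Heta H']]; [lra|].
  exists (fun u => s < u < s + eta) (fun v => s + 2 * PI - eta < v < s + 2 * PI).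
  - exists (mkposreal eta Heta). intros u Hu Hu2. unfold ball in Hu; simpl in Hu. unfold AbsRing_ball, abs, minus, plus, opp in Hu; simpl in Hu.
    apply Rabs_def2 in Hu. lra.
  - exists (mkposreal eta Heta). intros u Hu Hu2. unfold ball in Hu; simpl in Hu. unfold AbsRing_ball, abs, minus, plus, opp in Hu; simpl in Hu.
    apply Rabs_def2 in Hu. lra.
  - intros u v Hu Hv. simpl.
    destruct (H' (u - s) (s + 2 * PI - v)) as [I [HI1 HI2]]; try lra.
    exists I. split.
    + unfold CRInt in HI1. replace (s + (u - s)) with u in HI1 by ring.
      replace (s + 2 * PI - (s + 2 * PI - v)) with v in HI1 by ring. exact HI1.
    + apply HP. pose proof (Rabs_fst_Cmod (I - L)). pose proof (Rabs_snd_Cmod (I - L)).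
      simpl in H0, H1. split; simpl; unfold ball; simpl; unfold AbsRing_ball, abs, minus, plus, opp; simpl; lra.
Qed.

(** A bounded integrand loses at most M (h1 + h2) by the cut-offs, so the improper integral agrees
    with the ordinary one. *)
Lemma CRInt_gen_of_bounded f s L M : 0 <= M ->
  (forall t, exists l, Cder f t l) -> (forall t, Cmod (f t) <= M) ->
  CRInt f s (s + 2 * PI) L ->
  RInt_gen (V := C_R_CompleteNormedModule) f (at_right s) (at_left (s + 2 * PI)) = L.
Proof.
  intros HM Hd Hb HL. apply is_CRInt_gen_intro. intros eps He.
  pose proof PI_RGT_0.
  exists (Rmin (PI / 2) (eps / (2 * (M + 1)))). split.
  { apply Rmin_glb_lt; [lra|]. apply Rdiv_lt_0_compat; lra. }
  intros h1 h2 H1 H2.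
  assert (Hm1 := Rmin_l (PI / 2) (eps / (2 * (M + 1)))). assert (Hm2 := Rmin_r (PI / 2) (eps / (2 * (M + 1)))).
  destruct (ex_CRInt f s (s + h1)) as [I1 HI1]; [lra|auto|].
  destruct (ex_CRInt f (s + h1) (s + 2 * PI - h2)) as [I2 HI2]; [lra|auto|].
  destruct (ex_CRInt f (s + 2 * PI - h2) (s + 2 * PI)) as [I3 HI3]; [lra|auto|].
  exists I2. split; auto.
  assert (E : L = (I1 + I2 + I3)%C).
  { apply (CRInt_unique f s (s + 2 * PI)); auto.
    eapply CRInt_Chasles; [eapply CRInt_Chasles; eassumption|assumption]. }
  rewrite E. replace (I2 - (I1 + I2 + I3))%C with (- (I1 + I3))%C by ring. rewrite Cmod_opp.
  eapply Rle_trans; [apply Cmod_triangle|].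
  assert (B1 := CRInt_bound_const f M s (s + h1) I1 ltac:(lra) (fun t _ => Hb t) HI1).
  assert (B3 := CRInt_bound_const f M (s + 2 * PI - h2) (s + 2 * PI) I3 ltac:(lra) (fun t _ => Hb t) HI3).
  assert (Hx : forall h, 0 < h < Rmin (PI / 2) (eps / (2 * (M + 1))) -> h * M <= eps / 2).
  { intros h Hh. apply Rle_trans with (eps / (2 * (M + 1)) * (M + 1)).
    - apply Rmult_le_compat; lra.
    - right; field. lra. }
  pose proof (Hx h1 H1). pose proof (Hx h2 H2). lra.
Qed.

Lemma sin_ge_quarter x : 0 <= x <= PI / 2 -> x / 4 <= sin x.
Proof.
  intros Hx. pose proof PI_RGT_0. pose proof PI_4.
  destruct (Rle_dec x (PI / 3)) as [H3|H3].
  - destruct (Req_dec x 0) as [->|Hx0]; [rewrite sin_0; lra|].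
    destruct (MVT_gen sin 0 x cos) as [c [Hc E]].
    + intros t _. apply is_derive_sin.
    + intros t _. apply continuity_pt_filterlim, (ex_derive_continuous (K := R_AbsRing) (V := R_NormedModule)).
      eexists; apply is_derive_sin.
    + rewrite Rmin_left, Rmax_right in Hc by lra. rewrite sin_0, Rminus_0_r in E.
      assert (/ 2 <= cos c).
      { replace (/ 2) with (cos (PI / 3)) by (rewrite cos_PI3; lra). apply cos_decr_1; lra. }
      rewrite E. nra.
  - assert (sin (PI / 3) <= sin x) by (apply sin_incr_1; lra).
    rewrite sin_PI3 in H1.
    assert (1.7 <= sqrt 3) by (apply Rsqr_incr_0_var; [rewrite Rsqr_sqrt by lra; unfold Rsqr; lra|apply sqrt_pos]).
    lra.
Qed.

Lemma one_minus_cos_ge x : 0 <= x <= PI -> x ^ 2 / 32 <= 1 - cos x.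
Proof.
  intros Hx. pose proof (sin_ge_quarter (x / 2) ltac:(lra)) as H.
  replace (cos x) with (1 - 2 * sin (x / 2) * sin (x / 2)).
  2:{ rewrite <- cos_2a_sin. f_equal; field. }
  nra.
Qed.

(** By the law of cosines the squared distance is (rho - r)^2 + 2 rho r (1 - cos h). The bound is
    uniform in r >= rho/2, which the limit r to rho requires; h is the angular distance from
    whichever end of the period is closer. *)
Lemma circle_distance rho r s t h : 0 < rho -> rho / 2 <= r -> 0 <= h <= PI ->
  (t - s = h \/ t - s = 2 * PI - h) ->
  rho * h / 6 <= Cmod (rho * cis s + - r * cis t).
Proof.
  intros Hrho Hr Hh Ht.
  assert (Ec : cos (t - s) = cos h).
  { destruct Ht as [->| ->]; auto. replace (2 * PI - h) with (- h + 2 * PI) by ring.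
    rewrite cos_plus, cos_2PI, sin_2PI, cos_neg. ring. }
  assert (E : Cmod (rho * cis s + - r * cis t) = sqrt ((rho - r) ^ 2 + 2 * rho * r * (1 - cos h))).
  { unfold Cmod. f_equal. rewrite <- Ec, cos_minus. unfold cis; simpl.
    pose proof (sin2_cos2 s) as H1. pose proof (sin2_cos2 t) as H2. unfold Rsqr in *.
    transitivity (rho ^ 2 * (sin s * sin s + cos s * cos s) + r ^ 2 * (sin t * sin t + cos t * cos t)
      - 2 * rho * r * (cos t * cos s + sin t * sin s)); [ring|]. rewrite H1, H2. ring. }
  rewrite E. rewrite <- (sqrt_pow2 (rho * h / 6)) by pos_tac. apply sqrt_le_1_alt.
  pose proof (one_minus_cos_ge h Hh) as H. pose proof (pow2_ge_0 (rho - r)).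
  assert (H3 : rho ^ 2 * (h ^ 2 / 32) <= 2 * rho * r * (1 - cos h)).
  { apply Rmult_le_compat; [pos_tac|pos_tac| |exact H]. simpl. nra. }
  replace ((rho * h / 6) ^ 2) with (rho ^ 2 * h ^ 2 / 36) by field.
  assert (0 <= rho ^ 2 * h ^ 2) by pos_tac. lra.
Qed.

Lemma is_RInt_inv_sqrt s a b : 0 < a -> a <= b ->
  is_RInt (fun t => / sqrt (t - s)) (s + a) (s + b) (2 * sqrt b - 2 * sqrt a).
Proof.
  intros Ha Hab.
  replace (2 * sqrt b - 2 * sqrt a) with (minus (2 * sqrt (s + b - s)) (2 * sqrt (s + a - s))).
  2:{ unfold minus, plus, opp; simpl. replace (s + b - s) with b by ring. replace (s + a - s) with a by ring. ring. }
  apply (is_RInt_derive (V := R_CompleteNormedModule) (fun t => 2 * sqrt (t - s))).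
  - intros t Ht. rewrite Rmin_left, Rmax_right in Ht by lra.
    assert (0 < sqrt (t - s)) by (apply sqrt_lt_R0; lra).
    auto_derive; [lra|]. change (t + - s) with (t - s). field. lra.
  - intros t Ht. rewrite Rmin_left, Rmax_right in Ht by lra.
    assert (0 < sqrt (t - s)) by (apply sqrt_lt_R0; lra).
    apply (ex_derive_continuous (K := R_AbsRing) (V := R_NormedModule)).
    auto_derive. change (t + - s) with (t - s). repeat split; lra.
Qed.

Lemma is_RInt_inv_sqrt_r s a b : 0 < a -> a <= b ->
  is_RInt (fun t => / sqrt (s - t)) (s - b) (s - a) (2 * sqrt b - 2 * sqrt a).
Proof.
  intros Ha Hab.
  replace (2 * sqrt b - 2 * sqrt a) with (minus (- 2 * sqrt (s - (s - a))) (- 2 * sqrt (s - (s - b)))).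
  2:{ unfold minus, plus, opp; simpl. replace (s - (s - a)) with a by ring. replace (s - (s - b)) with b by ring. ring. }
  apply (is_RInt_derive (V := R_CompleteNormedModule) (fun t => - 2 * sqrt (s - t))).
  - intros t Ht. rewrite Rmin_left, Rmax_right in Ht by lra.
    assert (0 < sqrt (s - t)) by (apply sqrt_lt_R0; lra).
    auto_derive; [lra|]. change (s + - t) with (s - t). field. lra.
  - intros t Ht. rewrite Rmin_left, Rmax_right in Ht by lra.
    assert (0 < sqrt (s - t)) by (apply sqrt_lt_R0; lra).
    apply (ex_derive_continuous (K := R_AbsRing) (V := R_NormedModule)).
    auto_derive. change (s + - t) with (s - t). repeat split; lra.
Qed.

Lemma ladder_lipschitz F n x v B : ladder_family F x v ->
  (forall m t, 0 <= t <= 1 -> (m = n - 1 \/ m = n + 1)%Z -> Cmod (F m (x + t * v)%C) <= B) ->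
  Cmod (F n (x + v)%C - F n x) <= 2 * (Cmod v * B).
Proof.
  intros HF HB.
  replace (F n (x + v)%C) with (F n (x + 1 * v)%C) by (f_equal; ring).
  replace (F n x) with (F n (x + 0 * v)%C) by (f_equal; ring).
  apply (Cmod_Cder_bound (fun t : R => F n (x + t * v)%C) _ (Cmod v * B) (fun t Ht => HF n t Ht)).
  intros t Ht. eapply Rle_trans; [apply Cmod_triangle|]. rewrite !Cmod_mult, Cmod_half, Cmod_zbeta.
  pose proof (Cmod_ge_0 v).
  pose proof (HB (n - 1)%Z t Ht (or_introl eq_refl)). pose proof (HB (n + 1)%Z t Ht (or_intror eq_refl)).
  nra.
Qed.

(* The diagonal case of Graf's formula is obtained as the limit of circles of radius r < rho;
   the logarithmic singularity is absorbed by the bound [D / sqrt (Cmod w)] on [chi 0 w]. *)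
Lemma CRInt_gen_chi_0_spec (rho s : R) m : 0 < rho ->
  forall eps, 0 < eps -> exists eta, 0 < eta /\ forall h1 h2, 0 < h1 < eta -> 0 < h2 < eta ->
    s + h1 <= s + 2 * PI - h2 /\
    exists I, CRInt (fun t => chi 0 (rho * cis s + - rho * cis t) * cis (- IZR m * t))%C
        (s + h1) (s + 2 * PI - h2) I /\
      Cmod (I - 2 * PI * (chi (- m) (rho * cis s) * psi m (- rho))) <= eps.
Proof.
  intros Hrho. pose proof PI_RGT_0 as HPI.
  set (f := fun (r t : R) => (chi 0 (rho * cis s + - r * cis t) * cis (- IZR m * t))%C).
  set (L := fun r : R => (2 * PI * (chi (- m) (rho * cis s) * psi m (- r)))%C).
  assert (HL : forall r, 0 <= r < rho -> CRInt (f r) s (s + 2 * PI) (L r)).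
  { intros r Hr. unfold f, L. change (- m)%Z with (0 - m)%Z. apply (CRInt_chi 0 m).
    rewrite Cmod_mult, Cmod_cis, Cmod_opp, !Cmod_R, !Rabs_pos_eq by lra. lra. }
  destruct (chi_upper (2 * rho)) as [D [HD HchiD]]; [lra|].
  assert (Hup : forall r t : R, 0 <= r <= rho -> Cmod (rho * cis s + - r * cis t) <= 2 * rho).
  { intros r t Hr. eapply Rle_trans; [apply Cmod_triangle|].
    rewrite !Cmod_mult, Cmod_opp, !Cmod_cis, !Cmod_R, !Rabs_pos_eq by lra. lra. }
  assert (Hf : forall r t mu : R, 0 <= r <= rho -> 0 < mu <= Cmod (rho * cis s + - r * cis t) -> Cmod (f r t) <= D / sqrt mu).
  { intros r t mu Hr Hmu. unfold f. rewrite Cmod_mult, Cmod_cis, Rmult_1_r.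
    eapply Rle_trans; [apply HchiD; split; [lra|now apply Hup]|].
    change (Z.abs_nat 0) with 0%nat. unfold hbound. simpl (INR (fact 0)). simpl pow.
    replace (D * (1 * 1)) with D by ring. apply Rmult_le_compat_l; [lra|].
    apply Rinv_le_contravar; [apply sqrt_lt_R0; lra|apply sqrt_le_1_alt; lra]. }
  set (D1 := D / sqrt (rho / 6)).
  assert (Hs3 : 0 < sqrt (rho / 6)) by (apply sqrt_lt_R0; lra).
  assert (HD1 : 0 < D1) by (unfold D1; pos_tac).
  assert (Hfh : forall r t h : R, rho / 2 <= r <= rho -> 0 < h <= PI -> (t - s = h \/ t - s = 2 * PI - h) ->
    Cmod (f r t) <= D1 * / sqrt h).
  { intros r t h Hr Hh Ht. pose proof (circle_distance rho r s t h Hrho ltac:(lra) ltac:(lra) Ht) as Hc.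
    eapply Rle_trans; [apply (Hf r t (rho * h / 6)); [lra|split; auto; pos_tac]|].
    unfold D1. right. replace (rho * h / 6) with (rho / 6 * h) by field.
    rewrite sqrt_mult by lra. assert (0 < sqrt h) by (apply sqrt_lt_R0; lra). field; lra. }
  assert (Hder : forall r t : R, 0 < Cmod (rho * cis s + - r * cis t) -> exists l, Cder (f r) t l).
  { intros r t H. destruct (chi_0_circle_Cder (rho * cis s) (- r) (- m) t H) as [l Hl]. exists l.
    eapply Cder_ext; [|exact Hl]. intros u. unfold f. rewrite opp_IZR. reflexivity. }
  intros eps He.
  (* Makes each end piece small: its contribution is at most D1 times 2 sqrt h, hence at most
     [eps / 2]. *)
  exists (Rmin (PI / 2) ((eps / (4 * D1)) ^ 2)). split.
  { apply Rmin_glb_lt; [lra|pos_tac]. }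
  intros h1 h2 H1 H2.
  assert (Hm1 := Rmin_l (PI / 2) ((eps / (4 * D1)) ^ 2)). assert (Hm2 := Rmin_r (PI / 2) ((eps / (4 * D1)) ^ 2)).
  split; [lra|]. set (h0 := Rmin h1 h2). assert (Hh0 : 0 < h0 /\ h0 <= h1 /\ h0 <= h2).
  { unfold h0. repeat split; [apply Rmin_glb_lt; lra|apply Rmin_l|apply Rmin_r]. }
  set (mu := rho * h0 / 6). assert (Hmu : 0 < mu) by (unfold mu; pos_tac).
  assert (Hmid : forall r t : R, rho / 2 <= r <= rho -> s + h1 <= t <= s + 2 * PI - h2 ->
    mu <= Cmod (rho * cis s + - r * cis t)).
  { intros r t Hr Ht. destruct (Rle_dec (t - s) PI) as [Hp|Hp].
    - eapply Rle_trans; [|apply (circle_distance rho r s t (t - s)); auto; lra].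
      unfold mu. assert (rho * h0 <= rho * (t - s)) by (apply Rmult_le_compat_l; lra). lra.
    - eapply Rle_trans; [|apply (circle_distance rho r s t (2 * PI - (t - s))); try lra; right; ring].
      unfold mu. assert (rho * h0 <= rho * (2 * PI - (t - s))) by (apply Rmult_le_compat_l; lra). lra. }
  destruct (ex_CRInt (f rho) (s + h1) (s + 2 * PI - h2)) as [I HI]; [lra| |].
  { intros t Ht. apply Hder. pose proof (Hmid rho t ltac:(lra) Ht). lra. }
  exists I. split; [exact HI|].
  destruct (chi_annulus_bound mu (2 * rho)) as [D' [HD' HchiD']]; auto.
  { eapply Rle_trans; [apply (Hmid rho (s + PI)); lra|]. apply Hup; lra. }
  destruct (psi_bounded rho) as [D'' [HD'' HpsiD]].
  set (X := Cmod (2 * PI * chi (- m) (rho * cis s))).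
  assert (HX : 0 <= X) by apply Cmod_ge_0.
  (* A Lipschitz constant in r for the middle integral and for the value [L r]. It depends on the
     cut-offs through mu, but these are fixed before r tends to rho. The factor 2/mu bounds the
     waves of order 1 and -1, into which [chi 0] differentiates. *)
  set (KK := 2 * PI * (2 * (D' * (2 / mu))) + X * (2 * D'')).
  assert (HKK : 0 <= KK).
  { unfold KK. pos_tac. }
  assert (Hmain : forall r : R, rho / 2 <= r < rho -> Cmod (I - L rho) <= eps + KK * (rho - r)).
  { intros r Hr.
    assert (Hpos : forall t : R, 0 < rho - r <= Cmod (rho * cis s + - r * cis t)).
    { intros t. split; [lra|].
      pose proof (Cmod_triangle (rho * cis s + - r * cis t) (r * cis t)) as H3.
      replace (rho * cis s + - r * cis t + r * cis t)%C with (rho * cis s)%C in H3 by ring.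
      rewrite !Cmod_mult, !Cmod_cis, !Cmod_R, !Rabs_pos_eq in H3 by lra. lra. }
    assert (Hd : forall t, exists l, Cder (f r) t l) by (intros t; apply Hder; pose proof (Hpos t); lra).
    set (M := D / sqrt (rho - r)).
    assert (HfM : forall t, Cmod (f r t) <= M) by (intros t; apply Hf; [lra|apply Hpos]).
    assert (HM0 : 0 <= M) by (eapply Rle_trans; [apply Cmod_ge_0|apply (HfM 0)]).
    destruct (ex_CRInt (f r) s (s + h1)) as [I1 HI1]; [lra|auto|].
    destruct (ex_CRInt (f r) (s + h1) (s + 2 * PI - h2)) as [I2 HI2]; [lra|auto|].
    destruct (ex_CRInt (f r) (s + 2 * PI - h2) (s + 2 * PI)) as [I3 HI3]; [lra|auto|].
    assert (E : L r = (I1 + I2 + I3)%C).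
    { apply (CRInt_unique (f r) s (s + 2 * PI)); [apply HL; lra|].
      eapply CRInt_Chasles; [eapply CRInt_Chasles; eassumption|assumption]. }
    assert (Hsq : forall h, 0 < h < Rmin (PI / 2) ((eps / (4 * D1)) ^ 2) -> D1 * (2 * sqrt h) <= eps / 2).
    { intros h Hh. assert (sqrt h <= eps / (4 * D1)).
      { rewrite <- (sqrt_pow2 (eps / (4 * D1))) by pos_tac. apply sqrt_le_1_alt. lra. }
      apply Rle_trans with (D1 * (2 * (eps / (4 * D1)))).
      - apply Rmult_le_compat_l; lra.
      - right; field; lra. }
    (* The bound with 1 / sqrt(t - s) is integrated only away from t = s; the sliver of length dl is
       covered by the cruder bound M, which depends on r. *)
    assert (B1 : Cmod I1 <= eps / 2).
    { apply le_epsilon. intros d Hd0.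
      set (dl := Rmin (h1 / 2) (d / (M + 1))).
      assert (Hdl : 0 < dl) by (apply Rmin_glb_lt; [lra|pos_tac]).
      assert (Hdl1 := Rmin_l (h1 / 2) (d / (M + 1))). assert (Hdl2 := Rmin_r (h1 / 2) (d / (M + 1))).
      fold dl in Hdl1, Hdl2.
      destruct (ex_CRInt (f r) s (s + dl)) as [Ia HIa]; [lra|auto|].
      destruct (ex_CRInt (f r) (s + dl) (s + h1)) as [Ib HIb]; [lra|auto|].
      rewrite (CRInt_unique _ _ _ _ _ HI1 (CRInt_Chasles _ _ _ _ _ _ HIa HIb)).
      eapply Rle_trans; [apply Cmod_triangle|].
      assert (Cmod Ia <= d).
      { eapply Rle_trans; [apply (CRInt_bound_const (f r) M s (s + dl)); auto; lra|].
        apply Rle_trans with (d / (M + 1) * (M + 1)); [|right; field; lra].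
        apply Rmult_le_compat; lra. }
      assert (Cmod Ib <= D1 * (2 * sqrt h1)); [|pose proof (Hsq h1 H1); lra].
      apply Rle_trans with (D1 * (2 * sqrt h1 - 2 * sqrt dl)).
      - apply (CRInt_bound (f r) (fun t => D1 * / sqrt (t - s)) (s + dl) (s + h1)); auto; [lra| |].
        + intros t Ht. apply Hfh; try lra.
        + apply (is_RInt_scal (V := R_NormedModule)). apply is_RInt_inv_sqrt; lra.
      - pose proof (sqrt_pos dl). apply Rmult_le_compat_l; lra. }
    assert (B3 : Cmod I3 <= eps / 2).
    { apply le_epsilon. intros d Hd0.
      set (dl := Rmin (h2 / 2) (d / (M + 1))).
      assert (Hdl : 0 < dl) by (apply Rmin_glb_lt; [lra|pos_tac]).
      assert (Hdl1 := Rmin_l (h2 / 2) (d / (M + 1))). assert (Hdl2 := Rmin_r (h2 / 2) (d / (M + 1))).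
      fold dl in Hdl1, Hdl2.
      destruct (ex_CRInt (f r) (s + 2 * PI - h2) (s + 2 * PI - dl)) as [Ia HIa]; [lra|auto|].
      destruct (ex_CRInt (f r) (s + 2 * PI - dl) (s + 2 * PI)) as [Ib HIb]; [lra|auto|].
      rewrite (CRInt_unique _ _ _ _ _ HI3 (CRInt_Chasles _ _ _ _ _ _ HIa HIb)).
      eapply Rle_trans; [apply Cmod_triangle|].
      assert (Cmod Ib <= d).
      { eapply Rle_trans; [apply (CRInt_bound_const (f r) M (s + 2 * PI - dl) (s + 2 * PI)); auto; lra|].
        apply Rle_trans with (d / (M + 1) * (M + 1)); [|right; field; lra].
        apply Rmult_le_compat; lra. }
      assert (Cmod Ia <= D1 * (2 * sqrt h2)); [|pose proof (Hsq h2 H2); lra].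
      apply Rle_trans with (D1 * (2 * sqrt h2 - 2 * sqrt dl)).
      - apply (CRInt_bound (f r) (fun t => D1 * / sqrt (s + 2 * PI - t)) (s + 2 * PI - h2) (s + 2 * PI - dl)); auto; [lra| |].
        + intros t Ht. apply Hfh; try lra.
        + apply (is_RInt_scal (V := R_NormedModule)). apply is_RInt_inv_sqrt_r; lra.
      - pose proof (sqrt_pos dl). apply Rmult_le_compat_l; lra. }
    (* Away from the ends the integrands for radii r and rho are compared along the radial segment
       between the two circle points, all of whose points keep distance at least mu from the
       source. *)
    assert (B2 : Cmod (I + - (1) * I2) <= (2 * PI) * (2 * (D' * (2 / mu)) * (rho - r))).
    { pose proof (CRInt_plus _ _ _ _ _ _ HI (CRInt_scal (- (1)) _ _ _ _ HI2)) as H4.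
      refine (Rle_trans _ _ _ (CRInt_bound_const _ (2 * (D' * (2 / mu)) * (rho - r)) _ _ _ _ _ H4) _).
      - lra.
      - intros t Ht. unfold f.
        replace (chi 0 (rho * cis s + - rho * cis t) * cis (- IZR m * t) + - (1) * (chi 0 (rho * cis s + - r * cis t) * cis (- IZR m * t)))%C
          with (- (chi 0 (rho * cis s + - r * cis t) - chi 0 (rho * cis s + - rho * cis t)) * cis (- IZR m * t))%C by ring.
        rewrite Cmod_mult, Cmod_cis, Rmult_1_r, Cmod_opp.
        assert (Epath : forall u : R, (rho * cis s + - rho * cis t + u * (RtoC (rho - r) * cis t))%C
          = (rho * cis s + - RtoC (rho - u * (rho - r)) * cis t)%C).
        { intros u. rewrite !RtoC_minus, RtoC_mult, RtoC_minus. ring. }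
        assert (Hu : forall u, 0 <= u <= 1 -> rho / 2 <= rho - u * (rho - r) <= rho).
        { intros u Hu. nra. }
        replace (rho * cis s + - r * cis t)%C with (rho * cis s + - rho * cis t + RtoC (rho - r) * cis t)%C
          by (rewrite RtoC_minus; ring).
        eapply Rle_trans; [apply (ladder_lipschitz chi 0 _ _ (D' * (2 / mu)))|].
        + apply chi_ladder. intros u Hu'. rewrite Epath. pose proof (Hmid _ t (Hu u Hu') Ht). lra.
        + intros j u Hu' Hj. rewrite Epath. pose proof (Hmid _ t (Hu u Hu') Ht) as Hlow.
          eapply Rle_trans; [apply HchiD'; split; [exact Hlow|apply Hup; pose proof (Hu u Hu'); lra]|].
          replace (Z.abs_nat j) with 1%nat by lia. unfold hbound. simpl (INR (fact 1)).
          rewrite pow_1, Rmult_1_l. apply Rmult_le_compat_l; [lra|].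
          apply Rmult_le_compat_l; [lra|]. apply Rinv_le_contravar; lra.
        + rewrite Cmod_mult, Cmod_cis, Cmod_R, Rabs_pos_eq by lra. right; ring.
      - apply Rmult_le_compat_r; [|lra].
        assert (0 < 2 / mu) by pos_tac. pos_tac. }
    assert (B4 : Cmod (L r - L rho) <= X * (2 * D'') * (rho - r)).
    { unfold L. replace (2 * PI * (chi (- m) (rho * cis s) * psi m (- r)) - 2 * PI * (chi (- m) (rho * cis s) * psi m (- rho)))%C
        with (2 * PI * chi (- m) (rho * cis s) * (psi m (- r) - psi m (- rho)))%C by ring.
      rewrite Cmod_mult. fold X. rewrite !Rmult_assoc. apply Rmult_le_compat_l; auto.
      replace (- RtoC r)%C with (- RtoC rho + RtoC (rho - r))%C by (rewrite RtoC_minus; ring).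
      eapply Rle_trans; [apply (ladder_lipschitz psi m (- RtoC rho)%C (RtoC (rho - r)) D'' (psi_ladder _ _))|].
      - intros j u Hu _. apply HpsiD. rewrite <- RtoC_opp, <- RtoC_mult, <- RtoC_plus, Cmod_R. apply Rabs_le. nra.
      - rewrite Cmod_R, Rabs_pos_eq by lra. right; ring. }
    replace (I - L rho)%C with ((I + - (1) * I2) + (- (I1 + I3) + (L r - L rho)))%C by (rewrite E; ring).
    eapply Rle_trans; [apply Cmod_triangle|].
    assert (Cmod (- (I1 + I3) + (L r - L rho)) <= eps + X * (2 * D'') * (rho - r)).
    { eapply Rle_trans; [apply Cmod_triangle|]. rewrite Cmod_opp.
      pose proof (Cmod_triangle I1 I3). lra. }
    unfold KK. lra. }
  (* With the cut-offs fixed, r tends to rho and the Lipschitz error disappears. *)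
  fold (L rho). apply le_epsilon. intros d Hd.
  set (r := Rmax (rho / 2) (rho - d / (KK + 1))).
  assert (Hdk : 0 < d / (KK + 1)) by pos_tac.
  assert (Hr : rho / 2 <= r < rho) by (unfold r; split; [apply Rmax_l|apply Rmax_lub_lt; lra]).
  assert (Hr2 : rho - d / (KK + 1) <= r) by apply Rmax_r.
  pose proof (Hmain r Hr).
  assert (KK * (rho - r) <= d); [|lra].
  apply Rle_trans with ((KK + 1) * (d / (KK + 1))); [|right; field; lra].
  apply Rmult_le_compat; lra.
Qed.

(** * Closed forms of the matrix and of the data *)

Definition bJ (n : Z) (r : R) : R := fst (psi n (RtoC r)).

Lemma psi_RtoC n r : psi n (RtoC r) = RtoC (bJ n r).
Proof.
  assert (E : psi n r = RtoC ((/ 2 * r) ^ Z.to_nat n * (- / 2 * r) ^ Z.to_nat (- n)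
    * jK (Z.abs_nat n) (Cmod r ^ 2 / 4))).
  { unfold psi, cyl, zp, Kj, zalpha, zbeta. rewrite Cconj_RtoC, <- RtoC_half.
    rewrite !RtoC_mult, !RtoC_pow, !RtoC_mult, RtoC_opp. reflexivity. }
  unfold bJ. rewrite E. reflexivity.
Qed.

Lemma psi_opp_RtoC n r : psi (- n) (- RtoC r) = RtoC (bJ n r).
Proof. now rewrite <- psi_conj, psi_RtoC, Cconj_RtoC. Qed.

(** A zero of [chi n] is also one of its reflected conjugate, and the two add up to 2 J_n(r), where
    [bJ n r] is J_n(r). *)
Lemma chi_neq_0 n r : bJ n r <> 0 -> chi n (RtoC r) <> 0.
Proof.
  intros H E. apply H. unfold bJ.
  pose proof (chi_herm n (RtoC r)) as Hh.
  assert (E2 : chi (- n) (- RtoC r) = RtoC 0).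
  { unfold chi, cyl in *. rewrite <- zp_conj, Cmod_opp, Zabs_nat_opp.
    destruct (Ceq_dec (zp n r) 0) as [Ez|Ez].
    - rewrite Ez, Cconj_RtoC. ring.
    - destruct (Ceq_dec (Kh (Z.abs_nat n) (Cmod r ^ 2 / 4)%R) 0) as [Ek|Ek].
      + rewrite Ek. ring.
      + exfalso. now apply (Cmult_neq_0 _ _ Ez Ek). }
  rewrite E, E2, Cconj_RtoC, Cplus_0_l in Hh.
  assert (E3 : psi n r = (/ 2 * (2 * psi n r))%C).
  { rewrite Cmult_assoc, Cinv_l, Cmult_1_l; auto. intros [=]; lra. }
  rewrite E3, <- Hh. simpl. ring.
Qed.

Lemma helmholtz_G_chi k x y : 0 < k -> 0 < Cmod (x - y) ->
  helmholtz_G k x y = (Ci / 4 * chi 0 (k * (x - y)))%C.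
Proof.
  intros Hk H. unfold helmholtz_G. rewrite chi_0_hankel.
  - now rewrite Cmod_mult, Cmod_R, Rabs_pos_eq by lra.
  - rewrite Cmod_mult, Cmod_R, Rabs_pos_eq by lra. now apply Rmult_lt_0_compat.
Qed.

Lemma circle_chi_0_bounded x v : Cmod v < Cmod x ->
  exists M, 0 <= M /\ forall t, Cmod (chi 0 (x + v * cis t)) <= M.
Proof.
  intros H. pose proof (Cmod_ge_0 v).
  destruct (chi_annulus_bound (Cmod x - Cmod v) (Cmod x + Cmod v)) as [D [HD HB]]; try lra.
  exists D. split; [lra|]. intros t.
  assert (Hv : Cmod (v * cis t) = Cmod v) by (rewrite Cmod_mult, Cmod_cis; ring).
  eapply Rle_trans; [apply HB|].
  - replace (x + v * cis t)%C with (x + 1 * (v * cis t))%C by ring. rewrite <- Hv at 1 2.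
    split; [apply Cmod_line_lower|apply Cmod_line_upper]; lra.
  - unfold hbound. simpl. lra.
Qed.

Lemma circle_gap x v t : Cmod v < Cmod x -> 0 < Cmod (x + v * cis t).
Proof.
  intros H. pose proof (Cmod_line_lower x (v * cis t) 1 ltac:(lra)) as H1.
  replace (x + 1 * (v * cis t))%C with (x + v * cis t)%C in H1 by ring.
  rewrite (Cmod_mult v), Cmod_cis in H1. lra.
Qed.

Lemma RInt_circle_gen c x v n s : Cmod v < Cmod x ->
  RInt_gen (V := C_R_CompleteNormedModule)
    (fun t => c * (chi 0 (x + v * cis t) * cis (IZR n * t)))%C
    (at_right s) (at_left (s + 2 * PI))
  = (c * (2 * PI * (chi n x * psi (- n) v)))%C.
Proof.
  intros H. destruct (circle_chi_0_bounded x v H) as [M [HM0 HM]].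
  apply CRInt_gen_of_bounded with (Cmod c * M).
  - pose proof (Cmod_ge_0 c). pos_tac.
  - intros t. destruct (chi_0_circle_Cder x v n t (circle_gap x v t H)) as [l Hl].
    exists (c * l)%C. now apply Cder_scal.
  - intros t. rewrite !Cmod_mult, Cmod_cis, Rmult_1_r.
    apply Rmult_le_compat_l; [apply Cmod_ge_0|apply HM].
  - apply CRInt_scal. pose proof (CRInt_chi 0 (- n) x v s H) as H'.
    replace (0 - - n)%Z with n in H' by lia.
    apply CRInt_ext with (fun t => chi 0 (x + v * cis t) * cis (- IZR (- n) * t))%C.
    + intros t. do 2 f_equal. rewrite opp_IZR. ring.
    + exact H'.
Qed.

Lemma RInt_C_eq f a b l : CRInt f a b l -> RInt (V := C_R_CompleteNormedModule) f a b = l.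
Proof. intros H. exact (is_RInt_unique (V := C_R_CompleteNormedModule) f a b l H). Qed.

Lemma sqrt_2PI_pos r : 0 < r -> 0 < sqrt (2 * PI * r).
Proof. intros H. pose proof PI_RGT_0. apply sqrt_lt_R0. pos_tac. Qed.

Lemma basis_eq r m t : 0 < r -> basis r m t = (RtoC (/ sqrt (2 * PI * r)) * cis (IZR m * t))%C.
Proof.
  intros H. pose proof (sqrt_2PI_pos r H). unfold basis. rewrite RtoC_inv by lra. unfold Cdiv. ring.
Qed.

(** Graf's formula is used once per circle: each integration extracts one Fourier coefficient, first
    over the source circle q for a fixed target point, then over the target circle p. *)
Lemma single_layer_off k O a p q m n : 0 < k -> 0 < a p -> 0 < a q ->
  a p + a q < Cmod (O p - O q) ->
  single_layer k O a p q m n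
  = (Ci / 4 * RtoC (a p * a q / (sqrt (2 * PI * a p) * sqrt (2 * PI * a q)) * (2 * PI) ^ 2)
      * (chi (n - m) (k * (O p - O q)) * bJ m (k * a p) * bJ n (k * a q)))%C.
Proof.
  intros Hk Hp Hq Hd. unfold single_layer.
  pose proof (sqrt_2PI_pos _ Hp) as Hsp. pose proof (sqrt_2PI_pos _ Hq) as Hsq.
  set (X := (k * (O p - O q))%C). set (u := RtoC (k * a p)). set (v := (- RtoC (k * a q))%C).
  assert (Hkp : 0 < k * a p) by (now apply Rmult_lt_0_compat).
  assert (Hkq : 0 < k * a q) by (now apply Rmult_lt_0_compat).
  assert (Hu : Cmod u = k * a p) by (unfold u; rewrite Cmod_R, Rabs_pos_eq; lra).
  assert (Hv : Cmod v = k * a q) by (unfold v; rewrite Cmod_opp, Cmod_R, Rabs_pos_eq; lra).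
  assert (HX : Cmod X = k * Cmod (O p - O q)) by (unfold X; rewrite Cmod_mult, Cmod_R, Rabs_pos_eq; lra).
  assert (HXuv : Cmod u + Cmod v < Cmod X).
  { rewrite Hu, Hv, HX, <- Rmult_plus_distr_l. now apply Rmult_lt_compat_l. }
  assert (HXs : forall s, Cmod v < Cmod (X + u * cis s)).
  { intros s. pose proof (Cmod_line_lower X (u * cis s) 1 ltac:(lra)) as H1.
    replace (X + 1 * (u * cis s))%C with (X + u * cis s)%C in H1 by ring.
    rewrite (Cmod_mult u), Cmod_cis in H1. lra. }
  set (c0 := (Ci / 4 * RtoC (/ sqrt (2 * PI * a q)) * RtoC (/ sqrt (2 * PI * a p)) * a q * a p)%C).
  assert (Hin : forall s t, (helmholtz_G k (circle_pt (O p) (a p) s) (circle_pt (O q) (a q) t)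
    * basis (a q) n t * Cconj (basis (a p) m s) * a q * a p)%C
    = (c0 * cis (- IZR m * s) * (chi 0 (X + u * cis s + v * cis t) * cis (IZR n * t)))%C).
  { intros s t.
    assert (E : (k * (circle_pt (O p) (a p) s - circle_pt (O q) (a q) t))%C = (X + u * cis s + v * cis t)%C).
    { unfold circle_pt, X, u, v. rewrite !RtoC_mult. ring. }
    rewrite helmholtz_G_chi; auto.
    - rewrite E, !basis_eq by auto. rewrite Cmult_conj, Cconj_RtoC, Cconj_cis.
      replace (- (IZR m * s)) with (- IZR m * s) by ring. unfold c0. ring.
    - pose proof (circle_gap (X + u * cis s) v t (HXs s)) as H1. rewrite <- E in H1.
      rewrite Cmod_mult, Cmod_R, Rabs_pos_eq in H1 by lra.
      destruct (Rle_lt_or_eq_dec 0 _ (Cmod_ge_0 (circle_pt (O p) (a p) s - circle_pt (O q) (a q) t))) as [|E0]; auto.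
      rewrite <- E0 in H1. lra. }
  apply RInt_C_eq.
  apply CRInt_ext with (fun s => (c0 * (2 * PI) * psi (- n) v) * (chi n (X + u * cis s) * cis (- IZR m * s)))%C.
  - intros s. symmetry. rewrite (functional_extensionality _ _ (Hin s)).
    rewrite RInt_circle_gen by apply HXs. ring.
  - replace (Ci / 4 * _ * _)%C with ((c0 * (2 * PI) * psi (- n) v) * (2 * PI * (chi (n - m) X * psi m u)))%C.
    + apply CRInt_scal. replace (2 * PI) with (0 + 2 * PI) at 1 by ring. apply CRInt_chi. pose proof (Cmod_ge_0 v); lra.
    + unfold v. rewrite psi_opp_RtoC. unfold u. rewrite psi_RtoC. fold X. unfold c0.
      replace (a p * a q / (sqrt (2 * PI * a p) * sqrt (2 * PI * a q)) * (2 * PI) ^ 2)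
        with (/ sqrt (2 * PI * a q) * / sqrt (2 * PI * a p) * a q * a p * (2 * PI) * (2 * PI)) by (field; lra).
      rewrite !RtoC_mult. ring.
Qed.

(** The inner integral is given by the limiting case of Graf's formula. Its dependence on s is the
    rotation factor e^(i m s), which the conjugate basis function cancels, so the outer integrand is
    constant. *)
Lemma single_layer_diag k O a p m : 0 < k -> 0 < a p ->
  single_layer k O a p p m m
  = (Ci / 4 * RtoC (a p * a p / (sqrt (2 * PI * a p) * sqrt (2 * PI * a p)) * (2 * PI) ^ 2)
      * (chi m (RtoC (k * a p)) * bJ m (k * a p)))%C.
Proof.
  intros Hk Hp. unfold single_layer.
  pose proof (sqrt_2PI_pos _ Hp) as Hsp.
  assert (Hkp : 0 < k * a p) by (now apply Rmult_lt_0_compat).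
  set (rho := k * a p) in *.
  set (c0 := (Ci / 4 * RtoC (/ sqrt (2 * PI * a p)) * RtoC (/ sqrt (2 * PI * a p)) * a p * a p)%C).
  assert (HPI := PI_RGT_0).
  assert (Hin : forall s t, s < t < s + 2 * PI ->
    (helmholtz_G k (circle_pt (O p) (a p) s) (circle_pt (O p) (a p) t)
    * basis (a p) m t * Cconj (basis (a p) m s) * a p * a p)%C
    = (c0 * cis (- IZR m * s) * (chi 0 (rho * cis s + - rho * cis t) * cis (- IZR (- m) * t)))%C).
  { intros s t Ht.
    assert (E : (k * (circle_pt (O p) (a p) s - circle_pt (O p) (a p) t))%C = (rho * cis s + - rho * cis t)%C).
    { unfold circle_pt, rho. rewrite !RtoC_mult. ring. }
    rewrite helmholtz_G_chi; auto.
    - rewrite E, !basis_eq by auto. rewrite Cmult_conj, Cconj_RtoC, Cconj_cis.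
      replace (- (IZR m * s)) with (- IZR m * s) by ring.
      replace (- IZR (- m) * t) with (IZR m * t) by (rewrite opp_IZR; ring). unfold c0. ring.
    - assert (H1 : 0 < Cmod (rho * cis s + - rho * cis t)).
      { destruct (Rle_dec (t - s) PI).
        - eapply Rlt_le_trans; [|apply (circle_distance rho rho s t (t - s)); try lra].
          assert (0 < rho * (t - s)) by (apply Rmult_lt_0_compat; lra). lra.
        - eapply Rlt_le_trans; [|apply (circle_distance rho rho s t (2 * PI - (t - s))); try lra].
          assert (0 < rho * (2 * PI - (t - s))) by (apply Rmult_lt_0_compat; lra). lra. }
      rewrite <- E in H1.
      rewrite Cmod_mult, Cmod_R, Rabs_pos_eq in H1 by lra.
      destruct (Rle_lt_or_eq_dec 0 _ (Cmod_ge_0 (circle_pt (O p) (a p) s - circle_pt (O p) (a p) t))) as [|E0]; auto.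
      rewrite <- E0 in H1. lra. }
  apply RInt_C_eq.
  apply CRInt_ext with (fun s => (c0 * (2 * PI) * bJ m rho * chi m (RtoC rho)) * cis (IZR 0 * s))%C.
  - intros s.
    set (I0 := (2 * PI * (chi (- - m) (rho * cis s) * psi (- m) (- rho)))%C).
    symmetry.
    transitivity (c0 * cis (- IZR m * s) * I0)%C.
    + apply is_CRInt_gen_intro. intros eps He.
      set (Cc := (c0 * cis (- IZR m * s))%C).
      destruct (CRInt_gen_chi_0_spec rho s (- m) Hkp (eps / (Cmod Cc + 1))) as [eta [Heta H]].
      { pose proof (Cmod_ge_0 Cc). pos_tac. }
      exists eta. split; auto. intros h1 h2 H1 H2. destruct (H h1 h2 H1 H2) as [Hle [I [HI1 HI2]]].
      exists (Cc * I)%C. split.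
      * apply (is_RInt_ext (V := C_R_NormedModule) (fun t => Cc * (chi 0 (rho * cis s + - rho * cis t) * cis (- IZR (- m) * t)))%C).
        -- intros t Ht. rewrite Rmin_left, Rmax_right in Ht by lra. symmetry. unfold Cc. apply Hin. lra.
        -- now apply CRInt_scal.
      * unfold I0. fold Cc. match goal with |- Cmod (?u * ?x - ?u * ?y) <= _ =>
          replace (u * x - u * y)%C with (u * (x - y))%C by ring end.
        rewrite Cmod_mult.
        pose proof (Cmod_ge_0 Cc).
        apply Rle_trans with ((Cmod Cc + 1) * (eps / (Cmod Cc + 1))); [|right; field; lra].
        apply Rmult_le_compat; try lra. apply Cmod_ge_0.
    + unfold I0. rewrite psi_opp_RtoC, Z.opp_involutive. unfold chi. rewrite cyl_rot.
      transitivity (c0 * (2 * PI) * bJ m rho * cyl Kh m rho * (cis (- IZR m * s) * cis (IZR m * s)))%C; [ring|].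
      rewrite <- cis_plus. do 2 f_equal. ring.
  - replace (Ci / 4 * _ * _)%C with ((c0 * (2 * PI) * bJ m rho * chi m (RtoC rho)) * RtoC (2 * PI))%C.
    + apply CRInt_scal. replace (2 * PI) with (0 + 2 * PI) at 1 by ring.
      pose proof (CRInt_cis 0 0) as H. destruct (Z.eq_dec 0 0); [exact H|lia].
    + unfold c0.
      replace (a p * a p / (sqrt (2 * PI * a p) * sqrt (2 * PI * a p)) * (2 * PI) ^ 2)
        with (/ sqrt (2 * PI * a p) * / sqrt (2 * PI * a p) * a p * a p * (2 * PI) * (2 * PI)) by (field; lra).
      rewrite !RtoC_mult. ring.
Qed.

(** The factor J_m(k a_p) occurs in both the off-diagonal and the diagonal entry and cancels,
    leaving only H_m(k a_p) in the denominator. *)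
Lemma mpe_A_off k O a p q m n : 0 < k -> 0 < a p -> 0 < a q -> p <> q ->
  a p + a q < Cmod (O p - O q) -> bJ m (k * a p) <> 0 ->
  mpe_A k O a p q m n
  = (RtoC (sqrt (a q) / sqrt (a p)) * (chi (n - m) (k * (O p - O q)) * bJ n (k * a q)
      / chi m (RtoC (k * a p))))%C.
Proof.
  intros Hk Hp Hq Hpq Hd HJ. unfold mpe_A.
  destruct (Nat.eqb_spec p q) as [|_]; [contradiction|].
  rewrite single_layer_off, single_layer_diag by auto.
  pose proof (chi_neq_0 m (k * a p) HJ) as Hchi.
  assert (HPI := PI_RGT_0).
  assert (Hs : 0 < sqrt (a p)) by (now apply sqrt_lt_R0). assert (Hsq : 0 < sqrt (a q)) by (now apply sqrt_lt_R0).
  assert (H2 : 0 < sqrt (2 * PI)) by (apply sqrt_lt_R0; lra).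
  rewrite !(sqrt_mult (2 * PI)) by lra.
  assert (HJC : RtoC (bJ m (k * a p)) <> 0) by (intros E; apply HJ; now apply RtoC_inj).
  replace (a p * a q / (sqrt (2 * PI) * sqrt (a p) * (sqrt (2 * PI) * sqrt (a q))) * (2 * PI) ^ 2)
    with (sqrt (a q) / sqrt (a p) * (a p * a p / (sqrt (2 * PI) * sqrt (a p) * (sqrt (2 * PI) * sqrt (a p))) * (2 * PI) ^ 2)).
  2:{ assert (G : forall x y X Y w, 0 < X -> 0 < Y -> 0 < w -> x = X * X -> y = Y * Y ->
        Y / X * (x * x / (w * X * (w * X)) * (2 * PI) ^ 2) = x * y / (w * X * (w * Y)) * (2 * PI) ^ 2)
        by (intros; subst; field; lra).
      apply G; auto; symmetry; apply sqrt_sqrt; lra. }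
  set (c := a p * a p / _ * _).
  assert (Hc : RtoC c <> 0).
  { intros E. apply RtoC_inj in E. assert (0 < c); [|lra]. unfold c. pos_tac. }
  rewrite (RtoC_mult _ c). field.
  repeat split; auto; intros [=]; lra.
Qed.

Definition incident_coef (k : R) (O : nat -> C) (inc : incident_field) (p : nat) (m : Z) : C :=
  match inc with
  | PlaneWave b => plane_wave (PI / 2 - b) (- m) (k * O p)
  | PointSource x0 => (Ci / 4 * chi (- m) (k * (O p - x0)))%C
  end.

Lemma rhs_coef_eq k O a inc p m : 0 < k -> 0 < a p ->
  (forall x0, inc = PointSource x0 -> a p < Cmod (O p - x0)) ->
  rhs_coef k O a inc p m
  = (- RtoC (a p * (2 * PI) / sqrt (2 * PI * a p)) * (incident_coef k O inc p m * bJ m (k * a p)))%C.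
Proof.
  intros Hk Hp Hx. unfold rhs_coef. apply RInt_C_eq.
  pose proof (sqrt_2PI_pos _ Hp) as Hsp.
  set (u := RtoC (k * a p)).
  assert (Hu : Cmod u = k * a p) by (unfold u; rewrite Cmod_R, Rabs_pos_eq; [auto|left; pos_tac]).
  set (c0 := (- RtoC (/ sqrt (2 * PI * a p) * a p))%C).
  destruct inc as [b|x0].
  - apply CRInt_ext with (fun s => c0 * (plane_wave (PI / 2 - b) 0 (k * O p + u * cis s) * cis (- IZR m * s)))%C.
    + intros s. rewrite basis_eq, Cmult_conj, Cconj_RtoC, Cconj_cis by auto.
      replace (- (IZR m * s)) with (- IZR m * s) by ring.
      replace (u_inc k (PlaneWave b) (circle_pt (O p) (a p) s)) with (plane_wave (PI / 2 - b) 0 (k * O p + u * cis s)).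
      * unfold c0. rewrite RtoC_mult. ring.
      * unfold plane_wave, u_inc. f_equal. rewrite sin_shift, cos_shift.
        unfold u, circle_pt. simpl. ring.
    + replace (- _ * _)%C with (c0 * (2 * PI * (plane_wave (PI / 2 - b) (0 - m) (k * O p) * psi m u)))%C.
      * apply CRInt_scal. replace (2 * PI) with (0 + 2 * PI) at 1 by ring. apply CRInt_plane_wave.
      * unfold c0, u. rewrite psi_RtoC. change (0 - m)%Z with (- m)%Z. unfold incident_coef.
        replace (a p * (2 * PI) / sqrt (2 * PI * a p)) with (/ sqrt (2 * PI * a p) * a p * (2 * PI)) by (field; lra).
        rewrite !RtoC_mult. ring.
  - specialize (Hx x0 eq_refl). set (X := (k * (O p - x0))%C).
    assert (HX : Cmod u < Cmod X).
    { rewrite Hu. unfold X. rewrite Cmod_mult, Cmod_R, Rabs_pos_eq by lra. now apply Rmult_lt_compat_l. }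
    apply CRInt_ext with (fun s => (c0 * (Ci / 4)) * (chi 0 (X + u * cis s) * cis (- IZR m * s)))%C.
    + intros s. rewrite basis_eq, Cmult_conj, Cconj_RtoC, Cconj_cis by auto.
      replace (- (IZR m * s)) with (- IZR m * s) by ring.
      assert (E : (k * (circle_pt (O p) (a p) s - x0))%C = (X + u * cis s)%C).
      { unfold circle_pt, X, u. rewrite !RtoC_mult. ring. }
      unfold u_inc. rewrite helmholtz_G_chi; auto.
      * rewrite E. unfold c0. rewrite RtoC_mult. ring.
      * pose proof (circle_gap X u s HX) as H1. rewrite <- E in H1.
        rewrite Cmod_mult, Cmod_R, Rabs_pos_eq in H1 by lra.
        destruct (Rle_lt_or_eq_dec 0 _ (Cmod_ge_0 (circle_pt (O p) (a p) s - x0))) as [|E0]; auto.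
        rewrite <- E0 in H1. lra.
    + replace (- _ * _)%C with ((c0 * (Ci / 4)) * (2 * PI * (chi (0 - m) X * psi m u)))%C.
      * apply CRInt_scal. replace (2 * PI) with (0 + 2 * PI) at 1 by ring. now apply CRInt_chi.
      * unfold c0, u. rewrite psi_RtoC. change (0 - m)%Z with (- m)%Z. unfold incident_coef.
        replace (a p * (2 * PI) / sqrt (2 * PI * a p)) with (/ sqrt (2 * PI * a p) * a p * (2 * PI)) by (field; lra).
        fold X. rewrite !RtoC_mult. ring.
Qed.

(** Only the dependence on m matters for the decay, so the constant stays existential. *)
Lemma mpe_G_eq k O a inc p : 0 < k -> 0 < a p ->
  (forall x0, inc = PointSource x0 -> a p < Cmod (O p - x0)) ->
  (forall m, bJ m (k * a p) <> 0) ->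
  exists c : C, forall m, mpe_G k O a inc p m = (c * (incident_coef k O inc p m / chi m (RtoC (k * a p))))%C.
Proof.
  intros Hk Hp Hx HJ. pose proof (sqrt_2PI_pos _ Hp) as Hsp. pose proof PI_RGT_0.
  set (c1 := a p * a p / (sqrt (2 * PI * a p) * sqrt (2 * PI * a p)) * (2 * PI) ^ 2).
  assert (Hc : RtoC c1 <> 0).
  { intros E. apply RtoC_inj in E. assert (0 < c1); [|lra]. unfold c1. pos_tac. }
  exists (- RtoC (a p * (2 * PI) / sqrt (2 * PI * a p)) / (Ci / 4 * c1))%C.
  intros m. unfold mpe_G. rewrite rhs_coef_eq, single_layer_diag by auto. fold c1.
  pose proof (chi_neq_0 m (k * a p) (HJ m)) as Hchi.
  assert (HJC : RtoC (bJ m (k * a p)) <> 0) by (intros E; apply (HJ m); now apply RtoC_inj).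
  field. repeat split; auto; intros [=]; lra.
Qed.

(** * Zeros of Bessel functions and Dirichlet eigenvalues *)

(* Finite combinations of the functions [psi n] are closed under partial derivatives, which
   makes J_m(k r) e^(i m theta) smooth without computing its derivatives. *)
Definition psi_comb (L : list (C * Z)) (w : C) : C := lsum (fun cn => fst cn * psi (snd cn) w)%C L.

Definition psi_comb_deriv (v : C) (L : list (C * Z)) : list (C * Z) :=
  flat_map (fun cn => ((fst cn * zalpha v)%C, (snd cn - 1)%Z) :: ((fst cn * zbeta v)%C, (snd cn + 1)%Z) :: nil) L.

Lemma psi_comb_Cder L x v t :
  Cder (fun u : R => psi_comb L (x + u * v)) t (psi_comb (psi_comb_deriv v L) (x + t * v)).
Proof.
  induction L as [|[c n] L IH].
  - unfold psi_comb, lsum; simpl. apply Cder_const.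
  - eapply Cder_eq; [|apply (Cder_plus (fun u : R => c * psi n (x + u * v))%C
      (fun u : R => psi_comb L (x + u * v)) t _ _ (Cder_scal c _ _ _ (cyl_ladder Kj n x v t (Kj_ladder _))) IH)].
    unfold psi_comb, lsum. simpl. unfold psi. ring.
Qed.

Lemma psi_comb_lipschitz L w : exists B, 0 <= B /\ forall v, Cmod v <= 1 ->
  Cmod (psi_comb L (w + v) - psi_comb L w) <= B * Cmod v.
Proof.
  destruct (psi_bounded (Cmod w + 1)) as [D [HD HB]].
  induction L as [|[c n] L [B [HB0 IH]]].
  - exists 0. split; [lra|]. intros v _. unfold psi_comb, lsum; simpl.
    replace (0 - 0)%C with (RtoC 0) by ring. rewrite Cmod_0. lra.
  - exists (Cmod c * (2 * D) + B). pose proof (Cmod_ge_0 c). split; [pos_tac|]. intros v Hv.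
    replace (psi_comb ((c, n) :: L) (w + v) - psi_comb ((c, n) :: L) w)%C
      with (c * (psi n (w + v) - psi n w) + (psi_comb L (w + v) - psi_comb L w))%C
      by (unfold psi_comb, lsum; simpl; ring).
    eapply Rle_trans; [apply Cmod_triangle|]. rewrite Cmod_mult, Rmult_plus_distr_r.
    apply Rplus_le_compat; [|auto]. rewrite Rmult_assoc. apply Rmult_le_compat_l; auto.
    eapply Rle_trans; [apply (ladder_lipschitz psi n w v D (psi_ladder _ _))|right; ring].
    intros m t Ht _. apply HB. eapply Rle_trans; [now apply Cmod_line_upper|lra].
Qed.

Definition planar_comb (k : R) (c : C) (L : list (C * Z)) (x y : R) : R :=
  fst (psi_comb L (k * ((x, y) - c))).

Lemma planar_comb_continuous k c L x y : 0 < k -> continuity_2d_pt (planar_comb k c L) x y.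
Proof.
  intros Hk eps. set (w := (k * ((x, y) - c))%C).
  destruct (psi_comb_lipschitz L w) as [B [HB0 HB]].
  assert (Hd : 0 < Rmin (/ (2 * k)) (eps / (2 * k * (B + 1)))).
  { destruct eps as [e He]; simpl. apply Rmin_glb_lt; pos_tac. }
  exists (mkposreal _ Hd). simpl. intros u v Hu Hv.
  assert (Hm1 := Rmin_l (/ (2 * k)) (eps / (2 * k * (B + 1)))).
  assert (Hm2 := Rmin_r (/ (2 * k)) (eps / (2 * k * (B + 1)))).
  set (dl := Rmin _ _) in *.
  set (d := ((u - x, v - y) : C)). set (z := (k * d)%C).
  assert (Hz : Cmod z < k * (2 * dl)).
  { unfold z, d. rewrite Cmod_mult, Cmod_R, Rabs_pos_eq by lra. apply Rmult_lt_compat_l; auto.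
    eapply Rle_lt_trans; [apply Cmod_le_Rabs|]. lra. }
  assert (E : (k * ((u, v) - c))%C = (w + z)%C).
  { unfold w, z, d. destruct c. unfold RtoC, Cminus, Cplus, Copp, Cmult; simpl; f_equal; ring. }
  unfold planar_comb. fold w. rewrite E.
  replace (fst (psi_comb L (w + z)) - fst (psi_comb L w)) with (fst (psi_comb L (w + z) - psi_comb L w)%C) by reflexivity.
  eapply Rle_lt_trans; [apply Rabs_fst_Cmod|].
  assert (H1 : k * (2 * dl) <= 1).
  { apply Rle_trans with (k * (2 * / (2 * k))); [apply Rmult_le_compat_l; lra|right; field; lra]. }
  eapply Rle_lt_trans; [apply HB; lra|].
  apply Rle_lt_trans with ((B + 1) * Cmod z); [pose proof (Cmod_ge_0 z); nra|].
  apply Rlt_le_trans with ((B + 1) * (k * (2 * dl))); [apply Rmult_lt_compat_l; lra|].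
  apply Rle_trans with ((B + 1) * (k * (2 * (eps / (2 * k * (B + 1)))))); [|right; field; lra].
  apply Rmult_le_compat_l; [lra|]. apply Rmult_le_compat_l; lra.
Qed.

Lemma planar_comb_dx k c L x y :
  is_derive (fun t => planar_comb k c L t y) x (planar_comb k c (psi_comb_deriv (RtoC k) L) x y).
Proof.
  destruct (psi_comb_Cder L (k * ((0, y) - c)) (RtoC k) x) as [H _].
  assert (E : forall u : R, (k * ((0, y) - c) + u * k)%C = (k * ((u, y) - c))%C).
  { intros u. destruct c. unfold RtoC, Cminus, Cplus, Copp, Cmult; simpl; f_equal; ring. }
  unfold planar_comb. rewrite <- E.
  eapply is_derive_ext; [|exact H]. intros t. simpl. now rewrite E.
Qed.

Lemma planar_comb_dy k c L x y :
  is_derive (fun t => planar_comb k c L x t) y (planar_comb k c (psi_comb_deriv (k * Ci) L) x y).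
Proof.
  destruct (psi_comb_Cder L (k * ((x, 0) - c)) (k * Ci)%C y) as [H _].
  assert (E : forall u : R, (k * ((x, 0) - c) + u * (k * Ci))%C = (k * ((x, u) - c))%C).
  { intros u. destruct c. unfold Ci, RtoC, Cminus, Cplus, Copp, Cmult; simpl; f_equal; ring. }
  unfold planar_comb. rewrite <- E.
  eapply is_derive_ext; [|exact H]. intros t. simpl. now rewrite E.
Qed.

Lemma planar_comb_ex_diff k c N L x y : 0 < k -> ex_diff_n (planar_comb k c L) N x y.
Proof.
  intros Hk. revert L; induction N as [|N IH]; intros L; simpl.
  - split; auto. now apply planar_comb_continuous.
  - split; [now apply planar_comb_continuous|].
    split; [eexists; apply planar_comb_dx|]. split; [eexists; apply planar_comb_dy|].
    split.
    + replace (fun u v : R => Derive (fun z => planar_comb k c L z v) u)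
        with (planar_comb k c (psi_comb_deriv (RtoC k) L)); auto.
      do 2 (apply functional_extensionality; intros ?). symmetry. apply is_derive_unique, planar_comb_dx.
    + replace (fun u v : R => Derive (fun z => planar_comb k c L u z) v)
        with (planar_comb k c (psi_comb_deriv (k * Ci) L)); auto.
      do 2 (apply functional_extensionality; intros ?). symmetry. apply is_derive_unique, planar_comb_dy.
Qed.

Lemma bJ_abs m r : bJ m r = 0 -> bJ (Z.of_nat (Z.abs_nat m)) r = 0.
Proof.
  intros H. destruct (Z_le_dec 0 m) as [Hm|Hm].
  - now rewrite Nat2Z.inj_abs_nat, Z.abs_eq.
  - rewrite Nat2Z.inj_abs_nat, Z.abs_neq by lia.
    assert (Hc : psi (- m) (RtoC r) = RtoC 0); [|unfold bJ; now rewrite Hc].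
    apply Cmod_eq_0.
    replace (Cmod (psi (- m) (RtoC r))) with (Cmod (psi m (RtoC r))).
    + rewrite psi_RtoC, H. apply Cmod_0.
    + unfold psi, cyl. now rewrite !Cmod_mult, !Cmod_zp, Zabs_nat_opp.
Qed.

(** The eigenfunction is the real part of J_n(k r) e^(i n theta) centred at c, with n = |m|. *)
Lemma bJ_zero_eigenvalue k c a m : 0 < k -> 0 < a -> bJ m (k * a) = 0 ->
  dirichlet_eigenvalue c a (k ^ 2).
Proof.
  intros Hk Ha HJ. apply bJ_abs in HJ. set (p := Z.abs_nat m) in HJ. set (n := Z.of_nat p) in HJ.
  set (L := (RtoC 1, n) :: nil).
  assert (HL : forall w, psi_comb L w = psi n w) by (intros w; unfold psi_comb, lsum, L; simpl; ring).
  exists (planar_comb k c L). split; [|split; [|split; [|split]]].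
  - intros x y _. now apply planar_comb_ex_diff.
  - intros [x y] _. pose proof (planar_comb_continuous k c L x y Hk) as H.
    apply continuity_2d_pt_filterlim in H.
    eapply filterlim_filter_le_1; [apply filter_le_within|exact H].
  - assert (Hs : exists s, 0 < s < a /\ jK p ((k * s) ^ 2 / 4) <> 0).
    { assert (Hc0 : jK p 0 = / INR (fact p)).
      { unfold jK. rewrite PSeries_0. unfold jc. simpl. field. apply INR_fact_neq_0. }
      assert (Hcont : continuous (jK p) 0).
      { apply (ex_derive_continuous (K := R_AbsRing) (V := R_NormedModule)). eexists; apply jK_derive. }
      assert (Hpos : 0 < / INR (fact p)) by (apply Rinv_0_lt_compat, INR_fact_lt_0).
      destruct (proj1 (filterlim_locally _ _) Hcont (mkposreal _ Hpos)) as [dl Hdl].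
      destruct dl as [dl Hdl0]. simpl in Hdl.
      set (s := Rmin (a / 2) (Rmin (dl / k ^ 2) 1)).
      assert (Hs0 : 0 < s) by (unfold s; repeat apply Rmin_glb_lt; pos_tac).
      assert (Hs1 : s <= a / 2) by apply Rmin_l.
      assert (Hs2 : s <= dl / k ^ 2) by (eapply Rle_trans; [apply Rmin_r|apply Rmin_l]).
      assert (Hs3 : s <= 1) by (eapply Rle_trans; [apply Rmin_r|apply Rmin_r]).
      exists s. split; [lra|].
      assert (Hb : (k * s) ^ 2 / 4 < dl).
      { assert (0 < k ^ 2) by pos_tac.
        assert (k ^ 2 * s <= dl).
        { apply Rle_trans with (k ^ 2 * (dl / k ^ 2)); [apply Rmult_le_compat_l; lra|right; field; lra]. }
        rewrite Rpow_mult_distr. assert (s ^ 2 <= s) by (simpl; nra).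
        assert (k ^ 2 * s ^ 2 <= k ^ 2 * s) by (apply Rmult_le_compat_l; lra). lra. }
      assert (H0 : 0 <= (k * s) ^ 2 / 4) by pos_tac.
      specialize (Hdl ((k * s) ^ 2 / 4)).
      intros E.
      assert (Hball : Rabs (jK p ((k * s) ^ 2 / 4) - jK p 0) < / INR (fact p)).
      { apply Hdl. unfold ball; simpl; unfold AbsRing_ball, abs, minus, plus, opp; simpl.
        rewrite Ropp_0, Rplus_0_r. rewrite Rabs_pos_eq by exact H0. exact Hb. }
      rewrite E, Hc0, Rminus_0_l, Rabs_Ropp, Rabs_pos_eq in Hball by lra. lra. }
    destruct Hs as [s [Hs HsJ]].
    exists (fst c + s), (snd c). split.
    + unfold open_disc. replace (((fst c + s)%R, snd c) - c)%C with (RtoC s).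
      * rewrite Cmod_R, Rabs_pos_eq; lra.
      * destruct c. unfold RtoC, Cminus, Cplus, Copp; simpl; f_equal; ring.
    + unfold planar_comb. replace (k * (((fst c + s)%R, snd c) - c))%C with (RtoC (k * s)).
      2:{ destruct c. unfold RtoC, Cminus, Cplus, Copp, Cmult; simpl; f_equal; ring. }
      rewrite HL. unfold psi, n. rewrite cyl_pos. unfold Kj, zalpha.
      rewrite <- RtoC_half, <- RtoC_mult, <- RtoC_pow, <- RtoC_mult. simpl fst.
      assert (Hks : 0 < k * s) by (apply Rmult_lt_0_compat; lra).
      rewrite Cmod_R, Rabs_pos_eq by lra.
      apply Rmult_integral_contrapositive. split; [|exact HsJ].
      apply pow_nonzero. lra.
  - intros x y H. unfold circle in H. unfold planar_comb. rewrite HL.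
    assert (E : psi n (k * ((x, y) - c)) = RtoC 0); [|now rewrite E].
    apply Cmod_eq_0. unfold psi, cyl. rewrite Cmod_mult, Cmod_zp.
    rewrite Cmod_mult, H, Cmod_R, Rabs_pos_eq by lra.
    assert (E : Cmod (psi n (RtoC (k * a))) = 0) by (rewrite psi_RtoC, HJ; apply Cmod_0).
    unfold psi, cyl in E. rewrite Cmod_mult, Cmod_zp, Cmod_R, Rabs_pos_eq in E by (left; pos_tac).
    exact E.
  - intros x y _.
    assert (Ex : partial_derive 2 0 (planar_comb k c L) x y = planar_comb k c (psi_comb_deriv (RtoC k) (psi_comb_deriv (RtoC k) L)) x y).
    { unfold partial_derive. simpl. apply is_derive_unique.
      apply is_derive_ext with (fun t => planar_comb k c (psi_comb_deriv (RtoC k) L) t y); [|apply planar_comb_dx].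
      intros t. symmetry. apply is_derive_unique, planar_comb_dx. }
    assert (Ey : partial_derive 0 2 (planar_comb k c L) x y = planar_comb k c (psi_comb_deriv (k * Ci) (psi_comb_deriv (k * Ci) L)) x y).
    { unfold partial_derive. simpl. apply is_derive_unique.
      apply is_derive_ext with (fun t => planar_comb k c (psi_comb_deriv (k * Ci) L) x t); [|apply planar_comb_dy].
      intros t. symmetry. apply is_derive_unique, planar_comb_dy. }
    rewrite Ex, Ey. unfold planar_comb. set (w := (k * ((x, y) - c))%C).
    (* The Laplacian applies the ladder twice in the directions k and k i. The terms of order n - 2
       and n + 2 carry the factor 1 + i^2 = 0, and those of order n add up to -k^2. *)
    assert (E : (psi_comb (psi_comb_deriv (RtoC k) (psi_comb_deriv (RtoC k) L)) w
      + psi_comb (psi_comb_deriv (k * Ci) (psi_comb_deriv (k * Ci) L)) w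
      = RtoC (- k ^ 2) * psi n w)%C).
    { assert (EK : RtoC (- k ^ 2) = (- (RtoC k * RtoC k))%C).
      { rewrite RtoC_opp, RtoC_pow. simpl. ring. }
      rewrite EK. unfold psi_comb, lsum, L. cbn [map fold_right flat_map app fst snd psi_comb_deriv].
      replace (n - 1 + 1)%Z with n by lia. replace (n + 1 - 1)%Z with n by lia.
      unfold zalpha, zbeta. rewrite <- RtoC_half, Cmult_conj, Cconj_RtoC.
      replace (Cconj Ci) with (- Ci)%C by (unfold Cconj, Ci, Copp; simpl; f_equal; ring).
      assert (Ei : (Ci * Ci = - (1))%C) by (unfold Ci, Cmult, Copp, RtoC; simpl; f_equal; ring).
      set (A := psi (n - 1 - 1) w). set (B := psi n w). set (D := psi (n + 1 + 1) w).
      rewrite ?RtoC_opp.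
      transitivity ((/ 2)%R * (/ 2)%R * (RtoC k * RtoC k) * (1 + Ci * Ci) * (A + D)
        + (- (2)) * ((/ 2)%R * (/ 2)%R) * (RtoC k * RtoC k) * (1 - Ci * Ci) * B)%C; [ring|].
      rewrite Ei. replace (RtoC (/ 2)) with (/ RtoC 2)%C by (symmetry; apply RtoC_half).
      field. }
    rewrite HL.
    match goal with |- - (fst ?A + fst ?B) = _ =>
      assert (E3 : fst A + fst B = - k ^ 2 * fst (psi n w)) end.
    { transitivity (fst (RtoC (- k ^ 2) * psi n w)%C); [rewrite <- E; reflexivity|].
      unfold Cmult, RtoC. cbn [fst snd]. ring. }
    rewrite E3. ring.
Qed.

(** * Finite families and further rules for unordered sums *)

(** Makes constants uniform over the finitely many discs. Any property that survives enlarging the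
    constant qualifies, so no maximum has to be formed explicitly. *)
Lemma finite_bound M (P : nat -> R -> Prop) :
  (forall p A B, P p A -> A <= B -> P p B) ->
  (forall p, (p < M)%nat -> exists A, P p A) ->
  exists A, 0 < A /\ forall p, (p < M)%nat -> P p A.
Proof.
  intros Hm. induction M as [|M IH]; intros H.
  - exists 1. split; [lra|]. intros p Hp; lia.
  - destruct IH as [A [HA HP]]; [intros; apply H; lia|].
    destruct (H M) as [B HB]; [lia|].
    exists (Rmax A B). split; [eapply Rlt_le_trans; [exact HA|apply Rmax_l]|].
    intros p Hp. destruct (Nat.eq_dec p M) as [->|].
    + apply Hm with B; auto. apply Rmax_r.
    + apply Hm with A; [apply HP; lia|apply Rmax_l].
Qed.

Lemma bsum_finite M (g : nat -> R) B : 0 <= B -> (forall q, (q < M)%nat -> g q <= B) ->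
  (forall q, (M <= q)%nat -> g q <= 0) -> bsum g (INR M * B).
Proof.
  intros HB H1 H2.
  apply bsum_le with (fun q => if lt_dec q M then B else 0).
  { intros q. destruct (lt_dec q M); [auto|apply H2; lia]. }
  intros L HL. set (h := fun q => if lt_dec q M then B else 0).
  apply Rle_trans with (lsumR h (filter (fun q => q <? M)%nat L)).
  { clear HL. induction L as [|q L IH]; [apply Rle_refl|].
    cbn [filter]. destruct (Nat.ltb_spec q M); unfold lsumR in *; cbn [map fold_right].
    - lra.
    - unfold h at 1. destruct (lt_dec q M); [lia|]. lra. }
  apply Rle_trans with (lsumR (fun _ => B) (seq 0 M)).
  - apply Rle_trans with (lsumR (fun _ => B) (filter (fun q => q <? M)%nat L)).
    + apply lsumR_le. intros q _. unfold h. destruct (lt_dec q M); lra.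
    + apply lsumR_incl; auto; [now apply NoDup_filter|].
      intros q Hq. apply filter_In in Hq as [_ Hq]. apply Nat.ltb_lt in Hq. apply in_seq; lia.
  - rewrite lsumR_const, length_seq. lra.
Qed.

Lemma has_sum_single {T} (f : T -> C) i : (forall j, j <> i -> f j = RtoC 0) -> has_sum f (f i).
Proof.
  intros H eps He. exists (i :: nil). split; [constructor; [easy|constructor]|].
  intros L HL HI.
  destruct (incl_NoDup_split (i :: nil) L) as [V HV]; auto; [constructor; [easy|constructor]|].
  rewrite (lsum_perm _ _ _ HV), lsum_app.
  assert (HN : NoDup ((i :: nil) ++ V)) by (eapply Permutation.Permutation_NoDup; eauto).
  rewrite (lsum_ext f (fun _ => RtoC 0) V).
  - rewrite lsum_RtoC, lsumR_const, Rmult_0_r. unfold lsum; simpl.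
    replace (f i + 0 + 0 - f i)%C with (RtoC 0) by ring. rewrite Cmod_0; lra.
  - intros x Hx. apply H. intros ->. simpl in HN. inversion HN; contradiction.
Qed.

Lemma tsum_single {T} (f : T -> C) i : (forall j, j <> i -> f j = RtoC 0) -> tsum f = f i.
Proof. intros H. now apply has_sum_tsum, has_sum_single. Qed.

Lemma bsum_single {T} (f : T -> R) i B : 0 <= B -> f i <= B ->
  (forall j, j <> i -> f j <= 0) -> bsum f B.
Proof.
  intros HB Hi H L HL. induction HL as [|x L Hx HL IH]; [exact HB|].
  destruct (excluded_middle_informative (x = i)) as [->|Hxi].
  - unfold lsumR in *; cbn [map fold_right]. clear IH.
    assert (lsumR f L <= 0).
    { clear HL. induction L as [|y L IHL]; [apply Rle_refl|]. unfold lsumR in *; cbn [map fold_right].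
      assert (f y <= 0) by (apply H; intros ->; apply Hx; now left).
      assert (fold_right Rplus 0 (map f L) <= 0) by (apply IHL; intros Hi'; apply Hx; now right). lra. }
    unfold lsumR in *. lra.
  - unfold lsumR in *; cbn [map fold_right]. pose proof (H x Hxi). lra.
Qed.

Lemma tsum_minus {T} (f g : T -> C) : summable f -> summable g ->
  tsum (fun x => f x - g x)%C = (tsum f - tsum g)%C.
Proof.
  intros Hf Hg. rewrite (tsum_ext _ (fun x => f x + (- (1)) * g x)%C) by (intros; ring).
  rewrite tsum_plus, tsum_scal; auto; [ring|]. now apply summable_scal.
Qed.

Lemma summable_conj {T} (f : T -> C) : summable f -> summable (fun x => Cconj (f x)).
Proof.
  intros [B HB]. exists B. eapply bsum_le; [|exact HB]. intros x. simpl. rewrite Cmod_conj; lra.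
Qed.

Lemma summable_outer {A B} (F : A * B -> C) : summable F -> summable (fun a => tsum (fun b => F (a, b))).
Proof.
  intros [Bd HB]. exists Bd.
  assert (HF : summable F) by (now exists Bd).
  intros K HK.
  assert (Hfin : forall e, 0 < e -> lsumR (fun a => Cmod (tsum (fun b => F (a, b)))) K <= Bd + INR (length K) * e).
  { intros e He.
    assert (Hc : forall K' : list A, exists B0 : list B, forall B1, NoDup B1 -> incl B0 B1 ->
      forall a, In a K' -> Cmod (lsum (fun b => F (a, b)) B1 - tsum (fun b => F (a, b))) <= e).
    { induction K' as [|a K' [B0 IH]].
      - exists nil; intros ? ? ? ? [].
      - destruct (summable_has_sum _ (summable_row F a HF) e He) as [Ba [_ Ha]].
        exists (Ba ++ B0). intros B1 HB1 HI1 a' [<-|Ha'].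
        + apply Ha; auto. intros x Hx; apply HI1, in_or_app; auto.
        + apply IH; auto. intros x Hx; apply HI1, in_or_app; auto. }
    destruct (Hc K) as [B0 H0].
    specialize (H0 (clnodup B0) (NoDup_clnodup _) (fun x Hx => proj2 (In_clnodup B0 x) Hx)).
    apply Rle_trans with (lsumR (fun a => lsumR (fun b => Cmod (F (a, b))) (clnodup B0) + e) K).
    - apply lsumR_le. intros a Ha. specialize (H0 a Ha).
      replace (tsum (fun b => F (a, b))) with (lsum (fun b => F (a, b)) (clnodup B0)
        + - (lsum (fun b => F (a, b)) (clnodup B0) - tsum (fun b => F (a, b))))%C by ring.
      eapply Rle_trans; [apply Cmod_triangle|]. rewrite Cmod_opp.
      pose proof (Cmod_lsum (fun b => F (a, b)) (clnodup B0)). lra.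
    - rewrite lsumR_plus, lsumR_const. apply Rplus_le_compat_r.
      rewrite <- (lsumR_prod (fun x => Cmod (F x))). apply HB. apply NoDup_prod; auto. apply NoDup_clnodup. }
  apply le_epsilon. intros e He.
  pose proof (pos_INR (length K)).
  specialize (Hfin (e / (INR (length K) + 1)) ltac:(pos_tac)).
  assert (INR (length K) * (e / (INR (length K) + 1)) <= e); [|lra].
  apply Rle_trans with ((INR (length K) + 1) * (e / (INR (length K) + 1))); [|right; field; lra].
  apply Rmult_le_compat_r; [pos_tac|lra].
Qed.

Lemma summable_mult_prod {A B} (u : A -> C) (v : B -> C) : summable u -> summable v ->
  summable (fun x => u (fst x) * v (snd x))%C.
Proof.
  intros [Bu Hu] [Bv Hv]. pose proof (bsum_nonneg _ _ Hv).
  apply summable_prod with (G := fun x => Cmod (u (fst x)) * Cmod (v (snd x)))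
    (g := fun a => Bv * Cmod (u a)) (Bd := Bv * Bu).
  - intros x. rewrite Cmod_mult; lra.
  - intros a. cbn [fst snd]. rewrite (Rmult_comm Bv). apply bsum_scal; auto using Cmod_ge_0.
  - now apply bsum_scal.
Qed.

Lemma tsum_mult_prod {A B} (u : A -> C) (v : B -> C) : summable u -> summable v ->
  tsum (fun x => u (fst x) * v (snd x))%C = (tsum u * tsum v)%C.
Proof.
  intros Hu Hv. rewrite tsum_fubini by now apply summable_mult_prod. cbn [fst snd].
  rewrite (tsum_ext _ (fun a => tsum v * u a)%C).
  - rewrite tsum_scal; auto. ring.
  - intros a. rewrite tsum_scal; auto. ring.
Qed.

Lemma tsum_nonneg_zero {T} (g : T -> R) : (forall x, 0 <= g x) -> summable (fun x => RtoC (g x)) ->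
  tsum (fun x => RtoC (g x)) = RtoC 0 -> forall x, g x = 0.
Proof.
  intros Hg Hs H0 x. apply Rle_antisym; auto. apply le_epsilon. intros e He.
  destruct (summable_has_sum _ Hs e He) as [L0 [HL0 H]].
  specialize (H (clnodup (x :: L0)) (NoDup_clnodup _)).
  rewrite H0, lsum_RtoC in H.
  assert (HI : incl L0 (clnodup (x :: L0))) by (intros y Hy; apply In_clnodup; now right).
  specialize (H HI). replace (lsumR g (clnodup (x :: L0)) - 0)%C with (RtoC (lsumR g (clnodup (x :: L0)))) in H by ring.
  rewrite Cmod_R, Rabs_pos_eq in H by now apply lsumR_ge_0.
  assert (g x <= lsumR g (clnodup (x :: L0))); [|lra].
  replace (g x) with (lsumR g (x :: nil)) by (unfold lsumR; simpl; ring).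
  apply lsumR_incl; auto; [constructor; [easy|constructor]|].
  intros y [<-|[]]. apply In_clnodup; now left.
Qed.

(** * Multipole expansions *)

Definition idx : Type := (nat * Z)%type.

Lemma nbc_weight m n : (INR n + 1) * nbc m n <= (INR m + 1) * nbc (S m) n.
Proof.
  unfold nbc. replace (S m + n)%nat with (S (m + n)) by lia. rewrite !fact_S_R, plus_INR.
  pose proof (INR_fact_lt_0 m); pose proof (INR_fact_lt_0 n); pose proof (INR_fact_lt_0 (m + n));
  pose proof (pos_INR m); pose proof (pos_INR n).
  replace ((INR m + 1) * ((INR m + INR n + 1) * INR (fact (m + n)) / ((INR m + 1) * INR (fact m) * INR (fact n))))
    with ((INR m + INR n + 1) * (INR (fact (m + n)) / (INR (fact m) * INR (fact n)))) by (field; lra).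
  apply Rmult_le_compat_r; [pos_tac|lra].
Qed.

(** The growth of J_n(rho_q) x_n with x_n = O(1 + |n|). It is what the field of outgoing waves needs
    to converge outside the circle of radius rho_q. *)
Definition multipole_coefs (M : nat) (rho : nat -> R) (c : idx -> C) : Prop :=
  (forall q n, (M <= q)%nat -> c (q, n) = RtoC 0) /\
  exists A, 0 < A /\ forall q n, (q < M)%nat ->
    Cmod (c (q, n)) <= A * ((INR (Z.abs_nat n) + 1) * ((rho q / 2) ^ Z.abs_nat n / INR (fact (Z.abs_nat n)))).

(** Summing over l first gives the power (1 - be)^(-(m + |n| + 1)), which turns the ratio al of the
    remaining sum into al/(1 - be). This is below 1 precisely when al + be < 1, the analytic form of
    a geometric gap. *)
Lemma bsum_Z_weighted m al be : 0 <= al -> 0 <= be -> al + be < 1 ->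
  bsum (fun nl : Z * Z => (INR (Z.abs_nat (fst nl)) + 1) * nbc m (Z.abs_nat (fst nl)) * al ^ Z.abs_nat (fst nl)
      * (nbc (m + Z.abs_nat (fst nl)) (Z.abs_nat (snd nl)) * be ^ Z.abs_nat (snd nl)))
    (2 * (2 / (1 - be) ^ S m * (INR m + 1) * / (1 - al / (1 - be)) ^ S (S m))).
Proof.
  intros Ha Hb Hab.
  assert (Hq : 0 <= al / (1 - be) < 1).
  { split; [pos_tac|]. apply Rmult_lt_reg_r with (1 - be); [lra|].
    unfold Rdiv. rewrite Rmult_assoc, Rinv_l by lra. lra. }
  apply bsum_prod with (fun n => (INR (Z.abs_nat n) + 1) * nbc m (Z.abs_nat n) * al ^ Z.abs_nat n * (2 * / (1 - be) ^ S (m + Z.abs_nat n))).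
  - intros [n l]. cbn [fst snd]. pose proof (nbc_pos m (Z.abs_nat n)).
    pose proof (nbc_pos (m + Z.abs_nat n) (Z.abs_nat l)). pose proof (pos_INR (Z.abs_nat n)). pos_tac.
  - intros n. cbn [fst snd]. pose proof (nbc_pos m (Z.abs_nat n)). pose proof (pos_INR (Z.abs_nat n)).
    apply bsum_scal; [pos_tac|].
    apply bsum_Z_abs with (fun l => nbc (m + Z.abs_nat n) l * be ^ l).
    + intros l. pose proof (nbc_pos (m + Z.abs_nat n) (Z.abs_nat l)). pos_tac.
    + intros l. apply Rle_refl.
    + apply nbc_bsum; lra.
  - apply bsum_Z_abs with (fun n => 2 / (1 - be) ^ S m * (INR m + 1) * (nbc (S m) n * (al / (1 - be)) ^ n)).
    + intros n. pose proof (nbc_pos m (Z.abs_nat n)). pose proof (pos_INR (Z.abs_nat n)).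
      assert (0 < (1 - be) ^ S (m + Z.abs_nat n)) by (apply pow_lt; lra). pos_tac.
    + intros n. set (p := Z.abs_nat n). pose proof (nbc_weight m p).
      assert (0 < (1 - be) ^ S m) by (apply pow_lt; lra). assert (0 < (1 - be) ^ p) by (apply pow_lt; lra).
      replace (S (m + p)) with (S m + p)%nat by lia. rewrite pow_add.
      unfold Rdiv at 2. rewrite Rpow_mult_distr, pow_inv.
      replace ((INR p + 1) * nbc m p * al ^ p * (2 * / ((1 - be) ^ S m * (1 - be) ^ p)))
        with ((INR p + 1) * nbc m p * (2 / (1 - be) ^ S m * al ^ p * / (1 - be) ^ p)) by (field; lra).
      replace (2 / (1 - be) ^ S m * (INR m + 1) * (nbc (S m) p * (al ^ p * / (1 - be) ^ p)))
        with ((INR m + 1) * nbc (S m) p * (2 / (1 - be) ^ S m * al ^ p * / (1 - be) ^ p)) by ring.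
      apply Rmult_le_compat_r; [pos_tac|auto].
    + pose proof (pos_INR m). apply bsum_scal; [|now apply nbc_bsum].
      assert (0 < (1 - be) ^ S m) by (apply pow_lt; lra). pos_tac.
Qed.

Lemma summable_idx_prod {T} (M : nat) (F : idx * T -> C) :
  (forall q n t, (M <= q)%nat -> F ((q, n), t) = RtoC 0) ->
  (forall q, (q < M)%nat -> exists B, bsum (fun nt : Z * T => Cmod (F ((q, fst nt), snd nt))) B) ->
  summable F.
Proof.
  intros H0 HB.
  destruct (finite_bound M (fun q B => bsum (fun nt : Z * T => Cmod (F ((q, fst nt), snd nt))) B)) as [B [HBpos HB']]; auto.
  { intros; eapply bsum_weaken; eauto. }
  set (F' := fun x : nat * (Z * T) => F ((fst x, fst (snd x)), snd (snd x))).
  assert (HF' : summable F').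
  { apply summable_prod with (G := fun x => Cmod (F' x)) (g := fun q => if lt_dec q M then B else 0) (Bd := INR M * B).
    - intros; apply Rle_refl.
    - intros q. unfold F'; cbn [fst snd]. destruct (lt_dec q M) as [Hq|Hq]; [now apply HB'|].
      intros L HL. rewrite <- (Rmult_0_r (INR (length L))), <- lsumR_const.
      apply lsumR_le. intros [n t] _. rewrite H0 by (cbn; lia). rewrite Cmod_0; lra.
    - apply bsum_finite; [lra| |]; intros q Hq; destruct (lt_dec q M); try lra; lia. }
  apply summable_ext with (fun x => F' (fst (fst x), (snd (fst x), snd x))).
  - intros [[q n] t]. reflexivity.
  - apply (summable_inj F' (fun x : idx * T => (fst (fst x), (snd (fst x), snd x)))); auto.
    intros [[q n] t] [[q' n'] t'] [=]; subst; auto.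
Qed.

Lemma multipole_summable M rho c (X V : nat -> C) m :
  multipole_coefs M rho c -> (forall q, (q < M)%nat -> 0 < rho q) ->
  (forall q, (q < M)%nat -> rho q + Cmod (V q) < Cmod (X q)) ->
  summable (fun jl : idx * Z => c (fst jl) * (chi (snd (fst jl) - m - snd jl) (X (fst (fst jl)))
     * psi (snd jl) (V (fst (fst jl)))))%C.
Proof.
  intros [Hc0 [A [HA Hc]]] Hrho HXV. apply summable_idx_prod with M.
  - intros q n l Hq. cbn [fst snd]. rewrite Hc0 by auto. ring.
  - intros q Hq. cbn [fst snd]. specialize (HXV q Hq). specialize (Hrho q Hq).
    pose proof (Cmod_ge_0 (V q)) as HV.
    destruct (chi_fixed (X q)) as [D [HD H1]]; [lra|]. destruct (psi_fixed (V q)) as [E [HE H2]].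
    set (r := Cmod (X q)) in *. set (v := Cmod (V q)) in *. set (m0 := Z.abs_nat m).
    assert (Hsum : 0 <= rho q / r /\ 0 <= v / r /\ rho q / r + v / r < 1).
    { repeat split; try pos_tac. apply Rmult_lt_reg_r with r; [lra|].
      replace ((rho q / r + v / r) * r) with (rho q + v) by (field; lra). lra. }
    destruct Hsum as [Ha [Hb Hab]].
    pose proof (bsum_Z_weighted m0 _ _ Ha Hb Hab) as HB.
    pose proof (hbound_pos m0 r ltac:(lra)) as Hh.
    eexists. eapply bsum_le; [|apply (bsum_scal _ (A * D * E * hbound m0 r) _ ltac:(pos_tac) HB)].
    intros [n l]. cbn [fst snd]. rewrite !Cmod_mult.
    set (n0 := Z.abs_nat n). set (l0 := Z.abs_nat l).
    pose proof (Hc q n Hq) as Hcn. fold n0 in Hcn. specialize (H2 l). fold l0 in H2.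
    assert (Hchi : Cmod (chi (n - m - l) (X q)) <= D * hbound (m0 + n0 + l0) r) by (apply H1; lia).
    pose proof (INR_fact_lt_0 n0); pose proof (INR_fact_lt_0 l0); pose proof (pos_INR n0).
    apply Rle_trans with (A * ((INR n0 + 1) * ((rho q / 2) ^ n0 / INR (fact n0))) *
      (D * hbound (m0 + n0 + l0) r * (E * ((v / 2) ^ l0 / INR (fact l0))))).
    + apply Rmult_le_compat; auto using Cmod_ge_0.
      * apply Rmult_le_pos; apply Cmod_ge_0.
      * apply Rmult_le_compat; auto using Cmod_ge_0.
    + right.
      transitivity (A * D * E * ((INR n0 + 1) * ((hbound (m0 + n0 + l0) r * ((v / 2) ^ l0 / INR (fact l0))) * ((rho q / 2) ^ n0 / INR (fact n0))))); [ring|].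
      rewrite hbound_term by lra.
      transitivity (A * D * E * ((INR n0 + 1) * ((hbound (m0 + n0) r * ((rho q / 2) ^ n0 / INR (fact n0))) * (nbc (m0 + n0) l0 * (v / r) ^ l0)))); [ring|].
      rewrite hbound_term by lra. ring.
Qed.

(** For m = 0 this is the radiated field at a point whose position relative to centre q is [X q]. A
    general m shifts all orders; these companion fields are the coefficients of local expansions. *)
Definition mult_exp (c : idx -> C) (m : Z) (X : nat -> C) : C :=
  tsum (fun j : idx => c j * chi (snd j - m) (X (fst j)))%C.

Lemma mult_exp_summable M rho c X m :
  multipole_coefs M rho c -> (forall q, (q < M)%nat -> 0 < rho q) ->
  (forall q, (q < M)%nat -> rho q < Cmod (X q)) ->
  summable (fun j : idx => c j * chi (snd j - m) (X (fst j)))%C.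
Proof.
  intros Hc Hr HX.
  (* Zero displacement: only l = 0 survives in the expanded sum. *)
  assert (H : forall q, (q < M)%nat -> rho q + Cmod ((fun _ => RtoC 0) q) < Cmod (X q)).
  { intros q Hq. simpl. rewrite Cmod_0. specialize (HX q Hq). lra. }
  pose proof (multipole_summable M rho c X (fun _ => RtoC 0) m Hc Hr H) as Hs.
  apply (summable_inj _ (fun j : idx => (j, 0%Z))) in Hs; [|now intros x y [= ->]].
  eapply summable_ext; [|exact Hs]. intros [q n]. cbn [fst snd]. rewrite psi_0_0.
  replace (n - m - 0)%Z with (n - m)%Z by lia. ring.
Qed.

Lemma mult_exp_shift M rho c (X V : nat -> C) m :
  multipole_coefs M rho c -> (forall q, (q < M)%nat -> 0 < rho q) ->
  (forall q, (q < M)%nat -> rho q + Cmod (V q) < Cmod (X q)) ->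
  mult_exp c m (fun q => X q + V q)%C
  = tsum (fun jl : idx * Z => c (fst jl) * (chi (snd (fst jl) - m - snd jl) (X (fst (fst jl)))
     * psi (snd jl) (V (fst (fst jl)))))%C.
Proof.
  intros Hc Hr HXV. rewrite (tsum_fubini _ (multipole_summable M rho c X V m Hc Hr HXV)).
  unfold mult_exp. apply tsum_ext. intros [q n]. cbn [fst snd].
  destruct (lt_dec q M) as [Hq|Hq].
  - specialize (HXV q Hq). specialize (Hr q Hq).
    assert (H : Cmod (V q) < Cmod (X q)) by lra.
    rewrite tsum_scal by now apply (summable_chi_graf (n - m)). now rewrite chi_graf.
  - destruct Hc as [Hc0 _]. rewrite Hc0 by lia.
    rewrite (tsum_ext _ (fun _ => RtoC 0)) by (intros; ring). rewrite tsum_0. ring.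
Qed.

(** The margin [4 * dl] leaves the circles enlarged by dl at mutual distance at least 2 dl, which is
    room for steps of the continuation argument. Lengths are measured in units of 1/k. *)
Definition geometry (M : nat) (o : nat -> C) (rho : nat -> R) (dl : R) : Prop :=
  0 < dl /\ (forall p, (p < M)%nat -> 0 < rho p) /\
  forall p q, (p < M)%nat -> (q < M)%nat -> p <> q -> rho p + rho q + 4 * dl <= Cmod (o p - o q).

Lemma Cmod_sym (x y : C) : Cmod (x - y) = Cmod (y - x).
Proof. rewrite <- Cmod_opp. f_equal. ring. Qed.

Lemma Cmod_tri_sub (x y z : C) : Cmod (x - z) <= Cmod (x - y) + Cmod (y - z).
Proof. replace (x - z)%C with ((x - y) + (y - z))%C by ring. apply Cmod_triangle. Qed.

Definition off_disc (c : idx -> C) (p : nat) (j : idx) : C :=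
  if (fst j =? p)%nat then RtoC 0 else c j.

(* The value at q = p is irrelevant, [off_disc c p] vanishing there. *)
Definition rel_center (o : nat -> C) (rho : nat -> R) (p q : nat) : C :=
  if (q =? p)%nat then RtoC (rho p + 1) else (o p - o q)%C.

Lemma off_disc_coefs M rho c p : multipole_coefs M rho c -> multipole_coefs M rho (off_disc c p).
Proof.
  intros [H0 [A [HA H]]]. split.
  - intros q n Hq. unfold off_disc; cbn [fst]. destruct (q =? p)%nat; auto.
  - exists A. split; auto. intros q n Hq. unfold off_disc; cbn [fst]. destruct (q =? p)%nat; auto.
    rewrite Cmod_0. eapply Rle_trans; [apply Cmod_ge_0|apply (H q n Hq)].
Qed.

Lemma rel_center_gap M o rho dl p q : geometry M o rho dl -> (p < M)%nat -> (q < M)%nat ->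
  rho q < Cmod (rel_center o rho p q).
Proof.
  intros [Hd [Hr Hg]] Hp Hq. unfold rel_center. destruct (Nat.eqb_spec q p) as [->|Hqp].
  - specialize (Hr p Hp). rewrite Cmod_R, Rabs_pos_eq; lra.
  - specialize (Hg p q Hp Hq ltac:(auto)). specialize (Hr p Hp). lra.
Qed.

Lemma multipole_coefs_summable M rho c : (forall q, (q < M)%nat -> 0 < rho q) ->
  multipole_coefs M rho c -> summable c.
Proof.
  intros Hr [H0 [A [HA H]]].
  assert (Hs : summable (fun x : idx * unit => c (fst x))).
  { apply summable_idx_prod with M.
    - intros q n [] Hq. cbn [fst]. auto.
    - intros q Hq. exists (2 * (A * exp (rho q))). cbn [fst snd]. specialize (Hr q Hq).
      pose proof (bsum_Z_abs (fun n => Cmod (c (q, n))) (fun n => A * (/ INR (fact n) * rho q ^ n)) (A * exp (rho q))) as Hb.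
      assert (Hb' : bsum (fun n => Cmod (c (q, n))) (2 * (A * exp (rho q)))).
      { apply Hb.
        - intros; apply Cmod_ge_0.
        - intros n. eapply Rle_trans; [apply (H q n Hq)|]. set (n0 := Z.abs_nat n).
          pose proof (pow2_ge_S n0). pose proof (INR_fact_lt_0 n0). pose proof (pos_INR n0).
          apply Rmult_le_compat_l; [lra|].
          replace (rho q) with (2 * (rho q / 2)) at 2 by field. rewrite Rpow_mult_distr.
          replace (/ INR (fact n0) * (2 ^ n0 * (rho q / 2) ^ n0)) with (2 ^ n0 * ((rho q / 2) ^ n0 / INR (fact n0))) by (field; lra).
          apply Rmult_le_compat_r; [pos_tac|auto].
        - apply bsum_scal; [lra|apply exp_bsum; lra]. }
      apply (bsum_inj (fun n => Cmod (c (q, n))) (fun nt : Z * unit => fst nt)); auto.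
      intros [x []] [y []] E. cbn [fst] in E. now subst. }
  apply (summable_inj _ (fun j : idx => (j, tt))) in Hs; [exact Hs|]. now intros x y [= ->].
Qed.

Lemma bsum_Z_row m al : 0 <= al < 1 ->
  bsum (fun n : Z => (INR (Z.abs_nat n) + 1) * (nbc m (Z.abs_nat n) * al ^ Z.abs_nat n))
    (2 * ((INR m + 1) * / (1 - al) ^ S (S m))).
Proof.
  intros Ha. apply bsum_Z_abs with (fun n => (INR m + 1) * (nbc (S m) n * al ^ n)).
  - intros n. pose proof (nbc_pos m (Z.abs_nat n)). pose proof (pos_INR (Z.abs_nat n)). pos_tac.
  - intros n. pose proof (nbc_weight m (Z.abs_nat n)).
    rewrite <- !Rmult_assoc. apply Rmult_le_compat_r; [pos_tac|auto].
  - pose proof (pos_INR m). apply bsum_scal; [lra|now apply nbc_bsum].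
Qed.

Lemma bsum_Z_poly_geom th : 0 <= th < 1 ->
  bsum (fun n : Z => (INR (Z.abs_nat n) + 1) ^ 2 * th ^ Z.abs_nat n) (4 * / (1 - th) ^ 3).
Proof.
  intros Ht. replace (4 * / (1 - th) ^ 3) with (2 * (2 * / (1 - th) ^ 3)) by ring.
  apply bsum_Z_abs with (fun n => 2 * (nbc 2 n * th ^ n)).
  - intros n. pose proof (pos_INR (Z.abs_nat n)). pos_tac.
  - intros n. set (p := Z.abs_nat n). pose proof (pos_INR p). rewrite <- Rmult_assoc.
    apply Rmult_le_compat_r; [pos_tac|]. unfold nbc. change (2 + p)%nat with (S (S p)).
    rewrite (fact_S_R (S p)), (fact_S_R p), S_INR. replace (INR (fact 2)) with 2 by (simpl; ring).
    pose proof (INR_fact_lt_0 p).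
    replace (2 * ((INR p + 1 + 1) * ((INR p + 1) * INR (fact p)) / (2 * INR (fact p)))) with ((INR p + 2) * (INR p + 1)) by (field; lra).
    nra.
  - apply bsum_scal; [lra|now apply nbc_bsum].
Qed.

Lemma ratio_bounds a b d : 0 < a -> 0 < b -> a + b < d ->
  0 <= b / d < 1 /\ 0 <= a / (d - b) < 1 /\ a / d / (1 - b / d) = a / (d - b).
Proof.
  intros Ha Hb Hd. repeat split; try (pos_tac).
  - apply Rmult_lt_reg_r with d; [lra|]. unfold Rdiv. rewrite Rmult_assoc, Rinv_l; lra.
  - apply Rmult_lt_reg_r with (d - b); [lra|]. unfold Rdiv. rewrite Rmult_assoc, Rinv_l; lra.
  - field. lra.
Qed.

(** The off-diagonal entries of the quadratic form in which the field of the other discs is paired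
    with the coefficients on disc p. *)
Definition pair_energy (c : idx -> C) (o : nat -> C) (rho : nat -> R) (ij : idx * idx) : C :=
  (Cconj (c (fst ij)) * (off_disc c (fst (fst ij)) (snd ij)
    * chi (snd (snd ij) - snd (fst ij)) (rel_center o rho (fst (fst ij)) (fst (snd ij)))))%C.

(** Summing over n first replaces the ratio rho_p/d by rho_p/(d - rho_q), which is below 1 since the
    discs are disjoint; the weights leave only (1 + |m|)^2. *)
Lemma pair_energy_summable M o rho dl c : geometry M o rho dl -> multipole_coefs M rho c ->
  summable (pair_energy c o rho).
Proof.
  intros HG Hc. assert (HG' := HG). destruct HG' as [Hd [Hr Hg]]. assert (Hc' := Hc). destruct Hc' as [H0 [A [HA H]]].
  apply summable_idx_prod with M.
  { intros p m j Hp. unfold pair_energy. cbn [fst snd]. rewrite H0 by auto. rewrite Cconj_RtoC. ring. }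
  intros p Hp.
  assert (Hs : summable (fun jm : idx * Z => pair_energy c o rho ((p, snd jm), fst jm))).
  { apply summable_idx_prod with M.
    - intros q n m Hq. unfold pair_energy, off_disc. cbn [fst snd]. destruct (q =? p)%nat; [|rewrite (H0 q n) by auto]; ring.
    - intros q Hq. cbn [fst snd]. unfold pair_energy, off_disc, rel_center. cbn [fst snd].
      destruct (Nat.eqb_spec q p) as [->|Hqp].
      + exists 0. intros L _. apply Rle_trans with (lsumR (fun _ : Z * Z => 0) L); [|rewrite lsumR_const; lra].
        apply lsumR_le. intros x _. rewrite Cmult_0_l, Cmult_0_r, Cmod_0. lra.
      + specialize (Hg p q Hp Hq ltac:(auto)). pose proof (Hr p Hp) as Hrp. pose proof (Hr q Hq) as Hrq.
        set (X := (o p - o q)%C) in *. set (d := Cmod X) in *.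
        destruct (ratio_bounds (rho p) (rho q) d) as [Hb1 [Hb2 Hb3]]; try lra.
        destruct (chi_fixed X) as [D [HD HDX]]; [fold d; lra|].
        set (al := rho q / d) in *. set (th := rho p / (d - rho q)) in *.
        set (K := A * A * D * hbound 0 d * 2 / (1 - al) ^ 2).
        pose proof (hbound_pos 0 d ltac:(lra)) as Hh. fold d in HDX.
        assert (Hal2 : 0 < (1 - al) ^ 2) by (apply pow_lt; lra).
        exists (K * (4 * / (1 - th) ^ 3)).
        set (Gr := fun mn : Z * Z => (A * A * D * hbound 0 d * ((INR (Z.abs_nat (fst mn)) + 1) * (rho p / d) ^ Z.abs_nat (fst mn)))
           * ((INR (Z.abs_nat (snd mn)) + 1) * (nbc (Z.abs_nat (fst mn)) (Z.abs_nat (snd mn)) * al ^ Z.abs_nat (snd mn)))).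
        assert (HGr : bsum Gr (K * (4 * / (1 - th) ^ 3))).
        { apply bsum_prod with (fun m => K * ((INR (Z.abs_nat m) + 1) ^ 2 * th ^ Z.abs_nat m)).
          - intros [m n]. unfold Gr; cbn [fst snd]. pose proof (nbc_pos (Z.abs_nat m) (Z.abs_nat n)).
            pose proof (pos_INR (Z.abs_nat m)). pose proof (pos_INR (Z.abs_nat n)). pos_tac.
          - intros m. unfold Gr; cbn [fst snd]. set (m0 := Z.abs_nat m). pose proof (pos_INR m0).
            eapply bsum_weaken; [apply bsum_scal; [|apply (bsum_Z_row m0 al Hb1)]|].
            + pos_tac.
            + right. unfold K. rewrite <- Hb3. fold al. unfold Rdiv at 3. rewrite Rpow_mult_distr, pow_inv.
              assert (0 < (1 - al) ^ m0) by (apply pow_lt; lra).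
              change ((1 - al) ^ S (S m0)) with ((1 - al) * ((1 - al) * (1 - al) ^ m0)). field. lra.
          - apply bsum_scal; [unfold K; pos_tac|]. apply bsum_Z_poly_geom. lra. }
        apply (bsum_inj Gr (fun nm : Z * Z => (snd nm, fst nm))) in HGr; [|intros [u1 u2] [v1 v2] Euv; cbn in Euv; congruence].
        eapply bsum_le; [|exact HGr]. intros [n m]. unfold Gr; cbn [fst snd].
        rewrite !Cmod_mult, Cmod_conj. set (m0 := Z.abs_nat m). set (n0 := Z.abs_nat n).
        pose proof (H p m Hp) as Hpm. fold m0 in Hpm. pose proof (H q n Hq) as Hqn. fold n0 in Hqn.
        assert (Hchi : Cmod (chi (n - m) X) <= D * hbound (0 + m0 + n0) d) by (apply HDX; lia).
        pose proof (INR_fact_lt_0 m0); pose proof (INR_fact_lt_0 n0); pose proof (pos_INR m0); pose proof (pos_INR n0).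
        apply Rle_trans with (A * ((INR m0 + 1) * ((rho p / 2) ^ m0 / INR (fact m0))) *
          (A * ((INR n0 + 1) * ((rho q / 2) ^ n0 / INR (fact n0))) * (D * hbound (0 + m0 + n0) d))).
        * apply Rmult_le_compat; auto using Cmod_ge_0.
          -- apply Rmult_le_pos; apply Cmod_ge_0.
          -- apply Rmult_le_compat; auto using Cmod_ge_0.
        * right.
          transitivity (A * A * D * (INR m0 + 1) * (INR n0 + 1) * ((hbound (0 + m0 + n0) d * ((rho q / 2) ^ n0 / INR (fact n0))) * ((rho p / 2) ^ m0 / INR (fact m0)))); [ring|].
          rewrite hbound_term by lra. fold al.
          transitivity (A * A * D * (INR m0 + 1) * (INR n0 + 1) * ((hbound (0 + m0) d * ((rho p / 2) ^ m0 / INR (fact m0))) * (nbc (0 + m0) n0 * al ^ n0))); [ring|].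
          rewrite hbound_term by lra. rewrite (nbc_sym 0 m0), nbc_0_r. simpl (0 + m0)%nat. ring. }
  destruct Hs as [B HB]. exists B.
  apply (bsum_inj _ (fun mj : Z * idx => (snd mj, fst mj))) in HB; [|intros [u1 u2] [v1 v2] Euv; cbn in Euv; congruence].
  exact HB.
Qed.

(** * Energy identity, far field and uniqueness *)

Lemma Cconj_mult_self (z : C) : (Cconj z * z)%C = RtoC (Cmod z ^ 2).
Proof.
  unfold Cmod. rewrite pow2_sqrt by nra. destruct z. unfold Cconj, Cmult, RtoC; simpl. f_equal; ring.
Qed.

(** The coefficient of the outgoing wave of order l after all multipoles have been moved to the
    origin by the addition theorem. *)
Definition far_coef (c : idx -> C) (o : nat -> C) (l : Z) : C :=
  tsum (fun j : idx => c j * psi (snd j - l) (- o (fst j)))%C.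

Lemma psi_sum_bound R0 n w : Cmod w <= R0 ->
  bsum (fun l => Cmod (psi (n - l) w)) (2 * (exp (R0 ^ 2 / 4) * exp (R0 / 2))).
Proof.
  intros Hw. pose proof (Cmod_ge_0 w).
  assert (He : forall a b, a <= b -> exp a <= exp b).
  { intros a b Hab. destruct (Req_dec a b) as [->|]; [lra|left; apply exp_increasing; lra]. }
  apply (bsum_inj (fun l => Cmod (psi l w)) (fun l => (n - l)%Z)); [intros; lia|].
  apply bsum_Z_abs with (fun l => exp (R0 ^ 2 / 4) * (/ INR (fact l) * (R0 / 2) ^ l)).
  - intros; apply Cmod_ge_0.
  - intros l. eapply Rle_trans; [apply psi_bound|].
    pose proof (INR_fact_lt_0 (Z.abs_nat l)). apply Rmult_le_compat; [pos_tac|pos_tac| |].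
    + apply He. apply Rmult_le_compat_r; [lra|]. apply pow_incr; lra.
    + unfold Rdiv at 1. rewrite Rmult_comm. apply Rmult_le_compat_l; [pos_tac|]. apply pow_incr; lra.
  - apply bsum_scal; [left; apply exp_pos|]. apply exp_bsum. lra.
Qed.

(* Positivity of the imaginary part of the single layer form: it is the squared norm of the
   far field, whose Fourier coefficients are the [far_coef c o l]. *)
Lemma far_coef_zero M o rho dl c : geometry M o rho dl -> multipole_coefs M rho c ->
  (forall p m, (p < M)%nat ->
    let e := (Cconj (c (p, m)) * mult_exp (off_disc c p) m (rel_center o rho p))%C in
    (RtoC (2 * Cmod (c (p, m)) ^ 2) + e + Cconj e)%C = RtoC 0) ->
  forall l, far_coef c o l = RtoC 0.
Proof.
  intros HG Hc He. assert (HG' := HG). destruct HG' as [Hd [Hr Hg]]. assert (Hc' := Hc). destruct Hc' as [H0 [A [HA H]]].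
  pose proof (multipole_coefs_summable M rho c Hr Hc) as Hcs.
  pose proof (pair_energy_summable M o rho dl c HG Hc) as HE.
  set (E := pair_energy c o rho) in *.
  set (e := fun i => tsum (fun j => E (i, j))).
  assert (Hei : forall i, (RtoC (2 * Cmod (c i) ^ 2) + e i + Cconj (e i))%C = RtoC 0).
  { intros [p m]. destruct (lt_dec p M) as [Hp|Hp].
    - rewrite <- (He p m Hp).
      replace (e (p, m)) with (Cconj (c (p, m)) * mult_exp (off_disc c p) m (rel_center o rho p))%C; auto.
      unfold e, E, pair_energy, mult_exp. cbn [fst snd]. rewrite tsum_scal; auto.
      apply (mult_exp_summable M rho); auto using off_disc_coefs.
      intros q Hq. eapply rel_center_gap; eauto.
    - assert (Hz : e (p, m) = RtoC 0).
      { unfold e, E, pair_energy. cbn [fst snd]. rewrite H0 by lia.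
        rewrite (tsum_ext _ (fun _ => RtoC 0)); [apply tsum_0|]. intros; rewrite Cconj_RtoC; ring. }
      rewrite Hz, H0 by lia. rewrite Cmod_0, Cconj_RtoC, <- !RtoC_plus. f_equal. ring. }
  (* On a single disc the kernel is psi_(n-m)(0), which is 1 for n = m and 0 otherwise; hence the
     diagonal part 2 |c|^2. *)
  set (Dg := fun ij : idx * idx => if excluded_middle_informative (snd ij = fst ij) then RtoC (2 * Cmod (c (fst ij)) ^ 2) else RtoC 0).
  assert (HDg : summable Dg).
  { destruct Hcs as [B HB]. pose proof (bsum_nonneg _ _ HB) as HB0.
    apply summable_prod with (G := fun ij => Cmod (Dg ij)) (g := fun i => 2 * B * Cmod (c i)) (Bd := 2 * B * B).
    - intros; apply Rle_refl.
    - intros i. pose proof (Cmod_ge_0 (c i)). apply bsum_single with i.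
      + pos_tac.
      + unfold Dg; cbn [fst snd]. destruct (excluded_middle_informative (i = i)); [|congruence].
        rewrite Cmod_R, Rabs_pos_eq by pos_tac. pose proof (bsum_point _ _ i HB) as Hi. simpl in Hi. nra.
      + intros j Hj. unfold Dg; cbn [fst snd]. destruct (excluded_middle_informative (j = i)); [contradiction|].
        rewrite Cmod_0; lra.
    - apply bsum_scal; [pos_tac|auto]. }
  set (E' := fun ij : idx * idx => Cconj (E (snd ij, fst ij))).
  assert (HE' : summable E') by (apply summable_conj, (summable_swap E), HE).
  (* Twice the form with J in place of H: by [chi_herm] it is the sum of the diagonal part, the
     energy and its Hermitian transpose, and the hypothesis makes its total vanish. *)
  set (H2 := fun ij : idx * idx => (2 * (Cconj (c (fst ij)) * c (snd ij) * psi (snd (snd ij) - snd (fst ij)) (o (fst (fst ij)) - o (fst (snd ij)))))%C).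
  assert (EH2 : forall ij, H2 ij = (Dg ij + (E ij + E' ij))%C).
  { intros [[p m] [q n]]. unfold H2, Dg, E', E, pair_energy, off_disc, rel_center. cbn [fst snd].
    rewrite (Nat.eqb_sym p q). destruct (Nat.eqb_spec q p) as [->|Hqp].
    - rewrite !Cmult_0_l, !Cmult_0_r, Cconj_RtoC.
      replace (o p - o p)%C with (RtoC 0) by ring.
      match goal with |- context [excluded_middle_informative ?P] => destruct (excluded_middle_informative P) as [Heq|Hne] end;
        [injection Heq as ->|].
      + rewrite Z.sub_diag, psi_0_0, RtoC_mult, <- Cconj_mult_self. ring.
      + rewrite psi_n_0; [ring|]. intros Hnm. apply Hne. f_equal. lia.
    - match goal with |- context [excluded_middle_informative ?P] => destruct (excluded_middle_informative P) as [Heq|_] end;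
        [exfalso; apply Hqp; congruence|].
      rewrite !Cmult_conj, Cconj_conj.
      pose proof (chi_herm (n - m) (o p - o q)) as Hh.
      replace (- (n - m))%Z with (m - n)%Z in Hh by lia. replace (- (o p - o q))%C with (o q - o p)%C in Hh by ring.
      transitivity (Cconj (c (p, m)) * c (q, n) * (chi (n - m) (o p - o q) + Cconj (chi (m - n) (o q - o p))))%C; [rewrite Hh; ring|ring]. }
  assert (Hs2 : summable H2).
  { apply summable_ext with (fun ij => Dg ij + (E ij + E' ij))%C; [intros; now rewrite EH2|].
    apply summable_plus; auto. now apply summable_plus. }
  assert (HQ : tsum H2 = RtoC 0).
  { rewrite (tsum_ext _ _ EH2), tsum_plus, tsum_plus; auto; [|now apply summable_plus].
    rewrite (tsum_fubini _ HDg), (tsum_fubini _ HE).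
    assert (EE' : tsum E' = Cconj (tsum E)).
    { unfold E'. rewrite (tsum_conj (fun ij : idx * idx => E (snd ij, fst ij))) by (now apply (summable_swap E)).
      f_equal. apply (tsum_bij E (fun x : idx * idx => (snd x, fst x)) (fun x : idx * idx => (snd x, fst x))); auto; intros []; auto. }
    rewrite EE', (tsum_fubini _ HE). fold e.
    assert (Hes : summable e) by (now apply summable_outer).
    rewrite <- (tsum_conj e Hes).
    rewrite (tsum_ext (fun i => tsum (fun j => Dg (i, j))) (fun i => RtoC (2 * Cmod (c i) ^ 2))).
    2:{ intros i. rewrite (tsum_single _ i).
        - unfold Dg; cbn [fst snd]. destruct (excluded_middle_informative (i = i)); congruence.
        - intros j Hj. unfold Dg; cbn [fst snd]. destruct (excluded_middle_informative (j = i)); [contradiction|auto]. }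
    rewrite <- tsum_plus, <- tsum_plus; auto using summable_conj.
    - rewrite (tsum_ext _ (fun _ => RtoC 0)); [apply tsum_0|].
      intros i. rewrite <- (Hei i). ring.
    - apply summable_ext with (fun i => (- (1)) * (e i + Cconj (e i)))%C.
      + intros i. specialize (Hei i). rewrite <- (Cplus_0_l (_ * _)), <- Hei at 1. ring.
      + apply summable_scal, summable_plus; auto. now apply summable_conj.
    - apply summable_plus; auto. now apply summable_conj. }
  destruct (finite_bound M (fun p B => Cmod (o p) <= B)) as [R0 [HR0 Ho]].
  { intros; lra. } { intros p _. exists (Cmod (o p)). lra. }
  destruct (psi_bounded R0) as [D [HD Hpsi]].
  set (Bp := 2 * (exp (R0 ^ 2 / 4) * exp (R0 / 2))).
  assert (HBp : 0 < Bp) by (unfold Bp; pos_tac).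
  set (H3 := fun (ij : idx * idx) (l : Z) => ((Cconj (c (fst ij)) * Cconj (psi (snd (fst ij) - l) (- o (fst (fst ij)))))
     * (c (snd ij) * psi (snd (snd ij) - l) (- o (fst (snd ij)))))%C).
  assert (Hs3 : summable (fun x => H3 (fst x) (snd x))).
  { destruct Hcs as [B HB]. pose proof (bsum_nonneg _ _ HB) as HB0.
    apply summable_prod with (G := fun x => Cmod (H3 (fst x) (snd x)))
      (g := fun ij : idx * idx => Cmod (c (fst ij)) * (D * Bp * Cmod (c (snd ij)))) (Bd := D * Bp * B * B).
    - intros; apply Rle_refl.
    - intros [[p m] [q n]]. unfold H3; cbn [fst snd].
      pose proof (Cmod_ge_0 (c (p, m))). pose proof (Cmod_ge_0 (c (q, n))).
      destruct (lt_dec p M) as [Hp|Hp]; [destruct (lt_dec q M) as [Hq|Hq]|].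
      + apply bsum_le with (fun l => (Cmod (c (p, m)) * (D * Cmod (c (q, n)))) * Cmod (psi (n - l) (- o q))).
        * intros l. rewrite !Cmod_mult, !Cmod_conj.
          assert (Cmod (psi (m - l) (- o p)) <= D) by (apply Hpsi; rewrite Cmod_opp; auto).
          pose proof (Cmod_ge_0 (psi (n - l) (- o q))).
          replace (Cmod (c (p, m)) * (D * Cmod (c (q, n))) * Cmod (psi (n - l) (- o q)))
            with (Cmod (c (p, m)) * D * (Cmod (c (q, n)) * Cmod (psi (n - l) (- o q)))) by ring.
          apply Rmult_le_compat_r; [pos_tac|]. apply Rmult_le_compat_l; auto.
        * replace (Cmod (c (p, m)) * (D * Bp * Cmod (c (q, n)))) with ((Cmod (c (p, m)) * (D * Cmod (c (q, n)))) * Bp) by ring.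
          apply bsum_scal; [pos_tac|]. apply psi_sum_bound. rewrite Cmod_opp; auto.
      + intros L _. rewrite (H0 q n) by lia. apply Rle_trans with (lsumR (fun _ : Z => 0) L).
        * apply lsumR_le. intros l _. rewrite Cmult_0_l, Cmult_0_r, Cmod_0. apply Rle_refl.
        * rewrite lsumR_const, Cmod_0, ?Rmult_0_r, ?Rmult_0_l. lra.
      + intros L _. rewrite (H0 p) by lia. apply Rle_trans with (lsumR (fun _ : Z => 0) L).
        * apply lsumR_le. intros l _. rewrite Cconj_RtoC, !Cmult_0_l, Cmod_0. lra.
        * rewrite lsumR_const, Cmod_0, ?Rmult_0_r, ?Rmult_0_l. lra.
    - apply bsum_prod with (fun i => D * Bp * B * Cmod (c i)).
      + intros [i j]. cbn [fst snd]. pos_tac.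
      + intros i. cbn [fst snd]. replace (D * Bp * B * Cmod (c i)) with (Cmod (c i) * (D * Bp * B)) by ring.
        apply bsum_scal; [apply Cmod_ge_0|]. apply bsum_scal; [pos_tac|auto].
      + apply bsum_scal; [pos_tac|auto]. }
  (* The addition theorem for J factors the kernel through the origin. This exhibits the form as a
     Gram form, with the far field coefficients as components. *)
  assert (E3 : forall ij, tsum (fun l => H3 ij l) = (/ 2 * H2 ij)%C).
  { intros [[p m] [q n]]. unfold H3, H2. cbn [fst snd].
    transitivity (Cconj (c (p, m)) * c (q, n) * psi (n - m) (- o q + o p))%C.
    2:{ replace (- o q + o p)%C with (o p - o q)%C by ring. field. }
    rewrite <- (psi_graf (n - m) (- o q) (o p)).
    destruct (psi_bounded (Cmod (o q) + Cmod (o p))) as [D' [HD' HB']].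
    assert (Hsum : summable (fun k => psi (n - m - k) (- o q) * psi k (o p))%C).
    { exists (D' * (2 * (exp (Cmod (o p) ^ 2 / 4) * exp (Cmod (o p) / 2)))).
      pose proof (psi_sum_bound (Cmod (o p)) 0 (o p) (Rle_refl _)) as Hb.
      apply (bsum_inj _ Z.opp) in Hb; [|intros; lia].
      eapply bsum_le; [|apply (bsum_scal _ D' _ ltac:(lra) Hb)]. intros k. cbv beta.
      replace (0 - - k)%Z with k by lia. rewrite Cmod_mult. apply Rmult_le_compat_r; [apply Cmod_ge_0|].
      apply HB'. rewrite Cmod_opp. pose proof (Cmod_ge_0 (o p)). lra. }
    rewrite <- tsum_scal; auto.
    rewrite <- (tsum_bij (fun k => Cconj (c (p, m)) * c (q, n) * (psi (n - m - k) (- o q) * psi k (o p)))%C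
      (fun l => (l - m)%Z) (fun k => (k + m)%Z)).
    - apply tsum_ext. intros l. rewrite psi_conj.
      replace (- (m - l))%Z with (l - m)%Z by lia. replace (- - o p)%C with (o p) by ring.
      replace (n - m - (l - m))%Z with (n - l)%Z by lia. ring.
    - intros; lia.
    - intros; lia.
    - now apply summable_scal. }
  assert (Hl : forall l, tsum (fun ij => H3 ij l) = RtoC (Cmod (far_coef c o l) ^ 2)).
  { intros l. rewrite <- Cconj_mult_self. unfold far_coef.
    assert (Hsl : summable (fun j : idx => c j * psi (snd j - l) (- o (fst j)))%C).
    { destruct Hcs as [B HB]. exists (D * B). eapply bsum_le; [|apply (bsum_scal _ D B ltac:(lra) HB)].
      intros [q n]. cbn [fst snd]. rewrite Cmod_mult, Rmult_comm.
      destruct (lt_dec q M).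
      - apply Rmult_le_compat_r; [apply Cmod_ge_0|]. apply Hpsi. rewrite Cmod_opp; auto.
      - rewrite H0 by lia. rewrite Cmod_0. lra. }
    rewrite <- tsum_conj by auto.
    rewrite <- (tsum_mult_prod (fun j : idx => Cconj (c j * psi (snd j - l) (- o (fst j)))) (fun j : idx => c j * psi (snd j - l) (- o (fst j)))%C);
      auto using summable_conj.
    apply tsum_ext. intros [i j]. unfold H3. cbn [fst snd]. now rewrite Cmult_conj. }
  assert (Hzero : tsum (fun l => RtoC (Cmod (far_coef c o l) ^ 2)) = RtoC 0).
  { rewrite <- (tsum_ext _ _ Hl). rewrite <- (tsum_fubini_swap H3 Hs3).
    rewrite (tsum_ext _ _ E3), tsum_scal, HQ by auto. ring. }
  assert (Hsumm : summable (fun l => RtoC (Cmod (far_coef c o l) ^ 2))).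
  { apply summable_ext with (fun l => tsum (fun ij => H3 ij l)); [apply Hl|].
    apply (summable_outer (fun x : Z * (idx * idx) => H3 (snd x) (fst x))).
    apply (summable_swap (fun x => H3 (fst x) (snd x)) Hs3). }
  intros l. apply Cmod_eq_0.
  pose proof (tsum_nonneg_zero (fun l => Cmod (far_coef c o l) ^ 2) (fun l => pow2_ge_0 _) Hsumm Hzero l) as Hz.
  cbv beta in Hz. apply Rsqr_0_uniq. unfold Rsqr. simpl in Hz. lra.
Qed.

(** The vanishing of one field at a point says little. With all order shifts included, every
    coefficient of the local expansion at x vanishes, and the property spreads to a
    neighbourhood. *)
Definition vanishes_at (c : idx -> C) (o : nat -> C) (x : C) : Prop :=
  forall m, mult_exp c m (fun q => x - o q)%C = RtoC 0.

Lemma mult_exp_ext c m (X Y : nat -> C) : (forall q, X q = Y q) -> mult_exp c m X = mult_exp c m Y.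
Proof. intros H. unfold mult_exp. apply tsum_ext. intros j. now rewrite H. Qed.

Lemma vanishes_far M o rho c x : multipole_coefs M rho c -> (forall q, (q < M)%nat -> 0 < rho q) ->
  (forall l, far_coef c o l = RtoC 0) ->
  (forall q, (q < M)%nat -> rho q + Cmod (o q) < Cmod x) -> vanishes_at c o x.
Proof.
  intros Hc Hr HF Hx m.
  assert (HXV : forall q, (q < M)%nat -> rho q + Cmod ((fun q => - o q)%C q) < Cmod ((fun _ => x) q)).
  { intros q Hq. rewrite Cmod_opp. auto. }
  pose proof (multipole_summable M rho c (fun _ => x) (fun q => - o q)%C m Hc Hr HXV) as Hs.
  rewrite (mult_exp_ext c m _ (fun q => (fun _ => x) q + (fun q => - o q) q)%C) by (intros; ring).
  rewrite (mult_exp_shift M rho c _ _ m Hc Hr HXV).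
  set (F := fun jl : idx * Z => (c (fst jl) * (chi (snd (fst jl) - m - snd jl) x * psi (snd jl) (- o (fst (fst jl)))))%C) in *.
  (* The new second index i = n - l is the order of the outgoing wave about the origin, so that
     summing over j first produces [far_coef c o i]. *)
  rewrite <- (tsum_bij F (fun ji : idx * Z => (fst ji, snd (fst ji) - snd ji)%Z) (fun jl : idx * Z => (fst jl, snd (fst jl) - snd jl)%Z)).
  2:{ intros [[q n] l]. cbn [fst snd]. f_equal. lia. }
  2:{ intros [[q n] l]. cbn [fst snd]. f_equal. lia. }
  2:{ exact Hs. }
  set (Fs := fun ji : idx * Z => F (fst ji, (snd (fst ji) - snd ji)%Z)).
  assert (HFs : summable Fs).
  { apply (summable_inj F (fun ji : idx * Z => (fst ji, (snd (fst ji) - snd ji)%Z))); auto.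
    intros [[q n] l] [[q' n'] l'] E. cbn [fst snd] in E. injection E as -> -> E. f_equal. lia. }
  change (tsum Fs = RtoC 0). rewrite (tsum_fubini Fs HFs).
  rewrite (tsum_fubini_swap (fun j i => Fs (j, i))).
  2:{ eapply summable_ext; [|exact HFs]. intros []; auto. }
  rewrite (tsum_ext _ (fun _ => RtoC 0)); [apply tsum_0|]. intros i.
  transitivity (tsum (fun j : idx => chi (i - m) x * (c j * psi (snd j - i) (- o (fst j))))%C).
  - apply tsum_ext. intros [q n]. unfold Fs, F. cbn [fst snd].
    replace (n - m - (n - i))%Z with (i - m)%Z by lia. ring.
  - rewrite tsum_scal.
    + fold (far_coef c o i). rewrite HF. ring.
    + destruct (finite_bound M (fun p B => Cmod (o p) <= B)) as [R0 [HR0 Ho]].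
      { intros; lra. } { intros p _. exists (Cmod (o p)). lra. }
      destruct (psi_bounded R0) as [D [HD Hpsi]].
      destruct (multipole_coefs_summable M rho c Hr Hc) as [B HB]. exists (D * B).
      eapply bsum_le; [|apply (bsum_scal _ D B ltac:(lra) HB)].
      intros [q n]. cbn [fst snd]. rewrite Cmod_mult, Rmult_comm.
      destruct (lt_dec q M).
      * apply Rmult_le_compat_r; [apply Cmod_ge_0|]. apply Hpsi. rewrite Cmod_opp; auto.
      * destruct Hc as [H0 _]. rewrite H0 by lia. rewrite Cmod_0. lra.
Qed.

(** Moving the observation point by a common v expands the field in regular waves [psi l v], whose
    coefficients are the shifted fields at the old point. *)
Lemma mult_exp_reexpand M rho c (X : nat -> C) v m : multipole_coefs M rho c ->
  (forall q, (q < M)%nat -> 0 < rho q) ->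
  (forall q, (q < M)%nat -> rho q + Cmod v < Cmod (X q)) ->
  mult_exp c m (fun q => X q + v)%C = tsum (fun l => psi l v * mult_exp c (m + l) X)%C
  /\ summable (fun l => psi l v * mult_exp c (m + l) X)%C.
Proof.
  intros Hc Hr HXV. pose proof (multipole_summable M rho c X (fun _ => v) m Hc Hr HXV) as Hs.
  assert (E : forall l, tsum (fun j : idx => c j * (chi (snd j - m - l) (X (fst j)) * psi l v))%C
    = (psi l v * mult_exp c (m + l) X)%C).
  { intros l. unfold mult_exp. rewrite <- tsum_scal.
    - apply tsum_ext. intros j. replace (snd j - m - l)%Z with (snd j - (m + l))%Z by lia. ring.
    - apply (mult_exp_summable M rho); auto. intros q Hq. specialize (HXV q Hq). pose proof (Cmod_ge_0 v). lra. }
  split.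
  - rewrite (mult_exp_shift M rho c X (fun _ => v) m Hc Hr HXV).
    transitivity (tsum (fun j : idx => tsum (fun l => c j * (chi (snd j - m - l) (X (fst j)) * psi l v)))%C).
    + exact (tsum_fubini _ Hs).
    + rewrite (tsum_fubini_swap (fun (j : idx) l => c j * (chi (snd j - m - l) (X (fst j)) * psi l v))%C Hs).
      apply tsum_ext. exact E.
  - eapply summable_ext; [exact E|].
    apply (summable_outer (fun x : Z * idx => c (snd x) * (chi (snd (snd x) - m - fst x) (X (fst (snd x))) * psi (fst x) v))%C).
    apply (summable_swap _ Hs).
Qed.

Lemma vanishes_step M o rho c x y : multipole_coefs M rho c -> (forall q, (q < M)%nat -> 0 < rho q) ->
  (forall q, (q < M)%nat -> rho q + Cmod (y - x) < Cmod (x - o q)) ->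
  vanishes_at c o x -> vanishes_at c o y.
Proof.
  intros Hc Hr Hq Hx m.
  rewrite (mult_exp_ext c m _ (fun q => (fun q => x - o q) q + (y - x))%C) by (intros; ring).
  rewrite (proj1 (mult_exp_reexpand M rho c (fun q => x - o q)%C (y - x) m Hc Hr Hq)).
  rewrite (tsum_ext _ (fun _ => RtoC 0)); [apply tsum_0|]. intros l. rewrite Hx. ring.
Qed.

(** A Lipschitz path is cut into N equal parts with L/N < d, each of which is one admissible
    step. *)
Lemma path_propagation (P : C -> Prop) (g : R -> C) L d : 0 < d -> 0 <= L ->
  (forall s t, 0 <= s <= 1 -> 0 <= t <= 1 -> Cmod (g s - g t) <= L * Rabs (s - t)) ->
  (forall s t, 0 <= s <= 1 -> 0 <= t <= 1 -> Cmod (g t - g s) < d -> P (g s) -> P (g t)) ->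
  P (g 0) -> P (g 1).
Proof.
  intros Hd HL Hlip Hstep H0.
  destruct (INR_unbounded (L / d)) as [N HN].
  assert (HN0 : 0 < INR N) by (assert (0 <= L / d) by pos_tac; lra).
  assert (H : forall i, (i <= N)%nat -> P (g (INR i / INR N))).
  { induction i as [|i IH]; intros Hi.
    - simpl. unfold Rdiv. now rewrite Rmult_0_l.
    - assert (Hr : forall j, (j <= N)%nat -> 0 <= INR j / INR N <= 1).
      { intros j Hj. apply le_INR in Hj. pose proof (pos_INR j). split; [pos_tac|].
        apply Rmult_le_reg_r with (INR N); auto. unfold Rdiv. rewrite Rmult_assoc, Rinv_l; lra. }
      apply (Hstep (INR i / INR N)); [apply Hr; lia|apply Hr; lia| |apply IH; lia].
      eapply Rle_lt_trans; [apply Hlip; apply Hr; lia|].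
      replace (INR (S i) / INR N - INR i / INR N) with (/ INR N) by (rewrite S_INR; field; lra).
      rewrite Rabs_pos_eq by (left; now apply Rinv_0_lt_compat).
      apply Rmult_lt_reg_r with (INR N); auto. rewrite Rmult_assoc, Rinv_l, Rmult_1_r by lra.
      apply Rmult_lt_reg_r with (/ d); [now apply Rinv_0_lt_compat|].
      replace (d * INR N * / d) with (INR N) by (field; lra). exact HN. }
  specialize (H N (le_n _)). replace (INR N / INR N) with 1 in H by (field; lra). exact H.
Qed.

Lemma polar_form (z : C) : exists th, z = (Cmod z * cis th)%C.
Proof.
  destruct (Ceq_dec z 0) as [->|Hz].
  - exists 0. rewrite Cmod_0. ring.
  - assert (Hr : 0 < Cmod z) by (now apply Cmod_gt_0).
    destruct z as [x y]. set (r := Cmod (x, y)) in *.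
    assert (E : r * r = x * x + y * y).
    { unfold r, Cmod. simpl. rewrite sqrt_sqrt by nra. ring. }
    assert (Ex : -1 <= x / r <= 1).
    { pose proof (Rabs_fst_Cmod (x, y)) as H. simpl in H. fold r in H.
      apply Rabs_le_between in H.
      split; apply Rmult_le_reg_r with r; auto; unfold Rdiv; rewrite Rmult_assoc, Rinv_l; lra. }
    assert (Es : r * sqrt (1 - (x / r)²) = Rabs y).
    { replace (1 - (x / r)²) with ((y / r)²).
      2:{ unfold Rsqr. transitivity ((r * r - x * x) / (r * r)); [replace (r * r - x * x) with (y * y) by lra|]; field; lra. }
      rewrite sqrt_Rsqr_abs. unfold Rdiv. rewrite Rabs_mult, (Rabs_pos_eq (/ r)) by (left; now apply Rinv_0_lt_compat). field. lra. }
    destruct (Rle_dec 0 y) as [Hy|Hy].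
    + exists (acos (x / r)). unfold cis. rewrite cos_acos, sin_acos by auto.
      unfold RtoC, Cmult; simpl. f_equal; [field; lra|]. rewrite Es, Rabs_pos_eq by auto. ring.
    + exists (- acos (x / r)). unfold cis. rewrite cos_neg, sin_neg, cos_acos, sin_acos by auto.
      unfold RtoC, Cmult; simpl. f_equal; [field; lra|].
      rewrite Ropp_mult_distr_r_reverse, Es, Rabs_left by lra. ring.
Qed.

Lemma cis_lipschitz a b : Cmod (cis a - cis b) <= 2 * Rabs (a - b).
Proof.
  pose proof (Cmod_Cder_bound (fun t : R => cis (b + t * (a - b))) (fun t => Ci * RtoC (a - b) * cis (b + t * (a - b)))%C (Rabs (a - b))) as H.
  cbv beta in H. replace (b + 1 * (a - b)) with a in H by ring. replace (b + 0 * (a - b)) with b in H by ring.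
  apply H.
  - intros t _. apply (Cder_cis (fun t : R => b + t * (a - b)) t). auto_derive; auto. ring.
  - intros t _. rewrite !Cmod_mult, Cmod_Ci, Cmod_R, Cmod_cis. lra.
Qed.

(* Analytic continuation from infinity: the field vanishes along any chain of small steps in the
   exterior of the discs; a path meeting a disc is rerouted around its circle. *)
Lemma vanishes_on_circle M o rho dl c q th : geometry M o rho dl -> multipole_coefs M rho c ->
  (forall l, far_coef c o l = RtoC 0) -> (q < M)%nat ->
  vanishes_at c o (o q + (rho q + dl)%R * cis th)%C.
Proof.
  intros [Hd [Hr Hg]] Hc HF Hq.
  set (circ := fun p => forall th, vanishes_at c o (o p + (rho p + dl)%R * cis th)%C).
  (* Inside an enlarged disc the field is not under control, so the property there is replaced by
     vanishing on the whole surrounding circle. In this form it can be carried along a straight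
     segment that crosses discs. *)
  set (P := fun x => ((forall p, (p < M)%nat -> rho p + dl <= Cmod (x - o p)) -> vanishes_at c o x)
    /\ (forall p, (p < M)%nat -> Cmod (x - o p) <= rho p + dl -> circ p)).
  assert (Hcirc_out : forall p th p', (p < M)%nat -> (p' < M)%nat ->
    rho p' + dl <= Cmod (o p + (rho p + dl)%R * cis th - o p')).
  { intros p t p' Hp Hp'. pose proof (Hr p Hp). destruct (Nat.eq_dec p p') as [->|Hne].
    - replace (o p' + (rho p' + dl)%R * cis t - o p')%C with ((rho p' + dl)%R * cis t)%C by ring.
      rewrite Cmod_mult, Cmod_cis, Cmod_R, Rabs_pos_eq by lra. lra.
    - specialize (Hg p p' Hp Hp' Hne).
      pose proof (Cmod_tri_sub (o p) (o p + (rho p + dl)%R * cis t) (o p')) as Ht.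
      replace (o p - (o p + (rho p + dl)%R * cis t))%C with (- ((rho p + dl)%R * cis t))%C in Ht by ring.
      rewrite Cmod_opp, Cmod_mult, Cmod_cis, Cmod_R, Rabs_pos_eq in Ht by lra. lra. }
  assert (Hrot : forall p t0, (p < M)%nat -> vanishes_at c o (o p + (rho p + dl)%R * cis t0)%C -> circ p).
  { intros p t0 Hp Hv t. pose proof (Hr p Hp).
    set (g := fun s : R => (o p + (rho p + dl)%R * cis (t0 + s * (t - t0)))%C).
    replace (o p + (rho p + dl)%R * cis t)%C with (g 1) by (unfold g; do 3 f_equal; ring).
    apply (path_propagation (vanishes_at c o) g ((rho p + dl) * (2 * Rabs (t - t0))) dl Hd).
    - pose proof (Rabs_pos (t - t0)). pos_tac.
    - intros s u _ _. unfold g.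
      replace (o p + (rho p + dl)%R * cis (t0 + s * (t - t0)) - (o p + (rho p + dl)%R * cis (t0 + u * (t - t0))))%C
        with ((rho p + dl)%R * (cis (t0 + s * (t - t0)) - cis (t0 + u * (t - t0))))%C by ring.
      rewrite Cmod_mult, Cmod_R, Rabs_pos_eq by lra. rewrite Rmult_assoc. apply Rmult_le_compat_l; [lra|].
      eapply Rle_trans; [apply cis_lipschitz|].
      replace (t0 + s * (t - t0) - (t0 + u * (t - t0))) with ((t - t0) * (s - u)) by ring.
      rewrite Rabs_mult. lra.
    - intros s u _ _ Hsu. apply (vanishes_step M o rho); auto.
      intros p' Hp'. pose proof (Hcirc_out p (t0 + s * (t - t0)) p' Hp Hp'). fold (g s) in H0. lra.
    - unfold g. replace (t0 + 0 * (t - t0)) with t0 by ring. exact Hv. }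
  (* The radial projection to the enlarged circle, used when the segment enters or leaves a disc. *)
  assert (Hproj : forall p x, (p < M)%nat -> exists t, Cmod (x - (o p + (rho p + dl)%R * cis t)) = Rabs (Cmod (x - o p) - (rho p + dl))).
  { intros p x Hp. destruct (polar_form (x - o p)) as [t Ht]. exists t.
    replace (x - (o p + (rho p + dl)%R * cis t))%C with ((x - o p) - (rho p + dl)%R * cis t)%C by ring.
    rewrite Ht at 1. replace (Cmod (x - o p) * cis t - (rho p + dl)%R * cis t)%C with (RtoC (Cmod (x - o p) - (rho p + dl)) * cis t)%C
      by (rewrite RtoC_minus; ring).
    rewrite Cmod_mult, Cmod_cis, Cmod_R. ring. }
  assert (Hstep : forall x y, Cmod (y - x) < dl / 2 -> P x -> P y).
  { intros x y Hxy [Hx1 Hx2]. split.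
    - intros Hy. destruct (excluded_middle_informative (forall p, (p < M)%nat -> rho p + dl <= Cmod (x - o p))) as [Hx|Hx].
      + apply (vanishes_step M o rho c x y Hc Hr); [|now apply Hx1].
        intros p Hp. specialize (Hx p Hp). lra.
      + apply not_all_ex_not in Hx as [p Hx]. apply imply_to_and in Hx as [Hp Hx].
        assert (Hcp : circ p) by (apply Hx2; auto; lra).
        destruct (Hproj p y Hp) as [t Ht].
        pose proof (Cmod_tri_sub y x (o p)) as Htri. specialize (Hy p Hp).
        rewrite Rabs_pos_eq in Ht by lra.
        apply (vanishes_step M o rho c (o p + (rho p + dl)%R * cis t) y Hc Hr); [|apply Hcp].
        intros p' Hp'. pose proof (Hcirc_out p t p' Hp Hp'). rewrite Ht. lra.
    - intros p Hp Hy. destruct (Rle_dec (Cmod (x - o p)) (rho p + dl)) as [Hx|Hx]; [now apply Hx2|].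
      pose proof (Cmod_tri_sub x y (o p)) as Htri. rewrite (Cmod_sym x y) in Htri.
      assert (Hvx : vanishes_at c o x).
      { apply Hx1. intros p' Hp'. destruct (Nat.eq_dec p p') as [->|Hne]; [lra|].
        specialize (Hg p p' Hp Hp' Hne). pose proof (Cmod_tri_sub (o p) x (o p')) as Ht2.
        rewrite (Cmod_sym (o p) x) in Ht2. lra. }
      destruct (Hproj p x Hp) as [t Ht]. rewrite Rabs_pos_eq in Ht by lra.
      apply (Hrot p t Hp). apply (vanishes_step M o rho c x _ Hc Hr); auto.
      intros p' Hp'. rewrite (Cmod_sym _ x), Ht. destruct (Nat.eq_dec p p') as [<-|Hne]; [lra|].
      specialize (Hg p p' Hp Hp' Hne). pose proof (Cmod_tri_sub (o p) x (o p')) as Ht2.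
      rewrite (Cmod_sym (o p) x) in Ht2. lra. }
  destruct (finite_bound M (fun p B => rho p + dl + Cmod (o p) < B)) as [R0 [HR0 HR]].
  { intros; lra. } { intros p _. exists (rho p + dl + Cmod (o p) + 1). lra. }
  assert (HP0 : P (RtoC R0)).
  { split.
    - intros _. apply (vanishes_far M o rho); auto. intros p Hp. rewrite Cmod_R, Rabs_pos_eq by lra.
      specialize (HR p Hp). lra.
    - intros p Hp Hx. exfalso. specialize (HR p Hp).
      pose proof (Cmod_triangle (R0 - o p) (o p)) as Ht. replace (R0 - o p + o p)%C with (RtoC R0) in Ht by ring.
      rewrite Cmod_R, Rabs_pos_eq in Ht by lra. lra. }
  (* The segment ends at the centre of disc q, where the second half of [P] is the desired
     conclusion. *)
  assert (HPq : P (o q)).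
  { set (g := fun s : R => (R0 + s * (o q - R0))%C).
    replace (o q) with (g 1) by (unfold g; ring).
    apply (path_propagation P g (Cmod (o q - R0)) (dl / 2)); [lra|apply Cmod_ge_0| | |].
    - intros s t _ _. unfold g. replace (R0 + s * (o q - R0) - (R0 + t * (o q - R0)))%C with ((o q - R0) * RtoC (s - t))%C by (rewrite RtoC_minus; ring).
      rewrite Cmod_mult, Cmod_R. lra.
    - intros s t _ _. apply Hstep.
    - unfold g. replace (R0 + 0 * (o q - R0))%C with (RtoC R0) by ring. exact HP0. }
  apply (proj2 HPq q Hq). replace (o q - o q)%C with (RtoC 0) by ring.
  rewrite Cmod_0. specialize (Hr q Hq). lra.
Qed.

Lemma hbound_unbounded r B : 0 < r -> exists l, B < hbound l r / (8 * (INR l + 1)) /\ forall l', (l <= l')%nat -> B < hbound l' r / (8 * (INR l' + 1)).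
Proof.
  intros Hr. destruct (INR_unbounded (8 * Rabs B * exp (2 * r))) as [l Hl].
  assert (H : forall l', (l <= l')%nat -> B < hbound l' r / (8 * (INR l' + 1))).
  { intros l' Hl'. pose proof (pos_INR l'). pose proof (pow_fact_le_exp (2 * r) l' ltac:(lra)) as Hp.
    pose proof (exp_pos (2 * r)) as He. pose proof (Rle_abs B). pose proof (Rabs_pos B).
    assert (Hh : 4 ^ l' <= hbound l' r * exp (2 * r)).
    { unfold hbound. replace 4 with (2 * r * (2 / r)) by (field; lra). rewrite Rpow_mult_distr.
      replace (INR (fact l') * (2 / r) ^ l' * exp (2 * r)) with (INR (fact l') * exp (2 * r) * (2 / r) ^ l') by ring.
      apply Rmult_le_compat_r; [pos_tac|auto]. }
    replace (4 ^ l') with (2 ^ l' * 2 ^ l') in Hh by (rewrite <- Rpow_mult_distr; f_equal; ring).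
    pose proof (pow2_ge_S l') as H2. apply le_INR in Hl'.
    apply Rmult_lt_reg_r with (8 * (INR l' + 1) * exp (2 * r)); [pos_tac|].
    replace (hbound l' r / (8 * (INR l' + 1)) * (8 * (INR l' + 1) * exp (2 * r))) with (hbound l' r * exp (2 * r)) by (field; lra).
    eapply Rlt_le_trans; [|exact Hh].
    apply Rle_lt_trans with ((8 * Rabs B * exp (2 * r)) * (INR l' + 1)).
    - replace (B * (8 * (INR l' + 1) * exp (2 * r))) with (8 * B * exp (2 * r) * (INR l' + 1)) by ring.
      apply Rmult_le_compat_r; [lra|]. apply Rmult_le_compat_r; lra.
    - assert (0 <= 8 * Rabs B * exp (2 * r)) by pos_tac. apply Rle_lt_trans with ((8 * Rabs B * exp (2 * r)) * 2 ^ l').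
      + apply Rmult_le_compat_l; auto.
      + apply Rmult_lt_compat_r; [apply pow_lt; lra|lra]. }
  exists l. split; auto.
Qed.

Lemma multipole_coefs_zero M o rho dl c : geometry M o rho dl -> multipole_coefs M rho c ->
  (forall l, far_coef c o l = RtoC 0) -> forall j, c j = RtoC 0.
Proof.
  intros HG Hc HF [q n]. assert (HG' := HG). destruct HG' as [Hd [Hr Hg]].
  destruct (lt_dec q M) as [Hq|Hq]; [|destruct Hc as [H0 _]; apply H0; lia].
  set (r := rho q + dl). assert (Hr0 : 0 < r) by (specialize (Hr q Hq); unfold r; lra).
  set (d := fun i => mult_exp (off_disc c q) i (rel_center o rho q)).
  pose proof (off_disc_coefs M rho c q Hc) as Hoc.
  set (cq := fun j : idx => if (fst j =? q)%nat then c j else RtoC 0).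
  (* On the circle of radius r around o_q, [g m l] is the l-th Fourier coefficient of the m-th
     shifted field: an outgoing part from disc q and a regular part from the other discs. *)
  set (g := fun m l => (c (q, m + l)%Z * chi l (RtoC r) + d (m + l)%Z * psi l (RtoC r))%C).
  assert (Hcond : forall th p, (p < M)%nat -> p <> q -> rho p + Cmod (r * cis th) < Cmod (o q - o p)).
  { intros th p Hp Hpq. rewrite Cmod_mult, Cmod_cis, Cmod_R, Rabs_pos_eq by lra.
    specialize (Hg q p Hq Hp ltac:(auto)). unfold r. lra. }
  (* The disc q is moved away so that the gap condition holds for every index; its coefficients vanish. *)
  set (X := fun p => if (p =? q)%nat then RtoC (rho q + r + 1) else (o q - o p)%C).
  assert (HX : forall th p, (p < M)%nat -> rho p + Cmod (r * cis th) < Cmod (X p)).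
  { intros th p Hp. unfold X. destruct (Nat.eqb_spec p q) as [->|Hpq]; auto.
    rewrite Cmod_mult, Cmod_cis, !Cmod_R, !Rabs_pos_eq; try lra. specialize (Hr q Hp). lra. }
  assert (HdX : forall i, mult_exp (off_disc c q) i X = d i).
  { intros i. unfold d, mult_exp. apply tsum_ext. intros [p k]. unfold off_disc, X, rel_center. cbn [fst snd].
    destruct (p =? q)%nat; [ring|auto]. }
  assert (Hsumm : forall m th, summable (fun l => g m l * cis (IZR l * th))%C /\
     tsum (fun l => g m l * cis (IZR l * th))%C = RtoC 0).
  { intros m th. set (w := (r * cis th)%C).
    assert (Hw : Cmod w = r) by (unfold w; rewrite Cmod_mult, Cmod_cis, Cmod_R, Rabs_pos_eq; lra).
    pose proof (vanishes_on_circle M o rho dl c q th HG Hc HF Hq m) as Hv. fold r in Hv.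
    destruct (mult_exp_reexpand M rho (off_disc c q) X w m Hoc Hr (HX th)) as [E1 S1].
    assert (HXs : forall p, (p < M)%nat -> rho p < Cmod (X p + w)).
    { intros p Hp. pose proof (HX th p Hp) as H1. fold w in H1.
      pose proof (Cmod_line_lower (X p) w 1 ltac:(lra)) as H2. replace (X p + 1 * w)%C with (X p + w)%C in H2 by ring. lra. }
    pose proof (mult_exp_summable M rho (off_disc c q) (fun p => X p + w)%C m Hoc Hr HXs) as S2.
    assert (Hcq : multipole_coefs M rho cq).
    { destruct Hc as [H0 [A [HA H]]]. split.
      - intros p k Hp. unfold cq; cbn [fst]. destruct (p =? q)%nat; auto.
      - exists A. split; auto. intros p k Hp. unfold cq; cbn [fst]. destruct (p =? q)%nat; auto.
        rewrite Cmod_0. eapply Rle_trans; [apply Cmod_ge_0|apply (H p k Hp)]. }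
    (* Only index q carries a nonzero coefficient; the other values merely satisfy the gap
       condition. *)
    set (Y := fun p : nat => if (p =? q)%nat then w else RtoC (rho p + 1)).
    assert (HY : forall p, (p < M)%nat -> rho p < Cmod (Y p)).
    { intros p Hp. unfold Y. destruct (Nat.eqb_spec p q) as [->|Hpq].
      - rewrite Hw. unfold r. lra.
      - specialize (Hr p Hp). rewrite Cmod_R, Rabs_pos_eq; lra. }
    pose proof (mult_exp_summable M rho cq Y m Hcq Hr HY) as S3.
    assert (Esplit : (mult_exp cq m Y + mult_exp (off_disc c q) m (fun p => X p + w)%C)%C = RtoC 0).
    { rewrite <- Hv. unfold mult_exp. rewrite <- tsum_plus; auto.
      apply tsum_ext. intros [p k]. unfold cq, off_disc, Y, X. cbn [fst snd].
      destruct (Nat.eqb_spec p q) as [->|Hpq].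
      - replace (o q + r * cis th - o q)%C with w by (unfold w; ring). ring.
      - replace (o q - o p + w)%C with (o q + r * cis th - o p)%C by (unfold w; ring). ring. }
    rewrite E1 in Esplit.
    set (h := fun l => (c (q, m + l)%Z * chi l w)%C).
    assert (Sh : summable h /\ tsum h = mult_exp cq m Y).
    { assert (Hq' : forall l, h l = (fun j : idx => cq j * chi (snd j - m) (Y (fst j)))%C (q, (m + l)%Z)).
      { intros l. unfold h, cq, Y; cbn [fst snd]. rewrite Nat.eqb_refl. replace (m + l - m)%Z with l by lia. auto. }
      split.
      - eapply summable_ext; [intros l; symmetry; apply Hq'|].
        apply (summable_inj (fun j : idx => cq j * chi (snd j - m) (Y (fst j)))%C (fun l => (q, (m + l)%Z))); auto.
        intros x y [=]. lia.
      - unfold mult_exp. rewrite (tsum_ext _ _ Hq').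
        transitivity (tsum (fun p : nat => tsum (fun k => cq (p, k) * chi (k - m) (Y p)))%C); [|symmetry; exact (tsum_fubini _ S3)].
        rewrite (tsum_single (fun p : nat => tsum (fun k => cq (p, k) * chi (k - m) (Y p)))%C q).
        + apply (tsum_bij (fun b => cq (q, b) * chi (snd (q, b) - m) (Y (fst (q, b))))%C (fun l => (m + l)%Z) (fun k => (k - m)%Z)).
          * intros; lia.
          * intros; lia.
          * now apply (summable_row (fun j : idx => cq j * chi (snd j - m) (Y (fst j)))%C q).
        + intros p Hp. rewrite (tsum_ext _ (fun _ => RtoC 0)); [apply tsum_0|].
          intros k. unfold cq; cbn [fst snd]. destruct (Nat.eqb_spec p q); [contradiction|ring]. }
    destruct Sh as [Sh Eh].
    assert (Eg : forall l, (h l + psi l w * mult_exp (off_disc c q) (m + l) X)%C = (g m l * cis (IZR l * th))%C).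
    { intros l. unfold h, g, w. rewrite HdX. unfold chi, psi. rewrite !cyl_rot. ring. }
    split.
    - eapply summable_ext; [exact Eg|]. now apply summable_plus.
    - rewrite <- (tsum_ext _ _ Eg), tsum_plus, Eh; auto. }
  assert (Hg0 : forall m l, g m l = RtoC 0).
  { intros m l. assert (Hs : summable (g m)).
    { destruct (Hsumm m 0) as [Hs _]. eapply summable_ext; [|exact Hs]. intros x. cbv beta. rewrite Rmult_0_r, cis_0. ring. }
    pose proof (CRInt_fourier (g m) (fun _ => RtoC 0) l 0 Hs (fun t => eq_sym (proj2 (Hsumm m t)))) as HI.
    assert (H0 : CRInt (fun t => RtoC 0 * cis (- IZR l * t))%C 0 (0 + 2 * PI) (RtoC 0)).
    { apply CRInt_ext with (fun _ => RtoC 0); [intros; ring|].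
      apply CRInt_pair; simpl; apply is_RInt_const_eq; ring. }
    pose proof (CRInt_unique _ _ _ _ _ HI H0) as E.
    assert (H2 : (2 * PI)%C <> 0).
    { rewrite <- RtoC_mult. intros E'. apply RtoC_inj in E'. pose proof PI_RGT_0. lra. }
    destruct (Ceq_dec (g m l) 0) as [|Hn]; auto. exfalso. now apply (Cmult_neq_0 _ _ H2 Hn). }
  (* Choosing the shift m = n - l keeps the coefficient c_n, and with it d_n, while the order l runs
     through all integers. *)
  assert (Hall : forall l, (c (q, n) * chi l (RtoC r) + d n * psi l (RtoC r))%C = RtoC 0).
  { intros l. pose proof (Hg0 (n - l)%Z l) as H. unfold g in H. replace (n - l + l)%Z with n in H by lia. exact H. }
  destruct (Ceq_dec (c (q, n)) 0) as [|Hn]; auto. exfalso.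
  assert (Hcn : 0 < Cmod (c (q, n))) by (now apply Cmod_gt_0).
  destruct (psi_bounded r) as [D [HD Hpsi]].
  destruct (chi_lower r Hr0) as [n0 Hlow].
  pose proof (Cmod_ge_0 (d n)).
  destruct (hbound_unbounded r (Cmod (d n) * D / Cmod (c (q, n))) Hr0) as [l [_ Hl]].
  set (L := (n0 + l)%nat). specialize (Hl L ltac:(lia)).
  specialize (Hlow (Z.of_nat L)). rewrite Zabs2Nat.id in Hlow.
  specialize (Hlow ltac:(lia) (RtoC r) ltac:(rewrite Cmod_R, Rabs_pos_eq; lra)).
  specialize (Hall (Z.of_nat L)).
  assert (Heq : Cmod (c (q, n)) * Cmod (chi (Z.of_nat L) (RtoC r)) = Cmod (d n) * Cmod (psi (Z.of_nat L) (RtoC r))).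
  { rewrite <- !Cmod_mult. rewrite <- (Cmod_opp (d n * _)). f_equal.
    transitivity (c (q, n) * chi (Z.of_nat L) r + d n * psi (Z.of_nat L) r - d n * psi (Z.of_nat L) r)%C; [ring|].
    rewrite Hall. ring. }
  assert (Hp : Cmod (psi (Z.of_nat L) (RtoC r)) <= D) by (apply Hpsi; rewrite Cmod_R, Rabs_pos_eq; lra).
  assert (Cmod (d n) * D < Cmod (c (q, n)) * Cmod (chi (Z.of_nat L) (RtoC r))).
  { apply Rlt_le_trans with (Cmod (c (q, n)) * (hbound L r / (8 * (INR L + 1)))).
    - apply Rmult_lt_reg_r with (/ Cmod (c (q, n))); [now apply Rinv_0_lt_compat|].
      replace (Cmod (c (q, n)) * (hbound L r / (8 * (INR L + 1))) * / Cmod (c (q, n))) with (hbound L r / (8 * (INR L + 1))).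
      + exact Hl.
      + pose proof (pos_INR L). field. lra.
    - apply Rmult_le_compat_l; lra. }
  rewrite Heq in H0.
  assert (Cmod (d n) * Cmod (psi (Z.of_nat L) (RtoC r)) <= Cmod (d n) * D) by (apply Rmult_le_compat_l; lra).
  lra.
Qed.

(** * Stability of the truncated systems *)

(** The condition [k <= th k] stands for tending to infinity; it is stable under composition, as the
    diagonal argument requires. *)
Lemma bounded_subsequence (u : nat -> R) B : (forall k, Rabs (u k) <= B) ->
  exists th : nat -> nat, (forall k, (k <= th k)%nat) /\ exists l : R, is_lim_seq (fun k => u (th k)) l.
Proof.
  intros HB.
  destruct (Bolzano_Weierstrass u (fun x => - B <= x <= B)) as [l Hl].
  - apply compact_P3.
  - intros n. apply Rabs_le_between, HB.
  - assert (H : forall k : nat, exists p : nat, (k <= p)%nat /\ Rabs (u p - l) < / (INR k + 1)).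
    { intros k. pose proof (pos_INR k).
      destruct (Hl (fun x => Rabs (x - l) < / (INR k + 1)) k) as [p [Hp1 Hp2]].
      - assert (Hd : 0 < / (INR k + 1)) by (apply Rinv_0_lt_compat; lra).
        exists (mkposreal _ Hd). intros x Hx. unfold disc in Hx. exact Hx.
      - exists p. auto. }
    apply choice in H as [th Hth]. exists th. split; [apply Hth|]. exists l.
    apply is_lim_seq_spec. intros [eps He]. simpl.
    destruct (INR_unbounded (/ eps)) as [N HN]. exists N. intros n Hn.
    destruct (Hth n) as [_ H]. eapply Rlt_le_trans; [exact H|].
    apply le_INR in Hn. pose proof (Rinv_0_lt_compat _ He).
    rewrite <- (Rinv_inv eps). apply Rinv_le_contravar; lra.
Qed.

Lemma diagonal_subsequence (u : nat -> nat -> R) (B : nat -> R) : (forall k i, Rabs (u k i) <= B i) ->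
  exists phi : nat -> nat, (forall k, (k <= phi k)%nat) /\
    forall i, exists l : R, is_lim_seq (fun k => u (phi k) i) l.
Proof.
  intros HB.
  assert (H : forall ip : nat * (nat -> nat), exists th : nat -> nat, (forall k, (k <= th k)%nat) /\
    exists l : R, is_lim_seq (fun k => u (snd ip (th k)) (fst ip)) l).
  { intros [i p]. cbn [fst snd]. apply bounded_subsequence with (u := fun k => u (p k) i) (B := B i). intros; apply HB. }
  apply choice in H as [th Hth].
  set (psi := fix psi (i : nat) : nat -> nat :=
    match i with O => fun k => k | S i' => fun k => psi i' (th (i', psi i') k) end).
  assert (Hge : forall i k, (k <= psi i k)%nat).
  { induction i as [|i IH]; intros k; cbn [psi]; [lia|].
    eapply Nat.le_trans; [apply (proj1 (Hth (i, psi i)))|apply IH]. }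
  (* Every later stage consists of terms of stage i at positions that are no smaller, so the
     diagonal eventually inherits each coordinate limit. *)
  assert (Hsub : forall d i k, exists j, (k <= j)%nat /\ psi (d + i)%nat k = psi i j).
  { induction d as [|d IH]; intros i k; [exists k; auto|].
    cbn [Nat.add psi]. destruct (IH i (th ((d + i)%nat, psi (d + i)%nat) k)) as [j [Hj E]].
    exists j. split; auto. eapply Nat.le_trans; [apply (proj1 (Hth ((d + i)%nat, psi (d + i)%nat)))|exact Hj]. }
  exists (fun k => psi k k). split; [intros; apply Hge|].
  intros i. destruct (Hth (i, psi i)) as [_ [l Hl]]. cbn [fst snd] in Hl. exists l.
  apply is_lim_seq_spec. intros eps. destruct (proj2 (is_lim_seq_spec _ _) Hl eps) as [N HN].
  exists (N + S i)%nat. intros n Hn.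
  destruct (Hsub (n - S i)%nat (S i) n) as [j [Hj E]].
  replace (n - S i + S i)%nat with n in E by lia. rewrite E. cbn [psi]. apply HN. lia.
Qed.

(** Even codes give nonnegative and odd codes nonpositive integers; 0 has two codes, which a mere
    enumeration tolerates. *)
Definition Z_of_code (b : nat) : Z :=
  if Nat.even b then Z.of_nat (Nat.div2 b) else (- Z.of_nat (Nat.div2 b))%Z.

Lemma Z_of_code_surj z : exists b, Z_of_code b = z.
Proof.
  unfold Z_of_code. destruct (Z_le_dec 0 z).
  - exists (2 * Z.to_nat z)%nat. rewrite Nat.even_even, Nat.div2_double. lia.
  - exists (S (2 * Z.to_nat (- z))). rewrite Nat.even_succ, Nat.odd_even, Nat.div2_succ_double. lia.
Qed.

Lemma idx_enumeration : exists e : nat -> idx, forall j, exists n, e n = j.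
Proof.
  exists (fun n => (fst (of_nat n), Z_of_code (snd (of_nat n)))).
  intros [q z]. destruct (Z_of_code_surj z) as [b Hb].
  exists (to_nat (q, b)). rewrite cancel_of_to. cbn [fst snd]. now rewrite Hb.
Qed.

Lemma idx_diagonal (y : nat -> idx -> C) (w : idx -> R) : (forall k i, Cmod (y k i) <= w i) ->
  exists (phi : nat -> nat) (z : idx -> C), (forall k, (k <= phi k)%nat) /\
    forall i, is_lim_seq (fun k => Cmod (y (phi k) i - z i)) 0.
Proof.
  intros Hy. destruct idx_enumeration as [e He].
  (* Real and imaginary parts are interleaved at even and odd positions, so one diagonal argument
     handles both. *)
  destruct (diagonal_subsequence
    (fun k n => if Nat.even n then fst (y k (e (Nat.div2 n))) else snd (y k (e (Nat.div2 n))))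
    (fun n => w (e (Nat.div2 n)))) as [phi [Hphi Hl]].
  { intros k n. eapply Rle_trans; [|apply (Hy k)]. destruct (Nat.even n); [apply Rabs_fst_Cmod|apply Rabs_snd_Cmod]. }
  exists phi.
  assert (H : forall i, exists z : C, is_lim_seq (fun k => Cmod (y (phi k) i - z)) 0).
  { intros i. destruct (He i) as [n Hn].
    destruct (Hl (2 * n)%nat) as [l1 H1]. destruct (Hl (S (2 * n))) as [l2 H2].
    rewrite Nat.even_even, Nat.div2_double, Hn in H1.
    rewrite Nat.even_succ, Nat.odd_even, Nat.div2_succ_double, Hn in H2.
    exists (l1, l2).
    assert (H1' := is_lim_seq_minus' _ _ _ _ H1 (is_lim_seq_const l1)).
    assert (H2' := is_lim_seq_minus' _ _ _ _ H2 (is_lim_seq_const l2)).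
    apply is_lim_seq_abs in H1'. apply is_lim_seq_abs in H2'.
    pose proof (is_lim_seq_plus' _ _ _ _ H1' H2') as H3. simpl in H3.
    replace (Rabs (l1 - l1) + Rabs (l2 - l2)) with 0 in H3.
    2:{ rewrite !Rminus_diag, Rabs_R0. ring. }
    eapply is_lim_seq_le_le; [|apply is_lim_seq_const|exact H3].
    intros k. split; [apply Cmod_ge_0|]. apply (Cmod_le_Rabs (fst (y (phi k) i) - l1) (snd (y (phi k) i) - l2)). }
  apply choice in H as [z Hz]. exists z. split; auto.
Qed.

Definition abs1 (m : Z) : R := INR (Z.abs_nat m) + 1.

Lemma abs1_ge m : 1 <= abs1 m.
Proof. unfold abs1. pose proof (pos_INR (Z.abs_nat m)). lra. Qed.

Definition wt (j : idx) : R := abs1 (snd j).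

Lemma wt_pos j : 1 <= wt j.
Proof. apply abs1_ge. Qed.

Definition apply_mat (A : idx -> idx -> C) (x : idx -> C) (i : idx) : C :=
  tsum (fun j => A i j * x j)%C.

Definition trunc (N : nat) (A : idx -> idx -> C) (i j : idx) : C :=
  if (inZN N (snd i) && inZN N (snd j))%bool then A i j else RtoC 0.

Lemma Cmod_trunc N (A : idx -> idx -> C) i j : Cmod (trunc N A i j) <= Cmod (A i j).
Proof.
  unfold trunc. destruct (_ && _)%bool; [apply Rle_refl|]. rewrite Cmod_0. apply Cmod_ge_0.
Qed.

Lemma inZN_true N m : (Z.abs_nat m <= N)%nat <-> inZN N m = true.
Proof. unfold inZN. rewrite Z.leb_le. lia. Qed.

Lemma apply_mat_summable (A : idx -> idx -> C) (x : idx -> C) (i : idx) B K : 0 <= K -> bsum (fun j => Cmod (A i j) * wt j) B ->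
  (forall j, Cmod (x j) <= K * wt j) -> summable (fun j => A i j * x j)%C.
Proof.
  intros HK HB Hx. exists (K * B). eapply bsum_le; [|apply (bsum_scal _ K _ HK HB)].
  intros j. cbv beta. rewrite Cmod_mult. pose proof (Cmod_ge_0 (A i j)). specialize (Hx j). nra.
Qed.

Lemma apply_mat_bound (A : idx -> idx -> C) (x : idx -> C) (i : idx) B K : 0 <= K -> bsum (fun j => Cmod (A i j) * wt j) B ->
  (forall j, Cmod (x j) <= K * wt j) -> Cmod (apply_mat A x i) <= K * B.
Proof.
  intros HK HB Hx. unfold apply_mat.
  apply Cmod_tsum_le with (fun j => K * (Cmod (A i j) * wt j)); [|now apply bsum_scal].
  intros j. rewrite Cmod_mult. pose proof (Cmod_ge_0 (A i j)). specialize (Hx j). nra.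
Qed.

Lemma trunc_bsum N (A : idx -> idx -> C) (i : idx) B : bsum (fun j => Cmod (A i j) * wt j) B ->
  bsum (fun j => Cmod (trunc N A i j) * wt j) B.
Proof.
  apply bsum_le. intros j. apply Rmult_le_compat_r; [pose proof (wt_pos j); lra|apply Cmod_trunc].
Qed.

Lemma poly_geom_small (K th eps : R) : 0 <= th < 1 -> 0 < eps -> 0 <= K ->
  exists m0 : nat, forall m, (m0 <= m)%nat -> K * (INR m + 1) * th ^ m <= eps.
Proof.
  intros Ht He HK. pose proof (is_lim_seq_poly2_geom th Ht) as H.
  assert (Hd : 0 < eps / (K + 1)) by pos_tac.
  destruct (proj2 (is_lim_seq_spec _ _) H (mkposreal _ Hd)) as [m0 Hm]. exists m0. intros m Hm'.
  specialize (Hm m Hm'). simpl in Hm. pose proof (pos_INR m).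
  rewrite Rminus_0_r, Rabs_pos_eq in Hm by pos_tac.
  apply Rle_trans with ((K + 1) * (eps / (K + 1))); [|right; field; lra].
  rewrite Rmult_assoc. apply Rmult_le_compat; [lra|pos_tac|lra|].
  apply Rle_trans with ((INR m + 1) * (INR m + 2) * th ^ m); [|lra].
  apply Rmult_le_compat_r; [pos_tac|]. nra.
Qed.

(* Uniform stability of the truncated systems, by compactness: a normalised sequence violating it
   converges entrywise along a subsequence to a nonzero element of the kernel, because the decay
   of the rows keeps the maximum of the weighted entries at bounded indices. *)
Lemma truncated_stability (M : nat) (A : idx -> idx -> C) (CA th : R) :
  0 <= th < 1 -> 0 < CA ->
  (forall p m j, (M <= p)%nat -> A (p, m) j = RtoC 0) ->
  (forall p m, (p < M)%nat ->
     bsum (fun j => Cmod (A (p, m) j) * wt j) (CA * wt (p, m) ^ 2 * th ^ Z.abs_nat m)) ->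
  (forall x : idx -> C, (exists K, 0 <= K /\ forall j, Cmod (x j) <= K * wt j) ->
     (forall i, x i + apply_mat A x i = RtoC 0)%C -> forall i, x i = RtoC 0) ->
  exists (K : R) (N0 : nat), 0 < K /\ forall N, (N0 <= N)%nat -> forall (x : idx -> C) eps, 0 <= eps ->
    (exists B, 0 <= B /\ forall j, Cmod (x j) <= B * wt j) ->
    (forall i, Cmod (x i + apply_mat (trunc N A) x i) <= eps * wt i) ->
    forall i, Cmod (x i) <= K * eps * wt i.
Proof.
  intros Hth HCA HA0 HA Hker.
  assert (HArow : forall i, exists B, bsum (fun j => Cmod (A i j) * wt j) B).
  { intros [p m]. destruct (lt_dec p M) as [Hp|Hp]; [eexists; now apply HA|].
    exists 0. intros L _. apply Rle_trans with (lsumR (fun _ : idx => 0) L); [|rewrite lsumR_const; lra].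
    apply lsumR_le. intros j _. rewrite HA0 by lia. rewrite Cmod_0; lra. }
  apply NNPP. intros Hno.
  assert (Hbad : forall k : nat, exists y : idx -> C, exists N : nat, (k <= N)%nat /\
    (forall i, Cmod (y i) <= wt i) /\
    (forall i, Cmod (y i + apply_mat (trunc N A) y i) <= / (INR k + 1) * wt i) /\
    exists i, wt i / 2 <= Cmod (y i)).
  { intros k. pose proof (pos_INR k) as Hk.
    apply NNPP. intros Hk'. apply Hno. exists (INR k + 1), k. split; [lra|].
    intros N HN x eps He [B [HB0 HB]] Hres i.
    apply NNPP. intros Hi. apply Rnot_le_lt in Hi. apply Hk'. clear Hk' Hno.
    pose proof (wt_pos i) as Hwi.
    (* The supremum S is the weighted norm of x. Dividing by it gives norm at most one and, at some
       index, a weighted value of at least one half. *)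
    destruct (completeness (fun r => exists j, r = Cmod (x j) / wt j)) as [S [HS1 HS2]].
    { exists B. intros r [j ->]. pose proof (wt_pos j). apply Rmult_le_reg_r with (wt j); [lra|].
      unfold Rdiv. rewrite Rmult_assoc, Rinv_l, Rmult_1_r by lra. apply HB. }
    { exists (Cmod (x i) / wt i), i. reflexivity. }
    assert (HS : forall j, Cmod (x j) <= S * wt j).
    { intros j. pose proof (wt_pos j). assert (Cmod (x j) / wt j <= S) by (apply HS1; eauto).
      apply Rmult_le_reg_r with (/ wt j); [apply Rinv_0_lt_compat; lra|].
      rewrite Rmult_assoc, Rinv_r, Rmult_1_r by lra. exact H0. }
    assert (HkS : (INR k + 1) * eps < S).
    { apply Rmult_lt_reg_r with (wt i); [lra|]. eapply Rlt_le_trans; [exact Hi|apply HS]. }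
    assert (HS0 : 0 < S) by (assert (0 <= (INR k + 1) * eps) by pos_tac; lra).
    exists (fun j => RtoC (/ S) * x j)%C, N. split; [exact HN|].
    assert (Hmod : forall z : C, Cmod (RtoC (/ S) * z) = Cmod z / S).
    { intros z. rewrite Cmod_mult, Cmod_R, Rabs_pos_eq by (left; now apply Rinv_0_lt_compat). unfold Rdiv; ring. }
    split; [|split].
    - intros j. rewrite Hmod. apply Rmult_le_reg_r with S; auto.
      unfold Rdiv. rewrite Rmult_assoc, Rinv_l, Rmult_1_r by lra. rewrite Rmult_comm. apply HS.
    - intros j. destruct (HArow j) as [Bj HBj].
      replace (RtoC (/ S) * x j + apply_mat (trunc N A) (fun j => RtoC (/ S) * x j) j)%C
        with (RtoC (/ S) * (x j + apply_mat (trunc N A) x j))%C.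
      + rewrite Hmod. apply Rmult_le_reg_r with S; auto.
        unfold Rdiv. rewrite Rmult_assoc, Rinv_l, Rmult_1_r by lra.
        eapply Rle_trans; [apply Hres|]. pose proof (wt_pos j).
        replace (/ (INR k + 1) * wt j * S) with ((/ (INR k + 1) * S) * wt j) by ring.
        apply Rmult_le_compat_r; [lra|]. apply Rmult_le_reg_l with (INR k + 1); [lra|].
        rewrite <- Rmult_assoc, Rinv_r, Rmult_1_l by lra. lra.
      + unfold apply_mat. rewrite Cmult_plus_distr_l. f_equal.
        rewrite <- tsum_scal.
        * apply tsum_ext. intros l. ring.
        * apply (apply_mat_summable (trunc N A) x j Bj B); auto. now apply trunc_bsum.
    - apply NNPP. intros Hn. assert (S <= S / 2); [|lra]. apply HS2. intros r [j ->].
      apply Rnot_lt_le. intros Hj. apply Hn. exists j. rewrite Hmod. pose proof (wt_pos j).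
      apply Rmult_le_reg_r with S; auto. unfold Rdiv at 2. rewrite Rmult_assoc, Rinv_l, Rmult_1_r by lra.
      apply Rmult_lt_compat_r with (r := wt j) in Hj; [|lra].
      unfold Rdiv at 2 in Hj. rewrite Rmult_assoc, Rinv_l, Rmult_1_r in Hj by lra. lra. }
  apply choice in Hbad as [y Hy]. apply choice in Hy as [N HyN].
  destruct (idx_diagonal y wt) as [phi [z [Hphi Hz]]]; [intros; apply HyN|].
  assert (Hzb : forall i, Cmod (z i) <= 1 * wt i).
  { intros i. rewrite Rmult_1_l. apply Cmod_le_eps. intros e He.
    destruct (proj2 (is_lim_seq_spec _ _) (Hz i) (mkposreal e He)) as [n Hn].
    specialize (Hn n (le_n _)). simpl in Hn. rewrite Rminus_0_r, Rabs_pos_eq in Hn by apply Cmod_ge_0.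
    replace (z i) with (y (phi n) i + - (y (phi n) i - z i))%C by ring.
    eapply Rle_trans; [apply Cmod_triangle|]. rewrite Cmod_opp.
    pose proof (proj1 (proj2 (HyN (phi n))) i). lra. }
  assert (Hz0 : forall i, z i = RtoC 0).
  { apply Hker; [exists 1; split; [lra|exact Hzb]|].
    intros i. destruct (HArow i) as [B HB].
    (* Dominated convergence in one row: every fixed entry lies inside the truncation from some
       point on. *)
    assert (Hlim : is_lim_seq (fun k => Cmod (apply_mat (trunc (N (phi k)) A) (y (phi k)) i - apply_mat A z i)) 0).
    { unfold apply_mat.
      apply (bsum_lim (fun j => Cmod (A i j) * wt j) B
        (fun k j => trunc (N (phi k)) A i j * y (phi k) j)%C (fun j => A i j * z j)%C); auto.
      - intros j. pose proof (wt_pos j). pose proof (Cmod_ge_0 (A i j)). apply Rmult_le_pos; lra.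
      - intros k j. rewrite Cmod_mult. apply Rmult_le_compat; try apply Cmod_ge_0; [apply Cmod_trunc|apply HyN].
      - intros j.
        apply is_lim_seq_ext_loc with (fun k => Cmod (A i j) * Cmod (y (phi k) j - z j)).
        + exists (Z.abs_nat (snd i) + Z.abs_nat (snd j))%nat. intros k Hk.
          assert (HN : (k <= N (phi k))%nat) by (eapply Nat.le_trans; [apply Hphi|apply HyN]).
          unfold trunc. rewrite (proj1 (inZN_true _ _)) by lia. rewrite (proj1 (inZN_true _ _)) by lia.
          cbn [andb]. rewrite <- Cmod_mult. f_equal. ring.
        + replace (Finite 0) with (Rbar_mult (Cmod (A i j)) 0) by (simpl; f_equal; ring).
          apply is_lim_seq_scal_l, Hz. }
    apply Cmod_eq_0. apply Rle_antisym; [|apply Cmod_ge_0].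
    assert (Hres : is_lim_seq (fun k => Cmod (y (phi k) i - z i) + Cmod (apply_mat (trunc (N (phi k)) A) (y (phi k)) i - apply_mat A z i)
      + / (INR k + 1) * wt i) (0 + 0 + 0 * wt i)).
    { apply is_lim_seq_plus'; [apply is_lim_seq_plus'; auto|].
      apply is_lim_seq_mult'; [|apply is_lim_seq_const].
      apply is_lim_seq_spec. intros [e He]. simpl. destruct (INR_unbounded (/ e)) as [n Hn].
      exists n. intros k Hk. apply le_INR in Hk. pose proof (pos_INR k). pose proof (Rinv_0_lt_compat _ He).
      rewrite Rminus_0_r, Rabs_pos_eq by (left; apply Rinv_0_lt_compat; lra).
      rewrite <- (Rinv_inv e). apply Rinv_lt_contravar; [apply Rmult_lt_0_compat; lra|lra]. }
    replace (0 + 0 + 0 * wt i) with 0 in Hres by ring.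
    apply (is_lim_seq_le (fun _ => Cmod (z i + apply_mat A z i)) _ (Cmod (z i + apply_mat A z i)) 0) in Hres;
      [exact Hres| |apply is_lim_seq_const].
    intros k. set (t1 := apply_mat (trunc (N (phi k)) A) (y (phi k)) i).
    replace (z i + apply_mat A z i)%C with (- (y (phi k) i - z i) + (- (t1 - apply_mat A z i) + (y (phi k) i + t1)))%C by ring.
    eapply Rle_trans; [apply Cmod_triangle|]. rewrite Cmod_opp, Rplus_assoc. apply Rplus_le_compat_l.
    eapply Rle_trans; [apply Cmod_triangle|]. rewrite Cmod_opp. apply Rplus_le_compat_l.
    eapply Rle_trans; [apply (HyN (phi k))|]. pose proof (wt_pos i). apply Rmult_le_compat_r; [lra|].
    pose proof (Hphi k) as Hp. apply le_INR in Hp. pose proof (pos_INR k). apply Rinv_le_contravar; lra. }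
  (* For |m| >= m0 a row contributes at most 1/8 of the weight, and for k >= 8 so does the residual.
     Their sum is below the value 1/2 of a near-maximal entry, which is therefore confined to the
     finite box [F]. *)
  destruct (poly_geom_small CA th (/ 8) Hth ltac:(lra) ltac:(lra)) as [m0 Hm0].
  set (F := list_prod (seq 0 M) (map (fun n => (Z.of_nat n - Z.of_nat m0)%Z) (seq 0 (S (2 * m0))))).
  assert (Hlow : forall k, (8 <= k)%nat -> / 2 <= lsumR (fun i => Cmod (y k i)) F).
  { intros k Hk. destruct (HyN k) as [HNk [Hyb [Hyr [[p m] Hi]]]].
    pose proof (wt_pos (p, m)) as Hw.
    assert (Hk8 : / (INR k + 1) <= / 8).
    { apply le_INR in Hk. replace (INR 8) with 8 in Hk by (simpl; ring). apply Rinv_le_contravar; lra. }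
    specialize (Hyr (p, m)).
    assert (Hk8' : / (INR k + 1) * wt (p, m) <= / 8 * wt (p, m)) by (apply Rmult_le_compat_r; lra).
    assert (Htri : Cmod (y k (p, m)) <= / 8 * wt (p, m) + Cmod (apply_mat (trunc (N k) A) (y k) (p, m))).
    { replace (y k (p, m)) with ((y k (p, m) + apply_mat (trunc (N k) A) (y k) (p, m)) + - apply_mat (trunc (N k) A) (y k) (p, m))%C by ring.
      eapply Rle_trans; [apply Cmod_triangle|]. rewrite Cmod_opp.
      replace (y k (p, m) + apply_mat (trunc (N k) A) (y k) (p, m) + - apply_mat (trunc (N k) A) (y k) (p, m))%C with (y k (p, m)) by ring.
      lra. }
    assert (Hin : In (p, m) F).
    { apply NNPP. intros Hnin.
      assert (Hsmall : Cmod (apply_mat (trunc (N k) A) (y k) (p, m)) <= / 8 * wt (p, m)); [|lra].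
      destruct (lt_dec p M) as [Hp|Hp].
      - assert (Hm : (m0 <= Z.abs_nat m)%nat).
        { apply Nat.nlt_ge. intros Hlt. apply Hnin. unfold F. apply in_prod_iff. split; [apply in_seq; lia|].
          apply in_map_iff. exists (Z.to_nat (m + Z.of_nat m0)). split; [lia|apply in_seq; lia]. }
        eapply Rle_trans; [apply (apply_mat_bound _ _ _ _ 1 ltac:(lra) (trunc_bsum (N k) A (p, m) _ (HA p m Hp)))|].
        + intros j. rewrite Rmult_1_l. apply Hyb.
        + specialize (Hm0 (Z.abs_nat m) Hm).
          replace (1 * (CA * wt (p, m) ^ 2 * th ^ Z.abs_nat m)) with ((CA * (INR (Z.abs_nat m) + 1) * th ^ Z.abs_nat m) * wt (p, m)).
          * apply Rmult_le_compat_r; lra.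
          * unfold wt, abs1; cbn [snd]. ring.
      - unfold apply_mat. rewrite (tsum_ext _ (fun _ => RtoC 0)).
        + rewrite tsum_0, Cmod_0. lra.
        + intros j. unfold trunc. rewrite HA0 by lia. destruct (_ && _)%bool; ring. }
    apply Rle_trans with (Cmod (y k (p, m))); [lra|].
    replace (Cmod (y k (p, m))) with (lsumR (fun i => Cmod (y k i)) ((p, m) :: nil)) by (unfold lsumR; simpl; ring).
    apply lsumR_incl; [intros; apply Cmod_ge_0|constructor; [easy|constructor]|].
    intros i [<-|[]]. exact Hin. }
  assert (Hlim : is_lim_seq (fun k => lsumR (fun i => Cmod (y (phi k) i)) F) 0).
  { clear - Hz Hz0. induction F as [|i F IH]; unfold lsumR; simpl; [apply is_lim_seq_const|].
    replace (Finite 0) with (Finite (0 + 0)) by (f_equal; ring).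
    apply is_lim_seq_plus'; [|exact IH].
    eapply is_lim_seq_ext; [|apply (Hz i)]. intros k. cbv beta. rewrite Hz0. f_equal. ring. }
  destruct (proj2 (is_lim_seq_spec _ _) Hlim (mkposreal (/ 4) ltac:(lra))) as [n Hn].
  specialize (Hn (n + 8)%nat ltac:(lia)). simpl in Hn. rewrite Rminus_0_r in Hn.
  pose proof (Hlow (phi (n + 8)%nat) ltac:(pose proof (Hphi (n + 8)%nat); lia)).
  rewrite Rabs_pos_eq in Hn by lra. lra.
Qed.

(** * Decay of the matrix and of the data *)

(** Otherwise the point dividing the segment of centres in the ratio a_p : a_q would belong to both
    discs. *)
Lemma disjoint_discs_gap M O a p q : disjoint_closed_discs M O a ->
  (forall p, (p < M)%nat -> 0 < a p) -> (p < M)%nat -> (q < M)%nat -> p <> q ->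
  a p + a q < Cmod (O p - O q).
Proof.
  intros Hd Ha Hp Hq Hpq. apply Rnot_le_lt. intros H.
  pose proof (Ha p Hp). pose proof (Ha q Hq).
  set (t := a p / (a p + a q)).
  assert (Ht : 0 <= t) by (unfold t; pos_tac).
  assert (Ht' : 0 <= 1 - t).
  { replace (1 - t) with (a q / (a p + a q)) by (unfold t; field; lra). pos_tac. }
  apply (Hd p q Hp Hq Hpq (O p + t * (O q - O p))%C). unfold closed_disc. split.
  - replace (O p + t * (O q - O p) - O p)%C with (t * (O q - O p))%C by ring.
    rewrite Cmod_mult, Cmod_R, Rabs_pos_eq, Cmod_sym by auto.
    replace (a p) with (t * (a p + a q)) by (unfold t; field; lra).
    apply Rmult_le_compat_l; auto.
  - replace (O p + t * (O q - O p) - O q)%C with ((1 - t)%R * (O p - O q))%C by (rewrite RtoC_minus; ring).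
    rewrite Cmod_mult, Cmod_R, Rabs_pos_eq by auto.
    replace (a q) with ((1 - t) * (a p + a q)) by (unfold t; field; lra).
    apply Rmult_le_compat_l; auto.
Qed.

(** The asymptotic lower bound covers large orders; each of the finitely many remaining ones
    contributes a constant, because H_m(r) does not vanish there. *)
Lemma chi_lower_uniform r : 0 < r -> (forall m, bJ m r <> 0) ->
  exists A, 0 < A /\ forall m, hbound (Z.abs_nat m) r <= A * (abs1 m * Cmod (chi m (RtoC r))).
Proof.
  intros Hr HJ. destruct (chi_lower r Hr) as [n0 Hn0].
  destruct (finite_bound n0 (fun n A => forall m, Z.abs_nat m = n ->
    hbound (Z.abs_nat m) r <= A * (abs1 m * Cmod (chi m (RtoC r))))) as [A [HA HAm]].
  - intros n A B H HAB m Hm. eapply Rle_trans; [apply (H m Hm)|].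
    apply Rmult_le_compat_r; auto. pose proof (abs1_ge m). pos_tac.
  - intros n _.
    assert (Hm : forall m, exists A, 0 <= A /\ forall B, A <= B ->
      hbound (Z.abs_nat m) r <= B * (abs1 m * Cmod (chi m (RtoC r)))).
    { intros m. pose proof (abs1_ge m).
      assert (Hc : 0 < Cmod (chi m (RtoC r))) by (apply Cmod_gt_0, chi_neq_0, HJ).
      assert (Hh := hbound_pos (Z.abs_nat m) r Hr).
      exists (hbound (Z.abs_nat m) r / (abs1 m * Cmod (chi m (RtoC r)))).
      assert (0 < abs1 m * Cmod (chi m (RtoC r))) by pos_tac.
      split; [pos_tac|]. intros B HB.
      apply Rle_trans with (hbound (Z.abs_nat m) r / (abs1 m * Cmod (chi m (RtoC r))) * (abs1 m * Cmod (chi m (RtoC r)))).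
      - right; field. split; lra.
      - apply Rmult_le_compat_r; lra. }
    destruct (Hm (Z.of_nat n)) as [A [HA0 HA]]. destruct (Hm (- Z.of_nat n)%Z) as [B [HB0 HB]].
    exists (A + B). intros m Hmn. destruct (Z_le_dec 0 m).
    + replace m with (Z.of_nat n) by lia. apply HA; lra.
    + replace m with (- Z.of_nat n)%Z by lia. apply HB; lra.
  - exists (A + 8). split; [lra|]. intros m. pose proof (abs1_ge m). pose proof (Cmod_ge_0 (chi m (RtoC r))).
    assert (0 <= abs1 m * Cmod (chi m (RtoC r))) by pos_tac.
    destruct (lt_dec (Z.abs_nat m) n0) as [Hl|Hl].
    + specialize (HAm (Z.abs_nat m) Hl m eq_refl). lra.
    + specialize (Hn0 m ltac:(lia) (RtoC r) ltac:(rewrite Cmod_R, Rabs_pos_eq; lra)). fold (abs1 m) in Hn0.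
      apply Rmult_le_compat_r with (r := 8 * abs1 m) in Hn0; [|lra].
      unfold Rdiv in Hn0. rewrite Rmult_assoc, Rinv_l, Rmult_1_r in Hn0 by lra. nra.
Qed.

Lemma hbound_ratio n r d : 0 < r -> 0 < d -> hbound n d = hbound n r * (r / d) ^ n.
Proof.
  intros Hr Hd. unfold hbound. rewrite Rmult_assoc, <- Rpow_mult_distr. do 2 f_equal. field. lra.
Qed.

Lemma inv_chi_bound A h w c : 0 < h -> 0 < A -> 0 < Cmod c -> h <= A * (w * Cmod c) -> / Cmod c <= A * w / h.
Proof.
  intros Hh HA Hc H. apply Rmult_le_reg_r with (h * Cmod c); [pos_tac|].
  replace (/ Cmod c * (h * Cmod c)) with h by (field; lra).
  replace (A * w / h * (h * Cmod c)) with (A * (w * Cmod c)) by (field; lra). exact H.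
Qed.

Lemma mpe_A_bound k O a p q : 0 < k -> 0 < a p -> 0 < a q -> p <> q ->
  a p + a q < Cmod (O p - O q) -> (forall m, bJ m (k * a p) <> 0) ->
  exists C, 0 < C /\ forall m n, Cmod (mpe_A k O a p q m n)
    <= C * (abs1 m * (a p / Cmod (O p - O q)) ^ Z.abs_nat m
       * (nbc (Z.abs_nat m) (Z.abs_nat n) * (a q / Cmod (O p - O q)) ^ Z.abs_nat n)).
Proof.
  intros Hk Hp Hq Hpq Hg HJ. set (d := Cmod (O p - O q)) in *.
  assert (Hkd : Cmod (k * (O p - O q)) = k * d) by (rewrite Cmod_mult, Cmod_R, Rabs_pos_eq by lra; reflexivity).
  destruct (chi_fixed (k * (O p - O q))) as [D [HD HD']]; [rewrite Hkd; apply Rmult_lt_0_compat; lra|].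
  rewrite Hkd in HD'.
  destruct (psi_fixed (RtoC (k * a q))) as [E [HE HE']].
  assert (0 < k * a p) by pos_tac. assert (0 < k * a q) by pos_tac.
  assert (Hkd0 : 0 < k * d) by (apply Rmult_lt_0_compat; lra).
  rewrite Cmod_R, Rabs_pos_eq in HE' by lra.
  destruct (chi_lower_uniform (k * a p) ltac:(auto) HJ) as [A [HA HA']].
  pose proof (sqrt_lt_R0 _ Hp). pose proof (sqrt_lt_R0 _ Hq).
  exists (sqrt (a q) / sqrt (a p) * (D * E * A)). split; [pos_tac|].
  intros m n. rewrite mpe_A_off by auto.
  pose proof (chi_neq_0 m _ (HJ m)) as Hc0.
  rewrite Cmod_mult, Cmod_R, Rabs_pos_eq by pos_tac. rewrite Rmult_assoc. apply Rmult_le_compat_l; [pos_tac|].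
  rewrite Cmod_div, Cmod_mult by auto.
  specialize (HD' (n - m)%Z (Z.abs_nat m + Z.abs_nat n)%nat ltac:(lia)).
  specialize (HE' n). rewrite psi_RtoC in HE'. specialize (HA' m).
  apply Cmod_gt_0 in Hc0.
  apply inv_chi_bound in HA'; auto; [|now apply hbound_pos].
  apply Rle_trans with ((D * hbound (Z.abs_nat m + Z.abs_nat n) (k * d))
    * (E * ((k * a q / 2) ^ Z.abs_nat n / INR (fact (Z.abs_nat n)))) * (A * abs1 m / hbound (Z.abs_nat m) (k * a p))).
  - unfold Rdiv at 1. pose proof (Rinv_0_lt_compat _ Hc0).
    apply Rmult_le_compat; [pos_tac|lra| |exact HA'].
    apply Rmult_le_compat; try apply Cmod_ge_0; auto.
  - replace (D * hbound (Z.abs_nat m + Z.abs_nat n) (k * d) * (E * ((k * a q / 2) ^ Z.abs_nat n / INR (fact (Z.abs_nat n)))))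
      with (D * E * (hbound (Z.abs_nat m + Z.abs_nat n) (k * d) * ((k * a q / 2) ^ Z.abs_nat n / INR (fact (Z.abs_nat n))))) by ring.
    rewrite hbound_term by auto. rewrite (hbound_ratio _ (k * a p) (k * d)) by auto.
    replace (k * a q / (k * d)) with (a q / d) by (field; lra).
    replace (k * a p / (k * d)) with (a p / d) by (field; lra).
    pose proof (hbound_pos (Z.abs_nat m) (k * a p) ltac:(auto)). right. field. lra.
Qed.

Lemma mpe_A_row k O a p q sg : 0 < k -> 0 < a p -> 0 < a q -> p <> q ->
  a p + a q < Cmod (O p - O q) -> (forall m, bJ m (k * a p) <> 0) ->
  a p / (Cmod (O p - O q) - a q) <= sg ->
  exists C, 0 < C /\ forall m, bsum (fun n => Cmod (mpe_A k O a p q m n) * abs1 n)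
    (C * (abs1 m ^ 2 * sg ^ Z.abs_nat m)).
Proof.
  intros Hk Hp Hq Hpq Hg HJ Hsg. destruct (mpe_A_bound k O a p q) as [C [HC H]]; auto.
  set (d := Cmod (O p - O q)) in *.
  destruct (ratio_bounds (a p) (a q) d) as [Hb [Hr He]]; auto.
  set (be := a q / d) in *. set (al := a p / d) in *.
  assert (Hal : 0 <= al) by (unfold al; pos_tac).
  exists (C * (2 / (1 - be) ^ 2)). assert (0 < (1 - be) ^ 2) by (apply pow_lt; lra). split; [pos_tac|].
  intros m. pose proof (abs1_ge m).
  apply bsum_le with (fun n => C * (abs1 m * al ^ Z.abs_nat m)
    * ((INR (Z.abs_nat n) + 1) * (nbc (Z.abs_nat m) (Z.abs_nat n) * be ^ Z.abs_nat n))).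
  { intros n. pose proof (abs1_ge n). eapply Rle_trans; [apply Rmult_le_compat_r; [lra|apply H]|].
    right. unfold abs1. ring. }
  eapply bsum_weaken; [apply bsum_scal; [pos_tac|apply bsum_Z_row; lra]|].
  set (M := Z.abs_nat m). fold (abs1 m) in *. change (INR M + 1) with (abs1 m).
  assert (0 < (1 - be) ^ M) by (apply pow_lt; lra).
  replace (C * (abs1 m * al ^ M) * (2 * (abs1 m * / (1 - be) ^ S (S M))))
    with (C * (2 / (1 - be) ^ 2) * (abs1 m ^ 2 * (al ^ M * / (1 - be) ^ M))).
  2:{ replace (S (S M)) with (2 + M)%nat by lia. rewrite pow_add. field. split; lra. }
  rewrite <- pow_inv, <- Rpow_mult_distr. fold (al / (1 - be)). rewrite He.
  apply Rmult_le_compat_l; [pos_tac|]. apply Rmult_le_compat_l; [pos_tac|].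
  apply pow_incr. lra.
Qed.

Lemma chi_plus_conj m r : (chi m (RtoC r) + Cconj (chi m (RtoC r)))%C = (2 * bJ m r)%C.
Proof.
  rewrite <- psi_RtoC, <- chi_herm. f_equal. f_equal. unfold chi, cyl.
  rewrite <- zp_conj, Cmod_opp, Zabs_nat_opp. f_equal.
  unfold zp, zalpha, zbeta. rewrite Cconj_RtoC, <- RtoC_half, Cmult_conj, !Cpow_conj, !Cmult_conj, Copp_conj, !Cconj_RtoC.
  reflexivity.
Qed.

Definition disc_matrix (M : nat) (k : R) (O : nat -> C) (a : nat -> R) (i j : idx) : C :=
  if lt_dec (fst i) M then
    if lt_dec (fst j) M then mpe_A k O a (fst i) (fst j) (snd i) (snd j) else RtoC 0
  else RtoC 0.

Definition separated_discs (M : nat) (O : nat -> C) (a : nat -> R) (k sg : R) : Prop :=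
  0 < k /\ (forall p, (p < M)%nat -> 0 < a p) /\
  (forall p m, (p < M)%nat -> bJ m (k * a p) <> 0) /\
  forall p q, (p < M)%nat -> (q < M)%nat -> p <> q ->
    a p + a q < Cmod (O p - O q) /\ a p / (Cmod (O p - O q) - a q) <= sg.

Lemma disc_matrix_row M k O a sg : separated_discs M O a k sg -> 0 <= sg ->
  exists CA, 0 < CA /\ forall p m, (p < M)%nat ->
    bsum (fun j => Cmod (disc_matrix M k O a (p, m) j) * wt j) (CA * wt (p, m) ^ 2 * sg ^ Z.abs_nat m).
Proof.
  intros [Hk [Ha [HJ Hs]]] Hsg.
  destruct (finite_bound M (fun p A => 0 <= A /\ forall q m, (q < M)%nat ->
    bsum (fun n => Cmod (mpe_A k O a p q m n) * abs1 n) (A * (abs1 m ^ 2 * sg ^ Z.abs_nat m)))) as [A [HA H]].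
  - intros p A B [H0 H] HAB. split; [lra|]. intros q m Hq. eapply bsum_weaken; [now apply H|].
    pose proof (abs1_ge m). apply Rmult_le_compat_r; [pos_tac|lra].
  - intros p Hp. destruct (finite_bound M (fun q A => 0 <= A /\ forall m,
      bsum (fun n => Cmod (mpe_A k O a p q m n) * abs1 n) (A * (abs1 m ^ 2 * sg ^ Z.abs_nat m)))) as [A [HA H]].
    + intros q A B [H0 H] HAB. split; [lra|]. intros m. eapply bsum_weaken; [now apply H|].
      pose proof (abs1_ge m). apply Rmult_le_compat_r; [pos_tac|lra].
    + intros q Hq. destruct (Nat.eq_dec p q) as [<-|Hpq].
      * exists 0. split; [lra|]. intros m. rewrite Rmult_0_l.
        apply bsum_le with (fun _ : Z => 0).
        -- intros n. unfold mpe_A. rewrite Nat.eqb_refl, Cmod_0. lra.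
        -- intros L _. rewrite lsumR_const. lra.
      * destruct (Hs p q Hp Hq Hpq) as [Hg Hr].
        destruct (mpe_A_row k O a p q sg) as [C [HC H]]; auto. exists C. split; [lra|exact H].
    + exists A. split; [lra|]. intros q m Hq. apply H, Hq.
  - exists (INR M * A + 1). pose proof (pos_INR M). split; [assert (0 <= INR M * A) by pos_tac; lra|]. intros p m Hp.
    assert (Hw : 0 <= wt (p, m) ^ 2 * sg ^ Z.abs_nat m) by (pose proof (wt_pos (p, m)); pos_tac).
    apply bsum_weaken with (INR M * (A * (wt (p, m) ^ 2 * sg ^ Z.abs_nat m))).
    2:{ rewrite Rmult_assoc, <- Rmult_assoc. apply Rmult_le_compat_r; lra. }
    apply bsum_prod with (fun q => if lt_dec q M then A * (wt (p, m) ^ 2 * sg ^ Z.abs_nat m) else 0).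
    + intros j. pose proof (wt_pos j). pose proof (Cmod_ge_0 (disc_matrix M k O a (p, m) j)). apply Rmult_le_pos; lra.
    + intros q. unfold disc_matrix. cbn [fst snd]. destruct (lt_dec p M); [|contradiction].
      destruct (lt_dec q M) as [Hq|Hq].
      * apply (proj2 (H p Hp) q m Hq).
      * intros L _. apply Rle_trans with (lsumR (fun _ : Z => 0) L); [|rewrite lsumR_const; lra].
        apply lsumR_le. intros j _. rewrite Cmod_0; lra.
    + apply bsum_finite.
      * pos_tac.
      * intros q Hq. destruct (lt_dec q M); [lra|contradiction].
      * intros q Hq. destruct (lt_dec q M); [lia|lra].
Qed.

Lemma separated_geometry M O a k sg : separated_discs M O a k sg ->
  exists dl, geometry M (fun p => k * O p)%C (fun p => k * a p) dl.
Proof.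
  intros [Hk [Ha [_ Hs]]].
  destruct (finite_bound M (fun p A => forall q, (q < M)%nat -> p <> q ->
     / (Cmod (O p - O q) - a p - a q) <= A)) as [A [HA H]].
  - intros p A B H HAB q Hq Hpq. specialize (H q Hq Hpq). lra.
  - intros p Hp. destruct (finite_bound M (fun q A => p <> q -> / (Cmod (O p - O q) - a p - a q) <= A)) as [A [HA H]].
    + intros q A B H HAB Hpq. specialize (H Hpq). lra.
    + intros q Hq. eexists. intros _. apply Rle_refl.
    + exists A. intros q Hq Hpq. now apply H.
  - exists (k * (/ A / 4)). pose proof (Rinv_0_lt_compat _ HA). split; [pos_tac|]. split.
    + intros p Hp. specialize (Ha p Hp). pos_tac.
    + intros p q Hp Hq Hpq. destruct (Hs p q Hp Hq Hpq) as [Hg _]. specialize (H p Hp q Hq Hpq).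
      replace (k * O p - k * O q)%C with (k * (O p - O q))%C by ring.
      rewrite Cmod_mult, Cmod_R, Rabs_pos_eq by lra.
      replace (k * a p + k * a q + 4 * (k * (/ A / 4))) with (k * (a p + a q + / A)) by (field; lra).
      (* [finite_bound] supplies upper bounds, so the smallest gap was obtained through reciprocals;
         inverting [H] turns the bound A back into a lower bound for the gap. *)
      apply Rmult_le_compat_l; [lra|].
      apply Rinv_le_contravar in H; [|apply Rinv_0_lt_compat; lra]. rewrite Rinv_inv in H. lra.
Qed.

(** Besides J_n(k a_q), the factor sqrt(a_q) is included: the entries of A carry sqrt(a_q/a_p), and
    this scaling makes the interaction symmetric enough for the energy identity. *)
Definition layer_coefs (M : nat) (k : R) (a : nat -> R) (x : idx -> C) (j : idx) : C :=
  if lt_dec (fst j) M then (RtoC (bJ (snd j) (k * a (fst j)) * sqrt (a (fst j))) * x j)%C else RtoC 0.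

Lemma layer_coefs_multipole M k a (x : idx -> C) : 0 < k -> (forall p, (p < M)%nat -> 0 < a p) ->
  (exists K, 0 <= K /\ forall j, Cmod (x j) <= K * wt j) ->
  multipole_coefs M (fun p => k * a p) (layer_coefs M k a x).
Proof.
  intros Hk Ha [K [HK Hx]]. split.
  { intros q n Hq. unfold layer_coefs. cbn [fst]. destruct (lt_dec q M); [lia|reflexivity]. }
  destruct (finite_bound M (fun q A => 0 < a q -> forall n, Cmod (RtoC (bJ n (k * a q) * sqrt (a q)))
    <= A * ((k * a q / 2) ^ Z.abs_nat n / INR (fact (Z.abs_nat n))))) as [A [HA H]].
  - intros q A B H HAB Hq n. eapply Rle_trans; [now apply H|]. apply Rmult_le_compat_r; auto. assert (0 <= k * a q / 2) by pos_tac. pos_tac.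
  - intros q Hq. destruct (psi_fixed (RtoC (k * a q))) as [E [HE HE']]. exists (sqrt (a q) * E).
    intros Haq n. specialize (HE' n). rewrite psi_RtoC in HE'.
    assert (0 < k * a q) by pos_tac. rewrite (Cmod_R (k * a q)), (Rabs_pos_eq (k * a q)) in HE' by lra.
    pose proof (sqrt_pos (a q)).
    rewrite Rmult_comm, RtoC_mult, Cmod_mult, Cmod_R, Rabs_pos_eq, Rmult_assoc by auto.
    apply Rmult_le_compat_l; auto.
  - exists (A * (K + 1)). split; [pos_tac|]. intros q n Hq. unfold layer_coefs. cbn [fst snd].
    destruct (lt_dec q M); [|contradiction]. rewrite Cmod_mult.
    specialize (H q Hq (Ha q Hq) n). specialize (Hx (q, n)). pose proof (wt_pos (q, n)) as Hw.
    unfold wt, abs1 in *. cbn [snd] in *.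
    replace (A * (K + 1) * ((INR (Z.abs_nat n) + 1) * ((k * a q / 2) ^ Z.abs_nat n / INR (fact (Z.abs_nat n)))))
      with (A * ((k * a q / 2) ^ Z.abs_nat n / INR (fact (Z.abs_nat n))) * ((K + 1) * (INR (Z.abs_nat n) + 1))) by ring.
    apply Rmult_le_compat; [pos_tac|pos_tac|exact H|lra].
Qed.

(** Multiplying row (p, m) by sqrt(a_p) H_m(k a_p) clears its denominators; what remains is the
    field of the other discs at disc p. *)
Lemma layer_equation M k O a sg (x : idx -> C) p m : separated_discs M O a k sg ->
  (exists K, 0 <= K /\ forall j, Cmod (x j) <= K * wt j) -> (p < M)%nat ->
  (RtoC (sqrt (a p)) * chi m (RtoC (k * a p)) * apply_mat (disc_matrix M k O a) x (p, m))%C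
  = mult_exp (off_disc (layer_coefs M k a x) p) m (rel_center (fun p => k * O p)%C (fun p => k * a p) p).
Proof.
  intros HS Hx Hp. destruct (separated_geometry _ _ _ _ _ HS) as [dl HG].
  assert (HS' := HS). destruct HS' as [Hk [Ha [HJ Hs]]].
  pose proof (layer_coefs_multipole M k a x Hk Ha Hx) as Hc.
  assert (Hsum := mult_exp_summable M _ _ (rel_center (fun p => k * O p)%C (fun p => k * a p) p) m
    (off_disc_coefs M _ _ p Hc) (proj1 (proj2 HG))
    (fun q Hq => rel_center_gap _ _ _ _ p q HG Hp Hq)).
  pose proof (chi_neq_0 m _ (HJ p m Hp)) as Hchi.
  pose proof (sqrt_lt_R0 _ (Ha p Hp)) as Hsq.
  assert (Hsq' : RtoC (sqrt (a p)) <> 0) by (intros E; apply RtoC_inj in E; lra).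
  unfold apply_mat.
  rewrite (tsum_ext _ (fun j => / (RtoC (sqrt (a p)) * chi m (RtoC (k * a p)))
    * (off_disc (layer_coefs M k a x) p j * chi (snd j - m)
       (rel_center (fun p => k * O p)%C (fun p => (k * a p)%R) p (fst j))))%C).
  - rewrite tsum_scal by exact Hsum. unfold mult_exp.
    rewrite Cmult_assoc, Cinv_r, Cmult_1_l; auto. now apply Cmult_neq_0.
  - intros [q n]. cbn [fst snd]. unfold disc_matrix, off_disc, layer_coefs, rel_center. cbn [fst snd].
    destruct (lt_dec p M); [|contradiction].
    destruct (Nat.eqb_spec q p) as [->|Hqp].
    + destruct (lt_dec p M); [|contradiction]. unfold mpe_A. rewrite Nat.eqb_refl. ring.
    + destruct (lt_dec q M) as [Hq|Hq]; [|ring].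
      destruct (Hs p q Hp Hq ltac:(auto)) as [Hg _].
      rewrite mpe_A_off by auto.
      replace (k * O p - k * O q)%C with (k * (O p - O q))%C by ring.
      rewrite RtoC_div, (RtoC_mult (bJ n (k * a q))) by lra. field. auto.
Qed.

Lemma disc_matrix_kernel M k O a sg (x : idx -> C) : separated_discs M O a k sg ->
  (exists K, 0 <= K /\ forall j, Cmod (x j) <= K * wt j) ->
  (forall i, x i + apply_mat (disc_matrix M k O a) x i = RtoC 0)%C -> forall i, x i = RtoC 0.
Proof.
  intros HS Hx He. destruct (separated_geometry _ _ _ _ _ HS) as [dl HG].
  assert (HS' := HS). destruct HS' as [Hk [Ha [HJ Hs]]].
  pose proof (layer_coefs_multipole M k a x Hk Ha Hx) as Hc.
  assert (Hz : forall j, layer_coefs M k a x j = RtoC 0).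
  { apply (multipole_coefs_zero _ _ _ dl _ HG Hc).
    apply (far_coef_zero _ _ _ dl _ HG Hc). intros p m Hp. cbv zeta.
    rewrite <- (layer_equation M k O a sg) by auto.
    replace (apply_mat (disc_matrix M k O a) x (p, m)) with (- x (p, m))%C.
    2:{ rewrite <- (Cplus_0_l (- _)), <- (He (p, m)). ring. }
    unfold layer_coefs at 1 2 3. cbn [fst snd]. destruct (lt_dec p M); [|contradiction].
    set (b := bJ m (k * a p)). set (s := sqrt (a p)). set (y := x (p, m)).
    rewrite Cmult_conj, Cconj_RtoC.
    (* The pairing is a real multiple of H_m(k a_p). Adding its conjugate turns H into 2 J, and the
       result cancels the diagonal term exactly. *)
    replace (RtoC (b * s) * Cconj y * (RtoC s * chi m (RtoC (k * a p)) * - y))%C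
      with (RtoC (- (b * s * s * Cmod y ^ 2)) * chi m (RtoC (k * a p)))%C.
    2:{ rewrite RtoC_opp, !RtoC_mult, <- Cconj_mult_self. ring. }
    rewrite Cmult_conj, Cconj_RtoC, <- Cplus_assoc, <- Cmult_plus_distr_l, chi_plus_conj. fold b.
    rewrite Cmod_mult, Cmod_R, <- !RtoC_mult, <- RtoC_plus. f_equal.
    rewrite Rpow_mult_distr, pow2_abs. ring. }
  intros [p m]. specialize (Hz (p, m)). unfold layer_coefs in Hz. cbn [fst snd] in Hz.
  destruct (lt_dec p M) as [Hp|Hp].
  - apply NNPP. intros Hn. apply (Cmult_neq_0 (RtoC (bJ m (k * a p) * sqrt (a p))) (x (p, m))); auto.
    intros E. apply RtoC_inj in E. apply Rmult_integral in E. destruct E as [E|E]; [now apply (HJ p m Hp)|].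
    pose proof (sqrt_lt_R0 _ (Ha p Hp)). lra.
  - rewrite <- (He (p, m)). unfold apply_mat. rewrite (tsum_ext _ (fun _ => RtoC 0)), tsum_0; [ring|].
    intros j. unfold disc_matrix. cbn [fst snd]. destruct (lt_dec p M); [contradiction|ring].
Qed.

(** A reciprocal factorial decays faster than every geometric rate; this is why a plane wave
    contributes no ratio of its own to [gamma1]. *)
Lemma inv_hbound_superexp n r sg : 0 < r -> 0 < sg ->
  / hbound n r <= exp (r / 2 / sg) * sg ^ n.
Proof.
  intros Hr Hs. unfold hbound. pose proof (INR_fact_lt_0 n).
  pose proof (pow_fact_le_exp (r / 2 / sg) n ltac:(pos_tac)) as Hp.
  apply Rmult_le_reg_l with (INR (fact n) * (2 / r) ^ n); [pos_tac|].
  assert (0 < (2 / r) ^ n) by pos_tac.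
  rewrite Rinv_r by (apply Rgt_not_eq, Rlt_gt; pos_tac).
  apply Rle_trans with ((2 / r * sg) ^ n * (r / 2 / sg) ^ n).
  - rewrite <- Rpow_mult_distr. replace (2 / r * sg * (r / 2 / sg)) with 1 by (field; lra). rewrite pow1; lra.
  - apply Rmult_le_compat_l with (r := (2 / r * sg) ^ n) in Hp; [|pos_tac].
    eapply Rle_trans; [exact Hp|]. rewrite Rpow_mult_distr. right; ring.
Qed.

(** For a point source the quotient H_m(k d)/H_m(k a_p) has size (a_p/d)^|m|; for a plane wave the
    numerator has modulus one and any rate is available. *)
Lemma mpe_G_bound_at k O a inc p sg : 0 < k -> 0 < a p -> 0 < sg ->
  (forall m, bJ m (k * a p) <> 0) ->
  (forall x0, inc = PointSource x0 -> a p < Cmod (O p - x0) /\ a p / Cmod (O p - x0) <= sg) ->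
  exists C, 0 < C /\ forall m, Cmod (mpe_G k O a inc p m) <= C * (abs1 m * sg ^ Z.abs_nat m).
Proof.
  intros Hk Ha Hsg HJ Hx0.
  destruct (mpe_G_eq k O a inc p) as [c Hc]; auto.
  { intros x0 E. now apply Hx0. }
  assert (Hr : 0 < k * a p) by pos_tac.
  destruct (chi_lower_uniform (k * a p) Hr HJ) as [A [HA HA']].
  assert (Hcoef : exists B, 0 < B /\ forall m, Cmod (incident_coef k O inc p m) / hbound (Z.abs_nat m) (k * a p)
    <= B * sg ^ Z.abs_nat m).
  { destruct inc as [b|x0].
    - exists (exp (k * a p / 2 / sg)). split; [apply exp_pos|]. intros m. unfold incident_coef, plane_wave.
      rewrite Cmod_cis. unfold Rdiv at 1. rewrite Rmult_1_l. now apply inv_hbound_superexp.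
    - destruct (Hx0 x0 eq_refl) as [Hg Hs].
      set (d := Cmod (O p - x0)) in *.
      assert (Hkd : Cmod (k * (O p - x0)) = k * d) by (rewrite Cmod_mult, Cmod_R, Rabs_pos_eq by lra; reflexivity).
      assert (0 < k * d) by (apply Rmult_lt_0_compat; lra).
      destruct (chi_fixed (k * (O p - x0))) as [D [HD HD']]; [now rewrite Hkd|].
      rewrite Hkd in HD'.
      exists (/ 4 * D). split; [pos_tac|]. intros m.
      specialize (HD' (- m)%Z (Z.abs_nat m) ltac:(lia)).
      pose proof (hbound_pos (Z.abs_nat m) _ Hr) as Hh.
      rewrite (hbound_ratio _ (k * a p)) in HD' by auto.
      replace (k * a p / (k * d)) with (a p / d) in HD' by (field; lra).
      apply Rmult_le_reg_r with (hbound (Z.abs_nat m) (k * a p)); auto.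
      unfold Rdiv at 1. rewrite Rmult_assoc, Rinv_l, Rmult_1_r by lra.
      unfold incident_coef. rewrite Cmod_mult.
      replace (Cmod (Ci / 4)) with (/ 4).
      2:{ rewrite Cmod_div, Cmod_Ci, Cmod_R, Rabs_pos_eq by (try lra; intros [=]; lra). lra. }
      replace (/ 4 * D * sg ^ Z.abs_nat m * hbound (Z.abs_nat m) (k * a p))
        with (/ 4 * (D * (hbound (Z.abs_nat m) (k * a p) * sg ^ Z.abs_nat m))) by ring.
      apply Rmult_le_compat_l; [lra|]. eapply Rle_trans; [exact HD'|].
      apply Rmult_le_compat_l; [lra|]. apply Rmult_le_compat_l; [lra|].
      apply pow_incr. split; [|exact Hs]. apply Rdiv_le_0_compat; lra. }
  destruct Hcoef as [B [HB HB']].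
  pose proof (Cmod_ge_0 c).
  exists ((Cmod c + 1) * (A * B)). split; [pos_tac|]. intros m. pose proof (abs1_ge m).
  rewrite Hc, Cmod_mult.
  pose proof (chi_neq_0 m _ (HJ m)) as Hc0. rewrite Cmod_div by auto.
  specialize (HA' m). pose proof (hbound_pos (Z.abs_nat m) _ Hr) as Hh. apply Cmod_gt_0 in Hc0.
  apply inv_chi_bound in HA'; auto. specialize (HB' m).
  set (g := Cmod (incident_coef k O inc p m)) in *. assert (0 <= g) by apply Cmod_ge_0.
  assert (Hq : g / Cmod (chi m (RtoC (k * a p))) <= A * B * (abs1 m * sg ^ Z.abs_nat m)).
  { apply Rle_trans with (A * abs1 m * (g / hbound (Z.abs_nat m) (k * a p))).
    - unfold Rdiv at 1. eapply Rle_trans; [apply Rmult_le_compat_l; [auto|exact HA']|]. right. unfold Rdiv. ring.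
    - eapply Rle_trans; [apply Rmult_le_compat_l; [pos_tac|exact HB']|]. right; ring. }
  rewrite Rmult_assoc. apply Rmult_le_compat; [lra| |lra|exact Hq].
  apply Rdiv_le_0_compat; auto.
Qed.

(** * From the given row equations to unordered sums *)

Lemma csum_lsum M S : csum M S = lsum S (seq 0 M).
Proof. reflexivity. Qed.

Lemma tsum_csum M (S : nat -> C) :
  summable (fun q => if lt_dec q M then S q else RtoC 0) /\
  tsum (fun q => if lt_dec q M then S q else RtoC 0) = csum M S.
Proof.
  induction M as [|M [Hs IH]].
  - split; [exists 0; intros L _; apply Rle_trans with (lsumR (fun _ : nat => 0) L); [|rewrite lsumR_const; lra];
      apply lsumR_le; intros q _; destruct (lt_dec q 0); [lia|rewrite Cmod_0; lra]|].
    rewrite (tsum_ext _ (fun _ => RtoC 0)); [apply tsum_0|]. intros q. destruct (lt_dec q 0); [lia|reflexivity].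
  - set (h := fun q => if Nat.eq_dec q M then S q else RtoC 0).
    assert (Hh : summable h).
    { exists (Cmod (S M)). apply bsum_single with M.
      - apply Cmod_ge_0.
      - unfold h. destruct (Nat.eq_dec M M); [lra|easy].
      - intros q Hq. unfold h. destruct (Nat.eq_dec q M); [easy|rewrite Cmod_0; lra]. }
    assert (E : forall q, ((if lt_dec q M then S q else RtoC 0) + h q)%C = (if lt_dec q (Datatypes.S M) then S q else RtoC 0)).
    { intros q. unfold h. destruct (lt_dec q M), (lt_dec q (Datatypes.S M)), (Nat.eq_dec q M); try lia; ring. }
    split; [eapply summable_ext; [exact E|now apply summable_plus]|].
    rewrite <- (tsum_ext _ _ E), tsum_plus by auto. rewrite IH, (tsum_single h M).
    + rewrite !csum_lsum, seq_S, lsum_app. unfold h. destruct (Nat.eq_dec M M); [|easy].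
      unfold lsum; simpl. ring.
    + intros q Hq. unfold h. destruct (Nat.eq_dec q M); easy.
Qed.

Lemma acts_to_tsum M B alpha gamma p m : (p < M)%nat -> acts_to M B alpha gamma ->
  summable (fun j : idx => if lt_dec (fst j) M then B p (fst j) m (snd j) * alpha (fst j) (snd j) else RtoC 0)%C ->
  tsum (fun j : idx => if lt_dec (fst j) M then B p (fst j) m (snd j) * alpha (fst j) (snd j) else RtoC 0)%C = gamma p m.
Proof.
  intros Hp HB Hs. destruct (HB p m Hp) as [S [HS <-]].
  destruct (tsum_csum M S) as [_ <-]. etransitivity; [exact (tsum_fubini _ Hs)|].
  apply tsum_ext. intros q. pose proof (summable_row _ q Hs) as Hq. cbn [fst snd] in *.
  destruct (lt_dec q M) as [Hq'|Hq'].
  - apply is_seriesZ_tsum; auto.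
  - apply tsum_0.
Qed.

(** * Weighted norms *)

Lemma half_weight m : / abs1 m <= Rpower (1 + IZR m ^ 2) (- / 2) <= 1.
Proof.
  pose proof (pow2_ge_0 (IZR m)).
  rewrite Rpower_Ropp, Rpower_sqrt by lra.
  assert (E : IZR m ^ 2 = INR (Z.abs_nat m) ^ 2).
  { rewrite INR_IZR_INZ, Zabs2Nat.id_abs, abs_IZR. now rewrite pow2_abs. }
  assert (Hs : 1 <= sqrt (1 + IZR m ^ 2)) by (rewrite <- sqrt_1 at 1; apply sqrt_le_1_alt; lra).
  pose proof (pos_INR (Z.abs_nat m)). split.
  - apply Rinv_le_contravar; [lra|]. unfold abs1. rewrite E.
    rewrite <- (sqrt_pow2 (INR (Z.abs_nat m) + 1)) by lra. apply sqrt_le_1_alt. nra.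
  - apply Rle_trans with (/ 1); [apply Rinv_le_contravar; lra|lra].
Qed.

(** A single term of a convergent nonnegative series is at most its sum, so |alpha_m|^2 <= B (1 +
    |m|). Linear growth is weaker but matches the weight [wt], and the row decay absorbs it. *)
Lemma in_l_bound M alpha : in_l M (- / 2) alpha ->
  exists K, 0 < K /\ forall p m, (p < M)%nat -> Cmod (alpha p m) <= K * abs1 m.
Proof.
  intros H. destruct (finite_bound M (fun p K => forall m, Cmod (alpha p m) <= K * abs1 m)) as [K [HK HK']].
  - intros p A B HA HAB m. eapply Rle_trans; [apply HA|]. pose proof (abs1_ge m). apply Rmult_le_compat_r; lra.
  - intros p Hp. destruct (H p Hp) as [H1 H2].
    assert (Hpos : forall m, 0 <= l_term (- / 2) alpha p m).
    { intros m. unfold l_term. pose proof (half_weight m). pose proof (Cmod_ge_0 (alpha p m)).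
      pose proof (Rinv_0_lt_compat (abs1 m) ltac:(pose proof (abs1_ge m); lra)). pos_tac. }
    set (B := Series (fun n : nat => l_term (- / 2) alpha p (Z.of_nat n)) +
      Series (fun n : nat => l_term (- / 2) alpha p (- Z.of_nat (S n))%Z)).
    assert (HB : forall m, l_term (- / 2) alpha p m <= B).
    { assert (HB := bsum_Z_split (l_term (- / 2) alpha p) _ _
        (bsum_Series _ (fun n => Hpos (Z.of_nat n)) H1) (bsum_Series _ (fun n => Hpos (negS n)) H2)).
      intros m. exact (bsum_point _ _ m HB). }
    exists (B + 1). intros m. specialize (HB m). pose proof (Hpos m). unfold l_term in *.
    pose proof (abs1_ge m). pose proof (Cmod_ge_0 (alpha p m)). destruct (half_weight m) as [Hw _].
    assert (Hsq : Cmod (alpha p m) ^ 2 <= B * abs1 m).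
    { apply Rmult_le_reg_l with (/ abs1 m); [apply Rinv_0_lt_compat; lra|].
      replace (/ abs1 m * (B * abs1 m)) with B by (field; lra).
      eapply Rle_trans; [apply Rmult_le_compat_r; [pos_tac|exact Hw]|exact HB]. }
    apply Rnot_lt_le. intros Hlt. nra.
  - exists K. auto.
Qed.

Lemma bsum_inv_squares : bsum (fun n => / (INR n + 1) ^ 2) 2.
Proof.
  apply bsum_nat.
  - intros n. pose proof (pos_INR n). pos_tac.
  (* Telescoping: the partial sums stay below 2 - 1/(n+1). *)
  - intros n. apply Rle_trans with (2 - / (INR n + 1)).
    + induction n as [|n IH]; [rewrite sum_O; simpl; lra|].
      rewrite sum_Sn. unfold plus; simpl (AbelianMonoid.plus _ _). rewrite S_INR. pose proof (pos_INR n).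
      assert (/ (INR n + 1 + 1) ^ 2 <= / (INR n + 1) - / (INR n + 1 + 1)).
      { replace (/ (INR n + 1) - / (INR n + 1 + 1)) with (/ ((INR n + 1) * (INR n + 1 + 1))) by (field; lra).
        apply Rinv_le_contravar; nra. }
      apply Rle_trans with (2 - / (INR n + 1) + / (INR n + 1 + 1) ^ 2); [|lra].
      apply Rplus_le_compat_r, IH.
    + pose proof (pos_INR n). pose proof (Rinv_0_lt_compat (INR n + 1) ltac:(lra)). lra.
Qed.

Lemma rsum_const_le n f B : (forall i, (i < n)%nat -> f i <= B) -> rsum n f <= INR n * B.
Proof.
  intros H. induction n as [|n IH]; [unfold rsum; simpl; lra|].
  rewrite rsum_S, S_INR. specialize (IH ltac:(intros; apply H; lia)). specialize (H n ltac:(lia)). lra.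
Qed.

(** The weight is at most 1 and the squares of 1/(1 + |m|) sum to at most 2 on each half of the
    integers, hence 4 per disc. *)
Lemma l_norm_le M alpha B : 0 <= B ->
  (forall p m, (p < M)%nat -> Cmod (alpha p m) <= B * / abs1 m) ->
  l_norm M (- / 2) alpha <= B * sqrt (4 * INR M).
Proof.
  intros HB H. unfold l_norm. pose proof (pos_INR M).
  rewrite <- (sqrt_pow2 B) by auto. rewrite <- sqrt_mult by (try apply pow2_ge_0; lra).
  apply sqrt_le_1_alt. replace (B ^ 2 * (4 * INR M)) with (INR M * (4 * B ^ 2)) by ring.
  apply rsum_const_le. intros p Hp.
  assert (Ht : forall m, 0 <= l_term (- / 2) alpha p m <= B ^ 2 * / abs1 m ^ 2).
  { intros m. unfold l_term. destruct (half_weight m) as [H1 H2]. specialize (H p m Hp).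
    pose proof (abs1_ge m). pose proof (Rinv_0_lt_compat (abs1 m) ltac:(lra)). pose proof (Cmod_ge_0 (alpha p m)).
    split; [pos_tac|]. rewrite <- (Rmult_1_l (B ^ 2 * _)). apply Rmult_le_compat; [lra|pos_tac|auto|].
    rewrite <- pow_inv, <- Rpow_mult_distr. now apply pow_incr. }
  unfold SeriesZ.
  assert (H4 := bsum_scal _ (B ^ 2) 2 ltac:(pos_tac) bsum_inv_squares).
  replace (4 * B ^ 2) with (B ^ 2 * 2 + B ^ 2 * 2) by ring.
  apply Rplus_le_compat; (apply bsum_Series_le; [intros n; apply Ht|]; eapply bsum_le; [|exact H4]);
    intros n; cbv beta; (eapply Rle_trans; [apply Ht|]); apply Rmult_le_compat_l; try (pos_tac); unfold abs1.
  - rewrite Zabs2Nat.id. lra.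
  - replace (Z.abs_nat (- Z.of_nat (S n))) with (S n) by lia. rewrite S_INR. pose proof (pos_INR n).
    apply Rinv_le_contravar; [pos_tac|]. apply pow_incr. lra.
Qed.

Lemma poly_geom_bounded j sg : 0 <= sg < 1 -> exists C, 0 < C /\ forall d, (INR d + 1) ^ j * sg ^ d <= C.
Proof.
  intros Hs. destruct (Req_dec sg 0) as [->|Hs0].
  - exists 1. split; [lra|]. intros [|d]; simpl; [rewrite Rplus_0_l, pow1; lra|].
    rewrite Rmult_0_l, Rmult_0_r; lra.
  - set (t := - ln sg).
    assert (Ht : 0 < t). { unfold t. assert (ln sg < 0); [|lra]. rewrite <- ln_1. apply ln_increasing; lra. }
    exists (INR (fact j) * exp t / t ^ j). pose proof (INR_fact_lt_0 j). pose proof (exp_pos t).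
    split; [pos_tac|]. intros d. pose proof (pos_INR d).
    pose proof (pow_fact_le_exp ((INR d + 1) * t) j ltac:(pos_tac)) as Hp.
    assert (E : sg ^ d = exp (- (INR d * t))).
    { rewrite <- (exp_ln sg) at 1 by lra. replace (- (INR d * t)) with (INR d * ln sg) by (unfold t; ring).
      clear. induction d as [|d IH]; [simpl; now rewrite Rmult_0_l, exp_0|].
      rewrite S_INR, Rmult_plus_distr_r, Rmult_1_l, exp_plus, <- IH. simpl; ring. }
    rewrite E, exp_Ropp. rewrite Rmult_plus_distr_r, Rmult_1_l, exp_plus in Hp.
    replace (INR d * t + t) with ((INR d + 1) * t) in Hp by ring. rewrite Rpow_mult_distr in Hp.
    pose proof (exp_pos (INR d * t)). assert (0 < t ^ j) by pos_tac.
    apply Rmult_le_reg_r with (exp (INR d * t) * t ^ j); [pos_tac|].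
    replace ((INR d + 1) ^ j * / exp (INR d * t) * (exp (INR d * t) * t ^ j)) with ((INR d + 1) ^ j * t ^ j) by (field; lra).
    eapply Rle_trans; [exact Hp|]. right. field. lra.
Qed.

(** For n = N + d one has n + 1 <= (N + 1)(d + 1), so the excess d is controlled by a bounded
    factor. *)
Lemma poly_geom_shift j sg : 0 <= sg < 1 -> exists C, 0 < C /\ forall N n, (N <= n)%nat ->
  (INR n + 1) ^ j * sg ^ n <= C * ((INR N + 1) ^ j * sg ^ N).
Proof.
  intros Hs. destruct (poly_geom_bounded j sg Hs) as [C [HC H]]. exists C. split; auto.
  intros N n Hn. set (d := (n - N)%nat). replace n with (N + d)%nat by lia.
  rewrite pow_add. pose proof (pos_INR N). pose proof (pos_INR d).
  apply Rle_trans with (((INR d + 1) ^ j * sg ^ d) * ((INR N + 1) ^ j * sg ^ N)).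
  - replace ((INR d + 1) ^ j * sg ^ d * ((INR N + 1) ^ j * sg ^ N))
      with ((INR d + 1) ^ j * (INR N + 1) ^ j * (sg ^ N * sg ^ d)) by ring.
    apply Rmult_le_compat_r; [pos_tac|]. rewrite <- Rpow_mult_distr. apply pow_incr.
    rewrite plus_INR. nra.
  - apply Rmult_le_compat_r; [pos_tac|apply H].
Qed.

Lemma poly_subexponential C j : 0 < C -> subexponential (fun N => C * (INR N + 1) ^ j).
Proof.
  intros HC. split; [intros N; pose proof (pos_INR N); pos_tac|].
  intros c Hc.
  (* One power more than required: the surplus factor 1/(N + 1) provides convergence to 0. *)
  destruct (poly_geom_bounded (S j) (exp (- c))) as [D [HD H]].
  { split; [left; apply exp_pos|]. rewrite <- exp_0. apply exp_increasing. lra. }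
  assert (Hlim : is_lim_seq (fun n => C * D * / (INR n + 1)) 0).
  { replace (Finite 0) with (Rbar_mult (C * D) 0) by (simpl; f_equal; ring).
    apply is_lim_seq_scal_l. apply is_lim_seq_spec. intros [e He]. simpl.
    destruct (INR_unbounded (/ e)) as [n0 Hn]. exists n0. intros n Hn0. apply le_INR in Hn0.
    pose proof (pos_INR n). pose proof (Rinv_0_lt_compat _ He).
    rewrite Rminus_0_r, Rabs_pos_eq by (left; apply Rinv_0_lt_compat; lra).
    rewrite <- (Rinv_inv e). apply Rinv_lt_contravar; [apply Rmult_lt_0_compat; lra|lra]. }
  eapply is_lim_seq_le_le; [|apply is_lim_seq_const|exact Hlim].
  intros n. pose proof (pos_INR n). pose proof (exp_pos (c * INR n)). split; [pos_tac|].
  specialize (H n).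
  assert (E : exp (- c) ^ n = / exp (c * INR n)).
  { rewrite <- exp_Ropp. clear. induction n as [|n IH]; [simpl; now rewrite Rmult_0_r, Ropp_0, exp_0|].
    rewrite S_INR. replace (- (c * (INR n + 1))) with (- c + - (c * INR n)) by ring.
    rewrite exp_plus, <- IH. reflexivity. }
  rewrite E in H. apply Rmult_le_reg_r with (INR n + 1); [lra|].
  replace (C * D * / (INR n + 1) * (INR n + 1)) with (C * D) by (field; lra).
  replace (C * (INR n + 1) ^ j / exp (c * INR n) * (INR n + 1)) with (C * ((INR n + 1) ^ S j * / exp (c * INR n))).
  - apply Rmult_le_compat_l; lra.
  - simpl. field. lra.
Qed.

Definition restrict (M : nat) (alpha : sequence) (j : idx) : C :=
  if lt_dec (fst j) M then alpha (fst j) (snd j) else RtoC 0.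

Lemma restrict_bound M alpha K : 0 <= K -> (forall p m, (p < M)%nat -> Cmod (alpha p m) <= K * abs1 m) ->
  forall j, Cmod (restrict M alpha j) <= K * wt j.
Proof.
  intros HK H [p m]. unfold restrict. cbn [fst snd]. pose proof (wt_pos (p, m)).
  destruct (lt_dec p M); [now apply H|]. rewrite Cmod_0. pos_tac.
Qed.

(** Shared by the exact and the truncated system: the identity part collapses to one diagonal term,
    and the rest becomes an unordered sum over all indices. *)
Lemma system_equation M (D B : imatrix) alpha gamma p m (d : C) (row : idx -> C) : (p < M)%nat ->
  acts_to M (imat_plus D B) alpha gamma ->
  (forall q n, D p q m n = if ((p =? q)%nat && (m =? n)%Z)%bool then d else RtoC 0) ->
  (forall q n, (q < M)%nat -> row (q, n) = B p q m n) ->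
  summable (fun j => row j * restrict M alpha j)%C ->
  (d * restrict M alpha (p, m) + tsum (fun j => row j * restrict M alpha j))%C = gamma p m.
Proof.
  intros Hp Hact HD HB Hs.
  set (h := fun j : idx => if ((p =? fst j)%nat && (m =? snd j)%Z)%bool then (d * restrict M alpha j)%C else RtoC 0).
  assert (Hh : forall j, j <> (p, m) -> h j = RtoC 0).
  { intros [q n] Hj. unfold h. cbn [fst snd]. destruct (Nat.eqb_spec p q) as [<-|]; [|reflexivity].
    destruct (Z.eqb_spec m n) as [<-|]; [easy|reflexivity]. }
  assert (Ehp : h (p, m) = (d * restrict M alpha (p, m))%C).
  { unfold h. cbn [fst snd]. now rewrite Nat.eqb_refl, Z.eqb_refl. }
  assert (Hhs : summable h).
  { exists (Cmod (h (p, m))). apply bsum_single with (p, m); [apply Cmod_ge_0|lra|].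
    intros j Hj. rewrite Hh, Cmod_0 by auto. lra. }
  assert (E : forall j, (h j + row j * restrict M alpha j)%C
    = if lt_dec (fst j) M then (imat_plus D B p (fst j) m (snd j) * alpha (fst j) (snd j))%C else RtoC 0).
  { intros [q n]. unfold h, restrict, imat_plus. cbn [fst snd].
    destruct (lt_dec q M) as [Hq|Hq].
    - rewrite HD, HB by auto. destruct (_ && _)%bool; ring.
    - destruct (_ && _)%bool; ring. }
  rewrite <- Ehp, <- (tsum_single h (p, m) Hh), <- tsum_plus by auto.
  rewrite <- (acts_to_tsum M _ _ _ p m Hp Hact).
  - apply tsum_ext, E.
  - eapply summable_ext; [exact E|]. now apply summable_plus.
Qed.

(** The bound may depend on N; it only certifies finiteness of the weighted norm, while the
    stability constant does not involve it. *)
Lemma truncated_support_bound M N alpha : (forall p m, (p < M)%nat -> inZN N m = false -> alpha p m = RtoC 0) ->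
  exists K, 0 <= K /\ forall p m, (p < M)%nat -> Cmod (alpha p m) <= K * abs1 m.
Proof.
  intros H. destruct (finite_bound M (fun p K => forall m, Cmod (alpha p m) <= K * abs1 m)) as [K [HK HK']].
  - intros p A B HA HAB m. eapply Rle_trans; [apply HA|]. pose proof (abs1_ge m). apply Rmult_le_compat_r; lra.
  - intros p Hp. destruct (finite_bound (S N) (fun n K => Cmod (alpha p (Z.of_nat n)) <= K /\ Cmod (alpha p (- Z.of_nat n)%Z) <= K))
      as [K [HK HK']].
    + intros n A B [H1 H2] HAB. lra.
    + intros n _. exists (Cmod (alpha p (Z.of_nat n)) + Cmod (alpha p (- Z.of_nat n)%Z)).
      pose proof (Cmod_ge_0 (alpha p (Z.of_nat n))). pose proof (Cmod_ge_0 (alpha p (- Z.of_nat n)%Z)). lra.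
    + exists K. intros m. pose proof (abs1_ge m). apply Rle_trans with K; [|nra].
      destruct (inZN N m) eqn:E.
      * apply inZN_true in E. destruct (HK' (Z.abs_nat m) ltac:(lia)) as [H1 H2].
        destruct (Z_le_dec 0 m).
        -- now replace (Z.of_nat (Z.abs_nat m)) with m in H1 by lia.
        -- now replace (- Z.of_nat (Z.abs_nat m))%Z with m in H2 by lia.
      * rewrite (H p m Hp E), Cmod_0. lra.
  - exists K. split; [lra|auto].
Qed.

(** * The ratios behind [gamma1] *)

Lemma rmax_ge l x : In x l -> x <= rmax l.
Proof.
  unfold rmax. induction l as [|y l IH]; [intros []|]. intros [->|H]; simpl; [apply Rmax_l|].
  eapply Rle_trans; [now apply IH|apply Rmax_r].
Qed.

Lemma list_maximum (l : list R) : l <> nil -> exists x, In x l /\ forall y, In y l -> y <= x.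
Proof.
  induction l as [|y l IH]; [easy|]. intros _. destruct l as [|z l].
  - exists y. split; [now left|]. intros w [->|[]]. lra.
  - destruct IH as [x [Hx H]]; [easy|]. destruct (Rle_dec y x).
    + exists x. split; [now right|]. intros w [<-|Hw]; auto.
    + exists y. split; [now left|]. intros w [<-|Hw]; [lra|]. specialize (H w Hw). lra.
Qed.

Lemma in_offdiag_pairs M p q : In (p, q) (offdiag_pairs M) <-> (p < M)%nat /\ (q < M)%nat /\ p <> q.
Proof.
  unfold offdiag_pairs. rewrite filter_In, in_prod_iff, !in_seq. cbn [fst snd].
  rewrite Bool.negb_true_iff, Nat.eqb_neq. lia.
Qed.

Definition pair_rate (O : nat -> C) (a : nat -> R) (pq : nat * nat) : R :=
  a (fst pq) / (Cmod (O (fst pq) - O (snd pq)) - a (snd pq)).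

Definition rates (M : nat) (O : nat -> C) (a : nat -> R) (inc : incident_field) : list R :=
  map (pair_rate O a) (offdiag_pairs M) ++
  match inc with
  | PlaneWave _ => nil
  | PointSource x0 => map (fun p => a p / Cmod (O p - x0)) (seq 0 M)
  end.

Lemma rate_le_gamma1 M O a inc N r : In r (rates M O a inc) -> r ^ N <= gamma1 M O a inc N.
Proof.
  unfold rates. intros H. apply in_app_or in H. destruct H as [H|H].
  - apply Rle_trans with (gamma_discs M O a N).
    + unfold gamma_discs. apply rmax_ge. apply in_map_iff in H as [[p q] [<- H]].
      apply in_map_iff. exists (p, q). auto.
    + unfold gamma1. destruct inc; [lra|apply Rmax_r].
  - destruct inc as [b|x0]; [destruct H|]. unfold gamma1. eapply Rle_trans; [|apply Rmax_l].
    apply rmax_ge. apply in_map_iff in H as [p [<- H]]. apply in_map_iff. exists p. auto.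
Qed.

(** The largest ratio is attained, so its N-th power is itself one of the entries in the maximum
    defining [gamma1]; disjointness and the exterior position of the source put it below 1. *)
Lemma worst_rate M O a inc : (2 <= M)%nat -> (forall p, (p < M)%nat -> 0 < a p) ->
  disjoint_closed_discs M O a -> admissible_field M O a inc ->
  exists sg, 0 < sg < 1 /\ (forall N, sg ^ N <= gamma1 M O a inc N) /\
    forall r, In r (rates M O a inc) -> r <= sg.
Proof.
  intros HM Ha Hd Hinc. destruct (list_maximum (rates M O a inc)) as [sg [Hin Hmax]].
  - unfold rates. intros E. apply app_eq_nil in E as [E _]. apply map_eq_nil in E.
    (* With at least two discs there is a ratio to maximise. *)
    assert (H : In (0, 1)%nat (offdiag_pairs M)) by (apply in_offdiag_pairs; lia).
    rewrite E in H. destruct H.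
  - exists sg. split; [|split; [intros N; now apply rate_le_gamma1|exact Hmax]].
    clear Hmax. unfold rates in Hin. apply in_app_or in Hin. destruct Hin as [H|H].
    + apply in_map_iff in H as [[p q] [<- H]]. apply in_offdiag_pairs in H as [Hp [Hq Hpq]].
      unfold pair_rate. cbn [fst snd]. pose proof (disjoint_discs_gap M O a p q Hd Ha Hp Hq Hpq).
      pose proof (Ha p Hp). pose proof (Ha q Hq). split; [apply Rdiv_lt_0_compat; lra|].
      apply Rlt_div_l; lra.
    + destruct inc as [b|x0]; [destruct H|]. apply in_map_iff in H as [p [<- H]].
      apply in_seq in H. assert (Hp : (p < M)%nat) by lia. specialize (Hinc p Hp). pose proof (Ha p Hp).
      unfold closed_disc in Hinc. rewrite Cmod_sym in Hinc. apply Rnot_le_lt in Hinc.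
      split; [apply Rdiv_lt_0_compat; lra|]. apply Rlt_div_l; lra.
Qed.

(** * The truncation error *)

Lemma exact_equation M k O a sg inc Phi p m : separated_discs M O a k sg -> 0 <= sg ->
  exact_solution M k O a inc Phi -> (p < M)%nat ->
  (restrict M Phi (p, m) + apply_mat (disc_matrix M k O a) (restrict M Phi) (p, m))%C = mpe_G k O a inc p m.
Proof.
  intros HS Hsg [Hl Hact] Hp. destruct (disc_matrix_row M k O a sg HS Hsg) as [CA [HCA Hrow]].
  destruct (in_l_bound M Phi Hl) as [K [HK HPhi]].
  rewrite <- (Cmult_1_l (restrict M Phi (p, m))).
  apply (system_equation M imat_id (mpe_A k O a) Phi (mpe_G k O a inc) p m (RtoC 1)); auto.
  - intros q n Hq. unfold disc_matrix. cbn [fst snd]. destruct (lt_dec p M), (lt_dec q M); easy.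
  - eapply (apply_mat_summable (disc_matrix M k O a) (restrict M Phi) (p, m) _ K); [lra|now apply Hrow|].
    apply restrict_bound; auto; lra.
Qed.

Lemma truncated_equation M k O a sg inc N Phit p m : separated_discs M O a k sg -> 0 <= sg ->
  truncated_solution M k O a inc N Phit -> (p < M)%nat -> inZN N m = true ->
  (restrict M Phit (p, m) + apply_mat (trunc N (disc_matrix M k O a)) (restrict M Phit) (p, m))%C
  = mpe_G k O a inc p m.
Proof.
  intros HS Hsg [Hsupp Hact] Hp Hm. destruct (disc_matrix_row M k O a sg HS Hsg) as [CA [HCA Hrow]].
  destruct (truncated_support_bound M N Phit Hsupp) as [K [HK HPhi]].
  rewrite <- (Cmult_1_l (restrict M Phit (p, m))).
  replace (mpe_G k O a inc p m) with (trunc_seq N (mpe_G k O a inc) p m) by (unfold trunc_seq; now rewrite Hm).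
  assert (Hs : summable (fun j => trunc N (disc_matrix M k O a) (p, m) j * restrict M Phit j)%C).
  { apply (apply_mat_summable (trunc N (disc_matrix M k O a)) (restrict M Phit) (p, m) (CA * wt (p, m) ^ 2 * sg ^ Z.abs_nat m) K);
      [lra|apply trunc_bsum; now apply Hrow|now apply restrict_bound]. }
  assert (Hid : forall n, inZN N n = false -> forall q, restrict M Phit (q, n) = RtoC 0).
  { intros n Hn q. unfold restrict. cbn [fst snd]. destruct (lt_dec q M); auto. }
  apply (system_equation M (trunc_mat N imat_id) (trunc_mat N (mpe_A k O a)) Phit (trunc_seq N (mpe_G k O a inc)) p m (RtoC 1)); auto.
  - intros q n. unfold trunc_mat, imat_id. rewrite Hm. cbn [andb].
    destruct (Z.eqb_spec m n) as [<-|]; [now rewrite Hm|].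
    rewrite Bool.andb_false_r. now destruct (inZN N n).
  - intros q n Hq. unfold trunc, trunc_mat, disc_matrix. cbn [fst snd]. destruct (lt_dec p M), (lt_dec q M); easy.
Qed.

(** A bootstrap: linear growth of Phi, inserted once into the equation, becomes geometric decay
    through the rows of A and the data. *)
Lemma exact_decay M k O a sg inc Phi : separated_discs M O a k sg -> 0 < sg < 1 ->
  exact_solution M k O a inc Phi ->
  (forall p, (p < M)%nat -> forall x0, inc = PointSource x0 -> a p < Cmod (O p - x0) /\ a p / Cmod (O p - x0) <= sg) ->
  exists C, 0 < C /\ forall j, Cmod (restrict M Phi j) <= C * wt j ^ 2 * sg ^ Z.abs_nat (snd j).
Proof.
  intros HS Hsg HPhi Hinc. assert (HS' := HS). destruct HS' as [Hk [Ha [HJ Hs]]].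
  destruct (disc_matrix_row M k O a sg HS ltac:(lra)) as [CA [HCA Hrow]].
  destruct (in_l_bound M Phi (proj1 HPhi)) as [K [HK HPhiK]].
  destruct (finite_bound M (fun p C => forall m, Cmod (mpe_G k O a inc p m) <= C * (abs1 m * sg ^ Z.abs_nat m))) as [CG [HCG HG]].
  { intros p A B HA HAB m. eapply Rle_trans; [apply HA|]. pose proof (abs1_ge m).
    apply Rmult_le_compat_r; [pos_tac|lra]. }
  { intros p Hp. destruct (mpe_G_bound_at k O a inc p sg) as [C [_ HC]]; auto; try lra. exists C. exact HC. }
  exists (CG + K * CA). assert (0 < K * CA) by pos_tac. split; [lra|]. intros [p m]. cbn [snd].
  pose proof (wt_pos (p, m)) as Hw.
  destruct (lt_dec p M) as [Hp|Hp].
  - pose proof (exact_equation M k O a sg inc Phi p m HS ltac:(lra) HPhi Hp) as E.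
    replace (restrict M Phi (p, m)) with (mpe_G k O a inc p m + - apply_mat (disc_matrix M k O a) (restrict M Phi) (p, m))%C.
    2:{ rewrite <- E. ring. }
    eapply Rle_trans; [apply Cmod_triangle|]. rewrite Cmod_opp.
    replace ((CG + K * CA) * wt (p, m) ^ 2 * sg ^ Z.abs_nat m)
      with (CG * (wt (p, m) ^ 2 * sg ^ Z.abs_nat m) + K * (CA * wt (p, m) ^ 2 * sg ^ Z.abs_nat m)) by ring.
    assert (0 <= sg ^ Z.abs_nat m) by pos_tac.
    apply Rplus_le_compat.
    + eapply Rle_trans; [apply (HG p Hp m)|]. change (abs1 m) with (wt (p, m)).
      apply Rmult_le_compat_l; [lra|]. apply Rmult_le_compat_r; nra.
    + apply apply_mat_bound; [lra|now apply Hrow|apply restrict_bound; auto; lra].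
  - unfold restrict. cbn [fst snd]. destruct (lt_dec p M); [contradiction|]. rewrite Cmod_0.
    assert (0 < CG + K * CA) by lra. pos_tac.
Qed.

Lemma truncation_error M k O a sg inc Phi Phit N1 : separated_discs M O a k sg -> 0 < sg < 1 ->
  exact_solution M k O a inc Phi ->
  (forall p, (p < M)%nat -> forall x0, inc = PointSource x0 -> a p < Cmod (O p - x0) /\ a p / Cmod (O p - x0) <= sg) ->
  (forall N, (N1 <= N)%nat -> truncated_solution M k O a inc N (Phit N)) ->
  exists C N0, 0 < C /\ forall N, (N0 <= N)%nat -> forall p m, (p < M)%nat ->
    Cmod (Phi p m - Phit N p m) <= C * (INR N + 1) ^ 3 * sg ^ N * / abs1 m.
Proof.
  intros HS Hsg HPhi Hinc HPhit.
  destruct (disc_matrix_row M k O a sg HS ltac:(lra)) as [CA [HCA Hrow]].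
  destruct (exact_decay M k O a sg inc Phi HS Hsg HPhi Hinc) as [CX [HCX Hx]].
  destruct (in_l_bound M Phi (proj1 HPhi)) as [KX [HKX HPhiK]].
  destruct (poly_geom_shift 1 sg ltac:(lra)) as [C1 [HC1 H1]].
  destruct (poly_geom_shift 3 sg ltac:(lra)) as [C3 [HC3 H3]].
  set (A := disc_matrix M k O a) in *. set (x := restrict M Phi) in *.
  destruct (truncated_stability M A CA sg) as [K [N2 [HK Hstab]]]; auto; try lra.
  { intros p m j Hp. unfold A, disc_matrix. cbn [fst snd]. destruct (lt_dec p M); [lia|reflexivity]. }
  { intros y Hy Hy0. exact (disc_matrix_kernel M k O a sg y HS Hy Hy0). }
  set (E := CX * C1 * (1 + C1 * CA)).
  assert (HC1CA : 0 < C1 * CA) by pos_tac.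
  assert (HE : 0 < E) by (unfold E; pos_tac).
  exists (K * E + CX * C3), (N1 + N2)%nat. split; [assert (0 < K * E) by pos_tac; assert (0 < CX * C3) by pos_tac; lra|].
  intros N HN. specialize (HPhit N ltac:(lia)).
  set (y := restrict M (Phit N)).
  destruct (truncated_support_bound M N (Phit N) (proj1 HPhit)) as [KY [HKY HPhitK]].
  assert (Hxb : forall j, Cmod (x j) <= KX * wt j) by (apply restrict_bound; auto; lra).
  assert (Hyb : forall j, Cmod (y j) <= KY * wt j) by (apply restrict_bound; auto; lra).
  set (e := fun j => (x j - y j)%C).
  assert (Heb : forall j, Cmod (e j) <= (KX + KY) * wt j).
  { intros j. unfold e, Cminus. eapply Rle_trans; [apply Cmod_triangle|]. rewrite Cmod_opp.
    specialize (Hxb j). specialize (Hyb j). lra. }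
  pose proof (pos_INR N) as HN0.
  assert (HsN : 0 < sg ^ N) by pos_tac.
  set (eps := E * (INR N + 1) * sg ^ N).
  assert (Heps : 0 <= eps) by (unfold eps; pos_tac).
  assert (Hyout : forall p m, inZN N m = false -> y (p, m) = RtoC 0).
  { intros p m Hm. unfold y, restrict. cbn [fst snd]. destruct (lt_dec p M); [|reflexivity]. now apply (proj1 HPhit). }
  assert (Hfar : forall m, inZN N m = false -> (N <= Z.abs_nat m)%nat).
  { intros m Hm. destruct (le_dec (Z.abs_nat m) N) as [H|H]; [|lia]. apply inZN_true in H. congruence. }
  assert (HxE : forall j, inZN N (snd j) = false -> Cmod (x j) <= CX * C1 * (INR N + 1) * sg ^ N * wt j).
  { intros j Hj. eapply Rle_trans; [apply Hx|]. specialize (H1 N _ (Hfar _ Hj)). rewrite !pow_1 in H1.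
    fold (abs1 (snd j)) in H1. fold (wt j) in H1. pose proof (wt_pos j).
    replace (CX * wt j ^ 2 * sg ^ Z.abs_nat (snd j)) with (CX * wt j * (wt j * sg ^ Z.abs_nat (snd j))) by ring.
    replace (CX * C1 * (INR N + 1) * sg ^ N * wt j) with (CX * wt j * (C1 * ((INR N + 1) * sg ^ N))) by ring.
    apply Rmult_le_compat_l; [pos_tac|exact H1]. }
  (* In a retained row the two systems differ by the columns outside the truncation; in a discarded
     row the truncated matrix is zero and the residual is the entry of Phi. *)
  assert (Hres : forall i, Cmod (e i + apply_mat (trunc N A) e i) <= eps * wt i).
  { intros [p m]. pose proof (wt_pos (p, m)) as Hw.
    destruct (lt_dec p M) as [Hp|Hp].
    2:{ unfold e at 1, x, y, apply_mat, restrict. cbn [fst snd]. destruct (lt_dec p M); [contradiction|].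
        rewrite (tsum_ext _ (fun _ => RtoC 0)), tsum_0.
        - replace (RtoC 0 - RtoC 0 + RtoC 0)%C with (RtoC 0) by ring. rewrite Cmod_0. pos_tac.
        - intros j. unfold trunc, A, disc_matrix. cbn [fst snd]. destruct (lt_dec p M); [contradiction|].
          destruct (_ && _)%bool; ring. }
    destruct (inZN N m) eqn:Hm.
    - pose proof (exact_equation M k O a sg inc Phi p m HS ltac:(lra) HPhi Hp) as E1.
      pose proof (truncated_equation M k O a sg inc N (Phit N) p m HS ltac:(lra) HPhit Hp Hm) as E2.
      fold A x in E1. fold A y in E2.
      set (r := fun j => (A (p, m) j * x j - trunc N A (p, m) j * x j)%C).
      assert (Hsx : summable (fun j => A (p, m) j * x j)%C).
      { apply (apply_mat_summable A x (p, m) (CA * wt (p, m) ^ 2 * sg ^ Z.abs_nat m) KX); auto; lra. }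
      assert (Hstx : summable (fun j => trunc N A (p, m) j * x j)%C).
      { apply (apply_mat_summable (trunc N A) x (p, m) (CA * wt (p, m) ^ 2 * sg ^ Z.abs_nat m) KX); auto; [lra|].
        apply trunc_bsum; auto. }
      assert (Hsty : summable (fun j => trunc N A (p, m) j * y j)%C).
      { apply (apply_mat_summable (trunc N A) y (p, m) (CA * wt (p, m) ^ 2 * sg ^ Z.abs_nat m) KY); auto.
        apply trunc_bsum; auto. }
      assert (Ee : apply_mat (trunc N A) e (p, m) = (apply_mat (trunc N A) x (p, m) - apply_mat (trunc N A) y (p, m))%C).
      { unfold apply_mat. rewrite <- tsum_minus by auto. apply tsum_ext. intros j. unfold e. ring. }
      assert (Er : tsum r = (apply_mat A x (p, m) - apply_mat (trunc N A) x (p, m))%C).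
      { unfold apply_mat. rewrite <- tsum_minus by auto. reflexivity. }
      replace (e (p, m) + apply_mat (trunc N A) e (p, m))%C with (- tsum r)%C.
      2:{ transitivity ((x (p, m) + apply_mat A x (p, m)) - (y (p, m) + apply_mat (trunc N A) y (p, m)) - tsum r)%C.
          - rewrite E1, E2. ring.
          - rewrite Er, Ee. unfold e. ring. }
      rewrite Cmod_opp.
      apply Rle_trans with ((CX * C1 * (INR N + 1) * sg ^ N) * (CA * wt (p, m) ^ 2 * sg ^ Z.abs_nat m)).
      + assert (HQ : 0 <= CX * C1 * (INR N + 1) * sg ^ N) by pos_tac.
        apply Cmod_tsum_le with (fun j => CX * C1 * (INR N + 1) * sg ^ N * (Cmod (A (p, m) j) * wt j)).
        * intros j. unfold r, trunc. cbn [snd]. rewrite Hm. pose proof (wt_pos j). pose proof (Cmod_ge_0 (A (p, m) j)).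
          destruct (inZN N (snd j)) eqn:Hj; cbn [andb].
          -- unfold Cminus. rewrite Cplus_opp_r, Cmod_0. pos_tac.
          -- replace (A (p, m) j * x j - RtoC 0 * x j)%C with (A (p, m) j * x j)%C by ring.
             rewrite Cmod_mult. specialize (HxE j Hj).
             apply Rle_trans with (Cmod (A (p, m) j) * (CX * C1 * (INR N + 1) * sg ^ N * wt j)); [|right; ring].
             apply Rmult_le_compat_l; auto.
        * apply bsum_scal; auto.
      + specialize (H1 0%nat (Z.abs_nat m) ltac:(lia)). rewrite !pow_1 in H1. fold (abs1 m) in H1.
        change (abs1 m) with (wt (p, m)) in H1. rewrite pow_O in H1. simpl (INR 0) in H1.
        unfold eps, E.
        replace (CX * C1 * (INR N + 1) * sg ^ N * (CA * wt (p, m) ^ 2 * sg ^ Z.abs_nat m))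
          with (CX * C1 * (INR N + 1) * sg ^ N * CA * wt (p, m) * (wt (p, m) * sg ^ Z.abs_nat m)) by ring.
        apply Rle_trans with (CX * C1 * (INR N + 1) * sg ^ N * CA * wt (p, m) * C1).
        * apply Rmult_le_compat_l; [pos_tac|lra].
        * assert (0 <= CX * C1 * (INR N + 1) * sg ^ N * wt (p, m)) by pos_tac. nra.
    - unfold apply_mat. rewrite (tsum_ext _ (fun _ => RtoC 0)), tsum_0.
      + rewrite Cplus_0_r. unfold e. rewrite Hyout by auto.
        unfold Cminus. rewrite Copp_0, Cplus_0_r. eapply Rle_trans; [now apply HxE|].
        apply Rmult_le_compat_r; [lra|]. unfold eps, E.
        assert (0 <= CX * C1 * (INR N + 1) * sg ^ N) by pos_tac. nra.
      + intros j. unfold trunc. cbn [snd]. rewrite Hm. cbn [andb]. ring. }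
  assert (HeK : forall i, Cmod (e i) <= K * eps * wt i).
  { apply (Hstab N); auto; [lia|]. exists (KX + KY). split; [lra|exact Heb]. }
  intros p m Hp. pose proof (abs1_ge m) as Hm1.
  assert (Eem : e (p, m) = (Phi p m - Phit N p m)%C).
  { unfold e, x, y, restrict. cbn [fst snd]. destruct (lt_dec p M); [reflexivity|contradiction]. }
  rewrite <- Eem. apply Rmult_le_reg_r with (abs1 m); [lra|].
  rewrite (Rmult_assoc _ (/ abs1 m)), Rinv_l, Rmult_1_r by lra.
  (* The norm needs decay 1/(1 + |m|), whereas stability allows growth 1 + |m|. On retained indices
     this is bridged by (N + 1)^2, on the others by the geometric decay of Phi. *)
  destruct (inZN N m) eqn:Hm.
  - assert (Hab : abs1 m <= INR N + 1) by (apply inZN_true, le_INR in Hm; unfold abs1; lra).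
    specialize (HeK (p, m)). change (wt (p, m)) with (abs1 m) in HeK.
    apply Rle_trans with (K * eps * abs1 m * abs1 m); [apply Rmult_le_compat_r; lra|].
    unfold eps. apply Rle_trans with (K * E * (INR N + 1) * sg ^ N * (INR N + 1) ^ 2).
    + replace (K * (E * (INR N + 1) * sg ^ N) * abs1 m * abs1 m) with (K * E * (INR N + 1) * sg ^ N * abs1 m ^ 2) by ring.
      apply Rmult_le_compat_l; [pos_tac|]. apply pow_incr. lra.
    + assert (0 <= CX * C3 * (INR N + 1) ^ 3 * sg ^ N) by pos_tac.
      replace ((K * E + CX * C3) * (INR N + 1) ^ 3 * sg ^ N)
        with (K * E * (INR N + 1) * sg ^ N * (INR N + 1) ^ 2 + CX * C3 * (INR N + 1) ^ 3 * sg ^ N) by ring. lra.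
  - unfold e. rewrite Hyout by auto. unfold Cminus. rewrite Copp_0, Cplus_0_r.
    specialize (Hx (p, m)). cbn [snd] in Hx. change (wt (p, m)) with (abs1 m) in Hx.
    specialize (H3 N _ (Hfar m Hm)). fold (abs1 m) in H3.
    apply Rle_trans with (CX * (abs1 m ^ 3 * sg ^ Z.abs_nat m)).
    + apply Rle_trans with (CX * abs1 m ^ 2 * sg ^ Z.abs_nat m * abs1 m); [apply Rmult_le_compat_r; lra|right; ring].
    + apply Rle_trans with (CX * (C3 * ((INR N + 1) ^ 3 * sg ^ N))); [apply Rmult_le_compat_l; lra|].
      assert (0 <= K * E * ((INR N + 1) ^ 3 * sg ^ N)) by pos_tac. lra.
Qed.

Theorem theorem1p1 (M : nat) (O : nat -> C) (a : nat -> R) (k : R)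
    (inc : incident_field) (Phi : sequence) (Phit : nat -> sequence)
    (hM : (2 <= M)%nat)
    (ha : forall p : nat, (p < M)%nat -> (0 < a p)%R)
    (hdisj : disjoint_closed_discs M O a)
    (hk : (0 < k)%R)
    (hDir : forall p : nat, (p < M)%nat ->
       ~ dirichlet_eigenvalue (O p) (a p) (k ^ 2)%R)
    (hinc : admissible_field M O a inc)
    (hPhi : exact_solution M k O a inc Phi)
    (hPhit : exists N1 : nat, forall N : nat, (N1 <= N)%nat ->
       truncated_solution M k O a inc N (Phit N)) :
  lesssim (mpe_error M Phi Phit) (gamma1 M O a inc).
Proof.
  destruct hPhit as [N1 HN1].
  destruct (worst_rate M O a inc hM ha hdisj hinc) as [sg [Hsg [Hgamma Hrate]]].
  assert (HS : separated_discs M O a k sg).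
  { split; [exact hk|]. split; [exact ha|]. split.
    - intros p m Hp HJ. apply (hDir p Hp). apply bJ_zero_eigenvalue with m; auto.
    - intros p q Hp Hq Hpq. split; [now apply (disjoint_discs_gap M)|].
      apply Hrate. unfold rates. apply in_or_app. left. apply in_map_iff. exists (p, q). split; [reflexivity|].
      now apply in_offdiag_pairs. }
  assert (Hsource : forall p, (p < M)%nat -> forall x0, inc = PointSource x0 ->
    a p < Cmod (O p - x0) /\ a p / Cmod (O p - x0) <= sg).
  { intros p Hp x0 ->. split.
    - specialize (hinc p Hp). unfold closed_disc in hinc. rewrite Cmod_sym in hinc. now apply Rnot_le_lt.
    - apply Hrate. unfold rates. apply in_or_app. right. apply in_map_iff. exists p. split; [reflexivity|].
      apply in_seq. lia. }
  destruct (truncation_error M k O a sg inc Phi Phit N1 HS Hsg hPhi Hsource HN1) as [C [N0 [HC Herr]]].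
  assert (HM : 0 < sqrt (4 * INR M)) by (apply sqrt_lt_R0; assert (0 < INR M) by (apply lt_0_INR; lia); lra).
  (* The cubic factor of [truncation_error] times the constant of [l_norm_le]. *)
  exists (fun N => C * sqrt (4 * INR M) * (INR N + 1) ^ 3). split.
  - apply poly_subexponential. pos_tac.
  - exists N0. intros N HN. pose proof (pos_INR N). assert (0 < sg ^ N) by (apply pow_lt; lra).
    unfold mpe_error. eapply Rle_trans; [apply l_norm_le with (B := C * (INR N + 1) ^ 3 * sg ^ N)|].
    + pos_tac.
    + intros p m Hp. apply Herr; auto.
    + replace (C * (INR N + 1) ^ 3 * sg ^ N * sqrt (4 * INR M))
        with (C * sqrt (4 * INR M) * (INR N + 1) ^ 3 * sg ^ N) by ring.
      apply Rmult_le_compat_l; [pos_tac|apply Hgamma].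
Qed.
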